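(* Let $T>0$, $D:=\mathbb{R}^4\times[0,T]$, let $u_0\in L^2(\mathbb{R}^4;\mathbb{R}^4)$ and $f\in L^{3/2}(D;\mathbb{R}^4)$ be weakly divergence-free, and let $\{(u_k,p_k)\}_{k\in\mathbb{N}}$ be an approximating sequence of solutions of the regularized Navier-Stokes equations with data $u_0,f$. Then the families of measures $\{|\nabla u_k|^2dxdt\}_{k\in\mathbb{N}}$, $\{|u_k|^2dxdt\}_{k\in\mathbb{N}}$ and $\{|u_k|^3dxdt\}_{k\in\mathbb{N}}$ on $D$ are tight.
   Context: A collection of measures $\{\mu_i\}_{i\in\Lambda}$ on a space $X$ (here $X=D$) is tight if for any $\epsilon>0$ there is a compact set $K_\epsilon\subset X$ such that $\mu_i(X\setminus K_\epsilon)<\epsilon$ for all $i\in\Lambda$. Regularized equations: $\partial_tu_k-\Delta u_k+[(\chi_k*u_k)\cdot\nabla]u_k+\nabla p_k=f$, $\operatorname{div}u_k=0$, $u_k(\cdot,0)=u_0$, where $\{\chi_k\}\subset C_c^\infty(\mathbb{R}^4)$ are standard mollifiers (nonnegative, integral one, $\operatorname{diam}\operatorname{supp}\chi_k\to0$), convolution in $x$. $(u_k,p_k)$ is a distributional solution if $u_k$ is weakly divergence-free and for any $\varphi\in C_c^\infty(\mathbb{R}^4\times[0,T];\mathbb{R}^4)$ and $t\in[0,T]$: $-\int_0^t\int u_k^i\partial_t\varphi_i+\int_0^t\int\partial_ju_k^i\partial_j\varphi_i+\int_0^t\int(\chi_k*u_k)^j\partial_ju_k^i\varphi_i-\int_0^t\int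 p_k\operatorname{div}\varphi-\int_0^t\int f_i\varphi_i=\int_{\mathbb{R}^4}(u_0\cdot\varphi(0)-u_k(t)\cdot\varphi(t))dx$. Approximating sequence: distributional solutions $(u_k,p_k)\in (L_t^\infty L_x^2\cap L_t^2H_x^1(D))\times L^{3/2}(D)$ of the regularized equations such that $\{u_k\}$ is uniformly bounded in $L_t^\infty L_x^2\cap L_t^2\dot H_x^1(D)$, $\{p_k\}$ is uniformly bounded in $L^{3/2}(D)$, and $\{\partial_tu_k\}$ is uniformly bounded in $L^1_t$ with values, locally in space, in the dual of divergence-free $H^1$ fields. *)

(* Defs.v *)
From HB Require Import structures.
From mathcomp Require Import all_boot all_order all_algebra.
From mathcomp Require Import all_classical all_reals all_analysis.
From mathcomp Require Import measurable_realfun ess_sup_inf.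

Set Implicit Arguments.
Unset Strict Implicit.
Unset Printing Implicit Defensive.

Import Order.TTheory GRing.Theory Num.Theory.
Import numFieldNormedType.Exports.

Local Open Scope classical_set_scope.
Local Open Scope ring_scope.

(* R^4 is the iterated product, which carries at once the product topology, the
   normed module structure and the product sigma-algebra.  Its library norm is
   the sup norm; it is used only for the topology, for derivatives and for
   diameters tending to 0, none of which changes under an equivalent norm.
   Space-time points are pairs (x, t) : R4 R * R.  Vector fields take values in 'rV_4, and the
   Jacobian of v at x is the matrix (i, j) |-> d_j v^i (x). *)
Notation R4 R := (R * R * R * R)%type.

Section SpaceMeasures.
Variable R : realType.
Local Notation mR := (measurableTypeR R).
Local Notation leb := (@lebesgue_measure R).

Definition leb4 : set (mR * mR * mR * mR)%type -> \bar R :=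
  (leb \x leb \x leb \x leb)%E.

HB.instance Definition _ := Measure.on leb4.

Lemma prod_sigma_finite d1 d2 (T1 : measurableType d1) (T2 : measurableType d2)
    (m1 : {measure set T1 -> \bar R})
    (m2 : {sigma_finite_measure set T2 -> \bar R}) :
  sigma_finite setT m1 -> sigma_finite setT (m1 \x m2)%E.
Proof.
move=> /sigma_finiteP[F [TF ndF Foo]].
have /sigma_finiteP[G [TG ndG Goo]] := sigma_finiteT m2.
exists (fun n => F n `*` G n).
  rewrite -setXTT TF TG predeqE => -[x y]; split.
    move=> [/= [n _ Fnx] [k _ Gky]]; exists (maxn n k) => //; split.
    - by move: x Fnx; exact/subsetPset/ndF/leq_maxl.
    - by move: y Gky; exact/subsetPset/ndG/leq_maxr.
  by move=> [n _ []/= ? ?]; split; exists n.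
move=> k; have [? ?] := Foo k; have [? ?] := Goo k.
split; first exact: measurableX.
by rewrite product_measure1E// lte_mul_pinfty// ge0_fin_numE.
Qed.

Lemma leb4_sigma_finite : sigma_finite setT leb4.
Proof. by do 3 apply: prod_sigma_finite; exact: sigma_finiteT. Qed.

HB.instance Definition _ := Measure_isSigmaFinite.Build _ _ _ leb4 leb4_sigma_finite.

Definition leb41 : set (mR * mR * mR * mR * mR)%type -> \bar R :=
  (leb4 \x leb)%E.

HB.instance Definition _ := Measure.on leb41.

Lemma leb41_sigma_finite : sigma_finite setT leb41.
Proof. by apply: prod_sigma_finite; exact: leb4_sigma_finite. Qed.

HB.instance Definition _ := Measure_isSigmaFinite.Build _ _ _ leb41 leb41_sigma_finite.

End SpaceMeasures.
Arguments leb4 {R}.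
Arguments leb41 {R}.

Definition slab (R : realType) (T : R) : set (R4 R * R) := setT `*` `[0, T].

Section Smooth.
Variables (R : realType) (V W : normedModType R).

Fixpoint Ck (n : nat) (f : V -> W) : Prop :=
  continuous f /\
  if n is m.+1 then
    forall v : V, (forall x, derivable f x v) /\ Ck m (fun x => 'D_v f x)
  else True.

Definition smooth (f : V -> W) : Prop := forall n, Ck n f.

Definition supp (f : V -> W) : set V := closure [set x | f x != 0].

Definition Ccinfty (f : V -> W) : Prop := smooth f /\ compact (supp f).

End Smooth.

Section Norms.
Variable R : realType.
Local Notation leb := (@lebesgue_measure R).

(* Euclidean norm of a row vector, Frobenius norm of a matrix *)
Definition euclid m n (A : 'M[R]_(m, n)) : R :=
  Num.sqrt (\sum_i \sum_j A i j ^+ 2).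

Definition measurable_mx d (X : measurableType d) (A : set X) m n
    (v : X -> 'M[R]_(m, n)) : Prop :=
  forall i j, measurable_fun A (fun x => v x i j).

Local Open Scope ereal_scope.

Definition Lp_norm d (X : measurableType d) (mu : {measure set X -> \bar R})
    (A : set X) (p : \bar R) (g : X -> R) : \bar R :=
  'N[mu]_p[(EFin \o g) \_ A].

(* norm in L^q_t L^r_x over [0, T] *)
Definition mixed_norm (T : R) (q r : \bar R) m n
    (v : R4 R * R -> 'M[R]_(m, n)) : \bar R :=
  'N[leb]_q[(fun t : R => Lp_norm leb4 setT r
               (fun x : R4 R => euclid (v (x, t)))) \_ `[0%R, T]].

(* H^1 norm of a field with Jacobian Dv *)
Definition H1_norm (v : R4 R -> 'rV[R]_4) (Dv : R4 R -> 'M[R]_4) : \bar R :=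
  Lp_norm leb4 setT 2%:E
    (fun x => Num.sqrt (euclid (v x) ^+ 2 + euclid (Dv x) ^+ 2)%R).

End Norms.

Section WeakDerivatives.
Variable R : realType.

Definition e4 (j : 'I_4) : R4 R :=
  ((val j == 0%N)%:R, (val j == 1%N)%:R, (val j == 2%N)%:R, (val j == 3%N)%:R).

Definition dx (j : 'I_4) (g : R4 R * R -> R) (z : R4 R * R) : R :=
  'D_((e4 j, 0) : R4 R * R) g z.

Definition dt (g : R4 R * R -> R) (z : R4 R * R) : R :=
  'D_((0, 1) : R4 R * R) g z.

Definition locally_integrable4 (g : R4 R -> R) : Prop :=
  forall K : set (R4 R), compact K -> leb4.-integrable K (EFin \o g).

Definition weak_jacobian (v : R4 R -> 'rV[R]_4) (Dv : R4 R -> 'M[R]_4) : Prop :=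
  forall i j : 'I_4,
  [/\ locally_integrable4 (fun x => v x 0 i),
      locally_integrable4 (fun x => Dv x i j) &
      forall phi : R4 R -> R, Ccinfty phi ->
        \int[leb4]_x (v x 0 i * 'D_(e4 j) phi x) =
        - (\int[leb4]_x (Dv x i j * phi x))].

Definition weakly_divfree (v : R4 R -> 'rV[R]_4) : Prop :=
  forall phi : R4 R -> R, Ccinfty phi ->
  \int[leb4]_x (\sum_(i < 4) v x 0 i * 'D_(e4 i) phi x) = 0.

Definition weakly_divfree_slab (T : R) (v : R4 R * R -> 'rV[R]_4) : Prop :=
  forall phi : R4 R * R -> R,
  Ccinfty phi -> supp phi `<=` setT `*` `]0, T[ ->
  \int[leb41]_(z in slab T) (\sum_(i < 4) v z 0 i * dx i phi z) = 0.

Definition H1 (v : R4 R -> 'rV[R]_4) (Dv : R4 R -> 'M[R]_4) : Prop :=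
  [/\ measurable_mx setT v, measurable_mx setT Dv,
      weak_jacobian v Dv & (H1_norm v Dv < +oo)%E].

(* divergence-free H^1 fields vanishing a.e. outside K *)
Definition divfree_H1 (K : set (R4 R)) (v : R4 R -> 'rV[R]_4)
    (Dv : R4 R -> 'M[R]_4) : Prop :=
  [/\ H1 v Dv, weakly_divfree v & {ae leb4, forall x, ~ K x -> v x = 0}].

Definition dual_norm (K : set (R4 R)) (l : (R4 R -> 'rV[R]_4) -> R) : \bar R :=
  ereal_sup [set `|l v|%:E | v in
    [set v | exists Dv, divfree_H1 K v Dv /\ (H1_norm v Dv <= 1)%E]].

(* g : [0, T] -> (divfree_H1 K)^* is the distributional time derivative of u,
   a divergence-free field v being paired with u(t) by the L^2 product.
   As the space of test fields is separable, weak measurability of g amounts to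
   strong measurability. *)
Definition time_derivative (T : R) (K : set (R4 R))
    (u : R4 R * R -> 'rV[R]_4) (g : R -> (R4 R -> 'rV[R]_4) -> R) : Prop :=
  [/\ forall t, 0 <= t <= T -> forall (a : R) v Dv w Dw,
        divfree_H1 K v Dv -> divfree_H1 K w Dw ->
        g t (fun x => a *: v x + w x) = a * g t v + g t w,
      forall v Dv, divfree_H1 K v Dv -> measurable_fun `[0, T] (g ^~ v) &
      forall v Dv (psi : R -> R), divfree_H1 K v Dv ->
        Ccinfty psi -> supp psi `<=` `]0, T[ ->
        - (\int[lebesgue_measure]_(t in `[0, T])
             (derive1 psi t *
              \int[leb4]_x (\sum_(i < 4) u (x, t) 0 i * v x 0 i))) =
        \int[lebesgue_measure]_(t in `[0, T]) (psi t * g t v)].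

End WeakDerivatives.

Section NavierStokes.
Variable R : realType.
Implicit Types (T t : R) (chi : R4 R -> R) (p : R4 R * R -> R).
Implicit Types (u f : R4 R * R -> 'rV[R]_4) (Du : R4 R * R -> 'M[R]_4).

Definition diam (A : set (R4 R)) : \bar R :=
  ereal_sup [set `|xy.1 - xy.2|%:E | xy in A `*` A].

Definition standard_mollifiers (chi : nat -> R4 R -> R) : Prop :=
  [/\ forall k, Ccinfty (chi k),
      forall k x, 0 <= chi k x,
      forall k, \int[leb4]_x chi k x = 1 &
      diam (supp (chi k)) @[k --> \oo] --> 0%E].

Definition conv chi u (z : R4 R * R) : 'rV[R]_4 :=
  \row_i \int[leb4]_y (chi (z.1 - y) * u (y, z.2) 0 i).

(* The fields are actual functions, so that u(t) makes sense for every t.  The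
   test functions, smooth up to the boundary of the slab R^4 x [0, T], are
   restrictions of elements of C_c^oo(R^4 x R). *)
Definition distributional_solution T chi (u0 : R4 R -> 'rV[R]_4) f u Du p :
    Prop :=
  [/\ weakly_divfree_slab T u,
      forall t, 0 <= t <= T ->
        forall i, locally_integrable4 (fun x => u (x, t) 0 i) &
      forall phi : R4 R * R -> 'rV[R]_4, Ccinfty phi ->
      forall t, 0 <= t <= T ->
      let phi_ i := fun z => phi z 0 i in
      - (\int[leb41]_(z in slab t) (\sum_(i < 4) u z 0 i * dt (phi_ i) z))
      + (\int[leb41]_(z in slab t)
           (\sum_(i < 4) \sum_(j < 4) Du z i j * dx j (phi_ i) z))
      + (\int[leb41]_(z in slab t)
           (\sum_(i < 4) \sum_(j < 4) conv chi u z 0 j * Du z i j * phi_ i z))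
      - (\int[leb41]_(z in slab t) (p z * (\sum_(i < 4) dx i (phi_ i) z)))
      - (\int[leb41]_(z in slab t) (\sum_(i < 4) f z 0 i * phi_ i z))
      = \int[leb4]_x
          (\sum_(i < 4)
             (u0 x 0 i * phi_ i (x, 0) - u (x, t) 0 i * phi_ i (x, t)))].

(* u is in L^oo_t L^2_x and L^2_t H^1_x on the slab, with spatial gradient Du *)
Definition energy_space T u Du : Prop :=
  [/\ measurable_mx (slab T) u, measurable_mx (slab T) Du,
      (mixed_norm T +oo 2%:E u < +oo)%E,
      {ae lebesgue_measure, forall t, 0 <= t <= T ->
         H1 (fun x => u (x, t)) (fun x => Du (x, t))} &
      ('N[lebesgue_measure]_(2%:E)[(fun t : R =>
         H1_norm (fun x => u (x, t)) (fun x => Du (x, t))) \_ `[0%R, T]]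
       < +oo)%E].

Definition approximating_sequence T (chi : nat -> R4 R -> R)
    (u0 : R4 R -> 'rV[R]_4) f (u : nat -> R4 R * R -> 'rV[R]_4)
    (Du : nat -> R4 R * R -> 'M[R]_4) (p : nat -> R4 R * R -> R) : Prop :=
  [/\ forall k, [/\ energy_space T (u k) (Du k),
        measurable_fun (slab T) (p k),
        (Lp_norm leb41 (slab T) (3 / 2)%:E (p k) < +oo)%E &
        distributional_solution T (chi k) u0 f (u k) (Du k) (p k)],
      exists C : R, forall k,
        (mixed_norm T +oo 2%:E (u k) <= C%:E)%E /\
        (mixed_norm T 2%:E 2%:E (Du k) <= C%:E)%E,
      exists C : R, forall k,
        (Lp_norm leb41 (slab T) (3 / 2)%:E (p k) <= C%:E)%E &
      forall K : set (R4 R), compact K -> exists C : R, forall k,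
        exists2 g, time_derivative T K (u k) g &
        ('N[lebesgue_measure]_1[(fun t : R => dual_norm K (g t)) \_ `[0%R, T]]
         <= C%:E)%E].

End NavierStokes.

Definition tight (R : realType) (X : topologicalType) (A : set X) (I : Type)
    (mu : I -> set X -> \bar R) : Prop :=
  forall eps : R, 0 < eps ->
  exists K : set X, [/\ compact K, K `<=` A &
    forall i, (mu i (A `\` K) < eps%:E)%E].

(* Main.v *)
Require Import Defs.
From HB Require Import structures.
From mathcomp Require Import all_boot all_order all_algebra.
From mathcomp Require Import all_classical all_reals all_analysis.
From mathcomp Require Import measurable_realfun ess_sup_inf.
From mathcomp Require Import ring lra.

Set Implicit Arguments.
Unset Strict Implicit.
Unset Printing Implicit Defensive.

Import Order.TTheory GRing.Theory Num.Theory.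
Import numFieldNormedType.Exports.

Local Open Scope classical_set_scope.
Local Open Scope ring_scope.

(* Testing the regularized equation with [u_k psi], where [psi] vanishes on a cube
   of radius [rho] and equals one outside its double, bounds the energy outside
   the large cube, uniformly in [k]: the diffusion, transport and pressure terms
   carry a derivative of [psi] and are O(1/rho), and Young's inequality bounds the
   work of the force by t^3 |u_k|^3 plus t^(-3/2) |f|^(3/2) over the region where
   [psi] does not vanish.  In dimension four, Sobolev's embedding of H^1 into L^4
   and interpolation with L^2 bound |u_k|^3 in L^1, so that choosing first [t]
   small and then [rho] large makes the tails of |u_k|^2 (at almost every time)
   and |grad u_k|^2 small; the same interpolation outside the cube gives those of
   |u_k|^3.
   Since [u_k psi] is not an admissible test function, the equation is first
   mollified in space, [psi] is cut off at infinity, and both parameters are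
   removed at the end. *)

(** Mollification in space alone suffices because, at a fixed point [x], the equation presents
    [(eta * u_k)(x, .)] as the primitive of an integrable function of time, and the square of a
    primitive obeys the chain rule by Fubini on a triangle. The price is the commutator of [eta]
    with the transport by [chi_k * u_k]: it is of the order of the radius [d] of [eta], with a
    constant that depends on [k] through [chi_k]. So [d] tends to 0 while [k] is fixed, and only the
    limiting bounds are uniform in [k]. Only upper bounds have to survive this limit, hence lower
    semicontinuity replaces convergence in L2. Integrability in time shapes the cubic estimate: the
    L4 bound is quadratic in [N = N1 + D(s)], where [N1] bounds the squared L2 norms and [D(s)] the
    Dirichlet integrals at time [s]; interpolating with the weight [N] makes the integral of
    [|u_k|^3] linear in [N], hence integrable in [s]. Conditions that hold at almost every time are
    made to hold at every time by setting the fields to 0 outside a measurable set of good times of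
    full measure. Every smooth cutoff is manufactured from the given mollifiers. *)

Section Invariance.
Context {R : realType}.
Local Open Scope ereal_scope.

(** Stated on integrals of nonnegative functions rather than on sets, so that invariance passes to
    products by Tonelli, one factor at a time. *)
Definition preserves d (X : measurableType d) (m : set X -> \bar R)
    (phi : X -> X) : Prop :=
  measurable_fun setT phi /\ forall f : X -> \bar R, measurable_fun setT f ->
    (forall x, 0 <= f x) -> \int[m]_x f (phi x) = \int[m]_x f x.

Lemma preserves_prod d1 d2 (X1 : measurableType d1) (X2 : measurableType d2)
    (m1 : {sigma_finite_measure set X1 -> \bar R})
    (m2 : {sigma_finite_measure set X2 -> \bar R}) phi1 phi2 :
  preserves m1 phi1 -> preserves m2 phi2 ->
  preserves (m1 \x m2) (fun z : X1 * X2 => (phi1 z.1, phi2 z.2)).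
Proof.
move=> [mphi1 p1] [mphi2 p2].
have mphi : measurable_fun setT (fun z : X1 * X2 => (phi1 z.1, phi2 z.2)).
  by apply: measurable_fun_pair; apply: measurableT_comp.
split=> // f mf f0.
have mff : measurable_fun setT (fun z : X1 * X2 => f (phi1 z.1, phi2 z.2)).
  exact: (measurableT_comp mf).
rewrite (fubini_tonelli1 _ mff)// (fubini_tonelli1 _ mf)//.
rewrite -[RHS]p1.
- apply: eq_integral => x _; rewrite /fubini_F/= (p2 (fun y => f (phi1 x, y)))//.
  exact: (measurableT_comp mf).
- exact: measurable_fun_fubini_tonelli_F.
- by move=> x; exact: integral_ge0.
Qed.

(** The image measure gives each half-open interval its length, and Lebesgue measure is the only
    such measure. *)
Lemma preserves_leb_add (a : R) :
  preserves (@lebesgue_measure R) (fun x => (a + x)%R).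
Proof.
have mphi : measurable_fun setT (fun x : measurableTypeR R => (a + x)%R : measurableTypeR R).
  exact: measurable_funD.
split=> // f mf f0.
rewrite -(ge0_integral_pushforward mphi _ measurableT mf)//.
apply: eq_measure_integral => //= A mA _; apply/esym.
apply: (@lebesgue_measure_unique R (measure_function_pushforward__canonical__measure_function_Measure lebesgue_measure mphi)) => //.
move=> _ [[b c] _ <-]; rewrite [RHS](_ : _ = lebesgue_measure `](b - a)%R, (c - a)%R]%classic); last first.
  congr lebesgue_measure.
  by apply/seteqP; split=> x /=; rewrite !in_itv/= ltrBlDl lerBrDl.
by rewrite !lebesgue_measure_itv/= !lte_fin ltrD2r -!EFinB opprB addrA subrK.
Qed.

Lemma preserves_leb_opp : preserves (@lebesgue_measure R) (fun x => (- x)%R).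
Proof.
have mphi : measurable_fun setT (fun x : measurableTypeR R => (- x)%R : measurableTypeR R).
  exact: oppr_measurable.
split=> // f mf f0.
rewrite -(ge0_integral_pushforward mphi _ measurableT mf)//.
apply: eq_measure_integral => //= A mA _; apply/esym.
apply: (@lebesgue_measure_unique R (measure_function_pushforward__canonical__measure_function_Measure lebesgue_measure mphi)) => //.
(* Reflection exchanges the open and the closed end, which leaves the length unchanged. *)
move=> _ [[b c] _ <-]; rewrite [RHS](_ : _ = lebesgue_measure `[(- c)%R, (- b)%R[%classic); last first.
  congr lebesgue_measure.
  by apply/seteqP; split=> x /=; rewrite !in_itv/= lerNl ltrNr andbC.
by rewrite !lebesgue_measure_itv/= !lte_fin ltrN2 -!EFinB opprK addrC.
Qed.

End Invariance.

(** The same set as [R4 R]: topology and algebra are read on [R4 R], the product sigma-algebra on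
    [M4 R]. *)
Notation M4 R := (measurableTypeR R * measurableTypeR R * measurableTypeR R
  * measurableTypeR R)%type.

(** * Invariance of the Lebesgue measure of R^4 *)

Section InvarianceR4.
Context {R : realType}.
Local Notation mR := (measurableTypeR R).
Local Notation leb := (@lebesgue_measure R).
Local Open Scope ereal_scope.

(** Naming the partial products gives each of them its own sigma-finite structure, so that [leb4] is
    seen as the product of [leb3] with a line. *)
Definition leb2 : set (mR * mR)%type -> \bar R := leb \x leb.
HB.instance Definition _ := Measure.on leb2.
Lemma leb2_sigma_finite : sigma_finite setT leb2.
Proof. by apply: prod_sigma_finite; exact: sigma_finiteT. Qed.
HB.instance Definition _ :=
  Measure_isSigmaFinite.Build _ _ _ leb2 leb2_sigma_finite.

Definition leb3 : set (mR * mR * mR)%type -> \bar R := leb2 \x leb.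
HB.instance Definition _ := Measure.on leb3.
Lemma leb3_sigma_finite : sigma_finite setT leb3.
Proof. by apply: prod_sigma_finite; exact: leb2_sigma_finite. Qed.
HB.instance Definition _ :=
  Measure_isSigmaFinite.Build _ _ _ leb3 leb3_sigma_finite.

Lemma leb4E : @leb4 R = (leb3 \x leb)%E.
Proof. by []. Qed.

Lemma preserves_leb4_add (a : R4 R) :
  preserves (@leb4 R) (fun x : R4 R => (a + x)%R).
Proof.
have h2 : preserves leb2 (fun z => (a.1.1.1 + z.1, a.1.1.2 + z.2)%R).
  by rewrite /leb2; apply: preserves_prod; exact: preserves_leb_add.
have h3 : preserves leb3
    (fun z => ((a.1.1.1 + z.1.1, a.1.1.2 + z.1.2), a.1.2 + z.2)%R).
  rewrite /leb3; apply: (preserves_prod (m1 := leb2) (m2 := leb)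
    (phi1 := fun z => (a.1.1.1 + z.1, a.1.1.2 + z.2)%R)
    (phi2 := fun z => a.1.2 + z)%R) => //; exact: preserves_leb_add.
rewrite leb4E; apply: (preserves_prod (m1 := leb3) (m2 := leb)
  (phi1 := fun z => ((a.1.1.1 + z.1.1, a.1.1.2 + z.1.2), a.1.2 + z.2)%R)
  (phi2 := fun z => a.2 + z)%R); [exact: h3|exact: preserves_leb_add].
Qed.

Lemma preserves_leb4_opp : preserves (@leb4 R) (fun x : R4 R => (- x)%R).
Proof.
have o := @preserves_leb_opp R.
have h2 : preserves leb2 (fun z => (- z.1, - z.2)%R).
  by rewrite /leb2; apply: preserves_prod.
have h3 : preserves leb3 (fun z => ((- z.1.1, - z.1.2), - z.2)%R).
  rewrite /leb3; apply: (preserves_prod (m1 := leb2) (m2 := leb)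
    (phi1 := fun z => (- z.1, - z.2)%R) (phi2 := fun z => - z)%R) => //.
rewrite leb4E; apply: (preserves_prod (m1 := leb3) (m2 := leb)
  (phi1 := fun z => ((- z.1.1, - z.1.2), - z.2)%R)
  (phi2 := fun z => - z)%R) => //; exact: h3.
Qed.

End InvarianceR4.
Arguments leb2 {R}.
Arguments leb3 {R}.

(** * Measurability of continuous functions through countable bases *)

Section CountableBase.

(** The map [e] is in the end the identity of R^4; it links the two types that carry the topology
    and the sigma-algebra. Countability turns an open set into a countable union of measurable base
    sets. *)
Definition countable_measurable_base (T : topologicalType) d
    (M : measurableType d) (e : M -> T) : Prop :=
  exists (I : countType) (B : I -> set T), (forall i, measurable (e @^-1` B i)) /\
    forall x N, nbhs x N -> exists i, B i x /\ B i `<=` N.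

Lemma countable_measurable_base_prod (T1 T2 : topologicalType) d1 d2
    (M1 : measurableType d1) (M2 : measurableType d2) (e1 : M1 -> T1) (e2 : M2 -> T2) :
  countable_measurable_base e1 -> countable_measurable_base e2 ->
  countable_measurable_base (fun z : M1 * M2 => (e1 z.1, e2 z.2)).
Proof.
move=> [I1 [B1 [mB1 b1]]] [I2 [B2 [mB2 b2]]].
exists (I1 * I2)%type, (fun i => B1 i.1 `*` B2 i.2); split.
  move=> i; rewrite (_ : _ @^-1` _ = (e1 @^-1` B1 i.1) `*` (e2 @^-1` B2 i.2))//.
  exact: measurableX.
move=> [x y] N [[N1 N2] /= [/b1[i [ix iN]] /b2[j [jx jN]]] NN].
exists (i, j); split=> //= -[a b] [/= Ba Bb]; apply: NN; split => /=.
  exact: iN.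
exact: jN.
Qed.

Lemma countable_measurable_base_real (R : realType) :
  countable_measurable_base (fun x : measurableTypeR R => (x : R)).
Proof.
exists (rat * rat)%type, (fun q => `]ratr q.1, ratr q.2[%classic); split.
  by move=> i; exact: measurable_itv.
move=> x N /nbhs_ballP[e /= e0 eN].
have /rat_in_itvoo[q1] : x - e < x by rewrite ltrBlDr ltrDl.
have /rat_in_itvoo[q2] : x < x + e by rewrite ltrDl.
rewrite !in_itv/= => /andP[q2l q2u] /andP[q1l q1u].
exists (q1, q2); split; first by rewrite /= in_itv/= q1u q2l.
move=> y; rewrite /= in_itv/= => /andP[y1 y2]; apply: eN.
rewrite /ball/= ltr_norml; apply/andP; split.
  by rewrite ltrBrDl -ltrBrDr opprK (lt_trans y2).
by rewrite ltrBlDr -ltrBlDl (le_lt_trans _ (lt_trans q1l y1))// .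
Qed.

Lemma continuous_measurable_base (R : realType) (T : topologicalType) d
    (M : measurableType d) (e : M -> T) (f : T -> R) :
  countable_measurable_base e -> continuous f ->
  measurable_fun setT (fun x => f (e x)).
Proof.
move=> [I [B [mB b]]] cf; apply: (measurability _ (@RGenOpens.measurableE R)).
move=> _ [_ [a [c ->]] <-]; rewrite setTI.
set U := `]a, c[%classic.
have -> : (fun x => f (e x)) @^-1` U =
    \bigcup_(i in [set i | B i `<=` f @^-1` U]) (e @^-1` B i).
  apply/seteqP; split=> x /=.
    move=> Ux; have /b[i [ix iU]] : nbhs (e x) (f @^-1` U).
      by apply: cf; apply: open_nbhs_nbhs; split=> //; exact: itv_open.
    by exists i.
  by move=> [i /= iU ix]; exact: iU.
rewrite bigcup_mkcond; apply: countable_bigcupT_measurable; first exact: countableP.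
by move=> i; case: ifP.
Qed.

End CountableBase.

(** * Cubes of R^4 *)

Section BallsR4.
Context {R : realType}.
Local Notation mR := (measurableTypeR R).
Local Notation leb := (@lebesgue_measure R).

Lemma continuous_measurable4 (f : R4 R -> R) :
  continuous f -> measurable_fun (setT : set (M4 R)) f.
Proof.
have b := @countable_measurable_base_real R.
have b4 := countable_measurable_base_prod (countable_measurable_base_prod
  (countable_measurable_base_prod b b) b) b.
move=> cf; have := continuous_measurable_base b4 cf.
by congr measurable_fun; apply/funext => -[[[? ?] ?] ?].
Qed.

(** These are the closed balls of the norm of [R4 R], which is the sup norm; being products of
    segments, they are compact, measurable and of finite measure. *)
Definition cube (r : R) : set (R4 R) := [set x | `|x| <= r].

Lemma cubeE r : cube r =
  `[- r, r]%classic `*` `[- r, r]%classic `*` `[- r, r]%classic `*` `[- r, r]%classic.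
Proof.
apply/seteqP; split => [[[[a b] c] d]|[[[a b] c] d]];
  rewrite /cube/= !prod_normE/= !ge_max !in_itv/= -!ler_norml.
  by move=> /andP[/andP[/andP[-> ->] ->] ->].
by move=> [[[-> ->] ->] ->].
Qed.

Lemma measurable_cube r : measurable (cube r : set (M4 R)).
Proof. by rewrite cubeE; do 3 (apply: measurableX => //). Qed.

Lemma compact_cube r : compact (cube r).
Proof. by rewrite cubeE; do 3 (apply: compact_setX; last exact: segment_compact); exact: segment_compact. Qed.

Lemma leb4_cube_lty r : (leb4 (cube r) < +oo)%E.
Proof.
have l1 : (leb `[(- r)%R, r] < +oo)%E.
  by rewrite lebesgue_measure_itv/=; case: ifPn => // _; rewrite -EFinB ltry.
have l2 : (leb2 (`[(- r)%R, r] `*` `[(- r)%R, r]) < +oo)%E.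
  by rewrite /leb2 product_measure1E// lte_mul_pinfty// ge0_fin_numE.
have l3 : (leb3 (`[(- r)%R, r] `*` `[(- r)%R, r] `*` `[(- r)%R, r]) < +oo)%E.
  rewrite /leb3 product_measure1E//; last exact: measurableX.
  by apply: lte_mul_pinfty => //; rewrite ge0_fin_numE//.
rewrite cubeE leb4E product_measure1E//; last by do 2 (apply: measurableX => //).
by apply: lte_mul_pinfty => //; rewrite ge0_fin_numE//.
Qed.

Lemma bounded_sub_cube (K : set (R4 R)) : compact K -> exists2 r, 0 < r & K `<=` cube r.
Proof.
move=> /compact_bounded[M [_ MK]]; exists (`|M| + 1).
  by rewrite ltr_wpDl.
by move=> x Kx; apply: (MK (`|M| + 1)) => //; rewrite (le_lt_trans (ler_norm M))// ltrDl.
Qed.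

End BallsR4.

(** * General facts on integrals *)

Section GeneralMeasure.
Context {R : realType}.
Local Open Scope ereal_scope.

Lemma preserves_comp d (X : measurableType d) (m : set X -> \bar R)
    (phi psi : X -> X) :
  preserves m phi -> preserves m psi -> preserves m (fun x => phi (psi x)).
Proof.
move=> [mphi pphi] [mpsi ppsi]; split; first exact: (measurableT_comp mphi).
move=> f mf f0; rewrite (ppsi (fun x => f (phi x)))//; first exact: pphi.
exact: (measurableT_comp mf).
Qed.

Lemma preserves_integral d (X : measurableType d) (m : {measure set X -> \bar R})
    (phi : X -> X) (f : X -> \bar R) : preserves m phi -> measurable_fun setT f ->
  \int[m]_x f (phi x) = \int[m]_x f x.
Proof.
move=> [mphi p] mf; rewrite integralE [RHS]integralE; congr (_ - _).
  rewrite -[RHS]p//; last exact: measurable_funepos.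
  by apply: eq_integral => x _; rewrite funepos_comp.
rewrite -[RHS]p//; last exact: measurable_funeneg.
by apply: eq_integral => x _; rewrite funeneg_comp.
Qed.

Lemma preserves_integrable d (X : measurableType d) (m : {measure set X -> \bar R})
    (phi : X -> X) (f : X -> \bar R) : preserves m phi ->
  m.-integrable setT f -> m.-integrable setT (fun x => f (phi x)).
Proof.
move=> pp /integrableP[mf intf]; apply/integrableP; split.
  by apply: (measurableT_comp mf); exact: pp.1.
rewrite (pp.2 (fun x => `|f x|))//.
exact: measurableT_comp.
Qed.

Lemma integrable_setT_zero d (X : measurableType d) (m : {measure set X -> \bar R})
    (D : set X) (f : X -> R) : measurable D -> (forall x, ~ D x -> f x = 0%R) ->
  m.-integrable D (EFin \o f) -> m.-integrable setT (EFin \o f).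
Proof.
move=> mD f0 /(integrable_mkcond _ mD); congr (m.-integrable _ _).
apply/funext => x; rewrite patchE; case: ifPn => //.
by rewrite notin_setE => /f0 /= ->.
Qed.

Lemma integrable_bounded_mul d (X : measurableType d) (m : {measure set X -> \bar R})
    (D : set X) (h g : X -> R) (C : R) : measurable D -> measurable_fun D h ->
  (forall x, D x -> `|h x| <= C)%R -> m.-integrable D (EFin \o g) ->
  m.-integrable D (EFin \o (fun x => (h x * g x)%R)).
Proof.
move=> mD mh hC ig; have mg : measurable_fun D g.
  by apply/measurable_EFinP; case/integrableP : ig.
apply: (le_integrable mD _ _ (integrableZl mD C ig)).
  by apply/measurable_EFinP; exact: measurable_funM.
move=> x Dx; rewrite /= lee_fin !normrM ler_wpM2r//.
by rewrite (le_trans (hC _ Dx))// ler_norm.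
Qed.

(** Tonelli applies to the positive and negative parts separately, and [fine] is measurable, so the
    integral may be infinite or undefined for some [x]. *)
Lemma measurable_Rintegral d1 d2 (X1 : measurableType d1) (X2 : measurableType d2)
    (m2 : {sigma_finite_measure set X2 -> \bar R}) (F : X1 * X2 -> R) :
  measurable_fun setT F ->
  measurable_fun setT (fun x => (\int[m2]_y F (x, y))%R).
Proof.
move=> mF.
have mEF : measurable_fun setT (EFin \o F) by exact/measurable_EFinP.
rewrite (_ : (fun x => _) = fine \o
   (fun x => \int[m2]_y ((EFin \o F)^\+ (x, y)) - \int[m2]_y ((EFin \o F)^\- (x, y)))).
  apply: measurableT_comp => //; apply: emeasurable_funB.
    by apply: measurable_fun_fubini_tonelli_F => //; exact: measurable_funepos.
  by apply: measurable_fun_fubini_tonelli_F => //; exact: measurable_funeneg.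
apply/funext => x; rewrite /Rintegral/= integralE; congr (fine (_ - _)).
  by apply: eq_integral => y _; exact: (congr1 (@^~ y) (funepos_comp (EFin \o F) (fun y => (x, y)))).
by apply: eq_integral => y _; exact: (congr1 (@^~ y) (funeneg_comp (EFin \o F) (fun y => (x, y)))).
Qed.

Lemma Rintegral_le_ge0 d (X : measurableType d) (m : {measure set X -> \bar R})
    (D : set X) (f g : X -> R) : measurable D -> measurable_fun D f ->
  m.-integrable D (EFin \o g) -> (forall x, D x -> `|f x| <= g x)%R ->
  m.-integrable D (EFin \o f).
Proof.
move=> mD mf ig fg; apply: (le_integrable mD _ _ ig); first exact/measurable_EFinP.
by move=> x Dx /=; rewrite lee_fin (le_trans (fg _ Dx))// ler_norm.
Qed.

Lemma ge0_integrable d (X : measurableType d) (m : {measure set X -> \bar R})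
    (D : set X) (f : X -> R) : measurable D -> measurable_fun D f ->
  (forall x, D x -> 0 <= f x)%R -> \int[m]_(x in D) (f x)%:E < +oo ->
  m.-integrable D (EFin \o f).
Proof.
move=> mD mf f0 fi; apply/integrableP; split; first exact/measurable_EFinP.
rewrite (eq_integral (fun x => (f x)%:E))// => x /set_mem Dx.
by rewrite /= ger0_norm ?f0.
Qed.

Lemma EFin_Rintegral d (X : measurableType d) (m : {measure set X -> \bar R})
    (D : set X) (f : X -> R) : measurable D -> m.-integrable D (EFin \o f) ->
  (\int[m]_(x in D) f x)%R%:E = \int[m]_(x in D) (f x)%:E.
Proof. by move=> mD fi; rewrite /Rintegral fineK//; exact: integrable_fin_num. Qed.

End GeneralMeasure.

(** * Convolution with a compactly supported kernel *)

Section Convolution.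
Context {R : realType}.
Local Notation mR := (measurableTypeR R).
Implicit Types (k g : R4 R -> R) (x y : R4 R).

Lemma preserves_leb4_sub x : preserves (@leb4 R) (fun y : R4 R => x - y).
Proof.
exact: (preserves_comp (preserves_leb4_add x) preserves_leb4_opp).
Qed.

Lemma measurable_sub4 :
  measurable_fun setT (fun z : M4 R * M4 R => (z.1 : R4 R) - z.2 : M4 R).
Proof.
have -> : (fun z : M4 R * M4 R => (z.1 : R4 R) - z.2 : M4 R) =
   (fun z : M4 R * M4 R => (((z.1.1.1.1 - z.2.1.1.1, z.1.1.1.2 - z.2.1.1.2), z.1.1.2 - z.2.1.2),
         z.1.2 - z.2.2)%R).
  by apply/funext => -[[[[? ?] ?] ?] [[[? ?] ?] ?]].
repeat (apply: measurable_fun_pair); apply: measurable_funB;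
  repeat (first [exact: measurable_fst | exact: measurable_snd | apply: (measurableT_comp measurable_fst) | apply: (measurableT_comp measurable_snd)]).
Qed.

Definition Cc k := continuous k /\ exists r, forall x, r < `|x| -> k x = 0.

Lemma Cc_measurable k : Cc k -> measurable_fun (setT : set (M4 R)) k.
Proof. by move=> [ck _]; exact: continuous_measurable4. Qed.

Lemma Cc_bounded k : Cc k -> exists2 M, 0 < M & forall x, `|k x| <= M.
Proof.
move=> [ck [r k0]].
have : bounded_set (k @` cube r).
  apply: compact_bounded; apply: continuous_compact; last exact: compact_cube.
  exact: continuous_subspaceT.
move=> [M [_ hM]]; exists (`|M| + 1); first by rewrite ltr_wpDl.
move=> x; have [xr|rx] := leP `|x| r; last by rewrite k0// normr0 addr_ge0.
apply: (hM (`|M| + 1)); last by exists x.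
by rewrite (le_lt_trans (ler_norm M))// ltrDl.
Qed.

Lemma Cc_support k : Cc k -> exists2 r, 0 < r & forall x, r < `|x| -> k x = 0.
Proof.
move=> [_ [r k0]]; exists (`|r| + 1); first by rewrite ltr_wpDl.
move=> x rx; apply: k0; apply: le_lt_trans rx.
by rewrite (le_trans (ler_norm r))// lerDl.
Qed.

Definition locint g := measurable_fun (setT : set (M4 R)) g /\
  forall r, leb4.-integrable (cube r : set (M4 R)) (EFin \o g).

Definition cv k g x : R := \int[leb4]_y (k (x - y) * g y).

Lemma measurable_shift k x : Cc k ->
  measurable_fun (setT : set (M4 R)) (fun y : R4 R => k (x - y)).
Proof.
move=> Ck; apply: (measurableT_comp (Cc_measurable Ck)).
exact: (preserves_leb4_sub x).1.
Qed.

Lemma shift_integrable k g x : Cc k -> locint g ->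
  leb4.-integrable setT (EFin \o (fun y : R4 R => k (x - y) * g y)).
Proof.
move=> Ck [mg ig]; have [r r0 k0] := Cc_support Ck; have [M M0 kM] := Cc_bounded Ck.
apply: (integrable_setT_zero (m := leb4) (D := cube (r + `|x|))); first exact: measurable_cube.
  move=> y; rewrite /cube/= => /negP; rewrite -ltNge => h; rewrite k0 ?mul0r//.
  rewrite -ltrBrDr in h; apply: (lt_le_trans h).
  by rewrite -(normrN (x - y)) opprB lerB_dist.
apply: (integrable_bounded_mul (m := leb4) (C := M)) => //; first exact: measurable_cube.
by apply: measurable_funTS; exact: measurable_shift.
Qed.

(** For [|x| <= r] the kernel only sees the cube of radius [a + r], where [a] bounds its support,
    and there the integrand is at most [C |g|]. *)
Lemma cv_bounded k g r : Cc k -> locint g ->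
  exists2 M, 0 <= M & forall x, `|x| <= r -> `|cv k g x| <= M.
Proof.
move=> Ck lg; have [a a0 k0] := Cc_support Ck; have [C C0 kC] := Cc_bounded Ck.
have mB := @measurable_cube R (a + r).
have iB : leb4.-integrable (cube (a + r) : set (M4 R)) (EFin \o (fun y => C * `|g y|)).
  have := integrable_norm (lg.2 (a + r)).
  by move/(integrableZl mB C).
exists (\int[leb4]_(y in cube (a + r)) (C * `|g y|)).
  by apply: Rintegral_ge0 => y _; rewrite mulr_ge0// ltW.
move=> x xr; rewrite /cv.
rewrite (_ : \int[leb4]_y _ = \int[leb4]_(y in cube (a + r)) (k (x - y) * g y)); last first.
  rewrite [RHS]Rintegral_mkcond; apply: eq_Rintegral => y _; rewrite patchE.
  case: ifPn => //; rewrite notin_setE /cube/= => /negP; rewrite -ltNge => h.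
  rewrite k0 ?mul0r//.
  rewrite -ltrBrDr in h; rewrite -(normrN (x - y)) opprB.
  apply: (lt_le_trans _ (lerB_dist _ _)); apply: (lt_le_trans h).
  by rewrite lerB.
have i1 : leb4.-integrable (cube (a + r) : set (M4 R)) (EFin \o (fun y : R4 R => k (x - y) * g y)).
  by apply: integrableS (shift_integrable x Ck lg).
apply: (le_trans (le_normr_Rintegral mB i1)).
apply: le_Rintegral => //; first exact: integrable_norm.
by move=> y _; rewrite normrM ler_wpM2r.
Qed.

(** The parameter space [S] will be the time axis; the integrand is jointly measurable in [x], the
    parameter and [y], and only [y] is integrated out. *)
Lemma measurable_cv_joint d (S : measurableType d) k (g : R4 R * S -> R) : Cc k ->
  measurable_fun (setT : set (M4 R * S)) g ->
  measurable_fun (setT : set (M4 R * S)) (fun z => cv k (fun y => g (y, z.2)) z.1).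
Proof.
move=> Ck mg; pose F (w : (M4 R * S) * M4 R) : R := k ((w.1.1 : R4 R) - w.2) * g (w.2, w.1.2).
have mF : measurable_fun setT F.
  apply: measurable_funM.
    apply: (measurableT_comp (Cc_measurable Ck)).
    apply: (measurableT_comp measurable_sub4 (g := fun w : (M4 R * S) * M4 R => (w.1.1, w.2))).
    apply: measurable_fun_pair => //.
    exact: (measurableT_comp measurable_fst measurable_fst).
  apply: (measurableT_comp mg (g := fun w : (M4 R * S) * M4 R => (w.2, w.1.2))).
  apply: measurable_fun_pair => //.
  exact: (measurableT_comp measurable_snd measurable_fst).
exact: (measurable_Rintegral leb4 mF).
Qed.

Lemma measurable_cv k g : Cc k -> measurable_fun (setT : set (M4 R)) g ->
  measurable_fun (setT : set (M4 R)) (cv k g).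
Proof.
move=> Ck mg; pose F (w : M4 R * M4 R) : R := k ((w.1 : R4 R) - w.2) * g w.2.
have mF : measurable_fun setT F.
  apply: measurable_funM.
    exact: (measurableT_comp (Cc_measurable Ck) measurable_sub4).
  exact: (measurableT_comp mg measurable_snd).
exact: (measurable_Rintegral leb4 mF).
Qed.

Lemma cv_locint k g : Cc k -> locint g -> locint (cv k g).
Proof.
move=> Ck lg; have mc := measurable_cv Ck lg.1; split=> // r.
have [M M0 cM] := cv_bounded r Ck lg.
have mB := @measurable_cube R r.
apply: (measurable_bounded_integrable mB).
- exact: leb4_cube_lty.
- exact: measurable_funTS.
- exists M; split; first exact: num_real.
  by move=> x Mx y yr; apply: (le_trans (cM _ yr)); exact: ltW.
Qed.

End Convolution.

(** * Calculus of smooth functions *)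

Section SmoothCalculus.
Context {R : realType}.
Implicit Types V W : normedModType R.

(** Composition with an affine map leaves the difference quotient literally unchanged as a function
    of [h], so derivatives and derivability transfer without a chain rule. *)
Lemma derivative_affine V V' W (f : V -> W) (L : V' -> V) (a : V) (z v : V') :
  (forall (h : R) y w, L (h *: y + w) = h *: L y + L w) ->
  (fun h : R => h^-1 *: (((fun z => f (a + L z)) \o shift z) (h *: v) - f (a + L z))) =
  (fun h : R => h^-1 *: ((f \o shift (a + L z)) (h *: L v) - f (a + L z))).
Proof.
move=> linL; apply/funext => h /=; congr (_ *: (f _ - _)).
by rewrite linL addrCA.
Qed.

Lemma D_affine V V' W (f : V -> W) (L : V' -> V) (a : V) (z v : V') :
  (forall (h : R) y w, L (h *: y + w) = h *: L y + L w) ->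
  'D_v (fun z => f (a + L z)) z = 'D_(L v) f (a + L z).
Proof. by move=> linL; rewrite /derive (derivative_affine _ _ _ _ linL). Qed.

Lemma derivable_affine V V' W (f : V -> W) (L : V' -> V) (a : V) (z v : V') :
  (forall (h : R) y w, L (h *: y + w) = h *: L y + L w) ->
  derivable f (a + L z) (L v) -> derivable (fun z => f (a + L z)) z v.
Proof. by move=> linL; rewrite /derivable (derivative_affine _ _ _ _ linL). Qed.

Lemma Ck_continuous V W n (f : V -> W) : Ck n f -> continuous f.
Proof. by case: n => [|n] []. Qed.

Lemma CkS V W n (f : V -> W) : Ck n.+1 f -> Ck n f.
Proof.
elim: n f => [|n ih] f [cf df]; first by split.
by split=> // v; have [d1 d2] := df v; split=> //; exact: ih.
Qed.

Lemma Ck_affine V V' W n (f : V -> W) (L : V' -> V) (a : V) :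
  (forall (h : R) y w, L (h *: y + w) = h *: L y + L w) -> continuous L ->
  Ck n f -> Ck n (fun z => f (a + L z)).
Proof.
move=> linL cL; have cA : continuous (fun z => a + L z).
  by move=> z; apply: cvgD; [exact: cvg_cst|exact: cL].
elim: n f => [|n ih] f [cf df]; (split; first by
    move=> z; apply: (@continuous_comp _ _ _ (fun z => a + L z) f); [exact: cA|exact: cf]) => //.
move=> v; have [d1 d2] := df (L v); split.
  by move=> z; apply: derivable_affine.
suff -> : 'D_v (fun z => f (a + L z)) = (fun z => ('D_(L v) f) (a + L z)) by exact: (ih ('D_(L v) f)).
by apply/funext => z; rewrite D_affine.
Qed.

Lemma Ck_cst V W n (c : W) : Ck n (fun _ : V => c).
Proof.
elim: n c => [|n ih] c; (split; first by move=> z; exact: cvg_cst) => //.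
move=> v; split; first by move=> z; exact: derivable_cst.
suff -> : 'D_v (fun _ : V => c) = (fun=> 0) by exact: (ih 0).
by apply/funext => z; rewrite derive_cst.
Qed.

Lemma Ck_add V W n (f g : V -> W) : Ck n f -> Ck n g -> Ck n (fun z => f z + g z).
Proof.
elim: n f g => [|n ih] f g [cf df] [cg dg]; (split; first by
  move=> z; apply: cvgD; [exact: cf|exact: cg]) => //.
move=> v; have [df1 df2] := df v; have [dg1 dg2] := dg v; split.
  by move=> z; exact: derivableD.
suff -> : 'D_v (fun z => f z + g z) = (fun z => 'D_v f z + 'D_v g z) by exact: (ih ('D_v f) ('D_v g)).
by apply/funext => z; rewrite -deriveD.
Qed.

(** Leibniz's rule keeps one factor undifferentiated, still at order [n + 1], hence the appeal to
    [CkS]. *)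
Lemma Ck_mul V n (f g : V -> R) : Ck n f -> Ck n g -> Ck n (fun z => f z * g z).
Proof.
elim: n f g => [|n ih] f g hf hg; have [cf df] := hf; have [cg dg] := hg;
  (split; first by move=> z; apply: cvgM; [exact: cf|exact: cg]) => //.
move=> v; have [df1 df2] := df v; have [dg1 dg2] := dg v; split.
  by move=> z; exact: derivableM.
suff -> : 'D_v (fun z => f z * g z) = (fun z => f z * 'D_v g z + g z * 'D_v f z).
  by apply: Ck_add; apply: ih => //; exact: CkS.
by apply/funext => z; rewrite -[RHS]deriveM.
Qed.

Lemma D_scale V W (f : V -> R) (w : W) z v : derivable f z v ->
  is_derive z v (fun z => f z *: w) ('D_v f z *: w).
Proof.
move=> df.
have h : (fun h : R => h^-1 *: (((fun z => f z *: w) \o shift z) (h *: v) - f z *: w)) @ 0^' -->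
    'D_v f z *: w.
  rewrite (_ : (fun h : R => _) =
     (fun h : R => (h^-1 *: ((f \o shift z) (h *: v) - f z)) *: w)); last first.
    by apply/funext => h /=; rewrite -scalerBl scalerA.
  exact: cvgZr_tmp.
by apply: DeriveDef; [apply/cvg_ex; eexists; exact: h|exact: cvg_lim].
Qed.

Lemma Ck_scale V W n (f : V -> R) (w : W) : Ck n f -> Ck n (fun z => f z *: w).
Proof.
elim: n f => [|n ih] f [cf df];
  (split; first by move=> z; apply: cvgZr_tmp; exact: cf) => //.
move=> v; have [df1 df2] := df v; split.
  by move=> z; have [] := D_scale w (df1 z).
suff -> : 'D_v (fun z => f z *: w) = (fun z => 'D_v f z *: w) by exact: (ih ('D_v f)).
by apply/funext => z; apply: derive_val; exact: D_scale.
Qed.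

Lemma smooth_affine V V' W (f : V -> W) (L : V' -> V) (a : V) :
  (forall (h : R) y w, L (h *: y + w) = h *: L y + L w) -> continuous L ->
  smooth f -> smooth (fun z => f (a + L z)).
Proof. by move=> linL cL sf n; exact: Ck_affine. Qed.

Lemma smooth_mul V (f g : V -> R) : smooth f -> smooth g -> smooth (fun z => f z * g z).
Proof. by move=> sf sg n; exact: Ck_mul. Qed.

Lemma smooth_D V W (f : V -> W) v : smooth f -> smooth ('D_v f).
Proof. by move=> sf n; have [_ /(_ v)[]] := sf n.+1. Qed.

Lemma smooth_derivable V W (f : V -> W) z v : smooth f -> derivable f z v.
Proof. by move=> sf; have [_ /(_ v)[]] := sf 1%N. Qed.

Lemma supp_compact V W (f : V -> W) (K : set V) : compact K ->
  (forall x, f x != 0 -> K x) -> compact (supp f) /\ supp f `<=` K.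
Proof.
move=> cK fK; have cl : closed K by apply: compact_closed => //; exact: norm_hausdorff.
have sK : supp f `<=` K.
  by move=> x; rewrite {1}/supp => h; rewrite (closure_id K).1//; move: x h; exact: closureS.
by split=> //; apply: (subclosed_compact _ cK sK); exact: closed_closure.
Qed.

Lemma supp_sub V W (f : V -> W) x : f x != 0 -> supp f x.
Proof. by move=> fx; exact: subset_closure. Qed.

Lemma D_eq0 V W (f : V -> W) v x : (\forall y \near x, f y = 0) -> 'D_v f x = 0.
Proof.
move=> f0; rewrite -(derive_cst (0 : W) x v).
by apply: near_eq_derive => //; exact: f0.
Qed.

End SmoothCalculus.

(** * Partial derivatives along coordinate lines of R^4 *)

Section SmoothR4.
Context {R : realType}.
Implicit Types (k g : R4 R -> R) (x y : R4 R).

Lemma e4_norm (j : 'I_4) : `|@e4 R j| = 1.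
Proof.
rewrite /e4 !prod_normE/=; case: j => -[|[|[|[|//]]]] //= _;
  by rewrite ?normr0 ?normr1 /Num.max ?ltxx ?ltr01 ?ltr10 ?ltxx ?ltr01 ?ltr10.
Qed.

Lemma Ccinfty_Cc k : Ccinfty k -> Cc k.
Proof.
move=> [sk ck]; split; first exact: Ck_continuous (sk 0%N).
have [r r0 kr] := bounded_sub_cube ck.
exists r => x rx; apply/eqP/negPn/negP => /supp_sub /kr.
by rewrite /cube/= leNgt rx.
Qed.

Lemma CcinftyI k r : smooth k -> (forall x, r < `|x| -> k x = 0) -> Ccinfty k.
Proof.
move=> sk k0; split=> //.
apply: (proj1 (supp_compact (@compact_cube R r) _)) => x kx.
by rewrite /cube/= leNgt; apply: contra kx => /k0 ->.
Qed.

Lemma Ccinfty_D k (v : R4 R) : Ccinfty k -> Ccinfty ('D_v k).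
Proof.
move=> Ck; have [ck [r kr]] := Ccinfty_Cc Ck.
apply: (@CcinftyI _ r); first by apply: smooth_D; exact: Ck.1.
move=> x rx; apply: D_eq0 => //.
have : nbhs x ((fun y : R4 R => `|y|) @^-1` `]r, +oo[%classic).
  apply: (@norm_continuous _ (R4 R)); apply: open_nbhs_nbhs; split; first exact: rray_open.
  by rewrite /= in_itv/= rx.
by apply: filterS => y; rewrite /= in_itv/= andbT; exact: kr.
Qed.

(** Differentiability is only asked along coordinate lines, with a derivative that is continuous
    along them. This is what the fundamental theorem of calculus on a line uses, and mollified
    functions satisfy it by differentiation under the integral. *)
Definition pderiv (j : 'I_4) (F F' : R4 R -> R) : Prop := forall x,
  is_derive (0 : R) 1 (fun h : R => F (x + h *: e4 R j)) (F' x) /\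
  {for 0, continuous (fun h : R => F' (x + h *: e4 R j))}.

Lemma line_linear (v : R4 R) (h : R) (y w : R) :
  (h *: y + w) *: v = h *: (y *: v) + w *: v.
Proof. by rewrite scalerDl scalerA. Qed.

Lemma line_continuous x (v : R4 R) : continuous (fun h : R => x + h *: v).
Proof. by move=> h; apply: cvgD; [exact: cvg_cst|apply: cvgZr_tmp; exact: cvg_id]. Qed.

Lemma smooth_pderiv j k : smooth k -> pderiv j k ('D_(e4 R j) k).
Proof.
move=> sk x; split.
  have dk : derivable k (x + 0 *: e4 R j) (1 *: e4 R j) by exact: smooth_derivable.
  have L := line_linear (@e4 R j).
  apply: DeriveDef; first exact: (derivable_affine (L := fun h : R => h *: e4 R j)).
  by rewrite (D_affine _ _ _ _ L) scale1r scale0r addr0.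
apply: (@continuous_comp _ _ _ (fun h : R => x + h *: e4 R j) ('D_(e4 R j) k)).
  exact: line_continuous.
exact: Ck_continuous (smooth_D (e4 R j) sk 0%N) _.
Qed.

Lemma pderivM j (F F' G G' : R4 R -> R) : pderiv j F F' -> pderiv j G G' ->
  pderiv j (fun x => F x * G x) (fun x => F x * G' x + G x * F' x).
Proof.
move=> pF pG x; have [dF cF] := pF x; have [dG cG] := pG x; split.
  have [dF1 dF2] := dF; have [dG1 dG2] := dG.
  apply: DeriveDef; first exact: (derivableM dF1 dG1).
  rewrite [LHS](deriveM dF1 dG1) dF2 dG2 !scale0r !addr0.
  by [].
have cF0 : {for 0, continuous (fun h : R => F (x + h *: e4 R j))}.
  by apply: differentiable_continuous; apply/derivable1_diffP; case: dF.
have cG0 : {for 0, continuous (fun h : R => G (x + h *: e4 R j))}.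
  by apply: differentiable_continuous; apply/derivable1_diffP; case: dG.
apply: cvgD; apply: cvgM => //.
Qed.

(** The definition speaks of the parameter 0 only, but at every base point; moving the base point by
    [h] gives the property along the whole line. *)
Lemma pderiv_line j F F' x (h : R) : pderiv j F F' ->
  is_derive h 1 (fun h : R => F (x + h *: e4 R j)) (F' (x + h *: e4 R j)) /\
  {for h, continuous (fun h : R => F' (x + h *: e4 R j))}.
Proof.
move=> /(_ (x + h *: e4 R j))[[d1 d2] c]; have eq (G : R4 R -> R) :
    (fun t : R => G (x + t *: e4 R j)) = (fun t : R => (fun t : R => G (x + h *: e4 R j + t *: e4 R j)) (- h + t)).
  by apply/funext => t; congr G; rewrite -addrA -scalerDl addrA subrr add0r.
pose f (t : R) := F (x + h *: e4 R j + t *: e4 R j).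
split.
  rewrite eq; apply: DeriveDef.
    by apply: (derivable_affine (f := f) (L := id)); [|rewrite addNr].
  by rewrite (D_affine f (L := id)) // addNr -d2.
rewrite eq; apply: (@continuous_comp _ _ _ (fun t : R => - h + t)
   (fun t : R => F' (x + h *: e4 R j + t *: e4 R j))).
  by apply: cvgD; [exact: cvg_cst|exact: cvg_id].
by rewrite addNr.
Qed.

End SmoothR4.

(** * Mollifiers and smooth steps *)

Section Mollifiers.
Context {R : realType}.
Local Notation leb := (@lebesgue_measure R).

Lemma Rintegral_eq0 d (X : measurableType d) (m : {measure set X -> \bar R})
    (D : set X) (f : X -> R) : (forall x, D x -> f x = 0) ->
  \int[m]_(x in D) f x = 0.
Proof.
move=> f0; rewrite /Rintegral integral0_eq// => x Dx; by rewrite f0.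
Qed.

Lemma ge0_subset_Rintegral d (X : measurableType d) (m : {measure set X -> \bar R})
    (D E : set X) (f : X -> R) : measurable D -> measurable E -> D `<=` E ->
  (forall x, E x -> 0 <= f x) -> m.-integrable E (EFin \o f) ->
  \int[m]_(x in D) f x <= \int[m]_(x in E) f x.
Proof.
move=> mD mE DE f0 fi; have fD : m.-integrable D (EFin \o f) by exact: integrableS fi.
rewrite -lee_fin !EFin_Rintegral//; apply: ge0_subset_integral => //.
by case/integrableP : fi.
Qed.

Lemma leb_segment_lty (a b : R) : (leb `[a, b]%classic < +oo)%E.
Proof. by rewrite lebesgue_measure_itv/=; case: ifPn => // _; rewrite -EFinB ltry. Qed.

Lemma bounded_integrable d (X : measurableType d) (m : {measure set X -> \bar R})
    (D : set X) (f : X -> R) (M : R) : measurable D -> (m D < +oo)%E ->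
  measurable_fun D f -> (forall x, D x -> `|f x| <= M) -> m.-integrable D (EFin \o f).
Proof.
move=> mD fD mf fM; apply: measurable_bounded_integrable => //.
exists M; split; first exact: num_real.
by move=> x Mx y Dy; apply: (le_trans (fM _ Dy)); exact: ltW.
Qed.

Definition mollifier (eps : R) (eta : R4 R -> R) : Prop :=
  [/\ Ccinfty eta, forall x, 0 <= eta x, \int[leb4]_x eta x = 1 &
      forall x, eps < `|x| -> eta x = 0].

Lemma Cc_integrable (k : R4 R -> R) : Cc k -> leb4.-integrable setT (EFin \o k).
Proof.
move=> Ck; have [r r0 kr] := Cc_support Ck; have [M M0 kM] := Cc_bounded Ck.
apply: (integrable_setT_zero (m := leb4) (D := cube r)).
- exact: measurable_cube.
- by move=> x; rewrite /cube/= => /negP; rewrite -ltNge => /kr.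
apply: measurable_bounded_integrable; first exact: measurable_cube.
- exact: leb4_cube_lty.
- apply: measurable_funTS; exact: Cc_measurable.
- exists M; split; first exact: num_real.
  by move=> x Mx y yr; apply: (le_trans (kM _)); exact: ltW.
Qed.

(* The supports in [standard_mollifiers] need not be close to the origin, so the
   approximate identity has to be recentred. *)
Lemma mollifier_exists (chi : nat -> R4 R -> R) (eps : R) :
  standard_mollifiers chi -> 0 < eps -> exists eta, mollifier eps eta.
Proof.
move=> [Cchi chi0 chi1 dchi] eps0.
have [n dn] : exists n, (diam (supp (chi n)) < eps%:E)%E.
  have : \forall n \near \oo, (diam (supp (chi n)) < eps%:E)%E.
    apply: (dchi [set y | (y < eps%:E)%E]).
    by apply: open_nbhs_nbhs; split; [exact: open_ereal_lt_ereal|rewrite /= lte_fin].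
  by move=> [n _ /(_ n (leqnn n))]; exists n.
have [z zn] : exists z, chi n z != 0.
  apply: contrapT => /forallNP h.
  have := chi1 n; rewrite (_ : \int[leb4]_x _ = 0); first by move/eqP; rewrite eq_sym oner_eq0.
  by apply: Rintegral_eq0 => x _; apply/eqP/negPn/negP/h.
have Lid (h : R) (y w : R4 R) : h *: y + w = h *: y + w by [].
have hx x : chi n (z + x) != 0 -> `|x| < eps.
  move=> /supp_sub sx; rewrite -lte_fin; apply: le_lt_trans dn.
  apply: ereal_sup_ubound; exists (z + x, z) => /=; last by rewrite addrAC subrr add0r.
  by split=> //=; exact: supp_sub.
exists (fun x => chi n (z + x)); split.
- apply: (@CcinftyI _ _ eps).
    apply: (smooth_affine (f := chi n) (L := id) z Lid); last exact: (Cchi n).1.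
    by move=> x; exact: cvg_id.
  move=> x ex; apply/eqP/negPn/negP => /hx; by rewrite ltNge (ltW ex).
- by move=> x; exact: chi0.
- rewrite -(chi1 n) /Rintegral; congr fine.
  have mc : measurable_fun (setT : set (M4 R)) (EFin \o chi n).
    by apply/measurable_EFinP; apply: Cc_measurable; apply: Ccinfty_Cc; exact: Cchi.
  exact: (preserves_integral (preserves_leb4_add z) mc).
- by move=> x ex; apply/eqP/negPn/negP => /hx; rewrite ltNge (ltW ex).
Qed.

(** The fundamental theorem gives the derivative in direction 1; the other directions follow by
    linearity of the differential, and all of them are multiples of the smooth [c]. *)
Lemma smooth_primitive (c : R -> R) : smooth c ->
  (forall t, leb.-integrable `]-oo, t] (EFin \o c)) ->
  smooth (fun t : R => \int[leb]_(s in `]-oo, t]) c s).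
Proof.
move=> sc ic.
have dS (t : R) : is_derive t (1 : R) (fun t : R => \int[leb]_(s in `]-oo, t]) c s) (c t).
  have [] := @continuous_FTC1 R c -oo%O t (t + 1) _ (ic _) _ _.
  - by rewrite ltrDl.
  - by rewrite ltNyr.
  - exact: Ck_continuous (sc 0%N) t.
  - by move=> d1 d2; apply: DeriveDef; [exact: d1|rewrite -derive1E; exact: d2].
case=> [|n].
  split=> // t; apply: differentiable_continuous; apply/derivable1_diffP.
  by have [] := dS t.
split; first by move=> t; apply: differentiable_continuous; apply/derivable1_diffP; case: (dS t).
move=> v; have dv (t : R) : is_derive t v (fun t : R => \int[leb]_(s in `]-oo, t]) c s) (v * c t).
  have [d1 d2] := dS t.
  have /derivable1_diffP df := d1.
  apply: DeriveDef; first exact: diff_derivable.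
  rewrite -d2 -{1}[v]mulr1 (deriveE _ df) (deriveE _ df).
  exact: linearZ.
split; first by move=> t; have [] := dv t.
suff -> : 'D_v (fun t : R => \int[leb]_(s in `]-oo, t]) c s) = (fun t => v * c t).
  apply: Ck_mul; [exact: Ck_cst|exact: sc].
by apply/funext => t; apply: derive_val; exact: dv.
Qed.

Definition smooth_step (S : R -> R) : Prop :=
  [/\ smooth S, forall t, 0 <= S t <= 1, forall t, t <= -1 -> S t = 0 &
      forall t, 1 <= t -> S t = 1].

(** A mollifier restricted to a line through a point where it is positive is a bump [c]; the step is
    the primitive of [c] divided by its integral. With radius one third, that point has norm at most
    one third, so [c] vanishes as soon as [|s| >= 1]. *)
Lemma smooth_step_exists (eta : R4 R -> R) : mollifier 3^-1 eta ->
  exists S, smooth_step S.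
Proof.
move=> [Ceta eta0 eta1 etas].
have [z zn] : exists z, eta z != 0.
  apply: contrapT => /forallNP h.
  move: eta1; rewrite (_ : \int[leb4]_x _ = 0); first by move/eqP; rewrite eq_sym oner_eq0.
  by apply: Rintegral_eq0 => x _; apply/eqP/negPn/negP/h.
have zle : `|z| <= 3^-1.
  by rewrite leNgt; apply: contra zn => /etas ->.
pose c (s : R) := eta (z + s *: e4 R 0).
have sc : smooth c.
  apply: (smooth_affine (f := eta) (L := fun s : R => s *: e4 R 0)); last exact: Ceta.1.
    exact: line_linear.
  by move=> s; apply: cvgZr_tmp; exact: cvg_id.
have c0 s : 1 <= `|s| -> c s = 0.
  move=> s1; apply: etas; rewrite addrC -[z]opprK.
  apply: (lt_le_trans _ (lerB_dist _ _)); rewrite normrN normrZ e4_norm mulr1.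
  by move: zle s1; lra.
have cc : continuous c by exact: Ck_continuous (sc 0%N).
have cge s : 0 <= c s by exact: eta0.
have mc : measurable_fun setT c by exact: continuous_measurable_fun.
have [M M0 cM] := Cc_bounded (Ccinfty_Cc Ceta).
have ic : leb.-integrable setT (EFin \o c).
  apply: (integrable_setT_zero (m := leb) (D := `[-1, 1]%classic)) => //.
    move=> x; rewrite /= in_itv/= -ler_norml => /negP; rewrite -ltNge => /ltW; exact: c0.
  apply: measurable_bounded_integrable => //.
  - exact: leb_segment_lty.
  - exact: measurable_funTS.
  - exists M; split; first exact: num_real.
    by move=> x Mx y yr; apply: (le_trans (cM _)); exact: ltW.
have icS (D : set R) : measurable D -> leb.-integrable D (EFin \o c).
  by move=> mD; exact: integrableS ic.
pose F t := \int[leb]_(s in `]-oo, t]) c s.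
have Fs : smooth F.
  apply: (@smooth_primitive c) => // t; exact: icS.
pose J := \int[leb]_s c s.
have FJ t : 1 <= t -> F t = J.
  move=> t1; rewrite /F /J Rintegral_mkcond; apply: eq_Rintegral => s _.
  rewrite patchE; case: ifPn => //; rewrite notin_setE/= in_itv/= => /negP.
  rewrite -ltNge => ts; rewrite c0//.
  by rewrite (le_trans t1)// (le_trans (ltW ts))// ler_norm.
have Fle t : F t <= J.
  exact: ge0_subset_Rintegral.
have F0 t : t <= -1 -> F t = 0.
  move=> t1; apply: Rintegral_eq0 => s; rewrite /= in_itv/= => st.
  have s1 : s <= -1 by rewrite (le_trans st).
  apply: c0; rewrite ler0_norm; first by rewrite lerNr.
  by rewrite (le_trans s1)// oppr_le0.
(* [c 0 = eta z] is positive, so by continuity [c] exceeds [c 0 / 2] on a segment to the right of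
   0. *)
have J0 : 0 < J.
  have cz : 0 < c 0 by rewrite /c scale0r addr0 lt_neqAle eq_sym zn eta0.
  have /nbhs_ballP[d /= d0 hd] : nbhs 0 (c @^-1` `]c 0 / 2, +oo[%classic).
    apply: cc; apply: open_nbhs_nbhs; split; first exact: rray_open.
    by rewrite /= in_itv/= andbT ltr_pdivrMr// ltr_pMr// ltr1n.
  have mI : measurable (`[0, d / 2]%classic : set R) by exact: measurable_itv.
  apply: (@lt_le_trans _ _ (\int[leb]_(s in `[0, d / 2]) (c 0 / 2))).
    rewrite Rintegral_cst//= lebesgue_measure_itv/= lte_fin divr_gt0//=.
    by rewrite subr0 mulr_gt0// divr_gt0.
  apply: (@le_trans _ _ (\int[leb]_(s in `[0, d / 2]) c s)).
    apply: le_Rintegral => //; last 1 first.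
    - move=> s; rewrite /= in_itv/= => /andP[s0 sd]; apply/ltW.
      have := hd s; rewrite /ball/= in_itv/= andbT; apply.
      rewrite sub0r normrN ger0_norm// (le_lt_trans sd)//.
      by rewrite ltr_pdivrMr// ltr_pMr// ltr1n.
    - apply: (@bounded_integrable _ _ _ _ _ `|c 0 / 2|) => //; exact: leb_segment_lty.
    - exact: icS.
  exact: ge0_subset_Rintegral.
exists (fun t => J^-1 * F t); split.
- by apply: smooth_mul => // n; exact: Ck_cst.
- move=> t; rewrite mulr_ge0 ?invr_ge0 ?(ltW J0)//=; last first.
    by apply: Rintegral_ge0 => s _.
  by rewrite mulrC ler_pdivrMr// mul1r.
- by move=> t t1; rewrite F0// mulr0.
- by move=> t t1; rewrite FJ// mulVf// gt_eqF.
Qed.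

End Mollifiers.

(** * Cutoffs of cubes and annuli *)

Section Cutoffs.
Context {R : realType}.
Local Notation leb := (@lebesgue_measure R).

Lemma D_realZ (f : R -> R) (t v : R) : derivable f t 1 -> 'D_v f t = v * 'D_1 f t.
Proof.
move=> /derivable1_diffP df; rewrite (deriveE _ df) (deriveE _ df) -{1}[v]mulr1.
exact: linearZ.
Qed.

Lemma bump_exists (S : R -> R) : smooth_step S -> exists kappa : R -> R,
  [/\ smooth kappa, forall t, 0 <= kappa t <= 1,
      forall t, `|t| <= 1 -> kappa t = 1 & forall t, 2 < `|t| -> kappa t = 0].
Proof.
move=> [sS S01 S0 S1].
have lin (c : R) (h y w : R) : c * (h *: y + w) = h *: (c * y) + c * w.
  by rewrite mulrDr [in RHS]/GRing.scale/= mulrCA.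
have aff (c : R) : smooth (fun t => S (3 + c * t)).
  apply: (smooth_affine (f := S) (L := fun t => c * t)) => //.
  by move=> t; apply: cvgM; [exact: cvg_cst|exact: cvg_id].
(* Both [3 - 2 t] and [3 + 2 t] are at least 1 on [-1, 1], and one of them is below -1 when
   [|t| > 2]. *)
exists (fun t => S (3 + (- 2) * t) * S (3 + 2 * t)); split.
- by apply: smooth_mul; exact: aff.
- move=> t; have /andP[a1 a2] := S01 (3 + -2 * t); have /andP[b1 b2] := S01 (3 + 2 * t).
  by rewrite mulr_ge0//= mulr_ile1.
- by move=> t; rewrite ler_norml => /andP[t1 t2]; rewrite !S1 ?mulr1//; lra.
- move=> t; rewrite ltr_normr => /orP[t2|t2].
    by rewrite S0 ?mul0r//; lra.
  by rewrite [X in _ * X]S0 ?mulr0//; lra.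
Qed.

(** A product of one-dimensional bumps suffices because the norm is the sup norm. *)
Lemma unit_cutoff_exists (S : R -> R) : smooth_step S -> exists zeta : R4 R -> R,
  [/\ smooth zeta, forall x, 0 <= zeta x <= 1,
      forall x, `|x| <= 1 -> zeta x = 1 & forall x, 2 < `|x| -> zeta x = 0].
Proof.
move=> /bump_exists[kappa [sk k01 k1 k0]].
have sm (L : R4 R -> R) : (forall (h : R) y w, L (h *: y + w) = h *: L y + L w) ->
    continuous L -> smooth (fun x => kappa (L x)).
  move=> linL cL.
  have := smooth_affine (f := kappa) 0 linL cL sk.
  by congr smooth; apply/funext => x; rewrite add0r.
exists (fun x => kappa x.1.1.1 * kappa x.1.1.2 * kappa x.1.2 * kappa x.2); split.
- have c1 : continuous (fun x : R4 R => x.1) by move=> x; exact: cvg_fst.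
  have c11 : continuous (fun x : R4 R => x.1.1).
    by move=> x; apply: (@continuous_comp _ _ _ (fun x : R4 R => x.1) fst); [exact: cvg_fst|exact: cvg_fst].
  repeat apply: smooth_mul; apply: sm => //.
  + by move=> x; apply: (@continuous_comp _ _ _ (fun x : R4 R => x.1.1) fst); [exact: c11|exact: cvg_fst].
  + by move=> x; apply: (@continuous_comp _ _ _ (fun x : R4 R => x.1.1) snd); [exact: c11|exact: cvg_snd].
  + by move=> x; apply: (@continuous_comp _ _ _ (fun x : R4 R => x.1) snd); [exact: c1|exact: cvg_snd].
  + by move=> x; exact: cvg_snd.
- move=> x; have /andP[a1 a2] := k01 x.1.1.1; have /andP[b1 b2] := k01 x.1.1.2.
  have /andP[c1 c2] := k01 x.1.2; have /andP[d1 d2] := k01 x.2.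
  by rewrite !mulr_ge0//= !mulr_ile1// ?mulr_ge0.
- move=> [[[a b] c] d]; rewrite !prod_normE/= !ge_max => /andP[/andP[/andP[? ?] ?] ?].
  by rewrite !k1// !mulr1.
- move=> [[[a b] c] d]; rewrite !prod_normE/= !lt_max => /orP[/orP[/orP[h|h]|h]|h].
  + by rewrite k0// !mul0r.
  + by rewrite [kappa b]k0// mulr0 !mul0r.
  + by rewrite [kappa c]k0// mulr0 !mul0r.
  + by rewrite [kappa d]k0// mulr0.
Qed.

Definition ball_cutoff (C r : R) (zeta : R4 R -> R) : Prop :=
  [/\ Ccinfty zeta, forall x, 0 <= zeta x <= 1,
      forall x, `|x| <= r -> zeta x = 1, forall x, 2 * r < `|x| -> zeta x = 0 &
      forall j x, `|'D_(e4 R j) zeta x| <= C / r].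

(** All radii share one profile, rescaled: the chain rule divides its derivatives by [r], so [C]
    does not depend on [r]. *)
Lemma ball_cutoff_exists (S : R -> R) : smooth_step S ->
  exists2 C, 0 < C & forall r, 0 < r -> exists zeta, ball_cutoff C r zeta.
Proof.
move=> /unit_cutoff_exists[zeta [sz z01 z1 z0]].
have Cz : Ccinfty zeta by exact: CcinftyI z0.
have bd j : exists2 M, 0 < M & forall x, `|'D_(e4 R j) zeta x| <= M.
  by apply: Cc_bounded; apply: Ccinfty_Cc; exact: Ccinfty_D.
pose M j := projT1 (cid2 (bd j)).
have MP j : 0 < M j /\ forall x, `|'D_(e4 R j) zeta x| <= M j.
  by rewrite /M; case: cid2 => m m0 mb.
exists (\sum_j M j).
  by rewrite (bigD1 ord0)//= ltr_wpDr ?sumr_ge0 ?(MP _).1// => j _; rewrite ltW ?(MP _).1.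
move=> r r0.
have lin (h : R) (y w : R4 R) : r^-1 *: (h *: y + w) = h *: (r^-1 *: y) + r^-1 *: w.
  by rewrite scalerDr !scalerA [r^-1 * h]mulrC.
have nr (x : R4 R) : `|r^-1 *: x| = `|x| / r.
  by rewrite normrZ ger0_norm ?invr_ge0 ?ltW// mulrC.
exists (fun x => zeta (0 + r^-1 *: x)); split.
- apply: (@CcinftyI _ _ (2 * r)).
    apply: (smooth_affine (f := zeta) (L := fun x : R4 R => r^-1 *: x)) => //.
    by move=> x; apply: cvgZr; exact: cvg_id.
  by move=> x xr; apply: z0; rewrite add0r nr ltr_pdivlMr.
- by [].
- by move=> x xr; apply: z1; rewrite add0r nr ler_pdivrMr// mul1r.
- by move=> x xr; apply: z0; rewrite add0r nr ltr_pdivlMr.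
- move=> j x; rewrite (D_affine zeta 0 (L := fun x : R4 R => r^-1 *: x))//.
  have -> : 'D_(r^-1 *: e4 R j) zeta (0 + r^-1 *: x) = r^-1 * 'D_(e4 R j) zeta (0 + r^-1 *: x).
    have L1 (h y w : R) : (h *: y + w) *: e4 R j = h *: (y *: e4 R j) + w *: e4 R j.
      exact: line_linear.
    have E (v : R) : 'D_v (fun h : R => zeta ((0 + r^-1 *: x) + h *: e4 R j)) 0 =
        'D_(v *: e4 R j) zeta (0 + r^-1 *: x).
      by rewrite (D_affine zeta (0 + r^-1 *: x) (L := fun h : R => h *: e4 R j))// scale0r addr0.
    have := E 1; rewrite scale1r => <-; rewrite -E.
    have df : derivable (fun h : R => zeta ((0 + r^-1 *: x) + h *: e4 R j)) 0 1.
      exact: (@ex_derive _ _ _ _ _ _ _ (smooth_pderiv j sz (0 + r^-1 *: x)).1).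
    exact: D_realZ.
  have ri0 : 0 <= r^-1 by rewrite invr_ge0 ltW.
  rewrite normrM (ger0_norm ri0) [leLHS]mulrC; apply: ler_wpM2r => //.
  rewrite (le_trans ((MP j).2 _))// (bigD1 j)//= lerDl sumr_ge0// => i _.
  by rewrite ltW// (MP _).1.
Qed.

Definition annulus_cutoff (C r r' : R) (psi : R4 R -> R) : Prop :=
  [/\ Ccinfty psi, forall x, 0 <= psi x <= 1,
      forall x, `|x| <= r -> psi x = 0,
      forall x, 2 * r < `|x| -> `|x| <= r' -> psi x = 1 &
      forall j x, `|'D_(e4 R j) psi x| <= C / r].

(** The gradient is at most [C / r' + C / r <= 2 C / r]: the outer radius costs no more than the
    inner one, so the bound survives when [r'] grows. *)
Lemma annulus_cutoff_exists (C r r' : R) zeta zeta' : 0 < C -> 0 < r -> r <= r' ->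
  ball_cutoff C r zeta -> ball_cutoff C r' zeta' ->
  annulus_cutoff (2 * C) r r' (fun x => (1 + (-1) * zeta x) * zeta' x).
Proof.
move=> C0 r0 rr' [Cz z01 z1 z0 Dz] [Cz' z01' z1' z0' Dz'].
have s1 : smooth (fun x => 1 + (-1) * zeta x).
  by move=> n; apply: Ck_add; [exact: Ck_cst|apply: Ck_mul; [exact: Ck_cst|exact: Cz.1]].
have [n1 n2] : (forall x, 0 <= 1 + (-1) * zeta x) /\ (forall x, 1 + (-1) * zeta x <= 1).
  by split=> x; have /andP[? ?] := z01 x; lra.
split.
- apply: (@CcinftyI _ _ (2 * r')); first by apply: smooth_mul => //; exact: Cz'.1.
  by move=> x xr; rewrite z0' ?mulr0.
- by move=> x; have /andP[? ?] := z01' x; rewrite mulr_ge0//= mulr_ile1.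
- by move=> x xr; rewrite z1// mulr1 subrr mul0r.
- by move=> x x1 x2; rewrite z0// z1'// mulr0 addr0 mulr1.
- move=> j x.
  have d1 : derivable (fun x => 1 + (-1) * zeta x) x (e4 R j) by exact: smooth_derivable.
  have dz : derivable zeta x (e4 R j) by apply: smooth_derivable; exact: Cz.1.
  have d2 : derivable zeta' x (e4 R j) by apply: smooth_derivable; exact: Cz'.1.
  rewrite [X in `|X|](deriveM d1 d2).
  have -> : 'D_(e4 R j) (fun x => 1 + (-1) * zeta x) x = - 'D_(e4 R j) zeta x.
    rewrite [LHS](@deriveD _ _ _ (fun=> (1 : R)) (fun x => (-1) * zeta x)) ?derive_cst ?add0r.
    + by rewrite [LHS](@deriveZ _ _ _ zeta (-1)) // scaleN1r.
    + exact: derivable_cst.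
    + exact: (@derivableZ _ _ _ zeta (-1)).
  rewrite (le_trans (ler_normD _ _))// !normrM normrN.
  have /andP[a1 a2] := z01' x.
  apply: (@le_trans _ _ (C / r' + C / r)).
    apply: lerD; rewrite -[leRHS]mul1r; apply: ler_pM => //.
    + by rewrite ger0_norm.
    + by rewrite ger0_norm.
  rewrite -mulrA mulr_natl mulr2n lerD2r ler_pM2l// lef_pV2// posrE//.
  exact: lt_le_trans rr'.
Qed.

End Cutoffs.

(** * Integration by parts on R^4 *)

Section IntegrationByParts.
Context {R : realType}.
Local Notation mR := (measurableTypeR R).
Local Notation leb := (@lebesgue_measure R).
Implicit Types (k g F : R4 R -> R) (x y : R4 R).

Lemma FTC_segment (f F : R -> R) (a b : R) : a < b ->
  (forall t, is_derive t (1 : R) F (f t)) -> continuous f ->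
  (\int[leb]_(t in `[a, b]) (f t)%:E = (F b - F a)%:E)%E.
Proof.
move=> ab dF cf; have cF : continuous F.
  by move=> t; apply: differentiable_continuous; apply/derivable1_diffP; case: (dF t).
rewrite EFinB (continuous_FTC2 (F := F))//.
- exact: continuous_subspaceT.
- split.
  + by move=> t _; have [] := dF t.
  + exact/cvg_at_right_filter/cF.
  + exact/cvg_at_left_filter/cF.
- by move=> t _; rewrite derive1E; apply: derive_val.
Qed.

Lemma measurable_line (v : R4 R) : measurable_fun setT
  (fun z : M4 R * mR => (z.1 : R4 R) + (z.2 : R) *: v : M4 R).
Proof.
have -> : (fun z : M4 R * mR => (z.1 : R4 R) + (z.2 : R) *: v : M4 R) =
   (fun z : M4 R * mR => (((z.1.1.1.1 + z.2 * v.1.1.1, z.1.1.1.2 + z.2 * v.1.1.2),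
       z.1.1.2 + z.2 * v.1.2), z.1.2 + z.2 * v.2)%R).
  by apply/funext => -[[[[? ?] ?] ?] ?]; case: v => -[[? ?] ?] ?.
have m2 (c : R) : measurable_fun setT (fun z : M4 R * mR => z.2 * c).
  by apply: measurable_funM => //; exact: measurable_snd.
repeat (apply: measurable_fun_pair); apply: measurable_funD => //.
- exact: (measurableT_comp measurable_fst (measurableT_comp measurable_fst
   (measurableT_comp measurable_fst measurable_fst))).
- exact: (measurableT_comp measurable_snd (measurableT_comp measurable_fst
   (measurableT_comp measurable_fst measurable_fst))).
- exact: (measurableT_comp measurable_snd (measurableT_comp measurable_fst measurable_fst)).
- exact: (measurableT_comp measurable_snd measurable_fst).
Qed.

Lemma integral_shift (f : M4 R -> \bar R) (a : R4 R) : measurable_fun setT f ->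
  (\int[leb4]_x f ((x : R4 R) + a)%R = \int[leb4]_x f x)%E.
Proof.
move=> mf; rewrite -[RHS](preserves_integral (preserves_leb4_add a) mf).
by apply: eq_integral => x _; rewrite addrC.
Qed.

(** By the fundamental theorem on each line, [F (x + e_j) - F x] is the integral of [F'] over a unit
    segment. Integrating in [x], the left side vanishes by translation invariance and the right side
    is the integral of [F'] by Fubini; integrability takes the place of compact support. *)
Lemma integral_pderiv_eq0 j F F' : pderiv j F F' -> leb4.-integrable setT (EFin \o F) ->
  leb4.-integrable setT (EFin \o F') -> \int[leb4]_x F' x = 0.
Proof.
move=> pF iF iF'.
have mF' : measurable_fun (setT : set (M4 R)) F'.
  by apply/measurable_EFinP; case/integrableP : iF'.
have mF : measurable_fun (setT : set (M4 R)) (EFin \o F) by case/integrableP : iF.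
have m01 : measurable (`[0, 1]%classic : set mR) by exact: measurable_itv.
have mI : measurable_fun (setT : set mR) (\1_`[0, 1]%classic : mR -> R) by exact: measurable_indic.
(* The segment [0, 1] makes the integrand integrable on the product, and has length one. *)
pose P (z : M4 R * mR) := (F' ((z.1 : R4 R) + (z.2 : R) *: e4 R j) * \1_`[0, 1]%classic z.2)%:E.
have mP : measurable_fun setT P.
  apply/measurable_EFinP; apply: measurable_funM.
    exact: (measurableT_comp mF' (measurable_line _)).
  exact: (measurableT_comp mI measurable_snd).
have ind (h : R) : (\1_`[0, 1]%classic h : R) = (if h \in `[0, 1]%classic then 1 else 0).
  by rewrite indicE; case: (_ \in _).
have Phx (h : R) : (\int[leb4]_x `|P (x, h)| =
    (\int[leb4]_x `|(F' x)%:E|) * (\1_`[0, 1]%classic h)%:E)%E.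
  rewrite /P/= (eq_integral (fun x : M4 R => `|(F' ((x : R4 R) + h *: e4 R j))%:E| * (\1_`[0, 1]%classic h)%:E)%E); last first.
    move=> x _; rewrite /= normrM EFinM; congr (_ * _%:E)%E.
    by rewrite ger0_norm// indicE.
  rewrite ge0_integralZr//; last first.
    apply/measurable_EFinP; apply: measurableT_comp => //.
    apply: (measurableT_comp mF').
    have := preserves_leb4_add (h *: e4 R j).
    move=> [+ _]; congr measurable_fun; apply/funext => x; exact: addrC.
  congr (_ * _)%E.
  rewrite (integral_shift (f := fun x => `|(F' x)%:E|%E))//.
  by apply: measurableT_comp => //; exact/measurable_EFinP.
have i01 : (\int[leb]_h (\1_`[0%R, 1%R]%classic h)%:E = 1)%E.
  transitivity (leb `[0, 1]%classic); first by rewrite integral_indic// setIT.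
  by rewrite lebesgue_measure_itv/= lte_fin ltr01 oppr0 adde0.
have iP : (leb4 \x leb)%E.-integrable setT P.
  apply/(integrable21ltyP _ _ mP).
  under eq_integral do rewrite Phx.
  rewrite ge0_integralZl//; [|exact/measurable_EFinP|exact: integral_ge0].
  by rewrite i01 mule1; case/integrableP : iF'.
have E1 : (\int[leb]_h \int[leb4]_x P (x, h) = (\int[leb4]_x F' x)%:E)%E.
  transitivity (\int[leb]_h ((\int[leb4]_x F' x)%:E * (\1_`[0%R, 1%R]%classic h)%:E))%E.
    apply: eq_integral => h _.
    rewrite /P/= ind; case: ifP => _; last first.
      by rewrite mule0 integral0_eq// => x _; rewrite mulr0.
    rewrite mule1 EFin_Rintegral//.
    rewrite -(integral_shift (f := fun x => (F' x)%:E) (h *: e4 R j)); last exact/measurable_EFinP.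
    by apply: eq_integral => x _; rewrite mulr1.
  rewrite integralZl//; first by rewrite i01 mule1.
  apply/integrableP; split; first by apply/measurable_EFinP; exact: measurable_indic.
  under eq_integral do rewrite /= ger0_norm ?indicE//.
  by under eq_integral do rewrite -indicE; rewrite i01 ltry.
have E2 : (\int[leb4]_x \int[leb]_h P (x, h) = \int[leb4]_x ((F ((x : R4 R) + e4 R j)%R)%:E - (F x)%:E))%E.
  apply: eq_integral => x _; rewrite -EFinB.
  have -> : F ((x : R4 R) + e4 R j) - F x = F ((x : R4 R) + (1 : R) *: e4 R j) - F ((x : R4 R) + (0 : R) *: e4 R j).
    by rewrite scale1r scale0r addr0.
  have FT := FTC_segment ltr01 (fun h => (pderiv_line x h pF).1)
    (fun h => (pderiv_line x h pF).2).
  rewrite -FT [RHS]integral_mkcond; apply: eq_integral => h _; rewrite /P patchE/= ind.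
  by case: ifP; rewrite ?mulr1 ?mulr0.
apply: EFin_inj; rewrite -E1 -(Fubini iP) E2.
have iFs := preserves_integrable (preserves_leb4_add (e4 R j)) iF.
rewrite integralB//.
- rewrite (integral_shift (f := fun x => (F x)%:E))// subee//.
  exact: integrable_fin_num.
- by move: iFs; congr (leb4.-integrable _ _); apply/funext => x /=; rewrite addrC.
Qed.

Lemma integration_by_parts4 j F F' G G' : pderiv j F F' -> pderiv j G G' ->
  leb4.-integrable setT (EFin \o (fun x => F x * G x)) ->
  leb4.-integrable setT (EFin \o (fun x => F x * G' x)) ->
  leb4.-integrable setT (EFin \o (fun x => G x * F' x)) ->
  \int[leb4]_x (F x * G' x) = - \int[leb4]_x (G x * F' x).
Proof.
move=> pF pG i1 i2 i3; have := integral_pderiv_eq0 (pderivM pF pG) i1.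
have iD : leb4.-integrable setT (EFin \o (fun x => F x * G' x + G x * F' x)).
  by have := integrableD measurableT i2 i3.
move=> /(_ iD); rewrite RintegralD// => /eqP; rewrite addr_eq0 => /eqP ->.
by [].
Qed.

(** Differentiation under the integral: the derivative falls on the kernel, and near a given [x] it
    is dominated by [M |g|] on a fixed cube. *)
Lemma cv_pderiv j (eta g : R4 R -> R) : Ccinfty eta -> locint g ->
  pderiv j (cv eta g) (cv ('D_(e4 R j) eta) g).
Proof.
move=> Ceta lg x.
pose deta := 'D_(e4 R j) eta.
have Cd : Cc deta by apply: Ccinfty_Cc; exact: Ccinfty_D.
have Ce : Cc eta by exact: Ccinfty_Cc.
have [M M0 dM] := Cc_bounded Cd; have [r r0 d0] := Cc_support Cd.
pose f (h : R) (y : M4 R) : R := eta (x + h *: e4 R j - (y : R4 R)) * g y.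
pose f' (h : R) (y : M4 R) : R := deta (x + h *: e4 R j - (y : R4 R)) * g y.
have sub (h : R) (y : R4 R) : x + h *: e4 R j - y = (x - y) + h *: e4 R j.
  by rewrite addrAC.
have df (h : R) y : is_derive h (1 : R) (f ^~ y) (f' h y).
  have [dl _] := pderiv_line (x - (y : R4 R)) h (smooth_pderiv j Ceta.1).
  have -> : f ^~ y = (fun h => g y * eta ((x - (y : R4 R)) + h *: e4 R j)).
    by apply/funext => t; rewrite /f sub mulrC.
  rewrite /f' sub mulrC; apply: DeriveDef.
    by apply: (@derivableZ _ _ _ _ (g y)); exact: ex_derive.
  rewrite [LHS](@deriveZ _ _ _ _ (g y)); last exact: ex_derive.
  by congr (_ * _); exact: derive_val.
have cf (h : R) y : {for h, continuous (f' ^~ y)}.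
  have [_ cl] := pderiv_line (x - (y : R4 R)) h (smooth_pderiv j Ceta.1).
  have -> : f' ^~ y = (fun h => deta ((x - (y : R4 R)) + h *: e4 R j) * g y).
    by apply/funext => t; rewrite /f' sub.
  by apply: cvgM; [exact: cl|exact: cvg_cst].
(* [|h| < 1] moves the centre of the kernel by less than one, whence the extra unit in the
   radius. *)
pose B : set (M4 R) := cube (r + (`|x| + 1)).
have mB : measurable B by exact: measurable_cube.
pose G (y : M4 R) : R := if y \in B then M * `|g y| else 0.
have iG : leb4.-integrable setT (EFin \o G).
  apply: (integrable_setT_zero (m := leb4) (D := B)) => //.
    by move=> y By; rewrite /G memNset.
  apply: (eq_integrable mB (EFin \o (fun y => M * `|g y|))).
    by move=> y yB; rewrite /= /G yB.
  by have := integrableZl mB M (integrable_norm (lg.2 (r + (`|x| + 1)))); apply.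
have G0 y : 0 <= G y by rewrite /G; case: ifP => // _; rewrite mulr_ge0// ltW.
have fG (h : R) y : -1 < h < 1 -> `|f' h y| <= G y.
  move=> h1; rewrite /f' /G; case: ifPn => yB.
    by rewrite normrM ler_wpM2r.
  rewrite d0 ?mul0r ?normr0//; move: yB; rewrite notin_setE /B/cube/= => /negP.
  rewrite -ltNge => yB; rewrite -normrN opprB.
  apply: (lt_le_trans _ (lerB_dist _ _)).
  have : `|x + h *: e4 R j| <= `|x| + 1.
    rewrite (le_trans (ler_normD _ _))// lerD2l normrZ e4_norm mulr1.
    by rewrite ler_norml; case/andP : h1 => ? ?; rewrite !ltW.
  by move: yB; lra.
have if1 (h : R) : leb4.-integrable setT (EFin \o f h).
  exact: shift_integrable.
have if2 (h : R) : leb4.-integrable setT (EFin \o f' h).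
  exact: shift_integrable.
have I0 : (`]-1, 1[%classic : set R) 0 by rewrite /= in_itv/= ltr01 oppr_lt0 ltr01.
have p1 (h : R) y : partial1of2 f h y = f' h y.
  by rewrite partial1of2E; apply: derive_val; exact: df.
have dfx h y : (`]-1, 1[%classic : set R) h -> setT y -> derivable (f ^~ y) h 1.
  by move=> _ _; exact: ex_derive.
have fGx h y : (`]-1, 1[%classic : set R) h -> setT y -> `|partial1of2 f h y| <= G y.
  by rewrite /= in_itv/= p1 => h1 _; exact: fG.
have D1 := @derivable_under_integral _ _ _ leb4 f setT measurableT 0 (-1) 1 I0 (fun h _ => if1 h) dfx G G0 iG fGx.
have D2 := @differentiation_under_integral _ _ _ leb4 f setT measurableT 0 (-1) 1 I0 (fun h _ => if1 h) dfx G G0 iG fGx.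
split.
  apply: DeriveDef; first exact: D1.
  rewrite -derive1E [LHS]D2; under eq_Rintegral do rewrite p1.
  by rewrite /cv /f'; under eq_Rintegral do rewrite scale0r addr0.
have C := @continuity_under_integral _ _ _ leb4 f' setT measurableT (-1) 1 (fun h _ => if2 h) _ G iG _.
apply: C; last by rewrite inE.
- by apply: aeW => y _ h _; exact: cf.
- by move=> h; rewrite /= in_itv/= => h1; apply: aeW => y _; exact: fG.
Qed.

End IntegrationByParts.

(** * Jensen's and Young's inequalities for mollified functions *)

Section Young.
Context {R : realType}.
Implicit Types (k g : R4 R -> R) (x y : R4 R).

Definition density k := [/\ Cc k, forall x, 0 <= k x & \int[leb4]_x k x = 1].

Lemma mollifier_density eps k : mollifier eps k -> density k.
Proof. by move=> [Ck k0 k1 _]; split=> //; exact: Ccinfty_Cc. Qed.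

Lemma density_integral k x : density k ->
  (\int[leb4]_y (k (x - (y : R4 R)))%:E = 1)%E.
Proof.
move=> [Ck k0 k1]; have mk : measurable_fun (setT : set (M4 R)) (EFin \o k).
  by apply/measurable_EFinP; exact: Cc_measurable.
have -> := preserves_integral (preserves_leb4_sub x) mk.
by rewrite -EFin_Rintegral ?k1//; exact: Cc_integrable.
Qed.

Lemma density_integralr k y : density k ->
  (\int[leb4]_x (k ((x : R4 R) - y))%:E = 1)%E.
Proof.
move=> [Ck k0 k1]; have mk : measurable_fun (setT : set (M4 R)) (EFin \o k).
  by apply/measurable_EFinP; exact: Cc_measurable.
have -> := integral_shift (- y) mk.
by rewrite -EFin_Rintegral ?k1//; exact: Cc_integrable.
Qed.

(** Convexity is encoded by supporting lines, [m] being a slope at [c], which is the form that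
    Jensen's inequality consumes. *)
Definition convex_ge0 (Phi : R -> R) := [/\ measurable_fun setT Phi,
  forall a, 0 <= Phi a & forall c, exists m, forall a, Phi c + m * (a - c) <= Phi a].

(** The supporting line at [c = cv k g x] is integrated against the probability density [k (x - .)].
    When the right-hand side is infinite nothing is to be proved; otherwise the integrals are
    linear. *)
Lemma jensen_cv k g Phi x : density k -> locint g -> convex_ge0 Phi ->
  ((Phi (cv k g x))%:E <= \int[leb4]_y (k (x - (y : R4 R)) * Phi (g y))%:E)%E.
Proof.
move=> dk lg [mPhi Phi0 sub]; have [Ck k0 k1] := dk.
have ms : measurable_fun (setT : set (M4 R)) (fun y : R4 R => k (x - y)) by exact: measurable_shift.
have mf : measurable_fun (setT : set (M4 R)) (fun y => k (x - (y : R4 R)) * Phi (g y)).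
  by apply: measurable_funM => //; exact: (measurableT_comp mPhi lg.1).
have f0 (y : M4 R) : setT y -> 0 <= k (x - (y : R4 R)) * Phi (g y) by rewrite mulr_ge0.
have [->|/eqP Iy] := eqVneq (\int[leb4]_y (k (x - (y : R4 R)) * Phi (g y))%:E)%E +oo%E.
  by rewrite leey.
have If : leb4.-integrable setT (EFin \o (fun y : M4 R => k (x - (y : R4 R)) * Phi (g y))).
  by apply: ge0_integrable => //; rewrite ltey; apply/eqP.
rewrite -EFin_Rintegral// lee_fin.
have [m hm] := sub (cv k g x); set c := cv k g x in hm *.
have ik : leb4.-integrable setT (EFin \o (fun y : M4 R => k (x - (y : R4 R)))).
  apply: ge0_integrable => //; by rewrite density_integral// ltry.
have ikg : leb4.-integrable setT (EFin \o (fun y : M4 R => k (x - (y : R4 R)) * g y)).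
  exact: shift_integrable.
have i1 : leb4.-integrable setT (EFin \o (fun y : M4 R => (Phi c - m * c) * k (x - (y : R4 R)))).
  by have := integrableZl measurableT (Phi c - m * c) ik.
have i2 : leb4.-integrable setT (EFin \o (fun y : M4 R => m * (k (x - (y : R4 R)) * g y))).
  by have := integrableZl measurableT m ikg.
have ik1 : \int[leb4]_y k (x - y) = 1 by rewrite /Rintegral density_integral.
have -> : Phi c = \int[leb4]_y ((Phi c - m * c) * k (x - y) + m * (k (x - y) * g y)).
  by rewrite RintegralD// !RintegralZl// ik1 -/(cv k g x) -/c mulr1 subrK.
apply: le_Rintegral => //.
  by have := integrableD measurableT i1 i2.
move=> y _; rewrite -[leRHS]mulrC.
rewrite (_ : _ + _ = (Phi c + m * (g y - c)) * k (x - y)); last by ring.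
by apply: ler_wpM2r.
Qed.

(** Jensen at each [x], then Tonelli, since the kernel has mass one in [x] as well. The sets record
    that points of [A] only see points of [B] through the kernel, which is how tails are transferred
    to mollified functions. *)
Lemma young_cv k g Phi (A B : set (M4 R)) : density k -> locint g -> convex_ge0 Phi ->
  measurable A -> measurable B ->
  (forall x y : R4 R, A x -> k (x - y) != 0 -> B y) ->
  (\int[leb4]_(x in A) (Phi (cv k g x))%:E <= \int[leb4]_(y in B) (Phi (g y))%:E)%E.
Proof.
move=> dk lg cPhi mA mB AB; have [mPhi Phi0 sub] := cPhi; have [Ck k0 k1] := dk.
pose h (z : M4 R * M4 R) := ((\1_A z.1 * k ((z.1 : R4 R) - z.2)) * Phi (g z.2))%:E.
have h0 z : (0 <= h z)%E by rewrite lee_fin !mulr_ge0// indicE.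
have mh : measurable_fun setT h.
  apply/measurable_EFinP; apply: measurable_funM; last first.
    exact: (measurableT_comp mPhi (measurableT_comp lg.1 measurable_snd)).
  apply: measurable_funM; last exact: (measurableT_comp (Cc_measurable Ck) measurable_sub4).
  have mI : measurable_fun (setT : set (M4 R)) (\1_A : M4 R -> R) by exact: measurable_indic.
  exact: (measurableT_comp mI measurable_fst).
apply: (@le_trans _ _ (\int[leb4]_x \int[leb4]_y h (x, y))%E).
  rewrite integral_mkcond; apply: ge0_le_integral => //.
  - by move=> x _; rewrite patchE; case: ifP => // _; rewrite lee_fin.
  - apply/(measurable_restrictT _ mA)/measurable_EFinP/measurable_funTS.
    exact: (measurableT_comp mPhi (measurable_cv Ck lg.1)).
  - exact: measurable_fun_fubini_tonelli_F.
  - move=> x _; rewrite patchE; case: ifPn => xA; last by apply: integral_ge0.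
    apply: (le_trans (jensen_cv x dk lg cPhi)).
    apply: ge0_le_integral => //.
    + by move=> y _; rewrite lee_fin mulr_ge0.
    + apply/measurable_EFinP; apply: measurable_funM; first exact: measurable_shift.
      exact: (measurableT_comp mPhi lg.1).
    + exact: (measurableT_comp mh (pair1_measurable x)).
    + by move=> y _; rewrite /h/= lee_fin indicE xA mul1r.
rewrite (fubini_tonelli _ mh h0) [leRHS]integral_mkcond.
apply: ge0_le_integral => //.
- by move=> y _; exact: integral_ge0.
- exact: measurable_fun_fubini_tonelli_G.
- apply/(measurable_restrictT _ mB)/measurable_EFinP/measurable_funTS.
  exact: (measurableT_comp mPhi lg.1).
- move=> y _; rewrite patchE; case: ifPn => yB.
    apply: (@le_trans _ _ (\int[leb4]_x ((k ((x : R4 R) - y))%:E * (Phi (g y))%:E))%E).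
      apply: ge0_le_integral => //.
      - exact: (measurableT_comp mh (pair2_measurable y)).
      - apply: emeasurable_funM; last exact: measurable_cst.
        apply/measurable_EFinP.
        apply: (measurableT_comp (Cc_measurable Ck)).
        apply: (measurableT_comp measurable_sub4 (g := fun x : M4 R => (x, y))).
        exact: pair2_measurable.
      - move=> x _; rewrite /h/= -EFinM lee_fin ler_wpM2r// indicE.
        by case: (_ \in _); rewrite ?mul1r// mul0r.
    have mky : measurable_fun (setT : set (M4 R)) (fun x => (k ((x : R4 R) - y))%:E).
      apply/measurable_EFinP.
      apply: (measurableT_comp (Cc_measurable Ck)).
      apply: (measurableT_comp measurable_sub4 (g := fun x : M4 R => (x, y))).
      exact: pair2_measurable.
    rewrite (ge0_integralZr _ measurableT mky) ?lee_fin//.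
      by rewrite density_integralr// mul1e.
    by move=> x _; rewrite lee_fin.
  rewrite integral0_eq// => x _; rewrite /h/= indicE.
  have [xA|] := boolP (x \in A); last by rewrite !mul0r.
  have [->|kxy] := eqVneq (k ((x : R4 R) - y)) 0; first by rewrite mulr0 mul0r.
  by move: yB; rewrite notin_setE => /(_ (AB _ _ (set_mem xA) kxy)).
Qed.

Lemma convex_sqr : convex_ge0 (fun a => a ^+ 2).
Proof.
split; first exact: exprn_measurable.
- by move=> a; exact: sqr_ge0.
- move=> c; exists (2 * c) => a; rewrite -subr_ge0.
  by rewrite (_ : _ - _ = (a - c) ^+ 2) ?sqr_ge0//; ring.
Qed.

Lemma convex_pow32 : convex_ge0 (fun a => `|a| `^ (3 / 2)).
Proof.
have E (a : R) : `|a| `^ (3 / 2) = Num.sqrt `|a| ^+ 3.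
  by rewrite -powR12_sqrt// -powR_mulrn ?powR_ge0// -powRrM; congr (_ `^ _); lra.
split.
- by apply: (measurableT_comp (measurable_powR _)).
- by move=> a; exact: powR_ge0.
- move=> c; exists (3 / 2 * Num.sqrt `|c| * Num.sg c) => a.
  rewrite !E; set s := Num.sqrt `|a|; set t := Num.sqrt `|c|.
  have s0 : 0 <= s by exact: sqrtr_ge0.
  have t0 : 0 <= t by exact: sqrtr_ge0.
  have Ea : `|a| = s ^+ 2 by rewrite sqr_sqrtr.
  have Ec : `|c| = t ^+ 2 by rewrite sqr_sqrtr.
  have h1 : Num.sg c * c = t ^+ 2 by rewrite -Ec normrEsg.
  have h2 : Num.sg c * a <= s ^+ 2.
    rewrite -Ea (le_trans (ler_norm _))// normrM normr_sg.
    by case: (c != 0); rewrite ?mul1r// mul0r.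
  (* This is [3 s^2 t <= 2 s^3 + t^3] in factored form; half of it plus three halves of [h4] is the
     supporting line inequality. *)
  have h3 : 0 <= (s - t) ^+ 2 * (2 * s + t).
    by rewrite mulr_ge0 ?sqr_ge0// addr_ge0// mulr_ge0.
  have h4 : 0 <= t * (s ^+ 2 - Num.sg c * a) by rewrite mulr_ge0// subr_ge0.
  have -> : 3 / 2 * t * Num.sg c * (a - c) =
      3 / 2 * (t * (Num.sg c * a)) - 3 / 2 * t * (Num.sg c * c) by ring.
  by rewrite h1; move: h3 h4; lra.
Qed.

End Young.

(** * Hoelder's inequality for three functions *)

Section LoomisWhitney.
Context {R : realType}.
Local Open Scope ereal_scope.
Local Notation c := (fun x : \bar R => x `^ (3^-1)%R).

Lemma cbrt_amgm (a b d : R) : (0 <= a -> 0 <= b -> 0 <= d ->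
  (a * b * d) `^ (3^-1) <= (a + b + d) / 3)%R.
Proof.
move=> a0 b0 d0.
have cb (z : R) : (0 <= z -> (z `^ (3^-1)) ^+ 3 = z)%R.
  by move=> z0; rewrite -powR_mulrn ?powR_ge0// -powRrM mulVf ?powRr1.
rewrite !powRM ?mulr_ge0// -{2}(cb a a0) -{2}(cb b b0) -{2}(cb d d0).
have := powR_ge0 a (3^-1)%R; have := powR_ge0 b (3^-1)%R; have := powR_ge0 d (3^-1)%R.
move: (a `^ _)%R (b `^ _)%R (d `^ _)%R => x y z x0 y0 z0.
(* The product is twice [x^3 + y^3 + z^3 - 3 x y z]. *)
suff : (0 <= (x + y + z) * ((x - y) ^+ 2 + (y - z) ^+ 2 + (x - z) ^+ 2))%R by lra.
by rewrite mulr_ge0 ?addr_ge0 ?sqr_ge0.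
Qed.

Lemma cbrt_le (x y : \bar R) : 0 <= x -> x <= y -> x `^ (3^-1)%R <= y `^ (3^-1)%R.
Proof.
move=> x0 xy; apply: gt0_ler_poweR => //.
- by rewrite in_itv/= x0 leey.
- by rewrite in_itv/= (le_trans x0 xy) leey.
Qed.

Context d (T : measurableType d) (m : {measure set T -> \bar R}).

(** The arithmetic-geometric inequality is applied to the three functions divided by their integrals
    [A], [B], [D]. Integrals equal to 0 or to +oo are set aside beforehand. *)
Lemma hoelder3 (f g h : T -> \bar R) :
  measurable_fun setT f -> measurable_fun setT g -> measurable_fun setT h ->
  (forall x, 0 <= f x) -> (forall x, 0 <= g x) -> (forall x, 0 <= h x) ->
  \int[m]_x c (f x * g x * h x) <= c ((\int[m]_x f x) * (\int[m]_x g x) * (\int[m]_x h x)).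
Proof.
move=> mf mg mh f0 g0 h0.
have If := integral_ge0 m (D := setT) (fun x _ => f0 x).
have Ig := integral_ge0 m (D := setT) (fun x _ => g0 x).
have Ih := integral_ge0 m (D := setT) (fun x _ => h0 x).
have mc : measurable_fun setT (fun x => c (f x * g x * h x)).
  apply: (measurableT_comp (measurable_poweR _)).
  by apply: emeasurable_funM => //; exact: emeasurable_funM.
have third : (3^-1 : R)%R != 0%R by rewrite invr_eq0.
(* A factor with integral 0 vanishes almost everywhere, and so does the product, because [0 * +oo]
   is 0 in the extended reals. *)
have zero (phi : T -> \bar R) : measurable_fun setT phi -> (forall x, 0 <= phi x) ->
    \int[m]_x phi x = 0 -> (forall x, phi x = 0 -> c (f x * g x * h x) = 0) ->
    \int[m]_x c (f x * g x * h x) = 0.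
  move=> mphi phi0 iphi H.
  have : ae_eq m setT phi (cst 0).
    apply/ae_eq_integral_abs => //.
    by under eq_integral do rewrite gee0_abs//.
  move=> ae; rewrite (ge0_ae_eq_integral (g := cst 0)) ?integral0//.
  - by move=> x _; exact: poweR_ge0.
  - by apply: filterS ae => x /(_ I) /= /H + _.
have [f00|fn0] := eqVneq (\int[m]_x f x) 0.
  rewrite (zero f)// ?poweR_ge0// => x ->; by rewrite !mul0e poweR0r.
have [g00|gn0] := eqVneq (\int[m]_x g x) 0.
  rewrite (zero g)// ?poweR_ge0// => x ->; by rewrite mule0 !mul0e poweR0r.
have [h00|hn0] := eqVneq (\int[m]_x h x) 0.
  rewrite (zero h)// ?poweR_ge0// => x ->; by rewrite mule0 poweR0r.
have fp : 0 < \int[m]_x f x by rewrite lt_neqAle eq_sym fn0.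
have gp : 0 < \int[m]_x g x by rewrite lt_neqAle eq_sym gn0.
have hp : 0 < \int[m]_x h x by rewrite lt_neqAle eq_sym hn0.
have [fy|fny] := eqVneq (\int[m]_x f x) +oo.
  by rewrite fy gt0_mulye// gt0_mulye// poweRE (negbTE third) eqxx leey.
have [gy|gny] := eqVneq (\int[m]_x g x) +oo.
  by rewrite gy gt0_muley// gt0_mulye// poweRE (negbTE third) eqxx leey.
have [hy|hny] := eqVneq (\int[m]_x h x) +oo.
  by rewrite hy gt0_muley ?mule_gt0// poweRE (negbTE third) eqxx leey.
have /fineK Ef : \int[m]_x f x \is a fin_num by rewrite ge0_fin_numE// ltey.
have /fineK Eg : \int[m]_x g x \is a fin_num by rewrite ge0_fin_numE// ltey.
have /fineK Eh : \int[m]_x h x \is a fin_num by rewrite ge0_fin_numE// ltey.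
rewrite -Ef -Eg -Eh -!EFinM poweR_EFin.
set A := fine _ in Ef *; set B := fine _ in Eg *; set D := fine _ in Eh *.
have A0 : (0 < A)%R by rewrite -lte_fin Ef.
have B0 : (0 < B)%R by rewrite -lte_fin Eg.
have D0 : (0 < D)%R by rewrite -lte_fin Eh.
set K := ((A * B * D) `^ (3^-1))%R.
have K0 : (0 < K)%R by rewrite powR_gt0// !mulr_gt0.
(* This is the arithmetic mean of the normalized functions times [K]; each of its three terms has
   integral [K / 3], so [bnd] integrates to [K]. *)
pose bnd x := (K / 3 / A)%:E * f x + (K / 3 / B)%:E * g x + (K / 3 / D)%:E * h x.
have cA : (0 < K / 3 / A)%R by rewrite !divr_gt0.
have cB : (0 < K / 3 / B)%R by rewrite !divr_gt0.
have cD : (0 < K / 3 / D)%R by rewrite !divr_gt0.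
have mbA : measurable_fun setT (fun x => (K / 3 / A)%:E * f x) by exact: measurable_funeM.
have mbB : measurable_fun setT (fun x => (K / 3 / B)%:E * g x) by exact: measurable_funeM.
have mbD : measurable_fun setT (fun x => (K / 3 / D)%:E * h x) by exact: measurable_funeM.
apply: (@le_trans _ _ (\int[m]_x bnd x)).
  apply: ge0_le_integral => //.
  - by move=> x _; exact: poweR_ge0.
  - by apply: emeasurable_funD => //; exact: emeasurable_funD.
  move=> x _; rewrite /bnd.
  have nn (k : R) (y : \bar R) : (0 < k)%R -> 0 <= y -> 0 <= k%:E * y.
    by move=> k0 y0; rewrite mule_ge0// lee_fin ltW.
  have nA := nn _ _ cA (f0 x); have nB := nn _ _ cB (g0 x); have nD := nn _ _ cD (h0 x).
  have inf (k : R) (y : \bar R) : (0 < k)%R -> y = +oo -> k%:E * y = +oo.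
    by move=> k0 ->; rewrite gt0_muley// lte_fin.
  have ya (y : \bar R) : 0 <= y -> +oo + y = +oo by case: y.
  have ay (y : \bar R) : 0 <= y -> y + +oo = +oo by case: y.
  have [/(inf _ _ cA) ->|fx] := eqVneq (f x) +oo.
    by rewrite ya// ya// leey.
  have [/(inf _ _ cB) ->|gx] := eqVneq (g x) +oo.
    by rewrite ay// ya// leey.
  have [/(inf _ _ cD) ->|hx] := eqVneq (h x) +oo.
    by rewrite ay ?adde_ge0// leey.
  have /fineK <- : f x \is a fin_num by rewrite ge0_fin_numE// ltey.
  have /fineK <- : g x \is a fin_num by rewrite ge0_fin_numE// ltey.
  have /fineK <- : h x \is a fin_num by rewrite ge0_fin_numE// ltey.
  have := fine_ge0 (f0 x); have := fine_ge0 (g0 x); have := fine_ge0 (h0 x).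
  move: (fine (f x)) (fine (g x)) (fine (h x)) => p q r r0 q0 p0.
  rewrite -!EFinM -!EFinD poweR_EFin lee_fin.
  have -> : (p * q * r = (A * B * D) * ((p / A) * (q / B) * (r / D)))%R.
    by field; rewrite ?gt_eqF.
  have P1 : (0 <= A * B * D)%R by rewrite !mulr_ge0 // ltW.
  have P2 : (0 <= p / A * (q / B) * (r / D))%R by rewrite !mulr_ge0// invr_ge0 ltW.
  rewrite (powRM _ P1 P2) -/K.
  apply: (@le_trans _ _ (K * ((p / A + q / B + r / D) / 3))%R).
    by rewrite ler_pM2l// cbrt_amgm// divr_ge0// ltW.
  rewrite le_eqVlt; apply/orP; left; apply/eqP; field; by rewrite ?gt_eqF.
have nA x : [set: T] x -> 0 <= (K / 3 / A)%:E * f x by move=> _; rewrite mule_ge0// lee_fin ltW.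
have nB x : [set: T] x -> 0 <= (K / 3 / B)%:E * g x by move=> _; rewrite mule_ge0// lee_fin ltW.
have nD x : [set: T] x -> 0 <= (K / 3 / D)%:E * h x by move=> _; rewrite mule_ge0// lee_fin ltW.
have nAB x : [set: T] x -> 0 <= (K / 3 / A)%:E * f x + (K / 3 / B)%:E * g x.
  by move=> _; rewrite adde_ge0// ?nA ?nB.
have mAB : measurable_fun setT (fun x => (K / 3 / A)%:E * f x + (K / 3 / B)%:E * g x).
  exact: emeasurable_funD.
rewrite /bnd ge0_integralD// ge0_integralD// !ge0_integralZl ?lee_fin ?(ltW cA) ?(ltW cB) ?(ltW cD)//.
rewrite -Ef -Eg -Eh -!EFinM -!EFinD lee_fin le_eqVlt; apply/orP; left; apply/eqP.
by field; rewrite ?gt_eqF.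
Qed.

(** In the Loomis-Whitney induction one of the four factors does not depend on the current variable:
    that is [k]. *)
Lemma hoelder3_cst (k : \bar R) (f g h : T -> \bar R) : 0 <= k ->
  measurable_fun setT f -> measurable_fun setT g -> measurable_fun setT h ->
  (forall x, 0 <= f x) -> (forall x, 0 <= g x) -> (forall x, 0 <= h x) ->
  \int[m]_x c (k * (f x * g x * h x)) <=
    c (k * ((\int[m]_x f x) * (\int[m]_x g x) * (\int[m]_x h x))).
Proof.
move=> k0 mf mg mh f0 g0 h0.
have mc : measurable_fun setT (fun x => c (f x * g x * h x)).
  apply: (measurableT_comp (measurable_poweR _)).
  by apply: emeasurable_funM => //; exact: emeasurable_funM.
under eq_integral do rewrite poweRM ?mule_ge0//.
rewrite ge0_integralZl//; first last.
- exact: poweR_ge0.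
- by move=> x _; exact: poweR_ge0.
rewrite poweRM ?mule_ge0 ?integral_ge0//.
by apply: lee_wpmul2l; [exact: poweR_ge0|exact: hoelder3].
Qed.

End LoomisWhitney.

Ltac measurable_proj := repeat first
  [ exact: measurable_fst | exact: measurable_snd | exact: measurable_id
  | exact: measurable_cst | apply: measurable_fun_pair
  | apply: (measurableT_comp measurable_fst)
  | apply: (measurableT_comp measurable_snd) ].

(** * The Loomis-Whitney inequality in dimension four *)

Section LoomisWhitney4.
Context {R : realType}.
Local Open Scope ereal_scope.
Local Notation c := (fun x : \bar R => x `^ (3^-1)%R).
Context d1 d2 d3 d4 (T1 : measurableType d1) (T2 : measurableType d2)
  (T3 : measurableType d3) (T4 : measurableType d4).
Context (m1 : {sigma_finite_measure set T1 -> \bar R})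
  (m2 : {sigma_finite_measure set T2 -> \bar R})
  (m3 : {sigma_finite_measure set T3 -> \bar R})
  (m4 : {sigma_finite_measure set T4 -> \bar R}).

Lemma ge0_le_integralT d (T : measurableType d) (m : {measure set T -> \bar R})
    (f g : T -> \bar R) : measurable_fun setT f -> measurable_fun setT g ->
  (forall x, 0 <= f x) -> (forall x, f x <= g x) -> \int[m]_x f x <= \int[m]_x g x.
Proof. by move=> mf mg f0 fg; apply: ge0_le_integral. Qed.

Lemma swap_integral d d' (X : measurableType d) (Y : measurableType d')
    (mX : {sigma_finite_measure set X -> \bar R})
    (mY : {sigma_finite_measure set Y -> \bar R}) (f : X -> Y -> \bar R) :
  measurable_fun setT (fun z : X * Y => f z.1 z.2) -> (forall x y, 0 <= f x y) ->
  \int[mX]_x \int[mY]_y f x y = \int[mY]_y \int[mX]_x f x y.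
Proof. by move=> mf f0; apply: (fubini_tonelli (fun z : X * Y => f z.1 z.2)). Qed.

Lemma measurable_slice_integral d d' (X : measurableType d) (Y : measurableType d')
    (mY : {sigma_finite_measure set Y -> \bar R}) (f : X -> Y -> \bar R) :
  measurable_fun setT (fun z : X * Y => f z.1 z.2) -> (forall x y, 0 <= f x y) ->
  measurable_fun setT (fun x => \int[mY]_y f x y).
Proof.
move=> mf f0; exact: (measurable_fun_fubini_tonelli_F (m2 := mY) (fun z : X * Y => f z.1 z.2) mf (fun z => f0 z.1 z.2)).
Qed.

Variables f1 f2 f3 f4 : T1 * T2 * T3 * T4 -> \bar R.
Hypotheses (mf1 : measurable_fun setT f1) (mf2 : measurable_fun setT f2)
  (mf3 : measurable_fun setT f3) (mf4 : measurable_fun setT f4).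
Hypotheses (p1 : forall z, 0 <= f1 z) (p2 : forall z, 0 <= f2 z)
  (p3 : forall z, 0 <= f3 z) (p4 : forall z, 0 <= f4 z).

Let I f := \int[m1]_x \int[m2]_y \int[m3]_z \int[m4]_w f (x, y, z, w).

(** The index is that of the function, the letter the stage reached: [G] has its own variable
    integrated, then [H] also [w], [K] also [z], [L] also [y]. A letter is skipped for the function
    whose own variable is the one of that stage. *)
Let G1 y z w := \int[m1]_x f1 (x, y, z, w).
Let G2 x z w := \int[m2]_y f2 (x, y, z, w).
Let G3 x y w := \int[m3]_z f3 (x, y, z, w).
Let G4 x y z := \int[m4]_w f4 (x, y, z, w).

Let G1_ge0 y z w : 0 <= G1 y z w. Proof. exact: integral_ge0. Qed.
Let G2_ge0 x z w : 0 <= G2 x z w. Proof. exact: integral_ge0. Qed.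
Let G3_ge0 x y w : 0 <= G3 x y w. Proof. exact: integral_ge0. Qed.
Let G4_ge0 x y z : 0 <= G4 x y z. Proof. exact: integral_ge0. Qed.

Let mG1 : measurable_fun setT (fun v : T2 * T3 * T4 => G1 v.1.1 v.1.2 v.2).
Proof.
apply: (@measurable_slice_integral _ _ _ _ _ (fun (v : T2 * T3 * T4) x => f1 (x, v.1.1, v.1.2, v.2))) => //.
apply: (measurableT_comp mf1 (g := fun u : (T2 * T3 * T4) * T1 => (u.2, u.1.1.1, u.1.1.2, u.1.2))).
measurable_proj.
Qed.
Let mG2 : measurable_fun setT (fun v : T1 * T3 * T4 => G2 v.1.1 v.1.2 v.2).
Proof.
apply: (@measurable_slice_integral _ _ _ _ _ (fun (v : T1 * T3 * T4) y => f2 (v.1.1, y, v.1.2, v.2))) => //.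
apply: (measurableT_comp mf2 (g := fun u : (T1 * T3 * T4) * T2 => (u.1.1.1, u.2, u.1.1.2, u.1.2))).
measurable_proj.
Qed.
Let mG3 : measurable_fun setT (fun v : T1 * T2 * T4 => G3 v.1.1 v.1.2 v.2).
Proof.
apply: (@measurable_slice_integral _ _ _ _ _ (fun (v : T1 * T2 * T4) z => f3 (v.1.1, v.1.2, z, v.2))) => //.
apply: (measurableT_comp mf3 (g := fun u : (T1 * T2 * T4) * T3 => (u.1.1.1, u.1.1.2, u.2, u.1.2))).
measurable_proj.
Qed.
Let mG4 : measurable_fun setT (fun v : T1 * T2 * T3 => G4 v.1.1 v.1.2 v.2).
Proof.
apply: (@measurable_slice_integral _ _ _ _ _ (fun (v : T1 * T2 * T3) w => f4 (v.1.1, v.1.2, v.2, w))) => //.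
apply: (measurableT_comp mf4 (g := fun u : (T1 * T2 * T3) * T4 => (u.1.1.1, u.1.1.2, u.1.2, u.2))).
measurable_proj.
Qed.

Let H1 y z := \int[m4]_w G1 y z w.
Let H2 x z := \int[m4]_w G2 x z w.
Let H3 x y := \int[m4]_w G3 x y w.
Let H1_ge0 y z : 0 <= H1 y z. Proof. exact: integral_ge0. Qed.
Let H2_ge0 x z : 0 <= H2 x z. Proof. exact: integral_ge0. Qed.
Let H3_ge0 x y : 0 <= H3 x y. Proof. exact: integral_ge0. Qed.
Let mH1 : measurable_fun setT (fun v : T2 * T3 => H1 v.1 v.2).
Proof. exact: (@measurable_slice_integral _ _ _ _ _ (fun (v : T2 * T3) w => G1 v.1 v.2 w)). Qed.
Let mH2 : measurable_fun setT (fun v : T1 * T3 => H2 v.1 v.2).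
Proof. exact: (@measurable_slice_integral _ _ _ _ _ (fun (v : T1 * T3) w => G2 v.1 v.2 w)). Qed.
Let mH3 : measurable_fun setT (fun v : T1 * T2 => H3 v.1 v.2).
Proof. exact: (@measurable_slice_integral _ _ _ _ _ (fun (v : T1 * T2) w => G3 v.1 v.2 w)). Qed.

Let K4 x y := \int[m3]_z G4 x y z.
Let K1 y := \int[m3]_z H1 y z.
Let K2 x := \int[m3]_z H2 x z.
Let K4_ge0 x y : 0 <= K4 x y. Proof. exact: integral_ge0. Qed.
Let K1_ge0 y : 0 <= K1 y. Proof. exact: integral_ge0. Qed.
Let K2_ge0 x : 0 <= K2 x. Proof. exact: integral_ge0. Qed.
Let mK4 : measurable_fun setT (fun v : T1 * T2 => K4 v.1 v.2).
Proof. exact: (@measurable_slice_integral _ _ _ _ _ (fun (v : T1 * T2) z => G4 v.1 v.2 z)). Qed.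
Let mK1 : measurable_fun setT K1.
Proof. exact: (@measurable_slice_integral _ _ _ _ _ (fun y z => H1 y z)). Qed.
Let mK2 : measurable_fun setT K2.
Proof. exact: (@measurable_slice_integral _ _ _ _ _ (fun x z => H2 x z)). Qed.

Let L3 x := \int[m2]_y H3 x y.
Let L4 x := \int[m2]_y K4 x y.
Let L1 := \int[m2]_y K1 y.
Let L3_ge0 x : 0 <= L3 x. Proof. exact: integral_ge0. Qed.
Let L4_ge0 x : 0 <= L4 x. Proof. exact: integral_ge0. Qed.
Let L1_ge0 : 0 <= L1. Proof. exact: integral_ge0. Qed.
Let mL3 : measurable_fun setT L3.
Proof. exact: (@measurable_slice_integral _ _ _ _ _ (fun x y => H3 x y)). Qed.
Let mL4 : measurable_fun setT L4.
Proof. exact: (@measurable_slice_integral _ _ _ _ _ (fun x y => K4 x y)). Qed.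

(** After an integration, the factor that is constant in the next variable is moved to the front, as
    [hoelder3_cst] expects. *)
Let rot (a b e k : \bar R) : a * (b * e * k) = k * (a * b * e).
Proof. by rewrite [RHS]muleC !muleA. Qed.

Let mc d (T : measurableType d) (f : T -> \bar R) : measurable_fun setT f ->
  measurable_fun setT (fun x => c (f x)).
Proof. exact: (measurableT_comp (measurable_poweR _)). Qed.

Let s1 {d d'} {X : measurableType d} {Y : measurableType d'} (f : X -> Y -> \bar R) x :
  measurable_fun setT (fun v : X * Y => f v.1 v.2) -> measurable_fun setT (f x).
Proof. by move=> mf; exact: (measurableT_comp mf (pair1_measurable x)). Qed.
Let s2 {d d'} {X : measurableType d} {Y : measurableType d'} (f : X -> Y -> \bar R) y :
  measurable_fun setT (fun v : X * Y => f v.1 v.2) -> measurable_fun setT (f ^~ y).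
Proof. by move=> mf; exact: (measurableT_comp mf (pair2_measurable y)). Qed.

Let sG (d d' d'' : measure_display) (X : measurableType d) (Y : measurableType d')
  (Z : measurableType d'') (G : X -> Y -> Z -> \bar R) x y :
  measurable_fun setT (fun v : X * Y * Z => G v.1.1 v.1.2 v.2) ->
  measurable_fun setT (G x y).
Proof. by move=> mG; exact: (measurableT_comp mG (pair1_measurable (x, y))). Qed.

Let P x y z w := c (G4 x y z * (G1 y z w * G2 x z w * G3 x y w)).
Let P_ge0 x y z w : 0 <= P x y z w. Proof. exact: poweR_ge0. Qed.
Let mP : measurable_fun setT (fun v : T1 * T2 * T3 * T4 => P v.1.1.1 v.1.1.2 v.1.2 v.2).
Proof.
apply: (mc (f := fun v : T1 * T2 * T3 * T4 => _)).
apply: emeasurable_funM.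
  apply: (measurableT_comp mG4 (g := fun v : T1 * T2 * T3 * T4 => (v.1.1.1, v.1.1.2, v.1.2))).
  measurable_proj.
apply: emeasurable_funM; first apply: emeasurable_funM.
- apply: (measurableT_comp mG1 (g := fun v : T1 * T2 * T3 * T4 => (v.1.1.2, v.1.2, v.2))).
  measurable_proj.
- apply: (measurableT_comp mG2 (g := fun v : T1 * T2 * T3 * T4 => (v.1.1.1, v.1.2, v.2))).
  measurable_proj.
- apply: (measurableT_comp mG3 (g := fun v : T1 * T2 * T3 * T4 => (v.1.1.1, v.1.1.2, v.2))).
  measurable_proj.
Qed.

Let step4 x y z : \int[m4]_w P x y z w <= c (H3 x y * (G4 x y z * H1 y z * H2 x z)).
Proof.
rewrite -rot; exact: (hoelder3_cst m4 (G4_ge0 x y z) (sG y z mG1) (sG x z mG2) (sG x y mG3)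
  (G1_ge0 y z) (G2_ge0 x z) (G3_ge0 x y)).
Qed.

Let step3 x y : \int[m3]_z \int[m4]_w P x y z w <= c (K2 x * (H3 x y * K4 x y * K1 y)).
Proof.
have m : measurable_fun setT (fun v : T1 * T2 * T3 => \int[m4]_w P v.1.1 v.1.2 v.2 w).
  exact: (@measurable_slice_integral _ _ _ _ _ (fun (v : T1 * T2 * T3) w => P v.1.1 v.1.2 v.2 w)).
have mB : measurable_fun setT (fun z => H3 x y * (G4 x y z * H1 y z * H2 x z)).
  exact: (emeasurable_funM (measurable_cst _)
    (emeasurable_funM (emeasurable_funM (sG x y mG4) (s1 y mH1)) (s1 x mH2))).
apply: (@le_trans _ _ (\int[m3]_z c (H3 x y * (G4 x y z * H1 y z * H2 x z)))).
  apply: ge0_le_integralT.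
  - exact: (measurableT_comp m (pair1_measurable (x, y))).
  - exact: (mc mB).
  - by move=> z; exact: integral_ge0.
  - by move=> z; exact: step4.
rewrite -rot; exact: (hoelder3_cst m3 (H3_ge0 x y) (sG x y mG4) (s1 y mH1) (s1 x mH2)
  (G4_ge0 x y) (H1_ge0 y) (H2_ge0 x)).
Qed.

Let step2 x : \int[m2]_y \int[m3]_z \int[m4]_w P x y z w <= c (L1 * (K2 x * L3 x * L4 x)).
Proof.
have m : measurable_fun setT (fun v : T1 * T2 => \int[m3]_z \int[m4]_w P v.1 v.2 z w).
  apply: (@measurable_slice_integral _ _ _ _ _ (fun (v : T1 * T2) z => \int[m4]_w P v.1 v.2 z w)).
    exact: (@measurable_slice_integral _ _ _ _ _ (fun (v : T1 * T2 * T3) w => P v.1.1 v.1.2 v.2 w)).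
  by move=> v z; exact: integral_ge0.
have mB : measurable_fun setT (fun y => K2 x * (H3 x y * K4 x y * K1 y)).
  exact: (emeasurable_funM (measurable_cst _)
    (emeasurable_funM (emeasurable_funM (s1 x mH3) (s1 x mK4)) mK1)).
apply: (@le_trans _ _ (\int[m2]_y c (K2 x * (H3 x y * K4 x y * K1 y)))).
  apply: ge0_le_integralT.
  - exact: (measurableT_comp m (pair1_measurable x)).
  - exact: (mc mB).
  - by move=> y; do 2 (apply: integral_ge0; move=> ? _).
  - by move=> y; exact: step3.
rewrite -rot; exact: (hoelder3_cst m2 (K2_ge0 x) (s1 x mH3) (s1 x mK4) mK1
  (H3_ge0 x) (K4_ge0 x) K1_ge0).
Qed.

(** The variables are integrated from the last to the first. At each stage the line integral in the
    current direction is constant and comes out, and Hoelder's inequality separates the three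
    others. *)
Lemma loomis_whitney :
  \int[m1]_x \int[m2]_y \int[m3]_z \int[m4]_w
    c ((\int[m4]_w' f4 (x, y, z, w')) * ((\int[m1]_x' f1 (x', y, z, w)) *
       (\int[m2]_y' f2 (x, y', z, w)) * (\int[m3]_z' f3 (x, y, z', w))))
  <= c (I f1 * (I f2 * I f3 * I f4)).
Proof.
have m : measurable_fun setT (fun x : T1 => \int[m2]_y \int[m3]_z \int[m4]_w P x y z w).
  apply: (@measurable_slice_integral _ _ _ _ _ (fun x y => \int[m3]_z \int[m4]_w P x y z w)).
    apply: (@measurable_slice_integral _ _ _ _ _ (fun (v : T1 * T2) z => \int[m4]_w P v.1 v.2 z w)).
      exact: (@measurable_slice_integral _ _ _ _ _ (fun (v : T1 * T2 * T3) w => P v.1.1 v.1.2 v.2 w)).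
    by move=> v z; exact: integral_ge0.
  by move=> x y; do 2 (apply: integral_ge0; move=> ? _).
have mB : measurable_fun setT (fun x => L1 * (K2 x * L3 x * L4 x)).
  exact: (emeasurable_funM (measurable_cst _)
    (emeasurable_funM (emeasurable_funM mK2 mL3) mL4)).
apply: (@le_trans _ _ (\int[m1]_x c (L1 * (K2 x * L3 x * L4 x)))).
  apply: ge0_le_integralT.
  - exact: m.
  - exact: (mc mB).
  - by move=> x; do 3 (apply: integral_ge0; move=> ? _); exact: poweR_ge0.
  - by move=> x; exact: step2.
apply: (le_trans (hoelder3_cst m1 L1_ge0 mK2 mL3 mL4 K2_ge0 L3_ge0 L4_ge0)).
have mp (f : T1 * T2 * T3 * T4 -> \bar R) d (T : measurableType d) (g : T -> T1 * T2 * T3 * T4) :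
    measurable_fun setT f -> measurable_fun setT g -> measurable_fun setT (fun v => f (g v)).
  by move=> mf mg; exact: (measurableT_comp mf mg).
have E1 : L1 = I f1.
  rewrite /I /L1 /K1 /H1 /G1.
  transitivity (\int[m2]_y \int[m3]_z \int[m1]_x \int[m4]_w f1 (x, y, z, w)).
    apply: eq_integral => y _; apply: eq_integral => z _; rewrite swap_integral//.
    by apply: (mp f1 _ _ (fun v : T4 * T1 => (v.2, y, z, v.1))) => //; measurable_proj.
  transitivity (\int[m2]_y \int[m1]_x \int[m3]_z \int[m4]_w f1 (x, y, z, w)).
    apply: eq_integral => y _; rewrite swap_integral//.
      apply: (@measurable_slice_integral _ _ _ _ _ (fun (v : T3 * T1) w => f1 (v.2, y, v.1, w))) => //.
      by apply: (mp f1 _ _ (fun v : T3 * T1 * T4 => (v.1.2, y, v.1.1, v.2))) => //; measurable_proj.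
    by move=> *; exact: integral_ge0.
  rewrite swap_integral//.
    apply: (@measurable_slice_integral _ _ _ _ _ (fun (v : T2 * T1) z => \int[m4]_w f1 (v.2, v.1, z, w))).
      apply: (@measurable_slice_integral _ _ _ _ _ (fun (v : T2 * T1 * T3) w => f1 (v.1.2, v.1.1, v.2, w))) => //.
      by apply: (mp f1 _ _ (fun v : T2 * T1 * T3 * T4 => (v.1.1.2, v.1.1.1, v.1.2, v.2))) => //; measurable_proj.
    by move=> *; exact: integral_ge0.
  by move=> *; do 2 (apply: integral_ge0; move=> ? _).
have E2 : \int[m1]_x K2 x = I f2.
  rewrite /I /K2 /H2 /G2; apply: eq_integral => x _.
  transitivity (\int[m3]_z \int[m2]_y \int[m4]_w f2 (x, y, z, w)).
    apply: eq_integral => z _; rewrite swap_integral//.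
    by apply: (mp f2 _ _ (fun v : T4 * T2 => (x, v.2, z, v.1))) => //; measurable_proj.
  rewrite swap_integral//.
    apply: (@measurable_slice_integral _ _ _ _ _ (fun (v : T3 * T2) w => f2 (x, v.2, v.1, w))) => //.
    by apply: (mp f2 _ _ (fun v : T3 * T2 * T4 => (x, v.1.2, v.1.1, v.2))) => //; measurable_proj.
  by move=> *; exact: integral_ge0.
have E3 : \int[m1]_x L3 x = I f3.
  rewrite /I /L3 /H3 /G3; apply: eq_integral => x _; apply: eq_integral => y _.
  rewrite swap_integral//.
  by apply: (mp f3 _ _ (fun v : T4 * T3 => (x, y, v.2, v.1))) => //; measurable_proj.
by rewrite E1 E2 E3.
Qed.

End LoomisWhitney4.

(** * The Sobolev embedding of H^1 into L^4 *)

Section Sobolev.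
Context {R : realType}.
Local Notation mR := (measurableTypeR R).
Local Notation leb := (@lebesgue_measure R).

Lemma leb4_iterated (f : M4 R -> \bar R) : measurable_fun setT f ->
  (forall z, 0 <= f z)%E ->
  (\int[leb4]_z f z =
   \int[leb]_x \int[leb]_y \int[leb]_z \int[leb]_w f (x, y, z, w))%E.
Proof.
move=> mf f0; rewrite leb4E (fubini_tonelli1 _ mf f0).
have m3 := @measurable_slice_integral R _ _ _ _ leb (fun (v : mR * mR * mR) w => f (v, w)).
have {m3} m3 : measurable_fun setT (fun v : mR * mR * mR => \int[leb]_w f (v, w))%E.
  apply: m3 => //; apply: (measurableT_comp mf (g := fun v : mR * mR * mR * mR => (v.1, v.2))).
  measurable_proj.
rewrite /leb3 (fubini_tonelli1 _ m3); last by move=> v; exact: integral_ge0.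
have m2 := @measurable_slice_integral R _ _ _ _ leb (fun (v : mR * mR) z => \int[leb]_w f (v, z, w))%E.
have {m2} m2 : measurable_fun setT (fun v : mR * mR => \int[leb]_z \int[leb]_w f (v, z, w))%E.
  apply: m2; last by move=> v z; exact: integral_ge0.
  apply: (measurableT_comp m3 (g := fun v : mR * mR * mR => (v.1, v.2))).
  measurable_proj.
rewrite /leb2 (fubini_tonelli1 _ m2) //.
by move=> v; apply: integral_ge0 => z _; exact: integral_ge0.
Qed.

Lemma integral_cube_bound (f : M4 R -> \bar R) (M : \bar R) : measurable_fun setT f ->
  (forall z, 0 <= f z)%E ->
  (forall n : nat, \int[leb4]_(z in cube n%:R) f z <= M)%E -> (\int[leb4]_z f z <= M)%E.
Proof.
move=> mf f0 fM.
pose F (n : nat) : set (M4 R) := cube n%:R.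
have UF : \bigcup_n F n = setT.
  apply/seteqP; split=> // x _; exists (Num.truncn `|x : R4 R|).+1 => //.
  by rewrite /F /cube/= ltW// truncnS_gt.
rewrite -UF; have C : (\int[leb4]_(x in F n) f x)%E @[n --> \oo] -->
    (\int[leb4]_(x in \bigcup_i F i) f x)%E.
  apply: ge0_nondecreasing_set_cvg_integral.
  - move=> n m nm; apply/subsetPset => x; rewrite /F /cube/= => /le_trans; apply.
    by rewrite ler_nat.
  - by move=> n; exact: measurable_cube.
  - by move=> n; exact: measurable_funTS.
  - by move=> n x _; exact: f0.
rewrite -(cvg_lim _ C)//; apply: lime_le; first by apply/cvg_ex; eexists; exact: C.
exact: nearW.
Qed.

Lemma sqr_normr_ge0 (a b : R) : 0 <= 3 * (a ^+ 2 * `|b|).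
Proof. by rewrite mulr_ge0// mulr_ge0// sqr_ge0. Qed.

Lemma line_coord (x y z w h : R) (j : 'I_4) : (x, y, z, w) + h *: e4 R j =
  (x + h * (val j == 0%N)%:R, y + h * (val j == 1%N)%:R,
   z + h * (val j == 2%N)%:R, w + h * (val j == 3%N)%:R).
Proof. by []. Qed.

(** Translating the parameter by the j-th coordinate of the point makes that coordinate itself the
    variable of integration. *)
Lemma integral_line (f : M4 R -> \bar R) (j : 'I_4) (x y z w : R) :
  measurable_fun setT f -> (forall v, 0 <= f v)%E ->
  (\int[leb]_h f ((x, y, z, w) + (h : R) *: e4 R j)%R =
   if val j == 0%N then \int[leb]_x' f (x', y, z, w)
   else if val j == 1%N then \int[leb]_y' f (x, y', z, w)
   else if val j == 2%N then \int[leb]_z' f (x, y, z', w)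
   else \int[leb]_w' f (x, y, z, w'))%E.
Proof.
move=> mf f0.
have tr (g : mR -> \bar R) a : measurable_fun setT g -> (forall v, 0 <= g v)%E ->
    (\int[leb]_h g h = \int[leb]_h g (a + (h : R))%R)%E.
  by move=> mg g0; rewrite (preserves_leb_add a).2.
have ms (phi : mR -> M4 R) : measurable_fun setT phi -> measurable_fun setT (fun h => f (phi h)).
  by move=> mphi; exact: (measurableT_comp mf).
case: j => -[|[|[|[|//]]]] jp /=.
- rewrite (tr (fun x' => f (x', y, z, w)) x)//; last by apply: ms; measurable_proj.
  by apply: eq_integral => h _; congr f; rewrite line_coord/= ?mulr0n ?mulr1n !mulr0 !addr0 mulr1.
- rewrite (tr (fun y' => f (x, y', z, w)) y)//; last by apply: ms; measurable_proj.
  by apply: eq_integral => h _; congr f; rewrite line_coord/= ?mulr0n ?mulr1n !mulr0 !addr0 mulr1.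
- rewrite (tr (fun z' => f (x, y, z', w)) z)//; last by apply: ms; measurable_proj.
  by apply: eq_integral => h _; congr f; rewrite line_coord/= ?mulr0n ?mulr1n !mulr0 !addr0 mulr1.
- rewrite (tr (fun w' => f (x, y, z, w')) w)//; last by apply: ms; measurable_proj.
  by apply: eq_integral => h _; congr f; rewrite line_coord/= ?mulr0n ?mulr1n !mulr0 !addr0 mulr1.
Qed.

Definition line_integral (f : M4 R -> \bar R) (j : 'I_4) (v : M4 R) : \bar R :=
  (\int[leb]_h f ((v : R4 R) + (h : R) *: e4 R j)%R)%E.

Lemma line_integral_ge0 (f : M4 R -> \bar R) j v : (forall u, 0 <= f u)%E ->
  (0 <= line_integral f j v)%E.
Proof. by move=> f0; apply: integral_ge0 => h _; exact: f0. Qed.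

Lemma measurable_line_integral (f : M4 R -> \bar R) j : measurable_fun setT f ->
  (forall u, 0 <= f u)%E -> measurable_fun setT (line_integral f j).
Proof.
move=> mf f0.
apply: (@measurable_slice_integral _ _ _ _ _ leb (fun v h => f ((v : R4 R) + (h : R) *: e4 R j)%R)).
  exact: (measurableT_comp mf (measurable_line (e4 R j))).
by move=> v h; exact: f0.
Qed.

Let j0 : 'I_4 := Ordinal (isT : 0 < 4)%N.
Let j1 : 'I_4 := Ordinal (isT : 1 < 4)%N.
Let j2 : 'I_4 := Ordinal (isT : 2 < 4)%N.
Let j3 : 'I_4 := Ordinal (isT : 3 < 4)%N.

Lemma loomis_whitney_lines (f : 'I_4 -> M4 R -> \bar R) :
  (forall j, measurable_fun setT (f j)) -> (forall j v, 0 <= f j v)%E ->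
  (\int[leb4]_v (line_integral (f j3) j3 v * (line_integral (f j0) j0 v *
     line_integral (f j1) j1 v * line_integral (f j2) j2 v)) `^ (3^-1)%R
   <= (\int[leb4]_v f j0 v * (\int[leb4]_v f j1 v * \int[leb4]_v f j2 v *
       \int[leb4]_v f j3 v)) `^ (3^-1)%R)%E.
Proof.
move=> mf f0.
have mQ : measurable_fun (setT : set (M4 R)) (fun v => (line_integral (f j3) j3 v * (line_integral (f j0) j0 v *
     line_integral (f j1) j1 v * line_integral (f j2) j2 v)) `^ (3^-1)%R)%E.
  apply: (measurableT_comp (measurable_poweR _)).
  have mL j := measurable_line_integral j (mf j) (f0 j).
  exact: (emeasurable_funM (mL j3) (emeasurable_funM (emeasurable_funM (mL j0) (mL j1)) (mL j2))).
rewrite (leb4_iterated mQ (fun v => poweR_ge0 _ _)).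
rewrite (leb4_iterated (mf j0) (f0 j0)) (leb4_iterated (mf j1) (f0 j1)).
rewrite (leb4_iterated (mf j2) (f0 j2)) (leb4_iterated (mf j3) (f0 j3)).
have LW := @loomis_whitney R _ _ _ _ mR mR mR mR leb leb leb leb
  (f j0) (f j1) (f j2) (f j3) (mf j0) (mf j1) (mf j2) (mf j3) (f0 j0) (f0 j1) (f0 j2) (f0 j3).
apply: le_trans LW; rewrite le_eqVlt; apply/orP; left; apply/eqP.
apply: eq_integral => x _; apply: eq_integral => y _; apply: eq_integral => z _.
apply: eq_integral => w _; rewrite /line_integral.
rewrite (integral_line j0 x y z w (mf j0) (f0 j0)) (integral_line j1 x y z w (mf j1) (f0 j1)).
by rewrite (integral_line j2 x y z w (mf j2) (f0 j2)) (integral_line j3 x y z w (mf j3) (f0 j3)).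
Qed.

(** [w^3] is a primitive of [3 w^2 Dw] along the line and vanishes at a starting point outside the
    support. *)
Lemma cube_le_integral_line (w Dw : R4 R -> R) j (r : R) (x : R4 R) : pderiv j w Dw ->
  measurable_fun (setT : set (M4 R)) w -> measurable_fun (setT : set (M4 R)) Dw ->
  (forall y, r < `|y| -> w y = 0) ->
  ((`|w x| ^+ 3)%:E <= \int[leb]_h (3 * (w (x + (h : R) *: e4 R j) ^+ 2 * `|Dw (x + (h : R) *: e4 R j)|))%:E)%E.
Proof.
move=> pw mw mDw w0.
pose u y := w y * (w y * w y).
pose Du y := w y * (w y * Dw y + w y * Dw y) + (w y * w y) * Dw y.
have pu : pderiv j u Du by apply: pderivM => //; exact: pderivM.
(* [x - L e_j] lies outside the cube of radius [r], and [L] is positive whatever the sign of [r]. *)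
pose L := r + `|x| + 1 + `|r|.
have L0 : - L < 0.
  rewrite oppr_lt0 /L; have := normr_ge0 x; have := ler_norm (- r); rewrite normrN; lra.
have FT := FTC_segment L0 (fun h => (pderiv_line x h pu).1) (fun h => (pderiv_line x h pu).2).
have wL : w (x + (- L) *: e4 R j) = 0.
  apply: w0; rewrite addrC -[x]opprK.
  apply: (lt_le_trans _ (lerB_dist _ _)); rewrite normrN normrZ e4_norm mulr1 normrN.
  apply: (lt_le_trans _ (lerB (ler_norm _) (lexx _))); rewrite /L.
  by have := normr_ge0 r; lra.
have mline (g : R4 R -> R) : measurable_fun (setT : set (M4 R)) g ->
    measurable_fun (setT : set mR) (fun h => g (x + (h : R) *: e4 R j)).
  move=> mg; apply: (measurableT_comp mg).
  exact: (measurableT_comp (measurable_line (e4 R j)) (pair1_measurable (x : M4 R))).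
have mw' := mline _ mw; have mD' := mline _ mDw.
have -> : (`|w x| ^+ 3)%:E = `| (u (x + 0 *: e4 R j) - u (x + (- L) *: e4 R j))%:E |%E.
  by rewrite /= /u wL mul0r subr0 scale0r addr0 !normrM !exprS expr0 mulr1.
rewrite -FT.
have mdu : measurable_fun (setT : set mR) (fun h => (Du (x + (h : R) *: e4 R j))%:E).
  apply/measurable_EFinP; apply: measurable_funD.
    by apply: measurable_funM => //; apply: measurable_funD; exact: measurable_funM.
  by apply: measurable_funM => //; exact: measurable_funM.
have mI : measurable (`[- L, 0]%classic : set mR) by exact: measurable_itv.
apply: (le_trans (le_abse_integral _ mI _)); first exact: measurable_funTS.
have E h : (`|(Du (x + (h : R) *: e4 R j))%:E| =
    (3 * (w (x + (h : R) *: e4 R j) ^+ 2 * `|Dw (x + (h : R) *: e4 R j)|))%:E)%E.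
  move: (x + h *: e4 R j) => y; rewrite /= /Du; congr (_%:E).
  rewrite (_ : _ + _ = 3 * (w y ^+ 2 * Dw y)); last by ring.
  by rewrite normrM [X in _ * X]normrM (ger0_norm (sqr_ge0 (w y))) ger0_norm.
under eq_integral do rewrite E.
apply: ge0_subset_integral => //.
- apply/measurable_EFinP; apply: measurable_funM => //; apply: measurable_funM.
    exact: measurable_funX.
  exact: measurableT_comp.
- by move=> h _; rewrite lee_fin; exact: sqr_normr_ge0.
Qed.

(** The argument of Gagliardo and Nirenberg: the bounds of [|w|^3] along the four lines are
    multiplied, Loomis-Whitney integrates the cube root of the product, and Cauchy-Schwarz gives
    [S^3 <= 81 B^2 S^2], where [S] is the integral of [w^4]. Compact support makes [S] finite, so
    [S^2] can be divided out; 81 is [3^4]. *)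
Lemma sobolev_compact (w : R4 R -> R) (Dw : 'I_4 -> R4 R -> R) (r M B : R) :
  (forall j, pderiv j w (Dw j)) -> measurable_fun (setT : set (M4 R)) w ->
  (forall j, measurable_fun (setT : set (M4 R)) (Dw j)) ->
  (forall y, r < `|y| -> w y = 0) -> (forall y, `|w y| <= M) -> 0 < B ->
  (forall j, \int[leb4]_x (Dw j x ^+ 2)%:E <= B%:E)%E ->
  (\int[leb4]_x (w x ^+ 4)%:E <= (81 * B ^+ 2)%:E)%E.
Proof.
move=> pw mw mDw w0 wM B0 DB.
have iw : leb4.-integrable setT (EFin \o (fun x : M4 R => w x ^+ 4)).
  apply: (integrable_setT_zero (m := leb4) (D := cube r)).
  - exact: measurable_cube.
  - move=> x; rewrite /cube/= => /negP; rewrite -ltNge => /w0 ->.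
    by rewrite expr0n.
  apply: (bounded_integrable (m := leb4) (M := M ^+ 4)).
  - exact: measurable_cube.
  - exact: leb4_cube_lty.
  - by apply: measurable_funTS; exact: measurable_funX.
  - by move=> x _; rewrite normrX lerXn2r// ?nnegrE// (le_trans _ (wM x)).
have w4 x : 0 <= w x ^+ 4 by rewrite (_ : w x ^+ 4 = (w x ^+ 2) ^+ 2) ?sqr_ge0//; ring.
set S := \int[leb4]_x w x ^+ 4.
have SE : (\int[leb4]_x (w x ^+ 4)%:E)%E = S%:E by rewrite EFin_Rintegral.
have S0 : 0 <= S by apply: Rintegral_ge0.
rewrite SE lee_fin.
have [->|Sn0] := eqVneq S 0; first by rewrite mulr_ge0// sqr_ge0.
have {S0 Sn0} S0 : 0 < S by rewrite lt_neqAle eq_sym Sn0.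
pose f j (x : M4 R) : \bar R := (3 * (w x ^+ 2 * `|Dw j x|))%:E.
have f0 j x : (0 <= f j x)%E by rewrite lee_fin; exact: sqr_normr_ge0.
have mf j : measurable_fun setT (f j).
  apply/measurable_EFinP; apply: measurable_funM => //; apply: measurable_funM.
    exact: measurable_funX.
  by apply: measurableT_comp => //; exact: mDw.
(* The weight in [3 w^2 |Dw| <= 3/2 (t w^4 + |Dw|^2 / t)] that balances [t S] and [B / t]; this
   plays the part of Cauchy-Schwarz, and both terms together give [3 B / t]. *)
pose t := Num.sqrt (B / S).
have t0 : 0 < t by rewrite sqrtr_gt0 divr_gt0.
have t2 : t ^+ 2 = B / S by rewrite sqr_sqrtr// ltW// divr_gt0.
pose m := 3 * B / t.
have m0 : 0 < m by rewrite divr_gt0// mulr_gt0.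
have fm j : (\int[leb4]_x f j x <= m%:E)%E.
  apply: (@le_trans _ _ (\int[leb4]_x ((3 / 2 * t)%:E * (w x ^+ 4)%:E + (3 / 2 / t)%:E * (Dw j x ^+ 2)%:E))%E).
    apply: ge0_le_integralT => //.
    - apply: emeasurable_funD; apply: measurable_funeM; apply/measurable_EFinP; exact: measurable_funX.
    - move=> x; rewrite /f -!EFinM -EFinD lee_fin.
      have := sqr_ge0 (t * w x ^+ 2 - `|Dw j x|).
      rewrite sqrrB (real_normK (num_real _)) => h.
      have -> : 3 / 2 * t * w x ^+ 4 + 3 / 2 / t * Dw j x ^+ 2 =
          3 / 2 / t * ((t * w x ^+ 2) ^+ 2 + Dw j x ^+ 2) by field; rewrite gt_eqF.
      have -> : 3 * (w x ^+ 2 * `|Dw j x|) = 3 / 2 / t * (t * w x ^+ 2 * `|Dw j x| *+ 2).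
        by rewrite mulr2n; field; rewrite gt_eqF.
      by rewrite ler_pM2l ?divr_gt0//; move: h; lra.
  have c1 : 0 <= 3 / 2 * t by rewrite mulr_ge0// ltW.
  have c2 : 0 <= 3 / 2 / t by rewrite mulr_ge0// invr_ge0 ltW.
  have mw4 : measurable_fun (setT : set (M4 R)) (fun x => (w x ^+ 4)%:E).
    by apply/measurable_EFinP; exact: measurable_funX.
  have mD2 : measurable_fun (setT : set (M4 R)) (fun x => (Dw j x ^+ 2)%:E).
    by apply/measurable_EFinP; exact: measurable_funX.
  have n1 (x : M4 R) : setT x -> (0 <= (3 / 2 * t)%:E * (w x ^+ 4)%:E)%E.
    by move=> _; rewrite -EFinM lee_fin mulr_ge0.
  have n2 (x : M4 R) : setT x -> (0 <= (3 / 2 / t)%:E * (Dw j x ^+ 2)%:E)%E.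
    by move=> _; rewrite -EFinM lee_fin mulr_ge0// sqr_ge0.
  have m1 : measurable_fun (setT : set (M4 R)) (fun x => (3 / 2 * t)%:E * (w x ^+ 4)%:E)%E.
    exact: measurable_funeM.
  have m2 : measurable_fun (setT : set (M4 R)) (fun x => (3 / 2 / t)%:E * (Dw j x ^+ 2)%:E)%E.
    exact: measurable_funeM.
  have n3 (x : M4 R) : setT x -> (0 <= (w x ^+ 4)%:E)%E by move=> _; rewrite lee_fin.
  have n4 (x : M4 R) : setT x -> (0 <= (Dw j x ^+ 2)%:E)%E by move=> _; rewrite lee_fin sqr_ge0.
  rewrite ge0_integralD// !ge0_integralZl ?lee_fin//.
  rewrite SE; apply: (@le_trans _ _ ((3 / 2 * t)%:E * S%:E + (3 / 2 / t)%:E * B%:E)%E).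
    by apply: leeD => //; apply: lee_wpmul2l => //; rewrite lee_fin.
  rewrite -!EFinM -EFinD lee_fin /m.
  have -> : 3 / 2 * t * S = 3 / 2 / t * (t ^+ 2 * S) by field; rewrite gt_eqF.
  rewrite t2 divfK ?gt_eqF//.
  by rewrite (_ : _ + _ = 3 * B / t)//; field; rewrite gt_eqF.
have Sm : (S%:E <= (m%:E * (m%:E * m%:E * m%:E)) `^ (3^-1)%R)%E.
  have LW := loomis_whitney_lines mf f0.
  have fI0 j : (0 <= \int[leb4]_v f j v)%E by apply: integral_ge0 => v _; exact: f0.
  have q0 := mule_ge0 (fI0 j1) (fI0 j2); have q1 := mule_ge0 q0 (fI0 j3).
  have {}LW : (\int[leb4]_v (line_integral (f j3) j3 v * (line_integral (f j0) j0 v *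
     line_integral (f j1) j1 v * line_integral (f j2) j2 v)) `^ (3^-1)%R <=
     (m%:E * (m%:E * m%:E * m%:E)) `^ (3^-1)%R)%E.
    apply: (le_trans LW); apply: cbrt_le; first exact: (mule_ge0 (fI0 j0) q1).
    exact: (lee_pmul (fI0 j0) q1 (fm j0) (lee_pmul q0 (fI0 j3) (lee_pmul (fI0 j1) (fI0 j2) (fm j1) (fm j2)) (fm j3))).
  apply: le_trans LW; rewrite -SE.
  have L0 j v := line_integral_ge0 j v (f0 j).
  have mL j := measurable_line_integral j (mf j) (f0 j).
  apply: ge0_le_integralT.
  - by apply/measurable_EFinP; exact: measurable_funX.
  - apply: (measurableT_comp (measurable_poweR _)).
    exact: (emeasurable_funM (mL j3) (emeasurable_funM (emeasurable_funM (mL j0) (mL j1)) (mL j2))).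
  - by move=> v; rewrite lee_fin.
  move=> v.
  have wL j : ((`|w v| ^+ 3)%:E <= line_integral (f j) j v)%E.
    exact: (cube_le_integral_line v (pw j) mw (mDw j) w0).
  have p0 : (0 <= (`|w v| ^+ 3)%:E)%E by rewrite lee_fin exprn_ge0.
  have p1 := mule_ge0 p0 p0; have p2 := mule_ge0 p1 p0.
  (* Four factors [|w|^3] under a cube root make [|w|^4]: here the dimension four meets the exponent
     four. *)
  have E : (w v ^+ 4)%:E = ((((`|w v| ^+ 3)%:E * ((`|w v| ^+ 3)%:E * (`|w v| ^+ 3)%:E * (`|w v| ^+ 3)%:E))) `^ (3^-1)%R)%E.
    rewrite -!EFinM poweR_EFin; congr (_%:E).
    have -> : `|w v| ^+ 3 * (`|w v| ^+ 3 * `|w v| ^+ 3 * `|w v| ^+ 3) = (w v ^+ 4) ^+ 3.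
      by rewrite -[w v ^+ 4](ger0_norm (w4 v)) normrX; ring.
    by rewrite -(powR_mulrn 3 (w4 v)) -powRrM mulfV// powRr1.
  rewrite E; apply: cbrt_le; first exact: (mule_ge0 p0 p2).
  exact: (lee_pmul p0 p2 (wL j3) (lee_pmul p1 p0 (lee_pmul p0 p0 (wL j0) (wL j1)) (wL j2))).
move: Sm; rewrite -!EFinM poweR_EFin lee_fin => Sm.
have m4 : 0 <= m * (m * m * m).
  exact: (mulr_ge0 (ltW m0) (mulr_ge0 (mulr_ge0 (ltW m0) (ltW m0)) (ltW m0))).
have S3 : S ^+ 3 <= m * (m * m * m).
  apply: (@le_trans _ _ (((m * (m * m * m)) `^ 3^-1) ^+ 3)).
    by rewrite lerXn2r// ?nnegrE ?powR_ge0// ltW.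
  by rewrite -powR_mulrn ?powR_ge0// -powRrM mulVf// powRr1.
(* [t^2 = B / S] turns [m^4 = 81 B^4 / t^4] into a multiple of [S^2]. *)
have mE : m * (m * m * m) = 81 * B ^+ 2 * S ^+ 2.
  have -> : m * (m * m * m) = 81 * B ^+ 4 / (t ^+ 2) ^+ 2 by rewrite /m; field; rewrite gt_eqF.
  by rewrite t2; field; rewrite !gt_eqF.
have S20 : 0 < S ^+ 2 by rewrite exprn_gt0.
by move: S3; rewrite mE exprS ler_pM2r.
Qed.

(** Compact support is obtained from cutoffs of growing radius. Their gradients are bounded by [C],
    so the L2 norm of [v] enters together with that of its gradient, and [N] bounds both. *)
Lemma sobolev_cv (eta v : R4 R -> R) (Dv : 'I_4 -> R4 R -> R) (C N : R)
    (zeta : nat -> R4 R -> R) :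
  0 < C -> (forall n, ball_cutoff C n.+1%:R (zeta n)) ->
  Ccinfty eta -> density eta -> locint v -> (forall j, locint (Dv j)) ->
  (forall j x, cv ('D_(e4 R j) eta) v x = cv eta (Dv j) x) ->
  0 < N -> (\int[leb4]_x (v x ^+ 2)%:E <= N%:E)%E ->
  (forall j, \int[leb4]_x (Dv j x ^+ 2)%:E <= N%:E)%E ->
  (\int[leb4]_x (cv eta v x ^+ 4)%:E <= (81 * ((2 + 2 * C ^+ 2) * N) ^+ 2)%:E)%E.
Proof.
move=> C0 Hz Ceta deta lv lDv wk N0 vN DN.
pose U := cv eta v; pose V j := cv eta (Dv j).
have Ce : Cc eta by exact: Ccinfty_Cc.
have mU : measurable_fun (setT : set (M4 R)) U by apply: measurable_cv => //; exact: lv.1.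
have mV j : measurable_fun (setT : set (M4 R)) (V j).
  by apply: measurable_cv => //; exact: (lDv j).1.
have UN : (\int[leb4]_x (U x ^+ 2)%:E <= N%:E)%E.
  apply: le_trans vN; exact: (young_cv deta lv convex_sqr measurableT measurableT).
have VN j : (\int[leb4]_x (V j x ^+ 2)%:E <= N%:E)%E.
  apply: le_trans (DN j); exact: (young_cv deta (lDv j) convex_sqr measurableT measurableT).
have pU j : pderiv j U (V j).
  have := cv_pderiv j Ceta lv; congr pderiv; apply/funext => x; exact: wk.
(* From [(a b + c d)^2 <= 2 a^2 b^2 + 2 c^2 d^2], with the cutoff at most 1 and its gradient at most
   [C]. *)
set B := (2 + 2 * C ^+ 2) * N.
have B0 : 0 < B by rewrite mulr_gt0// ltr_pwDl// mulr_ge0// sqr_ge0.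
apply: integral_cube_bound.
- by apply/measurable_EFinP; exact: measurable_funX.
- by move=> x; rewrite lee_fin (_ : _ ^+ 4 = (cv eta v x ^+ 2) ^+ 2) ?sqr_ge0//; ring.
move=> n; have [Cz z01 z1 z0 Dz] := Hz n.
have n1 : 0 < n.+1%:R :> R by rewrite ltr0n.
pose w x := zeta n x * U x.
pose Dw j x := zeta n x * V j x + U x * 'D_(e4 R j) (zeta n) x.
have mz : measurable_fun (setT : set (M4 R)) (zeta n) by apply: Cc_measurable; exact: Ccinfty_Cc.
have mDz j : measurable_fun (setT : set (M4 R)) ('D_(e4 R j) (zeta n)).
  by apply: Cc_measurable; apply: Ccinfty_Cc; exact: Ccinfty_D.
have w0 y : 2 * n.+1%:R < `|y| -> w y = 0 by move=> /z0 h; rewrite /w h mul0r.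
have [M M0 UM] := cv_bounded (2 * n.+1%:R) Ce lv.
apply: (@le_trans _ _ (\int[leb4]_x (w x ^+ 4)%:E)%E).
  have p4 (a : R) : 0 <= a ^+ 4 by rewrite (_ : _ ^+ 4 = (a ^+ 2) ^+ 2) ?sqr_ge0//; ring.
  rewrite integral_mkcond; apply: ge0_le_integralT.
  - apply/(measurable_restrictT _ (measurable_cube _))/measurable_EFinP/measurable_funTS.
    exact: measurable_funX.
  - by apply/measurable_EFinP; apply: measurable_funX; exact: measurable_funM.
  - by move=> x; rewrite patchE; case: ifP => // _; rewrite lee_fin.
  - move=> x; rewrite patchE; case: ifPn => [|_]; last by rewrite lee_fin.
    rewrite inE /cube/= => xn; rewrite /w z1 ?mul1r//.
    by rewrite (le_trans xn)// ler_nat.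
apply: (@sobolev_compact w Dw (2 * n.+1%:R) M B) => //.
- by move=> j; apply: pderivM => //; apply: smooth_pderiv; exact: Cz.1.
- exact: measurable_funM.
- by move=> j; apply: measurable_funD; exact: measurable_funM.
- move=> y; have [yr|/w0 ->] := leP `|y| (2 * n.+1%:R); last by rewrite normr0.
  rewrite normrM -[M]mul1r; apply: ler_pM => //; last exact: UM.
  by have /andP[? ?] := z01 y; rewrite ger0_norm.
move=> j; have Cj x : `|'D_(e4 R j) (zeta n) x| <= C.
  rewrite (le_trans (Dz j x))// ler_pdivrMr// -[leLHS]mulr1 ler_pM2l// ler1n.
  by [].
apply: (@le_trans _ _ (\int[leb4]_x (2%:E * (V j x ^+ 2)%:E + (2 * C ^+ 2)%:E * (U x ^+ 2)%:E))%E).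
  apply: ge0_le_integralT.
  - by apply/measurable_EFinP; apply: measurable_funX; apply: measurable_funD; exact: measurable_funM.
  - by apply: emeasurable_funD; apply: measurable_funeM; apply/measurable_EFinP; exact: measurable_funX.
  - by move=> x; rewrite lee_fin sqr_ge0.
  - move=> x; rewrite -!EFinM -EFinD lee_fin /Dw.
    set a := zeta n x; set b := V j x; set c := U x; set d := 'D_(_) _ _.
    have a1 : a ^+ 2 <= 1 by have /andP[? ?] := z01 x; rewrite expr_le1.
    have d1 : d ^+ 2 <= C ^+ 2.
      by rewrite -[d ^+ 2](real_normK (num_real _)) lerXn2r ?nnegrE ?(ltW C0)//; exact: Cj.
    have h1 : a ^+ 2 * b ^+ 2 <= b ^+ 2 by rewrite -[leRHS]mul1r ler_wpM2r// sqr_ge0.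
    have h2 : d ^+ 2 * c ^+ 2 <= C ^+ 2 * c ^+ 2 by rewrite ler_wpM2r// sqr_ge0.
    by have := sqr_ge0 (a * b - c * d); move: h1 h2; nra.
have c2 : 0 <= 2 * C ^+ 2 by rewrite mulr_ge0// sqr_ge0.
have mV2 : measurable_fun (setT : set (M4 R)) (fun x => (V j x ^+ 2)%:E).
  by apply/measurable_EFinP; exact: measurable_funX.
have mU2 : measurable_fun (setT : set (M4 R)) (fun x => (U x ^+ 2)%:E).
  by apply/measurable_EFinP; exact: measurable_funX.
have n2 (x : M4 R) : setT x -> (0 <= 2%:E * (V j x ^+ 2)%:E)%E.
  by move=> _; rewrite -EFinM lee_fin mulr_ge0// sqr_ge0.
have n3 (x : M4 R) : setT x -> (0 <= (2 * C ^+ 2)%:E * (U x ^+ 2)%:E)%E.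
  by move=> _; rewrite -EFinM lee_fin mulr_ge0// sqr_ge0.
have m2 : measurable_fun (setT : set (M4 R)) (fun x => 2%:E * (V j x ^+ 2)%:E)%E.
  exact: measurable_funeM.
have m3 : measurable_fun (setT : set (M4 R)) (fun x => (2 * C ^+ 2)%:E * (U x ^+ 2)%:E)%E.
  exact: measurable_funeM.
have n4 (x : M4 R) : setT x -> (0 <= (U x ^+ 2)%:E)%E by move=> _; rewrite lee_fin sqr_ge0.
have n5 (x : M4 R) : setT x -> (0 <= (V j x ^+ 2)%:E)%E by move=> _; rewrite lee_fin sqr_ge0.
rewrite ge0_integralD// !ge0_integralZl ?lee_fin//.
apply: (@le_trans _ _ (2%:E * N%:E + (2 * C ^+ 2)%:E * N%:E)%E).
  by apply: leeD; apply: lee_wpmul2l; rewrite ?lee_fin.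
rewrite -!EFinM -EFinD lee_fin /B le_eqVlt; apply/orP; left; apply/eqP; ring.
Qed.

End Sobolev.

(** * Closed sets and the sigma-algebra of R^4 *)

Lemma open_measurable_base (T : topologicalType) d (M : measurableType d)
    (e : M -> T) (U : set T) :
  countable_measurable_base e -> open U -> measurable (e @^-1` U).
Proof.
move=> [I [B [mB b]]] oU.
have -> : e @^-1` U = \bigcup_(i in [set i | B i `<=` U]) (e @^-1` B i).
  apply/seteqP; split=> x /=.
    move=> Ux; have /b[i [ix iU]] : nbhs (e x) U by exact: open_nbhs_nbhs.
    by exists i.
  by move=> [i /= iU ix]; exact: iU.
rewrite bigcup_mkcond; apply: countable_bigcupT_measurable; first exact: countableP.
by move=> i; case: ifP.
Qed.

Section ClosedGenerate.

(** One inclusion only; together with [closed_measurable4] it says that closed sets generate the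
    sigma-algebra of [M4 R], and they are stable under intersection as Dynkin's lemma requires. *)
Definition closed_generates (T : topologicalType) d (M : measurableType d)
    (e : M -> T) : Prop :=
  forall A : set M, measurable A -> <<s [set e @^-1` C | C in [set C | closed C]] >> A.

Lemma closed_generates_prod (T1 T2 : topologicalType) d1 d2
    (M1 : measurableType d1) (M2 : measurableType d2) (e1 : M1 -> T1) (e2 : M2 -> T2) :
  closed_generates e1 -> closed_generates e2 ->
  closed_generates (fun z : M1 * M2 => (e1 z.1, e2 z.2)).
Proof.
move=> g1 g2 A; set e := fun z : M1 * M2 => _.
set S := <<s _ >>; have sS : sigma_algebra setT S by exact: smallest_sigma_algebra.
have h1 (B : set M1) : measurable B -> S (fst @^-1` B).
  move=> /g1; have : <<s [set e1 @^-1` C | C in [set C | closed C]] >> `<=`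
      image_set_system setT fst S.
    apply: smallest_sub; first exact: sigma_algebra_image.
    move=> _ [C /= cC <-]; rewrite /image_set_system/= setTI.
    apply: sub_sigma_algebra; exists (fst @^-1` C); last by [].
    by apply: closed_comp => // x _; exact: cvg_fst.
  by move=> h /h; rewrite /image_set_system/= setTI.
have h2 (B : set M2) : measurable B -> S (snd @^-1` B).
  move=> /g2; have : <<s [set e2 @^-1` C | C in [set C | closed C]] >> `<=`
      image_set_system setT snd S.
    apply: smallest_sub; first exact: sigma_algebra_image.
    move=> _ [C /= cC <-]; rewrite /image_set_system/= setTI.
    apply: sub_sigma_algebra; exists (snd @^-1` C); last by [].
    by apply: closed_comp => // x _; exact: cvg_snd.
  by move=> h /h; rewrite /image_set_system/= setTI.
rewrite measurable_prod_measurableType; apply: smallest_sub => //.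
move=> _ [B mB [C mC <-]]; rewrite (_ : B `*` C = (fst @^-1` B) `&` (snd @^-1` C)) //.
have [S0 SC SU] := sS.
have cc (D : set (M1 * M2)) : S D -> S (~` D) by move=> /SC; rewrite setTD.
rewrite -[_ `&` _]setCK setCI -bigcup2E; apply: (cc _); apply: SU => -[|[|n]] /=.
- by apply: cc; exact: h1.
- by apply: cc; exact: h2.
- exact: S0.
Qed.

Lemma closed_generates_real (R : realType) :
  closed_generates (fun x : measurableTypeR R => (x : R)).
Proof.
move=> A mA; set S := <<s _ >>; have sS : sigma_algebra setT S by exact: smallest_sigma_algebra.
have : (@RGenOpens.G R).-sigma.-measurable A by rewrite -RGenOpens.measurableE.
apply: smallest_sub => // _ [x [y ->]]; have [_ SC _] := sS.
rewrite -[X in S X]setCK -setTD; apply: SC; apply: sub_sigma_algebra.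
exists (~` `]x, y[%classic); last by [].
by apply: open_closedC; exact: itv_open.
Qed.

Lemma closed_generates4 (R : realType) : closed_generates (fun x : M4 R => (x : R4 R)).
Proof.
have b := @closed_generates_real R.
have b4 := closed_generates_prod (closed_generates_prod
  (closed_generates_prod b b) b) b.
move=> A /b4; congr (<<s _ >> A); congr image; apply/funext => C; apply/seteqP.
by split=> -[[[? ?] ?] ?].
Qed.

End ClosedGenerate.

Lemma closed_measurable4 (R : realType) (C : set (R4 R)) : closed C ->
  measurable (C : set (M4 R)).
Proof.
have b := @countable_measurable_base_real R.
have b4 := countable_measurable_base_prod (countable_measurable_base_prod
  (countable_measurable_base_prod b b) b) b.
move=> cC; rewrite -[C]setCK; apply: measurableC.
have := open_measurable_base b4 (closed_openC cC).
by congr measurable; apply/seteqP; split=> -[[[? ?] ?] ?].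
Qed.

(** * Convergence of mollifications in L1 on cubes, and lower semicontinuity *)

Section MollifierConvergence.
Context {R : realType}.
Implicit Types (g h : R4 R -> R) (r delta : R).

Lemma cvD k g h x : Cc k -> locint g -> locint h ->
  cv k (fun y => g y + h y) x = cv k g x + cv k h x.
Proof.
move=> Ck lg lh; rewrite /cv -RintegralD//; last 2 first.
- exact: shift_integrable.
- exact: shift_integrable.
by apply: eq_Rintegral => y _; rewrite mulrDr.
Qed.

Lemma cvZ k g (c : R) x : Cc k -> locint g ->
  cv k (fun y => c * g y) x = c * cv k g x.
Proof.
move=> Ck lg; rewrite /cv -RintegralZl//; last exact: shift_integrable.
by apply: eq_Rintegral => y _; rewrite mulrCA.
Qed.

Lemma locintD g h : locint g -> locint h -> locint (fun y => g y + h y).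
Proof.
move=> [mg ig] [mh ih]; split; first exact: measurable_funD.
by move=> r; have := integrableD (measurable_cube r) (ig r) (ih r).
Qed.

Lemma locintZ g (c : R) : locint g -> locint (fun y => c * g y).
Proof.
move=> [mg ig]; split; first exact: measurable_funM.
by move=> r; have := integrableZl (measurable_cube r) c (ig r).
Qed.

Lemma locint_bounded g (M : R) : measurable_fun (setT : set (M4 R)) g ->
  (forall x, `|g x| <= M) -> locint g.
Proof.
move=> mg gM; split=> // r; apply: (bounded_integrable (m := leb4) (M := M)) => //.
- exact: measurable_cube.
- exact: leb4_cube_lty.
- exact: measurable_funTS.
Qed.

Lemma convex_abs : convex_ge0 (fun a : R => `|a|).
Proof.
split; [exact: normr_measurable|by []|] => c; exists (Num.sg c) => a.
rewrite mulrBr -normrEsg addrCA subrr addr0.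
rewrite (le_trans (ler_norm _))// normrM normr_sg.
by case: (c != 0); rewrite ?mul1r// mul0r.
Qed.

Variable eta : nat -> R4 R -> R.
Hypothesis etaP : forall n, mollifier n.+1%:R^-1 (eta n).

Let Ce n : Cc (eta n). Proof. by have [? _ _ _] := etaP n; exact: Ccinfty_Cc. Qed.
Let de n : density (eta n). Proof. exact: mollifier_density (etaP n). Qed.

Lemma mollifier_support n (x y : R4 R) r : `|x| <= r -> eta n (x - y) != 0 -> `|y| <= r + 1.
Proof.
move=> xr; have [_ _ _ e0] := etaP n; apply: contraR; rewrite -ltNge => yr.
apply/eqP/e0; rewrite -normrN opprB; apply: (lt_le_trans _ (lerB_dist _ _)).
apply: (@le_lt_trans _ _ 1); first by rewrite invf_le1 ?ler1n// ltr0n.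
by move: yr xr; lra.
Qed.

Definition moll_dist n g r : \bar R :=
  (\int[leb4]_(x in cube r) (`|cv (eta n) g x - g x|)%:E)%E.

Let md_measurable n g : locint g ->
  measurable_fun (setT : set (M4 R)) (fun x => (`|cv (eta n) g x - g x|)%:E).
Proof.
move=> lg; apply/measurable_EFinP; apply: measurableT_comp => //.
by apply: measurable_funB; [exact: measurable_cv (Ce n) lg.1|exact: lg.1].
Qed.

Let abs_measurable g : locint g ->
  measurable_fun (setT : set (M4 R)) (fun x => (`|g x|)%:E).
Proof. by move=> lg; apply/measurable_EFinP; apply: measurableT_comp => //; exact: lg.1. Qed.

Lemma moll_distD n g h r : locint g -> locint h ->
  (moll_dist n (fun y => g y + h y)%R r <= moll_dist n g r + moll_dist n h r)%E.
Proof.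
move=> lg lh; rewrite /moll_dist -ge0_integralD//; last 3 first.
- exact: measurable_cube.
- by apply: measurable_funTS; exact: md_measurable.
- by apply: measurable_funTS; exact: md_measurable.
apply: ge0_le_integral => //.
- exact: measurable_cube.
- by apply: measurable_funTS; apply: md_measurable; exact: locintD.
- by apply: emeasurable_funD; apply: measurable_funTS; exact: md_measurable.
move=> x _; rewrite -EFinD lee_fin cvD//.
by rewrite (le_trans _ (ler_normD _ _))// opprD addrACA.
Qed.

Lemma moll_distZ n g (c : R) r : locint g ->
  (moll_dist n (fun y => c * g y)%R r = `|c|%:E * moll_dist n g r)%E.
Proof.
move=> lg; rewrite /moll_dist -ge0_integralZl//; last first.
- by apply: measurable_funTS; exact: md_measurable.
- exact: measurable_cube.
by apply: eq_integral => x _; rewrite cvZ// -EFinM -mulrBr normrM.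
Qed.

(** The factor 2 counts [g] and its mollification, whose L1 norm on [cube r] is controlled on
    [cube (r + 1)] because all the kernels have radius at most 1. *)
Lemma moll_dist_bound n g r : locint g ->
  (moll_dist n g r <= 2%:E * \int[leb4]_(x in cube (r + 1)) (`|g x|)%:E)%E.
Proof.
move=> lg; have mr := @measurable_cube R r; have mr1 := @measurable_cube R (r + 1).
have m1 : measurable_fun (cube r : set (M4 R)) (fun x => (`|cv (eta n) g x|)%:E).
  by apply: measurable_funTS; apply: abs_measurable; exact: cv_locint.
have m2 : measurable_fun (cube r : set (M4 R)) (fun x => (`|g x|)%:E).
  by apply: measurable_funTS; exact: abs_measurable.
apply: (@le_trans _ _ (\int[leb4]_(x in cube r) ((`|cv (eta n) g x|)%:E + (`|g x|)%:E))%E).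
  apply: ge0_le_integral => //.
  - by apply: measurable_funTS; exact: md_measurable.
  - exact: emeasurable_funD.
  - by move=> x _; rewrite -EFinD lee_fin ler_normB.
rewrite ge0_integralD// mule_natl mule2n; apply: leeD.
  apply: (young_cv (de n) lg convex_abs mr mr1) => x y xr; exact: mollifier_support.
apply: ge0_subset_integral => //.
- by apply: measurable_funTS; exact: abs_measurable.
- by move=> x; rewrite /cube/= => /le_trans; apply; rewrite lerDl.
Qed.

Definition good g := locint g /\ forall r delta, 0 < delta ->
  exists N, forall n, (N <= n)%N -> (moll_dist n g r <= delta%:E)%E.

Lemma goodD g h : good g -> good h -> good (fun y => g y + h y).
Proof.
move=> [lg gg] [lh gh]; split; first exact: locintD.
move=> r d d0; have d2 : 0 < d / 2 by rewrite divr_gt0.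
have [N1 H1] := gg r _ d2; have [N2 H2] := gh r _ d2.
exists (maxn N1 N2) => n; rewrite geq_max => /andP[n1 n2].
apply: (le_trans (moll_distD _ _ lg lh)).
rewrite [d in (_ <= d%:E)%E]splitr EFinD; apply: leeD; [exact: H1|exact: H2].
Qed.

Lemma goodZ g (c : R) : good g -> good (fun y => c * g y).
Proof.
move=> [lg gg]; split; first exact: locintZ.
move=> r d d0; have c1 : 0 < `|c| + 1 by rewrite ltr_wpDl.
have [N H] := gg r _ (divr_gt0 d0 c1).
exists N => n Nn; rewrite moll_distZ//.
apply: (@le_trans _ _ (`|c|%:E * (d / (`|c| + 1))%:E)%E).
  by apply: lee_wpmul2l; rewrite ?lee_fin// H.
rewrite -EFinM lee_fin mulrA ler_pdivrMr// mulrC ler_pM2l//.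
by rewrite lerDl.
Qed.

(** Mollification is bounded in L1 uniformly in [n], so convergence on a dense class suffices: the
    remainder [g - h] costs twice [delta / 4], and [h] costs [delta / 2]. *)
Lemma good_approx g : locint g ->
  (forall r delta, 0 < delta -> exists2 h, good h &
    (\int[leb4]_(x in cube (r + 1)) (`|g x - h x|)%:E <= delta%:E)%E) ->
  good g.
Proof.
move=> lg H; split=> // r d d0.
have d4 : 0 < d / 4 by rewrite divr_gt0.
have d2 : 0 < d / 2 by rewrite divr_gt0.
have [h gh ghd] := H r _ d4; have [lh /(_ r _ d2)[N HN]] := gh.
exists N => n Nn.
have ln : locint (fun y => -1 * h y) by exact: locintZ.
have lgh : locint (fun y => g y + -1 * h y) by exact: locintD.
have -> : g = (fun y => (g y + -1 * h y) + h y) by apply/funext => y; ring.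
apply: (le_trans (moll_distD _ _ lgh lh)).
rewrite [d in (_ <= d%:E)%E]splitr EFinD; apply: leeD; last exact: HN.
apply: (le_trans (moll_dist_bound _ _ lgh)).
apply: (@le_trans _ _ (2%:E * (d / 4)%:E)%E).
  apply: lee_wpmul2l => //; apply: le_trans ghd.
  by rewrite le_eqVlt; apply/orP; left; apply/eqP; apply: eq_integral => x _; rewrite mulN1r.
rewrite -EFinM lee_fin le_eqVlt; apply/orP; left; apply/eqP; lra.
Qed.

Lemma good_sum (I : Type) (s : seq I) (F : I -> R4 R -> R) :
  (forall i, good (F i)) -> good (fun x => \sum_(i <- s) F i x).
Proof.
move=> gF; elim: s => [|i s ih].
  have g0 : good (fun x : R4 R => 0).
    have l0 : locint (fun x : R4 R => 0 : R).
      by apply: (@locint_bounded _ 0) => // x; rewrite normr0.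
    split=> // r d d0; exists 0%N => n _; rewrite /moll_dist integral0_eq ?lee_fin ?ltW// => x _.
    have -> : cv (eta n) (fun=> 0) x = 0 by apply: Rintegral_eq0 => y _; rewrite mulr0.
    by rewrite subrr normr0.
  by move: g0; congr good; apply/funext => x; rewrite big_nil.
by move: (goodD (gF i) ih); congr good; apply/funext => x; rewrite big_cons.
Qed.

Lemma bool_le1 (b : bool) : b%:R <= 1 :> R.
Proof. by case: b. Qed.

Lemma locint_indic (A : set (M4 R)) : measurable A -> locint (\1_A : R4 R -> R).
Proof.
move=> mA; apply: (@locint_bounded _ 1); first exact: measurable_indic.
by move=> x; rewrite indicE; case: (_ \in _); rewrite ?normr0 ?normr1.
Qed.

(* For bounded closed [A], the positive part of [eta_n * 1_A - 1_A] tends to 0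
   pointwise, and its integral over the whole space vanishes because [eta_n] has
   mass one; hence the L1 norm tends to 0 as well. *)
Lemma good_bounded_closed (A : set (R4 R)) r : closed A -> measurable (A : set (M4 R)) ->
  A `<=` cube r -> forall delta, 0 < delta ->
  exists N, forall n, (N <= n)%N ->
  (\int[leb4]_x (`|cv (eta n) \1_A x - \1_A x|)%:E <= delta%:E)%E.
Proof.
move=> cA mA Ar d d0.
have lA := locint_indic mA.
pose u n (x : M4 R) : R := cv (eta n) \1_A x - \1_A x.
have mu n : measurable_fun setT (u n).
  by apply: measurable_funB; [exact: measurable_cv (Ce n) lA.1|exact: lA.1].
have cv01 n x : 0 <= cv (eta n) \1_A x <= 1.
  have [_ e0 e1 _] := etaP n; apply/andP; split.
    by apply: Rintegral_ge0 => y _; rewrite mulr_ge0// indicE.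
  rewrite -lee_fin /cv EFin_Rintegral//; last exact: (shift_integrable x (Ce n) lA).
  rewrite -(density_integral x (de n)); apply: ge0_le_integralT.
  - apply/measurable_EFinP; apply: measurable_funM; last exact: lA.1.
    exact: (measurable_shift x (Ce n)).
  - by apply/measurable_EFinP; exact: (measurable_shift x (Ce n)).
  - by move=> y; rewrite lee_fin mulr_ge0// indicE.
  - move=> y; rewrite lee_fin indicE -[leRHS]mulr1; apply: ler_wpM2l; [exact: e0|exact: bool_le1].
have cv0 n x : r + 1 < `|x| -> cv (eta n) \1_A x = 0.
  move=> xr; apply: Rintegral_eq0 => y _; rewrite indicE.
  have [/set_mem /Ar yr|] := boolP (y \in A); last by rewrite mulr0.
  have [->|e0] := eqVneq (eta n (x - y)) 0; first by rewrite mul0r.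
  exfalso; move: xr; rewrite ltNge => /negP; apply.
  have [_ _ _ es] := etaP n.
  have : `|x - y| <= 1.
    rewrite leNgt; apply: contra e0 => h; apply/eqP/es; apply: le_lt_trans h.
    by rewrite invf_le1 ?ler1n// ltr0n.
  by move=> h; rewrite -[x](subrK y) (le_trans (ler_normD _ _))// addrC lerD.
have u0 n x : r + 1 < `|x| -> u n x = 0.
  move=> xr; rewrite /u cv0// indicE memNset ?subrr// => /Ar.
  by rewrite /cube/= leNgt (lt_trans _ xr)// ltrDl.
have u1 n x : `|u n x| <= 1.
  have := cv01 n x; rewrite /u indicE; case: (_ \in _) => /= /andP[h1 h2].
    by rewrite ler_norml; lra.
  by rewrite ler_norml; lra.
have mC := @measurable_cube R (r + 1).
have iu n : leb4.-integrable setT (EFin \o u n).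
  apply: (integrable_setT_zero (m := leb4) mC).
    by move=> x; rewrite /cube/= => /negP; rewrite -ltNge; exact: u0.
  apply: (bounded_integrable (m := leb4) (M := 1)) => //; first exact: leb4_cube_lty.
  exact: measurable_funTS.
have icv n : leb4.-integrable setT (EFin \o cv (eta n) (\1_A : R4 R -> R)).
  apply: (integrable_setT_zero (m := leb4) mC).
    by move=> x; rewrite /cube/= => /negP; rewrite -ltNge; exact: cv0.
  apply: (bounded_integrable (m := leb4) (M := 1)) => //; first exact: leb4_cube_lty.
    by apply: measurable_funTS; exact: measurable_cv (Ce n) lA.1.
  by move=> x _; have /andP[? ?] := cv01 n x; rewrite ger0_norm.
have iA : leb4.-integrable setT (EFin \o (\1_A : M4 R -> R)).
  apply: (integrable_setT_zero (m := leb4) (measurable_cube r)).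
    by move=> x xr; rewrite indicE memNset// => /Ar.
  exact: lA.2.
have Iu n : \int[leb4]_x u n x = 0.
  rewrite /u RintegralB//; apply/eqP; rewrite subr_eq0; apply/eqP/EFin_inj.
  rewrite !EFin_Rintegral//.
  pose k (z : M4 R * M4 R) : \bar R := (eta n ((z.1 : R4 R) - z.2) * \1_A z.2)%:E.
  have [_ e0 _ _] := etaP n.
  have k0 z : (0 <= k z)%E by rewrite lee_fin mulr_ge0// indicE.
  have mk : measurable_fun setT k.
    apply/measurable_EFinP; apply: measurable_funM.
      exact: (measurableT_comp (Cc_measurable (Ce n)) measurable_sub4).
    exact: (measurableT_comp lA.1 measurable_snd).
  transitivity (\int[leb4]_x \int[leb4]_y k (x, y))%E.
    by apply: eq_integral => x _; rewrite EFin_Rintegral//; exact: (shift_integrable x (Ce n) lA).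
  rewrite (fubini_tonelli _ mk k0); apply: eq_integral => y _.
  rewrite /k/= -[RHS]mul1e -(density_integralr y (de n)) -ge0_integralZr//.
  - apply/measurable_EFinP; apply: (measurableT_comp (Cc_measurable (Ce n))).
    exact: (measurableT_comp measurable_sub4 (pair2_measurable (y : M4 R))).
  - by move=> x _; rewrite lee_fin.
pose up n (x : M4 R) : R := Num.max (u n x) 0.
have mup m : measurable_fun setT (up m) by exact: measurable_maxr.
have up0 x : exists N, forall n, (N <= n)%N -> up n x = 0.
  have [/set_mem xA|xA] := boolP ((x : R4 R) \in A).
    exists 0%N => n _; rewrite /up /u indicE mem_set//; apply/max_idPr.
    by have /andP[_ h] := cv01 n x; rewrite subr_le0.
  have : nbhs (x : R4 R) (~` A).
    by apply: open_nbhs_nbhs; split; [exact: closed_openC|rewrite notin_setE in xA].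
  move=> /nbhs_ballP[e /= e0 eA].
  exists (Num.truncn e^-1) => n Nn; rewrite /up /u indicE (negbTE xA) subr0.
  rewrite (_ : cv _ _ _ = 0) ?maxxx//.
  apply: Rintegral_eq0 => y _; rewrite indicE.
  have [/set_mem yA|] := boolP (y \in A); last by rewrite mulr0.
  have [->|ey] := eqVneq (eta n ((x : R4 R) - y)) 0; first by rewrite mul0r.
  exfalso; apply: (eA y) => //; rewrite -ball_normE /ball_/=.
  have [_ _ _ es] := etaP n; apply: (@le_lt_trans _ _ n.+1%:R^-1).
    by rewrite leNgt; apply: contra ey => h; apply/eqP/es.
  rewrite invf_plt ?posrE ?ltr0n//; apply: (lt_le_trans (truncnS_gt _)).
  by rewrite ler_nat.
have i1 : leb4.-integrable setT (EFin \o (\1_(cube (r + 1)) : M4 R -> R)).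
  apply: (integrable_setT_zero (m := leb4) mC).
    by move=> x xr; rewrite indicE memNset.
  by apply: (locint_indic mC).2.
have mupE m : measurable_fun setT (fun x => (up m x)%:E) by exact/measurable_EFinP.
have ff : {ae leb4, forall x : M4 R, setT x -> (up n x)%:E @[n --> \oo] --> 0%E}.
  apply: aeW => x _; have [N HN] := up0 x; apply: cvg_near_cst.
  by exists N => // n /= Nn; rewrite HN.
have fg : {ae leb4, forall (x : M4 R) n, setT x -> (`|(up n x)%:E| <= (EFin \o \1_(cube (r + 1)%R)) x)%E}.
  apply: aeW => x n _ /=; rewrite lee_fin indicE.
  have [|] := boolP (x \in _) => xr /=.
    rewrite ger0_norm ?le_max ?lexx ?orbT// ge_max ler01 andbT.
    by rewrite (le_trans (ler_norm _)).
  rewrite /up u0 ?maxxx ?normr0//; move: xr; rewrite notin_setE /cube/= => /negP.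
  by rewrite -ltNge.
have [_ _ dc] := dominated_convergence measurableT mupE (measurable_cst _) ff i1 fg.
have {}dc : (\int[leb4]_x (up n x)%:E @[n --> \oo] --> 0)%E.
  by move: dc; rewrite integral0.
have : \forall n \near \oo, (\int[leb4]_x (up n x)%:E < (d / 2)%:E)%E.
  apply: (dc [set y | (y < (d / 2)%:E)%E]).
  by apply: open_nbhs_nbhs; split; [exact: open_ereal_lt_ereal|rewrite /= lte_fin divr_gt0].
move=> [N _ HN]; exists N => n /HN /= /ltW h.
have ui m : leb4.-integrable setT (EFin \o up m).
  apply: (Rintegral_le_ge0 measurableT (mup m) i1) => x _.
  rewrite indicE; have [|] := boolP (x \in _) => xr /=.
    rewrite ger0_norm ?le_max ?lexx ?orbT// ge_max ler01 andbT.
    by rewrite (le_trans (ler_norm _)).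
  rewrite /up u0 ?maxxx ?normr0//; move: xr; rewrite notin_setE /cube/= => /negP.
  by rewrite -ltNge.
have iu2 : leb4.-integrable setT (EFin \o (fun x => 2 * up n x)).
  by have := integrableZl measurableT 2 (ui n).
rewrite (_ : (\int[leb4]_x _)%E = (\int[leb4]_x (2 * up n x - u n x))%:E); last first.
  rewrite EFin_Rintegral//; last by have := integrableB measurableT iu2 (iu n).
  apply: eq_integral => x _; congr (_%:E); rewrite -/(u n x) /up.
  case: (leP (u n x) 0) => h0; first by rewrite ler0_norm// mulr0 sub0r.
  by rewrite gtr0_norm//; ring.
rewrite RintegralB// Iu subr0 RintegralZl// lee_fin.
move: h; rewrite -EFin_Rintegral// lee_fin; lra.
Qed.

(** On [cube r] the mollification only involves the part of [A] inside [cube (r + 1)], the kernels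
    having radius at most 1; this reduces the claim to a bounded set. *)
Lemma good_closed (A : set (R4 R)) : closed A -> measurable (A : set (M4 R)) -> good (\1_A : R4 R -> R).
Proof.
move=> cA mA; split; first exact: locint_indic.
move=> r d d0; have mC := @measurable_cube R (r + 1).
have cC : closed (cube (r + 1) : set (R4 R)) by apply: compact_closed; [exact: norm_hausdorff|exact: compact_cube].
have [N HN] := good_bounded_closed (closedI cA cC) (measurableI _ _ mA mC) (@subIsetr _ _ _) d0.
exists N => n /HN; apply: le_trans.
have mr := @measurable_cube R r.
have lAC := locint_indic (measurableI _ _ mA mC).
apply: (@le_trans _ _ (\int[leb4]_(x in cube r) (`|cv (eta n) \1_(A `&` cube (r + 1)) x - \1_(A `&` cube (r + 1)) x|)%:E)%E).
  rewrite le_eqVlt; apply/orP; left; apply/eqP; apply: eq_integral => x /set_mem xr.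
  have eqA (y : R4 R) : `|y| <= r + 1 -> (\1_A y : R) = \1_(A `&` cube (r + 1)) y.
    by move=> yr; rewrite !indicE in_setI [X in _ && X]mem_set ?andbT.
  rewrite -eqA; last by rewrite (le_trans xr)// lerDl.
  congr (`|_ - _|%:E); apply: eq_Rintegral => y _.
  have [->|ey] := eqVneq (eta n (x - y)) 0; first by rewrite !mul0r.
  by rewrite eqA//; exact: mollifier_support ey.
apply: ge0_subset_integral => //.
exact: md_measurable.
Qed.

(** Dynkin's lemma: closed sets form a pi-system, complements follow by linearity, and a disjoint
    union is approximated, in L1 of a cube, by its finite partial unions. *)
Lemma good_indic (A : set (M4 R)) : measurable A -> good (\1_A : R4 R -> R).
Proof.
move=> mA; set G := [set (fun x : M4 R => (x : R4 R)) @^-1` C | C in [set C | closed C]].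
have GE : @measurable _ (M4 R) = <<s G >>.
  apply/seteqP; split=> [B|]; first exact: closed_generates4.
  apply: smallest_sub; first exact: sigma_algebra_measurable.
  by move=> _ [C cC <-]; exact: closed_measurable4.
apply: (@dynkin_induction _ _ G (fun A : set (M4 R) => good (\1_A : R4 R -> R)) GE).
- move=> _ _ [C /= cC <-] [D /= cD <-]; exists (C `&` D) => //; exact: closedI.
- by apply: good_closed => //; exact: closedT.
- by move=> _ [C /= cC <-]; apply: good_closed => //; exact: closed_measurable4.
- move=> B mB gB; have g1 : good (\1_(setT : set (R4 R)) : R4 R -> R).
    by apply: good_closed => //; exact: closedT.
  move: (goodD g1 (goodZ (-1) gB)); congr good; apply/funext => x.
  by rewrite !indicE in_setC in_setT; case: (x \in B); rewrite /= ?mulr0n ?mulr1n; ring.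
- move=> F mF tF gF; apply: good_approx.
    by apply: locint_indic; exact: bigcupT_measurable.
  move=> r d d0; have mr := @measurable_cube R (r + 1).
  pose h k x : R := \sum_(i <- iota 0 k) \1_(F i) x.
  have hE k x : h k x = \1_(\bigcup_(i < k) F i) x.
    elim: k => [|k ih].
      by rewrite /h big_nil indicE bigcup_mkord big_ord0 in_set0.
    rewrite /h -addn1 iotaD big_cat/= big_cons big_nil addr0 -/(h k x) ih add0n.
    rewrite addn1 (_ : \bigcup_(i < k.+1) F i = (\bigcup_(i < k) F i) `|` F k); last first.
      by rewrite !bigcup_mkord big_ord_recr.
    rewrite !indicE in_setU.
    have [xk|] := boolP (x \in F k); last by rewrite orbF addr0.
    rewrite orbT memNset ?add0r// => -[i /= ik xi].
    have /trivIsetP /(_ i k I I) := tF; rewrite ltn_eqF// => /(_ isT)/seteqP[+ _] => /(_ x); apply.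
    by split=> //; exact: set_mem.
  (* The part of the union not yet covered decreases to the empty set inside a cube of finite
     measure, so its measure tends to 0. *)
  pose D k : set (M4 R) := cube (r + 1) `&` ((\bigcup_i F i) `\` \bigcup_(i < k) F i).
  have mU k : measurable (\bigcup_(i < k) F i : set (M4 R)).
    by apply: bigcup_measurable => i _; exact: mF.
  have mT : measurable (\bigcup_i F i : set (M4 R)) by exact: bigcupT_measurable.
  have mD k : measurable (D k) by apply: measurableI => //; exact: measurableD.
  have D0 : \bigcap_k D k = set0.
    apply/seteqP; split=> // x Dx; have [_ [[i _ xi] _]] := Dx 0%N I.
    by have [_ [_ n]] := Dx i.+1 I; apply: n; exists i => /=.
  have cD : (leb4 (D k) @[k --> \oo] --> leb4 (\bigcap_k D k))%E.
    apply: nonincreasing_cvg_mu => //.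
    - apply: (le_lt_trans _ (leb4_cube_lty (r + 1))); apply: le_measure; rewrite ?inE//.
      exact: subIsetl.
    - by rewrite D0.
    - move=> a b ab; apply/subsetPset => x [xr [xU xa]]; split=> //; split=> //.
      by move=> [i /= ia xi]; apply: xa; exists i => //=; exact: leq_trans ab.
  have : \forall k \near \oo, (leb4 (D k) < d%:E)%E.
    apply: (cD [set y | (y < d%:E)%E]).
    apply: open_nbhs_nbhs; split; first exact: open_ereal_lt_ereal.
    by rewrite /= D0 measure0 lte_fin.
  move=> [k _ /(_ k (leqnn k)) /= Dk]; exists (h k); first exact: good_sum.
  apply: le_trans (ltW Dk); rewrite -[D k]setIT -integral_indic//.
  rewrite [leLHS]integral_mkcond le_eqVlt; apply/orP; left; apply/eqP.
  apply: eq_integral => x _; rewrite patchE [in RHS]indicE /D in_setI.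
  case: (x \in cube (r + 1)) => //=; rewrite hE !indicE in_setD.
  have [|] := boolP (x \in \bigcup_i F i) => xU; have [|] := boolP (x \in \bigcup_(i < k) F i) => xk /=.
  + by rewrite subrr normr0.
  + by rewrite subr0 normr1.
  + exfalso; move: xU; rewrite notin_setE; apply.
    by have /set_mem[i _ xi] := xk; exists i.
  + by rewrite subrr normr0.
by rewrite -GE.
Qed.

Import HBSimple.

(** Simple functions are dense in L1 of the cube and are finite combinations of indicators. *)
Lemma good_locint g : locint g -> good g.
Proof.
move=> lg; apply: good_approx => // r d d0; have mr := @measurable_cube R (r + 1).
have [h [_ _ hg]] := approximation_sfun_integrable mr (lg.2 (r + 1)).
have /hg : nbhs (0 : \bar R)%E [set y | (y < d%:E)%E].
  by apply: open_nbhs_nbhs; split; [exact: open_ereal_lt_ereal|rewrite /= lte_fin].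
move=> [n _ /(_ n (leqnn n)) /= hn]; move: (h n) hn => h' hn.
pose P (y : R) : set (M4 R) := h' @^-1` [set y].
have gh : good (fun x : R4 R => \sum_(y <- finmap.enum_fset (fset_set (range h'))) (y * \1_(P y) x)).
  apply: good_sum => y; apply: goodZ; apply: good_indic.
  have : measurable (P y) by exact: measurable_sfunP.
  by [].
eexists; first exact: gh.
apply: le_trans (ltW hn); rewrite le_eqVlt; apply/orP; left; apply/eqP.
by apply: eq_integral => x _; rewrite /= fimfunE fsbig_finite.
Qed.

Lemma limn_einf_ge (a : \bar R) (b : nat -> \bar R) :
  (forall delta, 0 < delta -> exists N, forall n, (N <= n)%N -> (a <= b n + delta%:E)%E) ->
  (a <= limn_einf b)%E.
Proof.
move=> H; rewrite limn_einf_lim (cvg_lim _ (@cvg_einfs_sup _ b))//.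
apply/lee_addgt0Pr => d d0; have [N HN] := H d d0.
apply: (@le_trans _ _ (einfs b N + d%:E)%E).
  rewrite -leeBlDr//; apply: le_ereal_inf_tmp => _ [n /= Nn <-].
  by rewrite EFinN leeBlDr//; exact: HN.
by rewrite leeD2r//; apply: ereal_sup_ubound; exists N.
Qed.

(** Truncation at [M] makes the power Lipschitz, so that convergence in L1 can be applied to it. *)
Lemma powr_minn_lip (p : nat) (M a b : R) : 0 < M ->
  Num.min `|a| M ^+ p.+1 - Num.min `|b| M ^+ p.+1 <= p.+1%:R * M ^+ p * `|a - b|.
Proof.
move=> M0.
have m0 c : 0 <= Num.min `|c| M by rewrite le_min normr_ge0 ltW.
have mM c : Num.min `|c| M <= M by rewrite ge_min lexx orbT.
have h : Num.min `|a| M - Num.min `|b| M <= `|a - b|.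
  have := ler_dist_dist a b; rewrite ler_norml => /andP[_].
  by move=> h; have := normr_ge0 (a - b); case: (leP `|a| M); case: (leP `|b| M); lra.
have [ab|ab] := leP (Num.min `|a| M) (Num.min `|b| M).
  apply: (@le_trans _ _ 0); first by rewrite subr_le0 lerXn2r ?nnegrE.
  by apply: mulr_ge0 => //; apply: mulr_ge0 => //; apply: exprn_ge0; exact: ltW.
rewrite subrXX [leRHS]mulrC.
apply: ler_pM => //.
- by rewrite subr_ge0 ltW.
- by apply: sumr_ge0 => i _; apply: mulr_ge0; exact: exprn_ge0.
rewrite -[X in X%:R]card_ord -sum1_card natr_sum mulr_suml; apply: ler_sum => i _.
rewrite mul1r -[in leRHS](subnK (ltn_ord i : (i <= p)%N)) exprD.
by apply: ler_pM; rewrite ?exprn_ge0// lerXn2r ?nnegrE// ?(ltW M0).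
Qed.

Lemma measurable_absX (g : M4 R -> R) (p : nat) : measurable_fun setT g ->
  measurable_fun setT (fun x => (`|g x| ^+ p)%:E).
Proof.
move=> mg; apply/measurable_EFinP; apply: measurable_funX.
exact: (measurableT_comp (@normr_measurable _ _) mg).
Qed.

(** Fatou's lemma: at each point the truncations eventually equal [|g|]. *)
Lemma integral_truncation (g : M4 R -> R) (p : nat) (A : set (M4 R)) (c : \bar R) :
  measurable A -> measurable_fun setT g ->
  (forall M : nat, (\int[leb4]_(x in A) (Num.min `|g x| M.+1%:R ^+ p)%:E <= c)%E) ->
  (\int[leb4]_(x in A) (`|g x| ^+ p)%:E <= c)%E.
Proof.
move=> mA mg H; pose F M (x : M4 R) : \bar R := (Num.min `|g x| M.+1%:R ^+ p)%:E.
have mF M : measurable_fun A (F M).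
  apply: measurable_funTS; apply/measurable_EFinP; apply: measurable_funX.
  apply: measurable_minr; last exact: measurable_cst.
  exact: (measurableT_comp (@normr_measurable _ _) mg).
have F0 M x : A x -> (0 <= F M x)%E by move=> _; rewrite lee_fin exprn_ge0// le_min normr_ge0.
have -> : (\int[leb4]_(x in A) (`|g x| ^+ p)%:E = \int[leb4]_(x in A) limn_einf (F^~ x))%E.
  apply: eq_integral => x _; symmetry; have cF : F n x @[n --> \oo] --> (`|g x| ^+ p)%:E.
    apply: cvg_near_cst; exists (Num.truncn `|g x|) => // M /= h; rewrite /F; congr (_ ^+ _)%:E.
    apply/min_idPl; apply: (le_trans (ltW (truncnS_gt _))); by rewrite ler_nat ltnS.
  by rewrite is_cvg_limn_einfE; [exact: cvg_lim|apply: cvgP; exact: cF].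
apply: (le_trans (fatou _ mA mF F0)).
rewrite limn_einf_lim (cvg_lim _ (@cvg_einfs_sup _ _))//.
apply: ge_ereal_sup => _ [n _ <-]; apply: (le_trans _ (H n)).
by apply: ereal_inf_lbound; exists n => /=.
Qed.

(** The power truncated at level [M] is Lipschitz, hence passes to the L1 limit, and the truncated
    power of the mollified function lies below its full power. The level [M] is sent to infinity
    outside this argument. *)
Lemma lsc_mollified g (A : set (M4 R)) r (p : nat) : locint g -> measurable A -> A `<=` cube r ->
  (\int[leb4]_(x in A) (`|g x| ^+ p.+1)%:E <=
   limn_einf (fun n => \int[leb4]_(x in A) (`|cv (eta n) g x| ^+ p.+1)%:E))%E.
Proof.
move=> lg mA Ar; have mg := lg.1; have mr := @measurable_cube R r.
apply: integral_truncation => // M; apply: limn_einf_ge => d d0.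
have M0 : 0 < M.+1%:R :> R by [].
set L : R := p.+1%:R * M.+1%:R ^+ p.
have L0 : 0 < L by rewrite /L mulr_gt0// exprn_gt0.
have [_ /(_ r (d / L) (divr_gt0 d0 L0))[N HN]] := good_locint lg.
exists N => n /HN h.
have mc : measurable_fun setT (cv (eta n) g : M4 R -> R) by exact: measurable_cv (Ce n) mg.
have mm k : measurable_fun setT (k : M4 R -> R) ->
    measurable_fun A (fun x => (Num.min `|k x| M.+1%:R ^+ p.+1)%:E).
  move=> mk; apply: measurable_funTS; apply/measurable_EFinP; apply: measurable_funX.
  apply: measurable_minr; last exact: measurable_cst.
  exact: (measurableT_comp (@normr_measurable _ _) mk).
have md : measurable_fun A (fun x => (`|cv (eta n) g x - g x|)%:E).
  by apply: measurable_funTS; exact: md_measurable.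
have ml : measurable_fun A (fun x => (L * `|cv (eta n) g x - g x|)%:E).
  by apply: measurable_funTS; apply/measurable_EFinP; apply: measurable_funM => //;
     apply/measurable_EFinP; exact: md_measurable.
have mx : measurable_fun A (fun x => (`|cv (eta n) g x| ^+ p.+1)%:E).
  by apply: measurable_funTS; exact: measurable_absX.
have x0 x : A x -> (0 <= (`|cv (eta n) g x| ^+ p.+1)%:E)%E by rewrite lee_fin exprn_ge0.
have l0 x : A x -> (0 <= (L * `|cv (eta n) g x - g x|)%:E)%E.
  by rewrite lee_fin; move=> _; exact: mulr_ge0 (ltW L0) (normr_ge0 _).
apply: (@le_trans _ _ (\int[leb4]_(x in A) ((`|cv (eta n) g x| ^+ p.+1)%:E +
    (L * `|cv (eta n) g x - g x|)%:E))%E).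
  apply: ge0_le_integral => //.
  - by apply: mm.
  - exact: emeasurable_funD.
  move=> x _; rewrite -EFinD lee_fin addrC -lerBlDr.
  apply: (@le_trans _ _ (Num.min `|g x| M.+1%:R ^+ p.+1 - Num.min `|cv (eta n) g x| M.+1%:R ^+ p.+1)).
    by rewrite lerD2l lerN2; apply: lerXn2r; rewrite ?nnegrE ?le_min ?normr_ge0//= ge_min lexx.
  by rewrite distrC; exact: powr_minn_lip.
rewrite ge0_integralD//; apply: leeD => //.
under eq_integral do rewrite EFinM.
rewrite ge0_integralZl//; last by rewrite lee_fin ltW.
apply: (@le_trans _ _ (L%:E * (d / L)%:E)%E); last by rewrite -EFinM mulrC divfK// gt_eqF.
apply: lee_wpmul2l; first by rewrite lee_fin ltW.
apply: le_trans h; apply: ge0_subset_integral => //.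
by apply: measurable_funTS; exact: md_measurable.
Qed.

End MollifierConvergence.

Lemma Rintegral_le2 d (X : measurableType d) (R : realType) (m : {measure set X -> \bar R})
    (D : set X) (f g1 g2 : X -> R) (a1 a2 c1 c2 : R) : measurable D ->
  m.-integrable D (EFin \o f) -> measurable_fun D g1 -> measurable_fun D g2 ->
  (forall x, D x -> 0 <= g1 x) -> (forall x, D x -> 0 <= g2 x) -> 0 <= a1 -> 0 <= a2 ->
  (forall x, D x -> f x <= a1 * g1 x + a2 * g2 x) ->
  (\int[m]_(x in D) (g1 x)%:E <= c1%:E)%E -> (\int[m]_(x in D) (g2 x)%:E <= c2%:E)%E ->
  \int[m]_(x in D) f x <= a1 * c1 + a2 * c2.
Proof.
move=> mD fi mg1 mg2 g10 g20 a10 a20 fg h1 h2.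
have i1 : m.-integrable D (EFin \o g1) by apply: ge0_integrable => //; exact: le_lt_trans h1 (ltry _).
have i2 : m.-integrable D (EFin \o g2) by apply: ge0_integrable => //; exact: le_lt_trans h2 (ltry _).
have j1 : m.-integrable D (EFin \o (fun x => a1 * g1 x)) by have := integrableZl mD a1 i1.
have j2 : m.-integrable D (EFin \o (fun x => a2 * g2 x)) by have := integrableZl mD a2 i2.
have j : m.-integrable D (EFin \o (fun x => a1 * g1 x + a2 * g2 x)) by have := integrableD mD j1 j2.
apply: (@le_trans _ _ (\int[m]_(x in D) (a1 * g1 x + a2 * g2 x))); first exact: le_Rintegral.
rewrite RintegralD// !RintegralZl//.
apply: lerD; apply: ler_wpM2l => //; rewrite -lee_fin EFin_Rintegral//.
Qed.

(** * Locally bounded functions integrated against a cutoff *)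

Section LocallyBounded.
Context {R : realType}.
Implicit Types (F G psi : R4 R -> R).

(** Unlike local integrability this is stable under products, and every mollified function has it;
    so all products in the energy identity are integrable against a cutoff. *)
Definition locbd F := measurable_fun (setT : set (M4 R)) F /\
  forall r, exists M, forall x, `|x| <= r -> `|F x| <= M.

Lemma locbd_cv k g : Cc k -> locint g -> locbd (cv k g).
Proof.
move=> Ck lg; split; first exact: measurable_cv Ck lg.1.
by move=> r; have [M _ h] := cv_bounded r Ck lg; exists M.
Qed.

Lemma locbdM F G : locbd F -> locbd G -> locbd (fun x => F x * G x).
Proof.
move=> [mF bF] [mG bG]; split; first exact: measurable_funM.
move=> r; have [M hM] := bF r; have [N hN] := bG r.
by exists (M * N) => x xr; rewrite normrM; apply: ler_pM; rewrite ?normr_ge0 ?hM ?hN.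
Qed.

Lemma locbdD F G : locbd F -> locbd G -> locbd (fun x => F x + G x).
Proof.
move=> [mF bF] [mG bG]; split; first exact: measurable_funD.
move=> r; have [M hM] := bF r; have [N hN] := bG r.
by exists (M + N) => x xr; apply: (le_trans (ler_normD _ _)); apply: lerD; rewrite ?hM ?hN.
Qed.

Lemma locbdZ F (c : R) : locbd F -> locbd (fun x => c * F x).
Proof.
move=> [mF bF]; split; first exact: measurable_funM.
move=> r; have [M hM] := bF r; exists (`|c| * M) => x xr.
by rewrite normrM; apply: ler_wpM2l => //; exact: hM.
Qed.

Lemma locbd_sum (s : seq 'I_4) (F : 'I_4 -> R4 R -> R) :
  (forall j, locbd (F j)) -> locbd (fun x => \sum_(j <- s) F j x).
Proof.
move=> bF; elim: s => [|i s ih].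
  have : locbd (fun x : R4 R => 0 : R).
    by split=> // r; exists 0 => x _; rewrite normr0.
  by congr locbd; apply/funext => x; rewrite big_nil.
by move: (locbdD (bF i) ih); congr locbd; apply/funext => x; rewrite big_cons.
Qed.

Lemma locbd_locint F G : locbd F -> locint G -> locint (fun x => F x * G x).
Proof.
move=> [mF bF] [mG iG]; split; first exact: measurable_funM.
move=> r; have [M hM] := bF r.
apply: (integrable_bounded_mul (m := leb4) (C := M)) (iG r); first exact: measurable_cube.
  exact: measurable_funTS.
by move=> x; exact: hM.
Qed.

Lemma Cc_locbd_integrable psi F : Cc psi -> locbd F ->
  leb4.-integrable setT (EFin \o (fun x => psi x * F x)).
Proof.
move=> Cp [mF bF]; have [r r0 p0] := Cc_support Cp; have [M hM] := bF r.
have [P P0 hP] := Cc_bounded Cp; have mr := @measurable_cube R r.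
apply: (integrable_setT_zero (m := leb4) mr).
  by move=> x; rewrite /cube/= => /negP; rewrite -ltNge => /p0 ->; rewrite mul0r.
apply: (bounded_integrable (m := leb4) (M := P * M)) => //; first exact: leb4_cube_lty.
  by apply: measurable_funTS; apply: measurable_funM => //; exact: Cc_measurable.
by move=> x xr; rewrite normrM; apply: ler_pM; rewrite ?normr_ge0 ?hM ?hP.
Qed.

Lemma ibp_cutoff j psi F F' : Ccinfty psi -> pderiv j F F' -> locbd F -> locbd F' ->
  \int[leb4]_x (psi x * F' x) = - \int[leb4]_x ('D_(e4 R j) psi x * F x).
Proof.
move=> Cp pF bF bF'; have Cd := Ccinfty_Cc (Ccinfty_D (e4 R j) Cp).
have Cp' := Ccinfty_Cc Cp.
rewrite (integration_by_parts4 (smooth_pderiv j Cp.1) pF).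
- by congr (- _); apply: eq_Rintegral => x _; rewrite mulrC.
- exact: Cc_locbd_integrable.
- exact: Cc_locbd_integrable.
- have := Cc_locbd_integrable Cd bF.
  by congr (leb4.-integrable _ _); apply/funext => x /=; rewrite mulrC.
Qed.

End LocallyBounded.

Lemma ae_mono d (X : sigmaRingType d) (R : realType) (m : set X -> \bar R) (P Q : X -> Prop) :
  {ae m, forall x, P x} -> (forall x, P x -> Q x) -> {ae m, forall x, Q x}.
Proof.
move=> [N [mN N0 sub]] PQ; exists N; split=> // x nQ; apply: sub => /= Px.
by apply: nQ; exact: PQ.
Qed.

Section CutoffIntegral.
Context {R : realType}.
Variable psi : R4 R -> R.
Hypothesis Cpsi : Cc psi.

Lemma cutoff_integralD F G : locbd F -> locbd G ->
  \int[leb4]_x (psi x * (F x + G x)) = \int[leb4]_x (psi x * F x) + \int[leb4]_x (psi x * G x).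
Proof.
move=> bF bG; have iF := Cc_locbd_integrable Cpsi bF; have iG := Cc_locbd_integrable Cpsi bG.
by rewrite -RintegralD//; apply: eq_Rintegral => x _; rewrite mulrDr.
Qed.

Lemma cutoff_integralZ F (c : R) : locbd F ->
  \int[leb4]_x (psi x * (c * F x)) = c * \int[leb4]_x (psi x * F x).
Proof.
move=> bF; have iF := Cc_locbd_integrable Cpsi bF.
by rewrite -RintegralZl//; apply: eq_Rintegral => x _; rewrite mulrCA.
Qed.

Lemma cutoff_integral_sum (F : 'I_4 -> R4 R -> R) : (forall j, locbd (F j)) ->
  \int[leb4]_x (psi x * (\sum_j F j x)) = \sum_j \int[leb4]_x (psi x * F j x).
Proof.
move=> bF; elim: (index_enum _) => [|i s ih].
  by rewrite big_nil; apply: Rintegral_eq0 => x _; rewrite big_nil mulr0.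
rewrite big_cons -ih -cutoff_integralD//; last exact: locbd_sum.
by apply: eq_Rintegral => x _; rewrite big_cons.
Qed.

Lemma cutoff_integral_ae0 F G : locbd F -> locbd G -> {ae leb4, forall x, G x = 0} ->
  \int[leb4]_x (psi x * (F x * G x)) = 0.
Proof.
move=> bF bG G0; have iFG := Cc_locbd_integrable Cpsi (locbdM bF bG).
apply: EFin_inj; rewrite EFin_Rintegral//.
rewrite (ae_eq_integral (cst 0%E))//; first by rewrite integral0.
- by case/integrableP : iFG.
- by apply: (ae_mono G0) => x /= -> _; rewrite !mulr0.
Qed.

End CutoffIntegral.

(** * The energy identity of the mollified equation at a fixed time *)

Section EnergyIdentity.
Context {R : realType}.
Variables (eta psi : R4 R -> R) (v : 'I_4 -> R4 R -> R) (Dv : 'I_4 -> 'I_4 -> R4 R -> R).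
Variables (p : R4 R -> R) (f b db : 'I_4 -> R4 R -> R).
Hypotheses (Ceta : Ccinfty eta) (Cpsi : Ccinfty psi).
Hypotheses (lv : forall i, locint (v i)) (lDv : forall i j, locint (Dv i j)).
Hypotheses (lp : locint p) (lf : forall i, locint (f i)).
Hypothesis wk : forall i j x, cv ('D_(e4 R j) eta) (v i) x = cv eta (Dv i j) x.
Hypothesis divU : {ae leb4, forall x, \sum_i cv eta (Dv i i) x = 0}.
Hypothesis pb : forall j, pderiv j (b j) (db j).
Hypotheses (bb : forall j, locbd (b j)) (bdb : forall j, locbd (db j)).
Hypothesis divb : {ae leb4, forall x, \sum_j db j x = 0}.

Let U i := cv eta (v i).
Let V i j := cv eta (Dv i j).
Let B i j := cv eta (fun x => b j x * Dv i j x).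
Let P := cv eta p.
Let H i := cv eta (f i).

(** The time derivative of the mollified velocity according to the equation, with [b] as
    transporting field. One derivative of the Laplacian, and that of the pressure, fall on the
    kernel. *)
Definition mollified_rhs i x : R :=
  \sum_j cv ('D_(e4 R j) eta) (Dv i j) x - \sum_j B i j x
  - cv ('D_(e4 R i) eta) p x + H i x.

Let Ce : Cc eta. Proof. exact: Ccinfty_Cc. Qed.
Let Cde j : Cc ('D_(e4 R j) eta). Proof. exact/Ccinfty_Cc/Ccinfty_D. Qed.
Let Cp : Cc psi. Proof. exact: Ccinfty_Cc. Qed.
Let Cdp j : Cc ('D_(e4 R j) psi). Proof. exact/Ccinfty_Cc/Ccinfty_D. Qed.
Let bU i : locbd (U i). Proof. exact: locbd_cv. Qed.
Let bV i j : locbd (V i j). Proof. exact: locbd_cv. Qed.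
Let bB i j : locbd (B i j). Proof. apply: locbd_cv => //; exact: locbd_locint. Qed.
Let bP : locbd P. Proof. exact: locbd_cv. Qed.
Let bH i : locbd (H i). Proof. exact: locbd_cv. Qed.
Let bW i j : locbd (cv ('D_(e4 R j) eta) (Dv i j)). Proof. exact: locbd_cv. Qed.
Let bdP i : locbd (cv ('D_(e4 R i) eta) p). Proof. exact: locbd_cv. Qed.
Let pU i j : pderiv j (U i) (V i j).
Proof. by rewrite (_ : V i j = cv ('D_(e4 R j) eta) (v i)); [exact: cv_pderiv|apply/funext => x; rewrite wk]. Qed.

Let J F : R := \int[leb4]_x (psi x * F x).
Let Jd j F : R := \int[leb4]_x ('D_(e4 R j) psi x * F x).

Let diffusion i j : J (fun x => U i x * cv ('D_(e4 R j) eta) (Dv i j) x) =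
  - J (fun x => V i j x ^+ 2) - Jd j (fun x => U i x * V i j x).
Proof.
have pF := pderivM (pU i j) (cv_pderiv j Ceta (lDv i j)).
have := ibp_cutoff Cpsi pF (locbdM (bU i) (bV i j))
  (locbdD (locbdM (bU i) (bW i j)) (locbdM (bV i j) (bV i j))).
rewrite (cutoff_integralD Cp (locbdM (bU i) (bW i j)) (locbdM (bV i j) (bV i j))).
have aux (x y z : R) : x + y = - z -> x = - y - z by move=> h; lra.
move=> /aux h; apply: (eq_trans h); congr (- _ - _).
Qed.

(** [B - b V] is the commutator of mollification and transport. In the remaining term [U V] is half
    the derivative of [U^2], whence the factors one half; the term with [db] disappears after
    summation over [j]. *)
Let transport i j : J (fun x => U i x * B i j x) =
  J (fun x => U i x * (B i j x - b j x * V i j x))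
  - 2^-1 * Jd j (fun x => b j x * U i x ^+ 2) - 2^-1 * J (fun x => U i x ^+ 2 * db j x).
Proof.
have pF := pderivM (pb j) (pderivM (pU i j) (pU i j)).
have bUV := locbdM (bU i) (bV i j); have bUU := locbdM (bU i) (bU i).
have bbUV := locbdM (bb j) bUV.
have := ibp_cutoff Cpsi pF (locbdM (bb j) bUU)
  (locbdD (locbdM (bb j) (locbdD bUV bUV)) (locbdM bUU (bdb j))).
rewrite (cutoff_integralD Cp (locbdM (bb j) (locbdD bUV bUV)) (locbdM bUU (bdb j))).
have -> : \int[leb4]_x (psi x * (b j x * (U i x * V i j x + U i x * V i j x))) =
    2 * J (fun x => b j x * (U i x * V i j x)).
  rewrite -[RHS](cutoff_integralZ Cp _ bbUV); apply: eq_Rintegral => x _; ring.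
have -> : J (fun x => U i x * B i j x) =
    J (fun x => U i x * (B i j x - b j x * V i j x)) + J (fun x => b j x * (U i x * V i j x)).
  rewrite -(cutoff_integralD Cp _ bbUV).
    by apply: eq_Rintegral => x _; ring.
  apply: locbdM => //; have := locbdD (bB i j) (locbdZ (-1) (locbdM (bb j) (bV i j))).
  by congr locbd; apply/funext => x; ring.
have -> : Jd j (fun x => b j x * U i x ^+ 2) =
    \int[leb4]_x ('D_(e4 R j) psi x * (b j x * (U i x * U i x))).
  by apply: eq_Rintegral => x _; rewrite expr2.
have -> : J (fun x => U i x ^+ 2 * db j x) = \int[leb4]_x (psi x * (U i x * U i x * db j x)).
  by apply: eq_Rintegral => x _; rewrite expr2.
have aux (x y z w : R) : 2 * x + y = - z -> w + x = w - 2^-1 * z - 2^-1 * y by move=> h; lra.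
exact: aux.
Qed.

Let pressure i : J (fun x => U i x * cv ('D_(e4 R i) eta) p x) =
  - Jd i (fun x => U i x * P x) - J (fun x => P x * V i i x).
Proof.
have pF := pderivM (pU i i) (cv_pderiv i Ceta lp).
have b1 := locbdM (bU i) (bdP i); have b2 := locbdM bP (bV i i).
have := ibp_cutoff Cpsi pF (locbdM (bU i) bP) (locbdD b1 b2).
rewrite (cutoff_integralD Cp b1 b2).
have aux (x y z : R) : x + y = - z -> x = - z - y by move=> h; lra.
exact: aux.
Qed.

Lemma energy_identity :
  \sum_i \int[leb4]_x (psi x * (U i x * mollified_rhs i x)) =
  \sum_i \sum_j ((- \int[leb4]_x (psi x * V i j x ^+ 2))
    - \int[leb4]_x ('D_(e4 R j) psi x * (U i x * V i j x))
    + 2^-1 * \int[leb4]_x ('D_(e4 R j) psi x * (b j x * U i x ^+ 2))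
    - \int[leb4]_x (psi x * (U i x * (B i j x - b j x * V i j x))))
  + \sum_i (\int[leb4]_x ('D_(e4 R i) psi x * (U i x * P x))
    + \int[leb4]_x (psi x * (U i x * H i x))).
Proof.
(* The sum of the [V i i] is the divergence of [U], so the pressure survives only where the cutoff
   varies; [dB] uses in the same way that [b] is divergence free. *)
have dU : \sum_i J (fun x => P x * V i i x) = 0.
  rewrite -(cutoff_integral_sum Cp) => [|j]; last exact: locbdM.
  rewrite -[RHS](cutoff_integral_ae0 Cp bP (locbd_sum _ (fun i => bV i i)) divU).
  by apply: eq_Rintegral => x _; congr (_ * _); rewrite mulr_sumr.
have dB i : \sum_j J (fun x => U i x ^+ 2 * db j x) = 0.
  have bUU : locbd (fun x => U i x ^+ 2) by exact: locbdM (bU i) (bU i).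
  rewrite -(cutoff_integral_sum Cp) => [|j]; last exact: locbdM.
  rewrite -[RHS](cutoff_integral_ae0 Cp bUU (locbd_sum _ bdb) divb).
  by apply: eq_Rintegral => x _; congr (_ * _); rewrite mulr_sumr.
have split i : \int[leb4]_x (psi x * (U i x * mollified_rhs i x)) =
    \sum_j J (fun x => U i x * cv ('D_(e4 R j) eta) (Dv i j) x)
    - \sum_j J (fun x => U i x * B i j x) - J (fun x => U i x * cv ('D_(e4 R i) eta) p x)
    + J (fun x => U i x * H i x).
  have c1 := locbd_sum (index_enum _) (fun j => locbdM (bU i) (bW i j)).
  have c2 := locbdZ (-1) (locbd_sum (index_enum _) (fun j => locbdM (bU i) (bB i j))).
  have c3 := locbdZ (-1) (locbdM (bU i) (bdP i)).
  have c4 := locbdM (bU i) (bH i).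
  have s1 : \sum_j J (fun x => U i x * cv ('D_(e4 R j) eta) (Dv i j) x) = _ :=
    esym (cutoff_integral_sum Cp (fun j => locbdM (bU i) (bW i j))).
  have s2 : \sum_j J (fun x => U i x * B i j x) = _ :=
    esym (cutoff_integral_sum Cp (fun j => locbdM (bU i) (bB i j))).
  have aux (k k' l l' m n t : R) : k = k' -> l = l' ->
    k' + -1 * l' + -1 * m + n = t -> k - l - m + n = t by move=> -> -> <-; ring.
  apply: esym; apply: (aux _ _ _ _ _ _ _ s1 s2).
  rewrite -(cutoff_integralZ Cp _ (locbd_sum _ (fun j => locbdM (bU i) (bB i j)))).
  rewrite -(cutoff_integralZ Cp _ (locbdM (bU i) (bdP i))).
  rewrite -(cutoff_integralD Cp c1 c2) -(cutoff_integralD Cp (locbdD c1 c2) c3).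
  rewrite -(cutoff_integralD Cp (locbdD (locbdD c1 c2) c3) c4).
  apply: eq_Rintegral => x _; congr (_ * _); rewrite /mollified_rhs -!mulr_sumr; ring.
under eq_bigr do rewrite split.
rewrite big_split/= sumrB sumrB.
pose X1 (i j : 'I_4) := J (fun x => U i x * cv ('D_(e4 R j) eta) (Dv i j) x).
pose Y1 (i j : 'I_4) := - J (fun x => V i j x ^+ 2) - Jd j (fun x => U i x * V i j x).
have XY i j : X1 i j = Y1 i j by exact: diffusion.
have e1 : \sum_i \sum_j X1 i j = \sum_i \sum_j Y1 i j.
  by apply: eq_bigr => i _; apply: eq_bigr => j _; exact: XY.
have e2 : \sum_i \sum_j J (fun x => U i x * B i j x) =
  \sum_i \sum_j (J (fun x => U i x * (B i j x - b j x * V i j x))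
    - 2^-1 * Jd j (fun x => b j x * U i x ^+ 2)).
  apply: eq_bigr => i _; apply: (eq_trans (eq_bigr _ (fun j (_ : true) => transport i j))).
  have aux (X Z : 'I_4 -> R) : \sum_j Z j = 0 -> \sum_j (X j - 2^-1 * Z j) = \sum_j X j.
    by move=> Z0; rewrite sumrB -mulr_sumr Z0 mulr0 subr0.
  exact: aux (dB i).
have e3 : \sum_i J (fun x => U i x * cv ('D_(e4 R i) eta) p x) =
    - \sum_i Jd i (fun x => U i x * P x).
  apply: (eq_trans (eq_bigr _ (fun i (_ : true) => pressure i))).
  have aux (X Z : 'I_4 -> R) : \sum_j Z j = 0 -> \sum_j (- X j - Z j) = - \sum_j X j.
    by move=> Z0; rewrite sumrB Z0 subr0 sumrN.
  exact: aux dU.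
have aux (x y z w x' y' z' t : R) : x = x' -> y = y' -> z = z' ->
  x' - y' - z' + w = t -> x - y - z + w = t by move=> -> -> ->.
apply: (aux _ _ _ _ _ _ _ _ e1 e2 e3).
rewrite opprK [in RHS]big_split/= -addrA; congr (_ + _); rewrite -sumrB; apply: eq_bigr => i _.
rewrite -sumrB; apply: eq_bigr => j _.
have aux2 (k l m n : R) : k - l - (n - m) = k - l + m - n by ring.
exact: aux2.
Qed.

End EnergyIdentity.

(** * The energy inequality at a fixed time, with abstract constants *)

Lemma sum_const4 (R : nzRingType) (x : R) : \sum_(i < 4) x = 4 * x.
Proof. by rewrite sumr_const card_ord mulr_natl. Qed.

Lemma sum_const44 (R : nzRingType) (x : R) : \sum_(i < 4) \sum_(j < 4) x = 16 * x.
Proof. by rewrite !sum_const4 mulrA -natrM. Qed.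

Lemma le_combine (R : realFieldType) (x y z w c1 c2 c3 : R) :
  - c1 <= y -> z <= 2 * c2 -> - c3 <= w ->
  - x - y + 2^-1 * z - w + x <= c1 + c2 + c3.
Proof. lra. Qed.

Section EnergyInequality.
Context {R : realType}.

Lemma normr_Rintegral_le2 d (X : measurableType d) (m : {measure set X -> \bar R})
    (f g1 g2 : X -> R) (a1 a2 c1 c2 : R) :
  m.-integrable setT (EFin \o f) -> measurable_fun setT g1 -> measurable_fun setT g2 ->
  (forall x, 0 <= g1 x) -> (forall x, 0 <= g2 x) -> 0 <= a1 -> 0 <= a2 ->
  (forall x, `|f x| <= a1 * g1 x + a2 * g2 x) ->
  (\int[m]_x (g1 x)%:E <= c1%:E)%E -> (\int[m]_x (g2 x)%:E <= c2%:E)%E ->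
  `|\int[m]_x f x| <= a1 * c1 + a2 * c2.
Proof.
move=> fi mg1 mg2 g10 g20 a10 a20 fg h1 h2.
have fi' : m.-integrable setT (EFin \o (fun x => -1 * f x)).
  by have := integrableZl measurableT (-1) fi.
rewrite ler_norml; apply/andP; split.
  rewrite lerNl -mulN1r -RintegralZl//.
  apply: (Rintegral_le2 measurableT fi' mg1 mg2) => // x _.
  by rewrite mulN1r (le_trans _ (fg x))// -normrN ler_norm.
apply: (Rintegral_le2 measurableT fi mg1 mg2) => // x _.
by rewrite (le_trans _ (fg x))// ler_norm.
Qed.

Lemma mulr_sqr_le (a b : R) : `|a * b| <= 2^-1 * a ^+ 2 + 2^-1 * b ^+ 2.
Proof.
rewrite normrM -[a ^+ 2]real_normK ?num_real// -[b ^+ 2]real_normK ?num_real//.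
have := sqr_ge0 (`|a| - `|b|); rewrite sqrrB; lra.
Qed.

Lemma mulr_cube_le (a b : R) : `|a * b ^+ 2| <= `|a| ^+ 3 + `|b| ^+ 3.
Proof.
rewrite normrM normrX; have := normr_ge0 a; have := normr_ge0 b.
move: `|a| `|b| => x y y0 x0; have [xy|/ltW xy] := leP x y.
  apply: (@le_trans _ _ (y ^+ 3)); last by rewrite lerDr exprn_ge0.
  by rewrite [leRHS]exprS ler_wpM2r// exprn_ge0.
apply: (@le_trans _ _ (x ^+ 3)); last by rewrite lerDl exprn_ge0.
by rewrite [leRHS]exprS ler_wpM2l// lerXn2r.
Qed.

Variables (eta psi : R4 R -> R) (v : 'I_4 -> R4 R -> R) (Dv : 'I_4 -> 'I_4 -> R4 R -> R).
Variables (p : R4 R -> R) (f b db : 'I_4 -> R4 R -> R).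
Hypotheses (Ceta : Ccinfty eta) (Cpsi : Ccinfty psi).
Hypotheses (lv : forall i, locint (v i)) (lDv : forall i j, locint (Dv i j)).
Hypotheses (lp : locint p) (lf : forall i, locint (f i)).
Hypothesis wk : forall i j x, cv ('D_(e4 R j) eta) (v i) x = cv eta (Dv i j) x.
Hypothesis divU : {ae leb4, forall x, \sum_i cv eta (Dv i i) x = 0}.
Hypothesis pb : forall j, pderiv j (b j) (db j).
Hypotheses (bb : forall j, locbd (b j)) (bdb : forall j, locbd (db j)).
Hypothesis divb : {ae leb4, forall x, \sum_j db j x = 0}.

Let U i := cv eta (v i).
Let V i j := cv eta (Dv i j).
Let B i j := cv eta (fun x => b j x * Dv i j x).
Let P := cv eta p.
Let H i := cv eta (f i).

Variables (E : set (M4 R)) (A : 'I_4 -> 'I_4 -> R4 R -> R) (kappa omega lambda mu N S Pi Phi : R).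
Hypothesis mE : measurable E.
Hypotheses (psi01 : forall x, 0 <= psi x <= 1) (psi0 : forall x, ~ E x -> psi x = 0).
Hypothesis dpsi : forall j x, `|'D_(e4 R j) psi x| <= kappa.
Hypotheses (omega0 : 0 <= omega) (lambda0 : 0 <= lambda) (mu0 : 0 <= mu).
Hypothesis young : forall x y : R, `|x * y| <= lambda * `|x| ^+ 3 + mu * `|y| `^ (3 / 2).
Hypothesis young1 : forall x y : R, `|x * y| <= `|x| ^+ 3 + `|y| `^ (3 / 2).
Hypothesis UN : forall i, (\int[leb4]_x (U i x ^+ 2)%:E <= N%:E)%E.
Hypothesis VN : forall i j, (\int[leb4]_x (V i j x ^+ 2)%:E <= N%:E)%E.
Hypothesis US : forall i, (\int[leb4]_x (`|U i x| ^+ 3)%:E <= S%:E)%E.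
Hypothesis bS : forall i, (\int[leb4]_x (`|b i x| ^+ 3)%:E <= S%:E)%E.
Hypothesis PPi : (\int[leb4]_x (`|P x| `^ (3 / 2))%:E <= Pi%:E)%E.
Hypothesis HPhi : forall i, (\int[leb4]_x (\1_E x * `|H i x| `^ (3 / 2))%:E <= Phi%:E)%E.
Hypothesis mA : forall i j, measurable_fun (setT : set (M4 R)) (A i j).
Hypothesis AN : forall i j, (\int[leb4]_x (A i j x ^+ 2)%:E <= N%:E)%E.
Hypothesis BA : forall i j x, `|B i j x - b j x * V i j x| <= omega * `|A i j x|.

Let Ce : Cc eta. Proof. exact: Ccinfty_Cc. Qed.
Let Cp : Cc psi. Proof. exact: Ccinfty_Cc. Qed.
Let Cdp j : Cc ('D_(e4 R j) psi). Proof. exact/Ccinfty_Cc/Ccinfty_D. Qed.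
Let bU i : locbd (U i). Proof. exact: locbd_cv. Qed.
Let bV i j : locbd (V i j). Proof. exact: locbd_cv. Qed.
Let bB i j : locbd (B i j). Proof. apply: locbd_cv => //; exact: locbd_locint. Qed.
Let bP : locbd P. Proof. exact: locbd_cv. Qed.
Let bH i : locbd (H i). Proof. exact: locbd_cv. Qed.
Let k0 : 0 <= kappa. Proof. exact: le_trans (normr_ge0 _) (dpsi ord0 0). Qed.

Let m2 (F : R4 R -> R) : measurable_fun (setT : set (M4 R)) F ->
  measurable_fun (setT : set (M4 R)) (fun x => F x ^+ 2).
Proof. exact: measurable_funX. Qed.
Let m3 (F : R4 R -> R) : measurable_fun (setT : set (M4 R)) F ->
  measurable_fun (setT : set (M4 R)) (fun x => `|F x| ^+ 3).
Proof. by move=> mF; apply: measurable_funX; exact: (measurableT_comp (@normr_measurable _ _) mF). Qed.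
Let m32 (F : R4 R -> R) : measurable_fun (setT : set (M4 R)) F ->
  measurable_fun (setT : set (M4 R)) (fun x => `|F x| `^ (3 / 2)).
Proof. by move=> mF; have [m _ _] := @convex_pow32 R; exact: (measurableT_comp m mF). Qed.

Let t1 i j : `|\int[leb4]_x ('D_(e4 R j) psi x * (U i x * V i j x))| <= kappa * N.
Proof.
have := @normr_Rintegral_le2 _ _ leb4 _ _ _ (kappa * 2^-1) (kappa * 2^-1) N N
  (Cc_locbd_integrable (Cdp j) (locbdM (bU i) (bV i j))) (m2 (bU i).1) (m2 (bV i j).1)
  (fun x => sqr_ge0 _) (fun x => sqr_ge0 _) _ _ _ (UN i) (VN i j).
rewrite (_ : kappa * 2^-1 * N + kappa * 2^-1 * N = kappa * N); last by field.
have k2 : 0 <= kappa * 2^-1 by rewrite mulr_ge0.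
apply => // x; rewrite normrM -!mulrA -mulrDr; apply: ler_pM => //; exact: mulr_sqr_le.
Qed.

Let t2 i j : `|\int[leb4]_x ('D_(e4 R j) psi x * (b j x * U i x ^+ 2))| <= 2 * kappa * S.
Proof.
have := @normr_Rintegral_le2 _ _ leb4 _ _ _ kappa kappa S S
  (Cc_locbd_integrable (Cdp j) (locbdM (bb j) (locbdM (bU i) (bU i)))) (m3 (bb j).1) (m3 (bU i).1)
  (fun x => exprn_ge0 3 (normr_ge0 _)) (fun x => exprn_ge0 3 (normr_ge0 _)) _ _ _ (bS j) (US i).
rewrite (_ : kappa * S + kappa * S = 2 * kappa * S); last by ring.
apply => // x; rewrite normrM -mulrDr; apply: ler_pM => //; exact: mulr_cube_le.
Qed.

Let t3 i j : `|\int[leb4]_x (psi x * (U i x * (B i j x - b j x * V i j x)))| <= omega * N.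
Proof.
have bd : locbd (fun x => U i x * (B i j x - b j x * V i j x)).
  apply: locbdM => //; have := locbdD (bB i j) (locbdZ (-1) (locbdM (bb j) (bV i j))).
  by congr locbd; apply/funext => x; ring.
have := @normr_Rintegral_le2 _ _ leb4 _ _ _ (omega * 2^-1) (omega * 2^-1) N N
  (Cc_locbd_integrable Cp bd) (m2 (bU i).1) (m2 (mA i j))
  (fun x => sqr_ge0 _) (fun x => sqr_ge0 _) _ _ _ (UN i) (AN i j).
rewrite (_ : omega * 2^-1 * N + omega * 2^-1 * N = omega * N); last by field.
have k2 : 0 <= omega * 2^-1 by rewrite mulr_ge0.
apply => // x; rewrite normrM; have /andP[p0 p1] := psi01 x.
apply: (@le_trans _ _ `|U i x * (B i j x - b j x * V i j x)|).
  by rewrite -[leRHS]mul1r ler_wpM2r// ger0_norm.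
rewrite normrM; apply: (@le_trans _ _ (`|U i x| * (omega * `|A i j x|))).
  by apply: ler_wpM2l.
rewrite mulrCA -normrM -!mulrA -mulrDr; apply: ler_wpM2l => //; exact: mulr_sqr_le.
Qed.

Let t4 i : `|\int[leb4]_x ('D_(e4 R i) psi x * (U i x * P x))| <= kappa * (S + Pi).
Proof.
have := @normr_Rintegral_le2 _ _ leb4 _ _ _ kappa kappa S Pi
  (Cc_locbd_integrable (Cdp i) (locbdM (bU i) bP)) (m3 (bU i).1) (m32 bP.1)
  (fun x => exprn_ge0 3 (normr_ge0 _)) (fun x => powR_ge0 _ _) _ _ _ (US i) PPi.
rewrite -mulrDr; apply => // x; rewrite normrM -mulrDr; apply: ler_pM => //.
Qed.

Let t5 i : `|\int[leb4]_x (psi x * (U i x * H i x))| <= lambda * S + mu * Phi.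
Proof.
have mEH : measurable_fun (setT : set (M4 R)) (fun x => \1_E x * `|H i x| `^ (3 / 2)).
  by apply: measurable_funM; [exact: measurable_indic|exact: m32 (bH i).1].
have h0 x : 0 <= \1_E x * `|H i x| `^ (3 / 2) by apply: mulr_ge0; [rewrite indicE|exact: powR_ge0].
apply: (@normr_Rintegral_le2 _ _ leb4 _ _ _ lambda mu S Phi
  (Cc_locbd_integrable Cp (locbdM (bU i) (bH i))) (m3 (bU i).1) mEH
  (fun x => exprn_ge0 3 (normr_ge0 _)) h0) => // x.
rewrite indicE; have [_|] := boolP (x \in E).
  have /andP[p0 p1] := psi01 x.
  apply: (@le_trans _ _ `|U i x * H i x|).
    by rewrite normrM -[leRHS]mul1r ler_wpM2r// ger0_norm.
  by rewrite mul1r.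
rewrite notin_setE => /psi0 ->; rewrite !mul0r normr0 mulr0 addr0.
by apply: mulr_ge0 => //; exact: exprn_ge0.
Qed.

(** Each pair [(i, j)] costs [kappa N] for diffusion, [kappa S] for transport and [omega N] for the
    commutator; each [i] costs [kappa (S + Pi)] for the pressure and Young's bound for the force.
    Only the commutator and the force escape the gradient bound [kappa] of the cutoff. *)
Lemma energy_inequality :
  \sum_i \int[leb4]_x (psi x * (U i x * mollified_rhs eta Dv p f b i x)) +
  \sum_i \sum_j \int[leb4]_x (psi x * V i j x ^+ 2) <=
  16 * (kappa * N + kappa * S + omega * N) + 4 * (kappa * (S + Pi) + (lambda * S + mu * Phi)).
Proof.
have := energy_identity Ceta Cpsi lv lDv lp lf wk divU pb bb bdb divb.
have aux (x y z t : R) : x = y -> y + z <= t -> x + z <= t by move=> ->.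
move/aux; apply.
rewrite addrAC -big_split/=; apply: lerD.
  rewrite -sum_const44; apply: ler_sum => i _; rewrite -big_split/=; apply: ler_sum => j _.
  have := t1 i j; have := t2 i j; have := t3 i j.
  rewrite !ler_norml => /andP[h1 h2] /andP[h3 h4] /andP[h5 h6].
  by apply: le_combine => //; rewrite mulrA.
rewrite -sum_const4; apply: ler_sum => i _; have /ler_normlP[_ h4] := t4 i; have /ler_normlP[_ h5] := t5 i.
exact: lerD h4 h5.
Qed.

End EnergyInequality.

(** * Fubini's theorem for real-valued integrals *)

Lemma measurable_le_ind d (X : measurableType d) (R : realType) (f g : X -> R) :
  measurable_fun setT f -> measurable_fun setT g ->
  measurable_fun setT (fun z : X => (f z <= g z)%R%:R : R).
Proof.
move=> mf mg; rewrite (_ : (fun z : X => _) = (fun z : X => if f z <= g z then 1 else 0)).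
  by apply: measurable_fun_ifT => //; exact: measurable_fun_ler.
by apply/funext => z; case: ifP.
Qed.

Lemma normr_bool_mul (R : numDomainType) (b : bool) (x : R) : `|b%:R * x| <= `|x|.
Proof. by case: b; rewrite ?mul1r// mul0r normr0. Qed.

Section RealFubini.
Context d1 d2 (X1 : measurableType d1) (X2 : measurableType d2) (R : realType).
Variables (m1 : {sigma_finite_measure set X1 -> \bar R}).
Variables (m2 : {sigma_finite_measure set X2 -> \bar R}).
Implicit Type f : X1 * X2 -> R.

Lemma Rintegral_fubini1 f : (m1 \x m2)%E.-integrable setT (EFin \o f) ->
  (forall x, m2.-integrable setT (EFin \o (fun y => f (x, y)))) ->
  ((\int[m1]_x \int[m2]_y f (x, y))%:E = \int[(m1 \x m2)%E]_z (f z)%:E)%E.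
Proof.
move=> fi f2; rewrite -(integral12_prod_meas1 fi) /fubini_F.
have e x : (\int[m2]_y (f (x, y))%:E = (\int[m2]_y f (x, y))%:E)%E by rewrite EFin_Rintegral.
rewrite EFin_Rintegral//; first by apply: eq_integral => x _; rewrite /= e.
have := integrable_fubini_F fi; congr (m1.-integrable _ _).
by apply/funext => x; rewrite /fubini_F /= e.
Qed.

Lemma integrable_Rintegral2 f : (m1 \x m2)%E.-integrable setT (EFin \o f) ->
  (forall y, m1.-integrable setT (EFin \o (fun x => f (x, y)))) ->
  m2.-integrable setT (EFin \o (fun y => \int[m1]_x f (x, y))).
Proof.
move=> fi f1.
have e y : (\int[m1]_x (f (x, y))%:E = (\int[m1]_x f (x, y))%:E)%E by rewrite EFin_Rintegral.
have mf : measurable_fun setT (EFin \o f) by case/integrableP : fi.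
have mn : measurable_fun setT (fun z => (`|f z|)%:E).
  by apply/measurable_EFinP; apply: measurableT_comp => //; exact/measurable_EFinP.
have mG : measurable_fun setT (fun y => (\int[m1]_x f (x, y))%:E).
  have := measurable_fubini_G fi; congr measurable_fun.
  by apply/funext => y; rewrite /fubini_G /= e.
apply/integrableP; split=> //.
apply: le_lt_trans ((integrable21ltyP _ _ mf).1 fi).
apply: ge0_le_integralT => //.
- exact: measurableT_comp.
- by apply: (measurable_fun_fubini_tonelli_G (fun z => (`|f z|)%:E)).
move=> y; rewrite /= -abse_EFin -e.
apply: (le_trans (le_abse_integral _ _ _)) => //.
by case/integrableP : (f1 y).
Qed.

Lemma Rintegral_fubini2 f : (m1 \x m2)%E.-integrable setT (EFin \o f) ->
  (forall y, m1.-integrable setT (EFin \o (fun x => f (x, y)))) ->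
  ((\int[m2]_y \int[m1]_x f (x, y))%:E = \int[(m1 \x m2)%E]_z (f z)%:E)%E.
Proof.
move=> fi f1; rewrite -(integral21_prod_meas1 fi) /fubini_G.
have e y : (\int[m1]_x (f (x, y))%:E = (\int[m1]_x f (x, y))%:E)%E by rewrite EFin_Rintegral.
rewrite EFin_Rintegral//; first by apply: eq_integral => y _; rewrite /= e.
exact: integrable_Rintegral2.
Qed.

Lemma Rintegral_fubini f : (m1 \x m2)%E.-integrable setT (EFin \o f) ->
  (forall x, m2.-integrable setT (EFin \o (fun y => f (x, y)))) ->
  (forall y, m1.-integrable setT (EFin \o (fun x => f (x, y)))) ->
  \int[m1]_x \int[m2]_y f (x, y) = \int[m2]_y \int[m1]_x f (x, y).
Proof.
by move=> fi f2 f1; apply: EFin_inj; rewrite Rintegral_fubini1// Rintegral_fubini2.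
Qed.

Lemma integrable_prod_dom f (a : X1 -> R) (b : X2 -> R) : measurable_fun setT f ->
  m1.-integrable setT (EFin \o a) -> m2.-integrable setT (EFin \o b) ->
  (forall x y, `|f (x, y)| <= a x * b y) -> (m1 \x m2)%E.-integrable setT (EFin \o f).
Proof.
move=> mf ia ib fab; apply/integrable12ltyP; first exact/measurable_EFinP.
have ma : measurable_fun setT a by apply/measurable_EFinP; case/integrableP : ia.
have mb : measurable_fun setT b by apply/measurable_EFinP; case/integrableP : ib.
have na : measurable_fun setT (fun x => (`|a x|)%:E).
  by apply/measurable_EFinP; apply: measurableT_comp.
have nb : measurable_fun setT (fun x => (`|b x|)%:E).
  by apply/measurable_EFinP; apply: measurableT_comp.
pose c := (\int[m2]_y (`|b y|)%:E)%E.
have c0 : (0 <= c)%E by apply: integral_ge0 => y _; rewrite lee_fin.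
have coo : (c < +oo)%E by case/integrableP : ib.
apply: (@le_lt_trans _ _ (\int[m1]_x ((`|a x|)%:E * c))%E).
  apply: ge0_le_integralT.
  - apply: (measurable_fun_fubini_tonelli_F (fun z => (`|f z|)%:E)) => //.
    by apply/measurable_EFinP; apply: measurableT_comp.
  - by apply: emeasurable_funM => //.
  - by move=> x; apply: integral_ge0 => y _; rewrite lee_fin.
  move=> x; rewrite -ge0_integralZl//; apply: ge0_le_integralT => //.
  - apply/measurable_EFinP; apply: measurableT_comp => //.
    exact: (measurableT_comp mf (pair1_measurable x)).
  - by apply: emeasurable_funM.
  - by move=> y; rewrite -EFinM lee_fin (le_trans (fab x y))// -normrM ler_norm.
have [_ aoo] := integrableP _ _ _ ia.
rewrite ge0_integralZr// lte_mul_pinfty ?integral_ge0// ge0_fin_numE ?integral_ge0//.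
Qed.

End RealFubini.

(** * The chain rule for the square of a primitive *)

Section SquarePrimitive.
Context {R : realType}.
Local Notation mR := (measurableTypeR R).
Local Notation leb := (@lebesgue_measure R).

Lemma integrable_le_ind (g : mR -> R) (t : R) : leb.-integrable setT (EFin \o g) ->
  leb.-integrable setT (EFin \o (fun s => (s <= t)%R%:R * g s)).
Proof.
move=> ig; apply: (integrable_bounded_mul (m := leb) (C := 1)) ig => //.
- by apply: measurable_le_ind.
- by move=> s _; case: (s <= t); rewrite ?normr1 ?normr0.
Qed.

Lemma integrable_ge_ind (g : mR -> R) (t : R) : leb.-integrable setT (EFin \o g) ->
  leb.-integrable setT (EFin \o (fun s => (t <= s)%R%:R * g s)).
Proof.
move=> ig; apply: (integrable_bounded_mul (m := leb) (C := 1)) ig => //.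
- by apply: measurable_le_ind.
- by move=> s _; case: (t <= s); rewrite ?normr1 ?normr0.
Qed.

(** Fubini on the square: the triangles [s <= t] and [t <= s] contribute equally and overlap on the
    null diagonal. This stands for the chain rule of absolutely continuous functions. *)
Lemma sqr_integral (h : mR -> R) : leb.-integrable setT (EFin \o h) ->
  (\int[leb]_s h s) ^+ 2 = 2 * \int[leb]_t ((\int[leb]_s ((s <= t)%R%:R * h s)) * h t).
Proof.
move=> ih; have mh : measurable_fun setT h by apply/measurable_EFinP; case/integrableP : ih.
pose K (z : mR * mR) : R := (z.1 <= z.2)%R%:R * (h z.1 * h z.2).
have mle : measurable_fun setT (fun z : mR * mR => (z.1 <= z.2)%R%:R : R).
  by apply: measurable_le_ind.
have mK : measurable_fun setT K.
  apply: measurable_funM => //; apply: measurable_funM.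
    exact: (measurableT_comp mh measurable_fst).
  exact: (measurableT_comp mh measurable_snd).
have ina : leb.-integrable setT (EFin \o (fun s => `|h s|)) by have := integrable_norm ih.
have iK : (leb \x leb)%E.-integrable setT (EFin \o K).
  apply: (integrable_prod_dom mK ina ina) => x y; rewrite /K/= -normrM; exact: normr_bool_mul.
have K1 x : leb.-integrable setT (EFin \o (fun y => K (x, y))).
  have := integrableZl measurableT (h x) (integrable_ge_ind x ih).
  by congr (leb.-integrable _ _); apply/funext => y; rewrite /K/= -EFinM mulrCA.
have K2 y : leb.-integrable setT (EFin \o (fun x => K (x, y))).
  have := integrableZl measurableT (h y) (integrable_le_ind y ih).
  by congr (leb.-integrable _ _); apply/funext => x; rewrite /K/= -EFinM mulrCA [h x * h y]mulrC.
pose L t := \int[leb]_s ((s <= t)%R%:R * h s).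
have e2 : \int[leb]_y \int[leb]_x K (x, y) = \int[leb]_t (L t * h t).
  apply: eq_Rintegral => y _; rewrite /L mulrC -RintegralZl//; last exact: integrable_le_ind.
  by apply: eq_Rintegral => x _; rewrite /K/= [RHS]mulrC -mulrA.
have e1 : \int[leb]_x \int[leb]_y K (x, y) = \int[leb]_s ((\int[leb]_s h s - L s) * h s).
  apply: eq_Rintegral => x _; rewrite mulrC /L -RintegralB//; last exact: integrable_le_ind.
  rewrite -RintegralZl//; last first.
    by have := integrableB measurableT ih (integrable_le_ind x ih).
  apply: EFin_inj; rewrite !EFin_Rintegral//; last first.
    have := integrableZl measurableT (h x) (integrableB measurableT ih (integrable_le_ind x ih)).
    by [].
  apply: ae_eq_integral => //.
  - by case/integrableP : (K1 x).
  - apply/measurable_EFinP; apply: measurable_funM => //; apply: measurable_funB => //.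
    by apply: measurable_funM => //; exact: measurable_le_ind.
  (* The indicators of the two triangles add up to one except at [y = x]. *)
  exists [set x]; split; [exact: measurable_set1|exact: lebesgue_measure_set1|].
  move=> y /=; apply: contra_notP => yx _; rewrite /K/=; congr (_%:E).
  have [xy|xy|xy] := ltgtP x y.
  - by rewrite /= mul1r mul0r subr0.
  - by rewrite /= mul0r mul1r subrr mulr0.
  - by exfalso; apply: yx.
have mL : measurable_fun setT L.
  apply: (measurable_Rintegral leb (F := fun z : mR * mR => (z.2 <= z.1)%R%:R * h z.2)).
  apply: measurable_funM; first by apply: measurable_le_ind.
  exact: (measurableT_comp mh measurable_snd).
have bL t : `|L t| <= \int[leb]_s `|h s|.
  apply: (le_trans (le_normr_Rintegral _ _)) => //; first exact: integrable_le_ind.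
  apply: le_Rintegral => //.
    by have := integrable_norm (integrable_le_ind t ih).
  by move=> s _; exact: normr_bool_mul.
have iL : leb.-integrable setT (EFin \o (fun t => L t * h t)).
  by apply: (integrable_bounded_mul (m := leb) (C := \int[leb]_s `|h s|)).
have := Rintegral_fubini iK K1 K2; rewrite e1 e2 => e.
have iA : leb.-integrable setT (EFin \o (fun s => (\int[leb]_s h s) * h s)).
  by have := integrableZl measurableT (\int[leb]_s h s) ih.
move: e; under eq_Rintegral do rewrite mulrBl.
rewrite RintegralB// RintegralZl// -expr2 -/L.
by move=> e; rewrite mulr_natl mulr2n -[in RHS]e; move: e; lra.
Qed.

(** [sqr_integral] is applied to [h], equal to [g] up to time [t] and to 0 afterwards; below [t] the
    primitives of [h] and [g] agree. The constant [c] contributes the square and the cross term. *)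
Lemma sqr_primitive (g : mR -> R) (c t : R) : leb.-integrable setT (EFin \o g) ->
  let F s := c + \int[leb]_s' ((s' <= s)%R%:R * g s') in
  F t ^+ 2 = c ^+ 2 + 2 * \int[leb]_s ((s <= t)%R%:R * (F s * g s)).
Proof.
move=> ig F; pose h s := (s <= t)%R%:R * g s.
have ih : leb.-integrable setT (EFin \o h) by exact: integrable_le_ind.
pose L s := \int[leb]_s' ((s' <= s)%R%:R * h s').
have e s : (s <= t)%R%:R * (F s * g s) = c * h s + L s * h s.
  rewrite /h /F; have [st|] := boolP (s <= t); last by rewrite !mul0r !mulr0 addr0.
  rewrite !mul1r mulrDl; congr (_ + _ * _); apply: eq_Rintegral => r _; rewrite /h.
  by have [rs|_] := boolP (r <= s); [rewrite (le_trans rs st) !mul1r|rewrite !mul0r].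
have mh : measurable_fun setT h by apply/measurable_EFinP; case/integrableP : ih.
have mL : measurable_fun setT L.
  apply: (measurable_Rintegral leb (F := fun z : mR * mR => (z.2 <= z.1)%R%:R * h z.2)).
  apply: measurable_funM; first by apply: measurable_le_ind.
  exact: (measurableT_comp mh measurable_snd).
have bL s : `|L s| <= \int[leb]_s `|h s|.
  apply: (le_trans (le_normr_Rintegral _ _)) => //; first exact: integrable_le_ind.
  apply: le_Rintegral => //.
  - by have := integrable_norm (integrable_le_ind s ih).
  - by have := integrable_norm ih.
  by move=> r _; exact: normr_bool_mul.
have iL : leb.-integrable setT (EFin \o (fun t => L t * h t)).
  by apply: (integrable_bounded_mul (m := leb) (C := \int[leb]_s `|h s|)).
have ic : leb.-integrable setT (EFin \o (fun s => c * h s)).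
  by have := integrableZl measurableT c ih.
under [in RHS]eq_Rintegral do rewrite e.
rewrite RintegralD// RintegralZl// mulrDr -(sqr_integral ih).
have -> : F t = c + \int[leb]_s h s by [].
by move: (\int[leb]_s h s) => A; ring.
Qed.

End SquarePrimitive.

(** * Fubini under a bound by a product *)

Section RealFubiniDominated.
Context d1 d2 (X1 : measurableType d1) (X2 : measurableType d2) (R : realType).
Variables (m1 : {sigma_finite_measure set X1 -> \bar R}).
Variables (m2 : {sigma_finite_measure set X2 -> \bar R}).
Variables (f : X1 * X2 -> R) (a : X1 -> R) (b : X2 -> R).
Hypotheses (mf : measurable_fun setT f) (ia : m1.-integrable setT (EFin \o a)).
Hypotheses (ib : m2.-integrable setT (EFin \o b)).
Hypothesis fab : forall x y, `|f (x, y)| <= a x * b y.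

Lemma prod_dom_slice1 x : m2.-integrable setT (EFin \o (fun y => f (x, y))).
Proof.
have iab : m2.-integrable setT (EFin \o (fun y => a x * b y)).
  by have := integrableZl measurableT (a x) ib.
apply: (Rintegral_le_ge0 measurableT _ iab) => //.
exact: (measurableT_comp mf (pair1_measurable x)).
Qed.

Lemma prod_dom_slice2 y : m1.-integrable setT (EFin \o (fun x => f (x, y))).
Proof.
have iab : m1.-integrable setT (EFin \o (fun x => a x * b y)).
  have := integrableZl measurableT (b y) ia.
  by congr (m1.-integrable _ _); apply/funext => x /=; rewrite mulrC EFinM.
apply: (Rintegral_le_ge0 measurableT _ iab) => //.
exact: (measurableT_comp mf (pair2_measurable y)).
Qed.

Lemma Rintegral_fubini_dom :
  \int[m1]_x \int[m2]_y f (x, y) = \int[m2]_y \int[m1]_x f (x, y).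
Proof.
apply: Rintegral_fubini; first exact: (integrable_prod_dom mf ia ib fab).
- exact: prod_dom_slice1.
- exact: prod_dom_slice2.
Qed.

Lemma prod_dom_integrable1 : m1.-integrable setT (EFin \o (fun x => \int[m2]_y f (x, y))).
Proof.
have := integrable_fubini_F (integrable_prod_dom mf ia ib fab); congr (m1.-integrable _ _).
by apply/funext => x; rewrite /fubini_F/= EFin_Rintegral//; exact: prod_dom_slice1.
Qed.

End RealFubiniDominated.

(** * Energy balance of a function given by its initial value and its rate *)

Section TimeEnergy.
Context {R : realType}.
Local Notation mR := (measurableTypeR R).
Local Notation leb := (@lebesgue_measure R).
Implicit Types (G : M4 R * mR -> R).

(** One integrable function of time dominates [G] on a whole cube; after multiplication by a
    compactly supported [psi], bounds of the form [|psi x| * m s] allow the exchange of space and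
    time integrals. *)
Definition tdom G := measurable_fun setT G /\ forall r, exists2 m : mR -> R,
  leb.-integrable setT (EFin \o m) & forall (x : R4 R) s, `|x| <= r -> `|G (x, s)| <= m s.

Lemma tdom_slice G (x : R4 R) : tdom G -> leb.-integrable setT (EFin \o (fun s => G (x, s))).
Proof.
move=> [mG /(_ `|x|)[m im Gm]].
apply: (Rintegral_le_ge0 measurableT _ im) => [|s _]; last exact: Gm.
exact: (measurableT_comp mG (pair1_measurable (x : M4 R))).
Qed.

Lemma tdomD G1 G2 : tdom G1 -> tdom G2 -> tdom (fun z => G1 z + G2 z).
Proof.
move=> [m1 d1] [m2 d2]; split; first exact: measurable_funD.
move=> r; have [a ia ha] := d1 r; have [b ib hb] := d2 r.
exists (fun s => a s + b s); first by have := integrableD measurableT ia ib.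
by move=> x s xr; rewrite (le_trans (ler_normD _ _))// lerD ?ha ?hb.
Qed.

Lemma tdomZ G (c : R) : tdom G -> tdom (fun z => c * G z).
Proof.
move=> [m1 d1]; split; first exact: measurable_funM.
move=> r; have [a ia ha] := d1 r.
exists (fun s => `|c| * a s); first by have := integrableZl measurableT `|c| ia.
by move=> x s xr; rewrite normrM ler_wpM2l// ha.
Qed.

Lemma tdom_sum (s : seq 'I_4) (F : 'I_4 -> M4 R * mR -> R) :
  (forall j, tdom (F j)) -> tdom (fun z => \sum_(j <- s) F j z).
Proof.
move=> bF; elim: s => [|i s ih].
  have : tdom (fun=> 0).
    split=> // r; exists (fun=> 0) => [|x s _]; last by rewrite normr0.
    by have := integrable0 leb [set: mR].
  by congr tdom; apply/funext => x; rewrite big_nil.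
by move: (tdomD (bF i) ih); congr tdom; apply/funext => x; rewrite big_cons.
Qed.

Variables (psi F0 : R4 R -> R) (G : M4 R * mR -> R).
Hypotheses (Cp : Cc psi) (bF0 : locbd F0) (dG : tdom G).

(** The primitive starts at minus infinity: the rates inserted later vanish outside [0, T]. *)
Definition evolution (x : R4 R) (s : R) : R := F0 x + \int[leb]_s' ((s' <= s)%R%:R * G (x, s')).
Local Notation F := evolution.

Let mG : measurable_fun setT G. Proof. by case: dG. Qed.

Lemma measurable_evolution : measurable_fun setT (fun z : M4 R * mR => F z.1 z.2).
Proof.
apply: measurable_funD; first exact: (measurableT_comp bF0.1 measurable_fst).
pose K (w : (M4 R * mR) * mR) : R := (w.2 <= w.1.2)%R%:R * G (w.1.1, w.2).
apply: (measurable_Rintegral leb (F := K)); apply: measurable_funM.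
  apply: measurable_le_ind => //; exact: (measurableT_comp measurable_snd measurable_fst).
apply: (measurableT_comp mG (g := fun w : (M4 R * mR) * mR => (w.1.1, w.2))).
apply: measurable_fun_pair => //.
exact: (measurableT_comp measurable_fst measurable_fst).
Qed.

Lemma evolution_bounded r : exists M, forall x s, `|x| <= r -> `|F x s| <= M.
Proof.
have [M hM] := bF0.2 r; have [m im Gm] := dG.2 r.
exists (M + \int[leb]_s m s) => x s xr.
rewrite (le_trans (ler_normD _ _))// lerD ?hM//.
have iG := tdom_slice x dG.
apply: (le_trans (le_normr_Rintegral _ _)) => //; first exact: integrable_le_ind.
apply: le_Rintegral => //.
  by have := integrable_norm (integrable_le_ind s iG).
by move=> s' _; rewrite (le_trans (normr_bool_mul _ _))// Gm.
Qed.

Let work_dom t : exists (m : mR -> R), leb.-integrable setT (EFin \o m) /\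
  forall (x : R4 R) s, `|psi x * ((s <= t)%R%:R * (F x s * G (x, s)))| <= `|psi x| * m s.
Proof.
have [r r0 pr] := Cc_support Cp; have [M hM] := evolution_bounded r.
have [m im Gm] := dG.2 r.
exists (fun s => M * m s); split; first by have := integrableZl measurableT M im.
move=> x s; rewrite normrM; have [xr|/pr ->] := leP `|x| r; last by rewrite normr0 !mul0r.
apply: ler_wpM2l => //; rewrite (le_trans (normr_bool_mul _ _))// normrM.
by apply: ler_pM => //; [exact: hM|exact: Gm].
Qed.

Let work_measurable t : measurable_fun setT
  (fun z : M4 R * mR => psi z.1 * ((z.2 <= t)%R%:R * (F z.1 z.2 * G z))).
Proof.
apply: measurable_funM; first exact: (measurableT_comp (Cc_measurable Cp) measurable_fst).
apply: measurable_funM; first by apply: measurable_le_ind.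
by apply: measurable_funM => //; exact: measurable_evolution.
Qed.

Let ipsi : leb4.-integrable setT (EFin \o (fun x => `|psi x|)).
Proof. by have := integrable_norm (Cc_integrable Cp). Qed.

(** The chain rule holds at each [x] separately; multiplying by [psi] and exchanging the integrals
    makes it an energy balance. *)
Lemma energy_in_time t :
  \int[leb4]_x (psi x * F x t ^+ 2) = \int[leb4]_x (psi x * F0 x ^+ 2) +
  2 * \int[leb]_s ((s <= t)%R%:R * \int[leb4]_x (psi x * (F x s * G (x, s)))).
Proof.
pose K (z : M4 R * mR) := psi z.1 * ((z.2 <= t)%R%:R * (F z.1 z.2 * G z)).
have mK := work_measurable t; have [m [im Km]] := work_dom t.
have e x : psi x * F x t ^+ 2 = psi x * F0 x ^+ 2 + 2 * \int[leb]_s K (x, s).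
  rewrite (sqr_primitive (F0 x) t (tdom_slice x dG)) mulrDr; congr (_ + _); rewrite mulrCA; congr (_ * _).
  rewrite -RintegralZl//.
  have [r r0 pr] := Cc_support Cp.
  have [M hM] := evolution_bounded `|x|; have [m' im' Gm'] := dG.2 `|x|.
  have iM : leb.-integrable setT (EFin \o (fun s => M * m' s)).
    by have := integrableZl measurableT M im'.
  apply: (Rintegral_le_ge0 measurableT _ iM).
    apply: measurable_funM; first by apply: measurable_le_ind.
    apply: measurable_funM.
      exact: (measurableT_comp measurable_evolution (pair1_measurable (x : M4 R))).
    exact: (measurableT_comp mG (pair1_measurable (x : M4 R))).
  move=> s _; rewrite (le_trans (normr_bool_mul _ _))// normrM.
  by apply: ler_pM => //; [exact: hM|exact: Gm'].
under eq_Rintegral do rewrite e.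
have i1 : leb4.-integrable setT (EFin \o (fun x => psi x * F0 x ^+ 2)).
  exact: (Cc_locbd_integrable Cp (locbdM bF0 bF0)).
have i2 := prod_dom_integrable1 mK ipsi im Km.
have i3 : leb4.-integrable setT (EFin \o (fun x => 2 * \int[leb]_s K (x, s))).
  by have := integrableZl measurableT 2 i2.
rewrite RintegralD// RintegralZl//; congr (_ + 2 * _).
rewrite (Rintegral_fubini_dom mK ipsi im Km); apply: eq_Rintegral => s _.
have [st|_] := boolP (s <= t); last first.
  by rewrite mul0r; apply: Rintegral_eq0 => x _; rewrite mul0r mulr0.
by rewrite mul1r; apply: eq_Rintegral => x _; rewrite mul1r.
Qed.

End TimeEnergy.

Lemma Rintegral_sum4 d (X : measurableType d) (R : realType) (m : {measure set X -> \bar R})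
    (D : set X) (F : 'I_4 -> X -> R) : measurable D ->
  (forall j, m.-integrable D (EFin \o F j)) ->
  \int[m]_(x in D) (\sum_j F j x) = \sum_j \int[m]_(x in D) F j x.
Proof.
move=> mD iF; suff [] : m.-integrable D (EFin \o (fun x => \sum_j F j x)) /\
  \int[m]_(x in D) (\sum_j F j x) = \sum_j \int[m]_(x in D) F j x by [].
elim: (index_enum _) => [|i s [ih1 ih2]].
  have e : (fun x : X => \sum_(j <- [::]) F j x) = (fun=> 0) by apply/funext => x; rewrite big_nil.
  rewrite e big_nil; split; last by rewrite Rintegral_cst// mul0r.
  by have := integrable0 m D.
have e : (fun x : X => \sum_(j <- i :: s) F j x) = (fun x => F i x + \sum_(j <- s) F j x).
  by apply/funext => x; rewrite big_cons.
rewrite e big_cons RintegralD// ih2; split=> //.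
by have := integrableD mD (iF i) ih1.
Qed.

(** * Space-time fields restricted to good times *)

Section SpaceTime.
Context {R : realType}.
Local Notation mR := (measurableTypeR R).
Local Notation leb := (@lebesgue_measure R).
Implicit Types (h : M4 R * mR -> R).

(** Every slice, not almost every one, has to be locally integrable; zeroing the bad times makes
    this attainable. *)
Definition stint h := [/\ measurable_fun setT h,
  forall r, (leb4 \x leb)%E.-integrable setT (EFin \o (fun z => \1_(cube r) z.1 * h z)) &
  forall s, locint (fun y => h (y, s))].

Lemma measurable_space_kernel k (x : R4 R) : Cc k ->
  measurable_fun setT (fun z : M4 R * mR => k (x - (z.1 : R4 R)) : R).
Proof. by move=> Ck; exact: (measurableT_comp (measurable_shift x Ck) measurable_fst). Qed.

Lemma stint_kernel k h (x : R4 R) : Cc k -> stint h ->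
  (leb4 \x leb)%E.-integrable setT (EFin \o (fun z => k (x - (z.1 : R4 R)) * h z)).
Proof.
move=> Ck [mh ih _]; have [r r0 k0] := Cc_support Ck; have [M M0 kM] := Cc_bounded Ck.
have := integrable_bounded_mul measurableT (measurable_space_kernel x Ck)
  (fun z _ => kM (x - (z.1 : R4 R))) (ih (r + `|x|)).
congr (_.-integrable _ _); apply/funext => z /=; congr (_%:E).
rewrite indicE; have [|] := boolP (z.1 \in _); first by rewrite mul1r.
rewrite notin_setE /cube/= => /negP; rewrite -ltNge => h1; rewrite k0 ?mul0r//.
rewrite -ltrBrDr in h1; apply: (lt_le_trans h1).
by rewrite -(normrN (x - z.1)) opprB lerB_dist.
Qed.

(** The constants depend on the kernel only, so the bound applies uniformly to all time slices of a
    field. *)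
Lemma cv_le (k : R4 R -> R) : Cc k -> exists C a : R, [/\ 0 <= C, 0 <= a &
  forall (g : R4 R -> R) (r : R) (x : R4 R), locint g -> `|x| <= r ->
  `|cv k g x| <= C * \int[leb4]_y (\1_(cube (a + r)) y * `|g y|)].
Proof.
move=> Ck; have [a a0 k0] := Cc_support Ck; have [C C0 kC] := Cc_bounded Ck.
exists C, a; split=> [||g r x lg xr]; [exact: ltW|exact: ltW|].
have mB := @measurable_cube R (a + r).
have i1 : leb4.-integrable setT (EFin \o (fun y => \1_(cube (a + r)) y * `|g y|)).
  apply: (integrable_setT_zero (m := leb4) mB).
    by move=> y yr; rewrite indicE memNset// mul0r.
  have := integrable_norm (lg.2 (a + r)); apply: eq_integrable => // y yr /=.
  by rewrite indicE yr mul1r.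
have i2 : leb4.-integrable setT (EFin \o (fun y => C * (\1_(cube (a + r)) y * `|g y|))).
  by have := integrableZl measurableT C i1.
have i3 := shift_integrable x Ck lg.
rewrite -RintegralZl// (le_trans (le_normr_Rintegral _ i3))//.
apply: le_Rintegral => //; first by have := integrable_norm i3.
move=> y _; rewrite normrM indicE; have [_|] := boolP (y \in _).
  by rewrite mul1r ler_wpM2r.
rewrite notin_setE /cube/= => /negP; rewrite -ltNge => h1.
rewrite (_ : k _ = 0) ?normr0 ?mul0r ?mulr0//; apply: k0.
rewrite -ltrBrDr in h1; rewrite -(normrN (x - y)) opprB.
apply: (lt_le_trans _ (lerB_dist _ _)); apply: (lt_le_trans h1).
by rewrite lerB.
Qed.

(** By [cv_le], at points of a cube the convolution is at most a constant times the integral of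
    [|h (., s)|] over a larger cube, and that is an integrable function of [s]. *)
Lemma tdom_cv k h : Cc k -> stint h -> tdom (fun z => cv k (fun y => h (y, z.2)) z.1).
Proof.
move=> Ck [mh ih lh]; split; first exact: measurable_cv_joint.
move=> r; have [C [a [C0 a0 kC]]] := cv_le Ck.
exists (fun s => C * \int[leb4]_y (\1_(cube (a + r)) y * `|h (y, s)|)); last first.
  by move=> x s xr; exact: kC.
pose g (z : M4 R * mR) := `|\1_(cube (a + r)) z.1 * h z|.
have ig : (leb4 \x leb)%E.-integrable setT (EFin \o g) by have := integrable_norm (ih (a + r)).
have mB := @measurable_cube R (a + r).
have g1 s : leb4.-integrable setT (EFin \o (fun y => g (y, s))).
  apply: (integrable_setT_zero (m := leb4) mB).
    by move=> y yr; rewrite /g/= indicE memNset// mul0r normr0.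
  have := integrable_norm ((lh s).2 (a + r)); apply: eq_integrable => // y yr /=.
  by rewrite /g/= indicE yr mul1r.
have := integrableZl measurableT C (integrable_Rintegral2 ig g1).
congr (_.-integrable _ _); apply/funext => s /=; congr (_ * _)%:E.
by apply: eq_Rintegral => y _; rewrite /g/= normrM ger0_norm// indicE.
Qed.

Variables (T : R) (Gam : set mR).
Hypotheses (mGam : measurable Gam) (GamT : Gam `<=` `[0, T]%classic).
Hypothesis GamE : leb (`[0, T]%classic `\` Gam) = 0%E.

(** Zeroing outside [Gam] turns almost-everywhere statements in time into everywhere ones, and
    integrals over a slab into integrals over the whole space-time. *)
Definition hat (f : R4 R * R -> R) (z : M4 R * mR) : R := \1_Gam z.2 * f z.

Lemma measurable_hat (f : R4 R * R -> R) : measurable_fun (slab T : set (M4 R * mR)) f ->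
  measurable_fun setT (hat f).
Proof.
move=> mf; have ms : measurable (slab T : set (M4 R * mR)) by apply: measurableX.
rewrite (_ : hat f = fun z => \1_Gam z.2 * (f \_ (slab T)) z).
  apply: measurable_funM; last exact/(measurable_restrictT _ ms).
  have mI : measurable_fun setT (\1_Gam : mR -> R) by exact: measurable_indic.
  exact: (measurableT_comp mI measurable_snd).
apply/funext => z; rewrite /hat patchE indicE; have [/set_mem zG|] := boolP (z.2 \in Gam).
  by rewrite mem_set//; split=> //; exact: GamT.
by rewrite !mul0r.
Qed.

Let ms t : measurable (slab t : set (M4 R * mR)). Proof. exact: measurableX. Qed.

Let slab_sub t : t <= T -> (slab t : set (R4 R * R)) `<=` slab T.
Proof.
by move=> tT z [_ /=]; rewrite in_itv/= => /andP[z0 zt]; split=> //=; rewrite in_itv/= z0 (le_trans zt).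
Qed.

(** The two sides may differ only at times of [0, T] outside [Gam], which form a null set. *)
Lemma slab_ae (F : M4 R * mR -> R) t : t <= T ->
  {ae leb41, forall z, (F \_ (slab t)) z = (z.2 <= t)%R%:R * hat F z}.
Proof.
move=> tT; exists (setT `*` (`[0, T]%classic `\` Gam)); split.
- by apply: measurableX => //; exact: measurableD.
- have : ((leb4 \x leb)%E (setT `*` (`[0%R, T]%classic `\` Gam)) = 0)%E.
    rewrite product_measure1E//; last by apply: measurableD => //; exact: measurable_itv.
    by rewrite [X in (_ * X)%E](_ : _ = 0%E) ?mule0.
  by [].
move=> z /= zn; split=> //; apply: contrapT => zG; apply: zn; rewrite patchE /hat indicE.
have [/set_mem z2|z2] := boolP (z.2 \in Gam).
  rewrite mul1r; have := GamT z2; rewrite /= in_itv/= => /andP[z0 _].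
  have [zt|zt] := leP z.2 t; first by rewrite mem_set ?mul1r//; split=> //=; rewrite in_itv/= z0.
  by rewrite memNset ?mul0r// => -[_ /=]; rewrite in_itv/= [z.2 <= t]leNgt zt andbF.
rewrite mul0r mulr0 memNset// => -[_ /= zt]; apply: zG; split.
  by move: zt; rewrite !in_itv/= => /andP[-> /le_trans ->].
by move=> h; move: z2; rewrite mem_set.
Qed.

Let slab_restrict_measurable (F : M4 R * mR -> R) t : t <= T ->
  measurable_fun (slab T : set (M4 R * mR)) F -> measurable_fun setT (F \_ (slab t)).
Proof.
move=> tT mF; apply/(measurable_restrictT _ (ms t)).
exact: (measurable_funS (ms T) (slab_sub tT) mF).
Qed.

Let measurable_cut (F : M4 R * mR -> R) t : measurable_fun (slab T : set (M4 R * mR)) F ->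
  measurable_fun setT (fun z : M4 R * mR => (z.2 <= t)%R%:R * hat F z).
Proof.
move=> mF; apply: measurable_funM; last exact: measurable_hat.
by apply: measurable_le_ind.
Qed.

Lemma slab_integral (F : M4 R * mR -> R) t : t <= T ->
  measurable_fun (slab T : set (M4 R * mR)) F ->
  \int[leb41]_(z in slab t) F z = \int[(leb4 \x leb)%E]_z ((z.2 <= t)%R%:R * hat F z).
Proof.
move=> tT mF; rewrite Rintegral_mkcond /Rintegral; congr fine.
apply: ae_eq_integral => //.
- by apply/measurable_EFinP; exact: slab_restrict_measurable.
- by apply/measurable_EFinP; exact: measurable_cut.
by apply: (ae_mono (slab_ae F tT)) => z /= -> _.
Qed.

Lemma slab_cv k (f : R4 R * R -> R) x t : Cc k -> t <= T ->
  measurable_fun (slab T : set (M4 R * mR)) f -> stint (hat f) ->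
  \int[leb41]_(z in slab t) (k (x - z.1) * f z) =
  \int[leb]_s ((s <= t)%R%:R * cv k (fun y => hat f (y, s)) x).
Proof.
move=> Ck tT mf sf; have [mh ih lh] := sf.
have mk := measurable_space_kernel x Ck.
rewrite slab_integral//; last by apply: measurable_funM => //; exact: measurable_funTS.
pose K (z : M4 R * mR) : R := (z.2 <= t)%R%:R * (k (x - (z.1 : R4 R)) * hat f z).
have iK : (leb4 \x leb)%E.-integrable setT (EFin \o K).
  apply: (integrable_bounded_mul (C := 1)) (stint_kernel x Ck sf) => //.
    by apply: measurable_le_ind.
  by move=> z _; case: (z.2 <= t)%R; rewrite ?normr1 ?normr0.
have K1 s : leb4.-integrable setT (EFin \o (fun y => K (y, s))).
  by have := integrableZl measurableT ((s <= t)%R%:R : R) (shift_integrable x Ck (lh s)).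
have /(congr1 fine) e := Rintegral_fubini2 iK K1.
transitivity (\int[(leb4 \x leb)%E]_z K z).
  by apply: eq_Rintegral => z _; rewrite /K /hat; congr (_ * _); rewrite mulrCA.
apply: (etrans (esym e)); apply: eq_Rintegral => s _; rewrite -RintegralZl//.
exact: (shift_integrable x Ck (lh s)).
Qed.

Lemma slab_kernel_integrable k (f : R4 R * R -> R) x t : Cc k -> t <= T ->
  measurable_fun (slab T : set (M4 R * mR)) f -> stint (hat f) ->
  leb41.-integrable (slab t) (EFin \o (fun z => k (x - z.1) * f z)).
Proof.
move=> Ck tT mf sf; pose F (z : M4 R * mR) : R := k (x - (z.1 : R4 R)) * f z.
have mF : measurable_fun (slab T : set (M4 R * mR)) F.
  by apply: measurable_funM => //; apply: measurable_funTS; exact: measurable_space_kernel.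
have iK : (leb4 \x leb)%E.-integrable setT
    (EFin \o (fun z : M4 R * mR => (z.2 <= t)%R%:R * (k (x - (z.1 : R4 R)) * hat f z))).
  apply: (integrable_bounded_mul (C := 1)) (stint_kernel x Ck sf) => //.
    by apply: measurable_le_ind.
  by move=> z _; case: (z.2 <= t)%R; rewrite ?normr1 ?normr0.
have mr := slab_restrict_measurable tT mF.
have : leb41.-integrable setT (EFin \o (F \_ (slab t))).
  apply/integrableP; split; first exact/measurable_EFinP.
  have [_] := integrableP _ _ _ iK; apply: le_lt_trans.
  rewrite le_eqVlt; apply/orP; left; apply/eqP.
  apply: ae_eq_integral => //.
  - by apply: measurableT_comp => //; exact/measurable_EFinP.
  - by apply: measurableT_comp => //; case/integrableP : iK.
  apply: (ae_mono (slab_ae F tT)) => z /= -> _; congr (`|_%:E|)%E.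
  by rewrite /F /hat; congr (_ * _); rewrite mulrCA.
move=> h; apply/(integrable_mkcond _ (ms t)).
by move: h; congr (_.-integrable _ _); apply/funext => z; rewrite /= /patch; case: ifP.
Qed.

Lemma slab_sum_cv (k : 'I_4 -> R4 R -> R) (f : 'I_4 -> R4 R * R -> R) x t :
  (forall j, Cc (k j)) -> t <= T ->
  (forall j, measurable_fun (slab T : set (M4 R * mR)) (f j)) -> (forall j, stint (hat (f j))) ->
  \int[leb41]_(z in slab t) (\sum_j k j (x - z.1) * f j z) =
  \int[leb]_s ((s <= t)%R%:R * \sum_j cv (k j) (fun y => hat (f j) (y, s)) x).
Proof.
move=> Ck tT mf sf; rewrite Rintegral_sum4//; last first.
  by move=> j; exact: slab_kernel_integrable.
under eq_bigr do rewrite slab_cv//.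
rewrite -Rintegral_sum4//; first by apply: eq_Rintegral => s _; rewrite mulr_sumr.
move=> j; apply: integrable_le_ind.
exact: (tdom_slice x (tdom_cv (Ck j) (sf j))).
Qed.

End SpaceTime.

(** * Test functions built from a kernel and a time cutoff *)

Section TestFunction.
Context {R : realType}.
Variables (eta : R4 R -> R) (theta : R -> R) (x : R4 R) (r : R).
Hypotheses (Ceta : Ccinfty eta) (stheta : smooth theta).
Hypothesis theta0 : forall s, r < `|s| -> theta s = 0.

Let L1 (z : R4 R * R) : R4 R := - z.1.
Let L2 (z : R4 R * R) : R := z.2.
Let L1lin (h : R) y w : L1 (h *: y + w) = h *: L1 y + L1 w.
Proof. by rewrite /L1 /= opprD scalerN. Qed.
Let L2lin (h : R) y w : L2 (h *: y + w) = h *: L2 y + L2 w. Proof. by []. Qed.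
Let L1c : continuous L1.
Proof. by move=> z; apply: cvgN; exact: cvg_fst. Qed.
Let L2c : continuous L2.
Proof. by move=> z; exact: cvg_snd. Qed.

(** The kernel is reflected and centred at [x], so that testing with it produces convolutions at
    [x]; [theta] supplies the compact support in time. *)
Definition test_fun (z : R4 R * R) : R := eta (x - z.1) * theta z.2.

Let theE z : theta z.2 = theta (0 + L2 z). Proof. by rewrite add0r. Qed.

Let s1 : smooth (fun z : R4 R * R => eta (x + L1 z)).
Proof. by apply: smooth_affine => //; exact: Ceta.1. Qed.
Let s2 : smooth (fun z : R4 R * R => theta (0 + L2 z)).
Proof. exact: smooth_affine. Qed.

Let testE : test_fun = (fun z => eta (x + L1 z) * theta (0 + L2 z)).
Proof. by apply/funext => z; rewrite /test_fun theE. Qed.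

Lemma test_fun_smooth : smooth test_fun.
Proof. by rewrite testE; exact: smooth_mul. Qed.

Let D_opp (v y : R4 R) : 'D_(- v) eta y = - 'D_v eta y.
Proof.
pose L (h : R) : R4 R := h *: v; have Ll := line_linear v.
have sg : smooth (fun h : R => eta (y + L h)).
  apply: smooth_affine => //; last exact: Ceta.1.
  by move=> h; apply: cvgZr_tmp; exact: cvg_id.
have dg : derivable (fun h : R => eta (y + L h)) 0 1 by exact: smooth_derivable.
have := D_realZ (-1) dg.
by rewrite !(D_affine _ _ _ _ Ll) /L scale1r scaleN1r scale0r addr0 mulN1r.
Qed.

Let D_test v z : 'D_v test_fun z =
  eta (x - z.1) * 'D_(v.2) theta z.2 - theta z.2 * 'D_(v.1) eta (x - z.1).
Proof.
rewrite testE deriveM; [|exact: smooth_derivable|exact: smooth_derivable].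
rewrite (D_affine _ _ _ _ L2lin) (D_affine _ _ _ _ L1lin) /L1 /L2 add0r.
by rewrite D_opp scalerN.
Qed.

Lemma dx_test_fun j z : dx j test_fun z = - theta z.2 * 'D_(e4 R j) eta (x - z.1).
Proof. by rewrite /dx D_test/= derive0 mulr0 sub0r mulNr. Qed.

Lemma dt_test_fun z : (\forall s \near z.2, theta s = 1) -> dt test_fun z = 0.
Proof.
move=> th; rewrite /dt D_test/= derive0 mulr0 subr0.
rewrite (_ : 'D_1 theta z.2 = 0) ?mulr0//.
rewrite -(derive_cst (1 : R) z.2 (1 : R)); apply: near_eq_derive => //; exact: oner_neq0.
Qed.

Lemma test_fun_compact : exists K : set (R4 R * R), compact K /\
  forall z, test_fun z != 0 -> K z.
Proof.
have [a a0 e0] := Cc_support (Ccinfty_Cc Ceta).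
exists (cube (a + `|x|) `*` `[- r, r]%classic); split.
  by apply: compact_setX; [exact: compact_cube|exact: segment_compact].
move=> z; rewrite /test_fun mulf_eq0 negb_or => /andP[h1 h2]; split => /=.
  rewrite /cube/= leNgt; apply: contra h1 => h; apply/eqP/e0.
  rewrite -ltrBrDr in h; apply: (lt_le_trans h).
  by rewrite -(normrN (x - z.1)) opprB lerB_dist.
rewrite in_itv/= -ler_norml leNgt; apply: contra h2 => h; exact/eqP/theta0.
Qed.

(** Testing the i-th component alone isolates the i-th scalar equation. *)
Definition test_field (i : 'I_4) (z : R4 R * R) : 'rV[R]_4 := test_fun z *: delta_mx 0 i.

Lemma test_field_Ccinfty i : Ccinfty (test_field i).
Proof.
have [K [cK tK]] := test_fun_compact; split; first by move=> n; apply: Ck_scale; exact: test_fun_smooth.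
apply: (proj1 (supp_compact cK _)) => z; rewrite /test_field => h; apply: tK.
by apply: contra h => /eqP ->; rewrite scale0r.
Qed.

Lemma test_fieldE i j : (fun z => test_field i z 0 j) = (fun z => (i == j)%:R * test_fun z).
Proof. by apply/funext => z; rewrite /test_field !mxE/= eq_sym mulrC. Qed.

End TestFunction.

Lemma balance_solve (R : realFieldType) (k l m n y z : R) :
  - 0 + k + l - m - n = z - y -> y = z + (-1 * k + -1 * l + m + n).
Proof. lra. Qed.

(** * The mollified velocity as a primitive in time *)

Section Representation.
Context {R : realType}.
Local Notation mR := (measurableTypeR R).
Local Notation leb := (@lebesgue_measure R).
Implicit Types (k eta : R4 R -> R).

Lemma CcZ k (c : R) : Cc k -> Cc (fun y => c * k y).
Proof.
move=> [ck [r kr]]; split; first by move=> y; apply: cvgM; [exact: cvg_cst|exact: ck].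
by exists r => y /kr ->; rewrite mulr0.
Qed.

Lemma cvZk k g (c : R) x : Cc k -> locint g -> cv (fun y => c * k y) g x = c * cv k g x.
Proof.
move=> Ck lg; rewrite /cv -RintegralZl//; last exact: shift_integrable.
by apply: eq_Rintegral => y _; rewrite mulrA.
Qed.

Variables (T : R) (Gam : set mR).
Hypotheses (mGam : measurable Gam) (GamT : Gam `<=` `[0, T]%classic).
Hypothesis GamE : leb (`[0, T]%classic `\` Gam) = 0%E.
Local Notation hat := (hat Gam).

Variables (chi : R4 R -> R) (u0 : R4 R -> 'rV[R]_4) (f u : R4 R * R -> 'rV[R]_4).
Variables (Du : R4 R * R -> 'M[R]_4) (p : R4 R * R -> R).
Hypothesis sol : distributional_solution T chi u0 f u Du p.
Let ST : set (M4 R * mR) := slab T.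
Hypothesis mDu : forall i j, measurable_fun ST (fun z => Du z i j).
Hypothesis mb : forall i j, measurable_fun ST (fun z => Defs.conv chi u z 0 j * Du z i j).
Hypothesis mp : measurable_fun ST p.
Hypothesis mf : forall i, measurable_fun ST (fun z => f z 0 i).
Hypothesis sDu : forall i j, stint (hat (fun z => Du z i j)).
Hypothesis sb : forall i j, stint (hat (fun z => Defs.conv chi u z 0 j * Du z i j)).
Hypothesis sp : stint (hat p).
Hypothesis sf : forall i, stint (hat (fun z => f z 0 i)).
Hypothesis lu0 : forall i, locint (fun y => u0 y 0 i).
Hypothesis lu : forall t i, 0 <= t <= T -> locint (fun y => u (y, t) 0 i).
Variable theta : R -> R.
Hypotheses (stheta : smooth theta) (theta1 : forall s, `|s| <= T + 1 -> theta s = 1).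
Hypothesis theta0 : forall s, 2 * (T + 1) < `|s| -> theta s = 0.

Lemma hat_transport i j (z : M4 R * mR) :
  hat (fun z => Defs.conv chi u z 0 j * Du z i j) z =
  cv chi (fun y => hat (fun z => u z 0 j) (y, z.2)) z.1 * hat (fun z => Du z i j) z.
Proof.
rewrite /hat indicE; have [zG|_] := boolP (z.2 \in Gam); last by rewrite !mul0r mulr0.
rewrite !mul1r /Defs.conv mxE; congr (_ * _); apply: eq_Rintegral => y _.
by rewrite mul1r.
Qed.

(** [mollified_rhs] of each time slice, the fields being zeroed at bad times and the transporting
    field being the convolution of [chi] with the velocity. *)
Definition rhs_field eta i (z : M4 R * mR) : R :=
  mollified_rhs eta (fun i j y => hat (fun z => Du z i j) (y, z.2))
    (fun y => hat p (y, z.2)) (fun i y => hat (fun z => f z 0 i) (y, z.2))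
    (fun j => cv chi (fun y => hat (fun z => u z 0 j) (y, z.2))) i z.1.

Let Wf eta i (z : M4 R * mR) : R := \sum_j cv ('D_(e4 R j) eta) (fun y => hat (fun z => Du z i j) (y, z.2)) z.1.
Let Bf eta i (z : M4 R * mR) : R :=
  \sum_j cv eta (fun y => hat (fun z => Defs.conv chi u z 0 j * Du z i j) (y, z.2)) z.1.
Let Pf eta i (z : M4 R * mR) : R := cv ('D_(e4 R i) eta) (fun y => hat p (y, z.2)) z.1.
Let Hf eta i (z : M4 R * mR) : R := cv eta (fun y => hat (fun z => f z 0 i) (y, z.2)) z.1.

Let rhsE eta i z : rhs_field eta i z =
  -1 * (-1 * Wf eta i z + Bf eta i z + Pf eta i z) + Hf eta i z.
Proof.
rewrite /rhs_field /mollified_rhs /Wf /Bf /Pf /Hf.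
set a := \sum_j _; set b := \sum_j _; set c := \sum_j _.
have -> : c = b.
  apply: eq_bigr => j _; apply: eq_Rintegral => y _; rewrite hat_transport //.
set d := cv _ _ _; set e := cv _ _ _; ring.
Qed.

Section Kernel.
Variable eta : R4 R -> R.
Hypothesis Ceta : Ccinfty eta.
Let Ce : Cc eta. Proof. exact: Ccinfty_Cc. Qed.
Let Cd j : Cc ('D_(e4 R j) eta). Proof. exact/Ccinfty_Cc/Ccinfty_D. Qed.

Let tW i : tdom (Wf eta i). Proof. by apply: tdom_sum => j; exact: tdom_cv. Qed.
Let tB i : tdom (Bf eta i). Proof. by apply: tdom_sum => j; exact: tdom_cv. Qed.
Let tP i : tdom (Pf eta i). Proof. exact: tdom_cv. Qed.
Let tH i : tdom (Hf eta i). Proof. exact: tdom_cv. Qed.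

Lemma tdom_rhs i : tdom (rhs_field eta i).
Proof.
have := tdomD (tdomZ (-1) (tdomD (tdomD (tdomZ (-1) (tW i)) (tB i)) (tP i))) (tH i).
by congr tdom; apply/funext => z; rewrite rhsE.
Qed.

Let D_test_field i j x v z : 'D_v (fun z => test_field eta theta x i z 0 j) z =
  (i == j)%:R * 'D_v (test_fun eta theta x) z.
Proof.
rewrite test_fieldE.
have d : derivable (test_fun eta theta x) z v by apply: smooth_derivable; exact: test_fun_smooth.
by have := deriveZ ((i == j)%:R : R) d.
Qed.

Let pick (F : 'I_4 -> R) i : \sum_j F j * (i == j)%:R = F i.
Proof.
rewrite (bigD1 i)//= eqxx mulr1 big1 ?addr0// => j /negbTE.
by rewrite eq_sym => ->; rewrite mulr0.
Qed.

Let theta_near s : 0 <= s <= T -> \forall s' \near s, theta s' = 1.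
Proof.
move=> /andP[s0 sT]; apply/nbhs_ballP; exists 1 => //= s' s1; apply: theta1.
rewrite -[s'](subrK s) (le_trans (ler_normD _ _))// addrC (ger0_norm s0) lerD//.
by rewrite distrC ltW.
Qed.

(** For a fixed [x] the test function turns each space integral into a convolution at [x], and since
    [theta] is one around [0, T] the boundary terms are the two mollified velocities. The identity
    holds at every [t], as does the weak formulation. *)
Lemma representation i x t : 0 <= t <= T ->
  cv eta (fun y => u (y, t) 0 i) x =
  evolution (cv eta (fun y => u0 y 0 i)) (rhs_field eta i) x t.
Proof.
move=> tT; have /andP[t0 tT'] := tT.
have [_ _ /(_ _ (test_field_Ccinfty x Ceta stheta theta0 i) t tT)] := sol.
cbv zeta.
have inslab z : slab t z -> 0 <= z.2 <= T.
  by move=> [_ /=]; rewrite in_itv/= => /andP[-> /le_trans ->].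
have th1 z : slab t z -> theta z.2 = 1.
  by move=> /inslab /andP[z0 zT]; apply: theta1; rewrite ger0_norm// (le_trans zT)// lerDl.
(* [theta] is constant near the times of the slab, so the time derivative of the test function
   vanishes there. *)
rewrite (_ : \int[leb41]_(z in slab t) _ = 0); last first.
  apply: Rintegral_eq0 => z zt; rewrite big1// => j _.
  by rewrite /dt D_test_field -/(dt _ _) dt_test_fun ?mulr0//; apply/theta_near/inslab.
(* The factor -1 comes from differentiating [eta (x - z)] in [z]. *)
rewrite (_ : \int[leb41]_(z in slab t) _ =
  \int[leb]_s ((s <= t)%R%:R * (-1 * Wf eta i (x, s)))); last first.
  transitivity (\int[leb41]_(z in slab t) (\sum_j (-1 * 'D_(e4 R j) eta (x - z.1)) * Du z i j)).
    apply: eq_Rintegral => z /set_mem zt; rewrite exchange_big/=; apply: eq_bigr => j _.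
    under eq_bigr do rewrite /dx D_test_field mulrA -/(dx _ _ _).
    rewrite -mulr_suml pick dx_test_fun// th1//; ring.
  rewrite (slab_sum_cv mGam GamT GamE (k := fun j y => -1 * 'D_(e4 R j) eta y) (f := fun j z => Du z i j) x)//; last by move=> j; exact: CcZ.
  apply: eq_Rintegral => s _; congr (_ * _); rewrite /Wf mulr_sumr; apply: eq_bigr => j _.
  by rewrite cvZk//; have [_ _] := sDu i j.
rewrite (_ : \int[leb41]_(z in slab t) _ =
  \int[leb]_s ((s <= t)%R%:R * Bf eta i (x, s))); last first.
  transitivity (\int[leb41]_(z in slab t) (\sum_j eta (x - z.1) * (Defs.conv chi u z 0 j * Du z i j))).
    apply: eq_Rintegral => z /set_mem zt; rewrite exchange_big/=; apply: eq_bigr => j _.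
    under eq_bigr do rewrite (congr1 (@^~ z) (test_fieldE eta theta x i _)) mulrA.
    by rewrite -mulr_suml pick /test_fun th1// mulr1 mulrC.
  by rewrite (slab_sum_cv mGam GamT GamE (k := fun j => eta) (f := fun j z => Defs.conv chi u z 0 j * Du z i j) x).
rewrite (_ : \int[leb41]_(z in slab t) _ =
  \int[leb]_s ((s <= t)%R%:R * (-1 * Pf eta i (x, s)))); last first.
  transitivity (\int[leb41]_(z in slab t) ((-1 * 'D_(e4 R i) eta (x - z.1)) * p z)).
    apply: eq_Rintegral => z /set_mem zt; under eq_bigr do rewrite /dx D_test_field mulrC -/(dx _ _ _).
    rewrite pick dx_test_fun// th1//; ring.
  rewrite (slab_cv mGam GamT GamE (k := fun y => -1 * 'D_(e4 R i) eta y) (f := p) x)//; last exact: CcZ.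
  apply: eq_Rintegral => s _; congr (_ * _); rewrite cvZk//; by have [_ _] := sp.
rewrite (_ : \int[leb41]_(z in slab t) _ =
  \int[leb]_s ((s <= t)%R%:R * Hf eta i (x, s))); last first.
  transitivity (\int[leb41]_(z in slab t) (eta (x - z.1) * f z 0 i)).
    apply: eq_Rintegral => z /set_mem zt.
    under eq_bigr do rewrite (congr1 (@^~ z) (test_fieldE eta theta x i _)) mulrA.
    by rewrite -mulr_suml pick /test_fun th1// mulr1 mulrC.
  by rewrite (slab_cv mGam GamT GamE (k := eta) (f := fun z => f z 0 i) x).
rewrite (_ : \int[leb4]_y _ = cv eta (fun y => u0 y 0 i) x - cv eta (fun y => u (y, t) 0 i) x); last first.
  have e0 : theta 0 = 1 by apply: theta1; rewrite normr0 addr_ge0// (le_trans t0).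
  have et : theta t = 1 by apply: theta1; rewrite ger0_norm// (le_trans tT')// lerDl.
  rewrite /cv -RintegralB//; last 2 first.
  - exact: shift_integrable.
  - by apply: shift_integrable => //; exact: lu.
  apply: eq_Rintegral => y _.
  transitivity (\sum_j (u0 y 0 j * eta (x - y) - u (y, t) 0 j * eta (x - y)) * (i == j)%:R).
    apply: eq_bigr => j _.
    rewrite !(congr1 (@^~ _) (test_fieldE eta theta x i j)) /test_fun /= e0 et; ring.
  by rewrite pick mulrC [in RHS]mulrC [X in _ - X]mulrC; ring.
have i1 := integrable_le_ind t (tdom_slice x (tdomZ (-1) (tW i))).
have i2 := integrable_le_ind t (tdom_slice x (tB i)).
have i3 := integrable_le_ind t (tdom_slice x (tdomZ (-1) (tP i))).
have i4 := integrable_le_ind t (tdom_slice x (tH i)).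
have j1 := integrableZl measurableT (-1) i1; have j2 := integrableZl measurableT (-1) i2.
have j12 := integrableD measurableT j1 j2; have j123 := integrableD measurableT j12 i3.
have e : \int[leb]_s ((s <= t)%R%:R * rhs_field eta i (x, s)) =
    -1 * \int[leb]_s ((s <= t)%R%:R * (-1 * Wf eta i (x, s))) +
    -1 * \int[leb]_s ((s <= t)%R%:R * Bf eta i (x, s)) +
    \int[leb]_s ((s <= t)%R%:R * (-1 * Pf eta i (x, s))) +
    \int[leb]_s ((s <= t)%R%:R * Hf eta i (x, s)).
  rewrite -!RintegralZl// -!RintegralD//.
  by apply: eq_Rintegral => s _; rewrite rhsE; ring.
rewrite /evolution e.
exact: balance_solve.
Qed.

End Kernel.
End Representation.

(** * Vanishing divergence of the mollified fields at almost every time *)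

Section DivergenceTime.
Context {R : realType}.
Local Notation mR := (measurableTypeR R).
Local Notation leb := (@lebesgue_measure R).

(* Testing against smooth approximations of the indicator of [`]a, b]] shows that
   the primitive of [g] is constant, and Lebesgue's theorem gives [g = 0]. *)
Lemma ae_eq0_test (g : mR -> R) (S : R -> R) (T : R) : smooth_step S ->
  leb.-integrable setT (EFin \o g) -> (forall s, ~~ (0 < s < T) -> g s = 0) ->
  (forall (theta : R -> R) a b, smooth theta -> 0 < a -> a < b -> b < T ->
     (forall s, 0 <= theta s <= 1) -> (forall s, s < a \/ b < s -> theta s = 0) ->
     \int[leb]_s (theta s * g s) = 0) ->
  {ae leb, forall s, g s = 0}.
Proof.
move=> [sS S01 S0 S1] ig g0 H.
have mg : measurable_fun setT g by apply/measurable_EFinP; case/integrableP : ig.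
(* The left ramp of [th n] lies in [[a, a + 2 / n]] and the right one in [[b, b + 2 / n]]: the
   pointwise limit is the indicator of the half-open interval, and for large [n] the support stays
   inside []0, T[]. *)
have key a b : 0 < a -> a < b -> b < T -> \int[leb]_s ((a < s <= b)%R%:R * g s) = 0.
  move=> a0 ab bT; pose th (n : nat) (s : R) := S (- (n%:R * a + 1) + n%:R * s) * S (n%:R * b + 1 + (- n%:R) * s).
  have sl (c d : R) : smooth (fun s : R => S (c + d * s)).
    apply: (smooth_affine (L := fun s : R => d * s)) => //.
      by move=> h y w; rewrite mulrDr; congr (_ + _); exact: mulrCA.
    by move=> s; apply: cvgM; [exact: cvg_cst|exact: cvg_id].
  have sth n : smooth (th n) by apply: smooth_mul; exact: sl.
  have th01 n s : 0 <= th n s <= 1.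
    have /andP[? ?] := S01 (- (n%:R * a + 1) + n%:R * s).
    have /andP[? ?] := S01 (n%:R * b + 1 + (- n%:R) * s).
    by rewrite mulr_ge0//= mulr_ile1.
  have thl n s : s < a -> th n s = 0.
    move=> sa; rewrite /th S0 ?mul0r//.
    have : n%:R * s <= n%:R * a :> R by rewrite ler_wpM2l// ltW.
    lra.
  have thr n s : 2 < n%:R * (s - b) -> th n s = 0.
    by move=> h; rewrite /th (S0 (_ + - _ * _)) ?mulr0//; move: h; rewrite mulrBr; lra.
  pose N := Num.truncn (4 / (T - b)).
  have Tb : 0 < T - b by rewrite subr_gt0.
  have th0 n : (N < n)%N -> \int[leb]_s (th n s * g s) = 0.
    move=> Nn; apply: (H _ a ((b + T) / 2)) => //; [lra|lra|].
    move=> s [sa|sb]; first exact: thl.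
    apply: thr; have : 4 < n%:R * (T - b).
      rewrite -ltr_pdivrMr//; apply: (lt_le_trans (truncnS_gt _)); by rewrite ler_nat.
    have : n%:R * ((T - b) / 2) <= n%:R * (s - b) :> R by apply: ler_wpM2l => //; lra.
    lra.
  pose F n (s : mR) : \bar R := (th n s * g s)%:E.
  have mth n : measurable_fun setT (th n : mR -> R).
    apply: continuous_measurable_fun; exact: Ck_continuous (sth n 0%N).
  have mF n : measurable_fun setT (F n) by apply/measurable_EFinP; exact: measurable_funM.
  have mI : measurable_fun setT (fun s : mR => (a < s <= b)%R%:R : R).
    rewrite (_ : (fun s => _) = \1_(`]a, b]%classic : set mR)); first exact: measurable_indic.
    by apply/funext => s; rewrite indicE mem_setE/= in_itv.
  have ff : {ae leb, forall s : mR, setT s -> F n s @[n --> \oo] --> ((a < s <= b)%R%:R * g s)%:E}.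
    apply: aeW => s _; apply: cvg_near_cst.
    have [sa|sa] /= := leP s a.
      exists 0%N => // n _; rewrite /F mul0r; congr (_%:E).
      rewrite /th S0 ?mul0r//.
      have : n%:R * s <= n%:R * a :> R by rewrite ler_wpM2l.
      lra.
    have [sb|sb] /= := leP s b.
      exists (Num.truncn (2 / (s - a))).+1 => // n /= hn; rewrite /F mul1r; congr (_%:E).
      have h2 : 2 < n%:R * (s - a).
        rewrite -ltr_pdivrMr ?subr_gt0//; apply: (lt_le_trans (truncnS_gt _)).
        by rewrite ler_nat.
      have h3 : n%:R * s <= n%:R * b :> R by rewrite ler_wpM2l.
      by rewrite /th !S1 ?mul1r//; move: h2 h3; rewrite ?mulrBr; lra.
    exists (Num.truncn (2 / (s - b))).+1 => // n /= hn; rewrite /F mul0r; congr (_%:E).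
    rewrite thr ?mul0r// -ltr_pdivrMr ?subr_gt0//; apply: (lt_le_trans (truncnS_gt _)).
    by rewrite ler_nat.
  pose ag (s : mR) : R := `|g s|.
  have ia : leb.-integrable setT (EFin \o ag) by have := integrable_norm ig.
  have fg : {ae leb, forall (s : mR) n, setT s -> (`|F n s| <= (EFin \o ag) s)%E}.
    apply: aeW => s n _; rewrite /= lee_fin normrM -[leRHS]mul1r ler_wpM2r//.
    by have /andP[? ?] := th01 n s; rewrite ger0_norm.
  have mlim : measurable_fun setT (fun s : mR => ((a < s <= b)%R%:R * g s)%:E).
    by apply/measurable_EFinP; exact: measurable_funM.
  have [ilim _ dc] := dominated_convergence measurableT mF mlim ff ia fg.
  have : (\int[leb]_s F n s @[n --> \oo] --> 0)%E.
    apply: cvg_near_cst; exists N.+1 => // n /= Nn; rewrite -EFin_Rintegral ?th0//.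
    apply: (integrable_bounded_mul (C := 1)) ig => // s _.
    by have /andP[? ?] := th01 n s; rewrite ger0_norm.
  move=> /(cvg_unique _ dc) e; apply: EFin_inj; rewrite EFin_Rintegral//.
  by apply: e; exact: ereal_hausdorff.
pose F (x : R) := \int[leb]_(t in `]-oo, x]) g t.
have FE x : F x = \int[leb]_s ((s <= x)%R%:R * g s).
  rewrite /F Rintegral_mkcond; apply: eq_Rintegral => s _; rewrite patchE mem_setE/= in_itv/=.
  by case: (s <= x); rewrite ?mul1r ?mul0r.
have Fab a b : 0 < a -> a < b -> b < T -> F b = F a.
  move=> a0 ab bT; apply/eqP; rewrite -subr_eq0 !FE -RintegralB//; last 2 first.
  - exact: integrable_le_ind.
  - exact: integrable_le_ind.
  apply/eqP; rewrite -(key _ _ a0 ab bT); apply: eq_Rintegral => s _; rewrite -mulrBl; congr (_ * _).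
  have [sa|sa] /= := leP s a; first by rewrite (le_trans sa (ltW ab)) subrr.
  by rewrite subr0.
have il y : leb.-integrable `]-oo, y] (EFin \o g) by apply: integrableS ig.
have := FTC1Ny il (open_integrable_locally openT ig); rewrite -/F => h.
apply: (ae_mono h) => x [_ Fx]; have [/andP[x0 xT]|/g0//] := boolP (0 < x < T).
rewrite -Fx derive1E -(derive_cst (F x) x (1 : R)); apply: near_eq_derive => //.
have : nbhs x `]0, T[%classic by apply: open_nbhs_nbhs; split; [exact: itv_open|rewrite /= in_itv/= x0].
apply: filterS => y /=; rewrite in_itv/= => /andP[y0 yT].
by have [xy|xy|->//] := ltgtP x y; [rewrite (Fab x y)|rewrite (Fab y x)].
Qed.

(** The double integral of [|D|] vanishes, and Tonelli lets either variable come first. *)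
Lemma ae_slice_eq0 (D : M4 R * mR -> R) : measurable_fun setT D ->
  (forall x, {ae leb, forall s, D (x, s) = 0}) ->
  {ae leb, forall s, {ae leb4, forall x, D (x, s) = 0}}.
Proof.
move=> mD D0; pose a (z : M4 R * mR) : \bar R := (`|D z|)%:E.
have ma : measurable_fun setT a.
  by apply/measurable_EFinP; exact: (measurableT_comp (@normr_measurable _ _) mD).
have a0 z : (0 <= a z)%E by rewrite lee_fin.
have e : (\int[leb]_s \int[leb4]_x a (x, s) = 0)%E.
  rewrite -(fubini_tonelli _ ma a0) integral0_eq// => x _.
  have m1 : measurable_fun setT (fun s : mR => (D (x, s))%:E).
    by apply/measurable_EFinP; exact: (measurableT_comp mD (pair1_measurable x)).
  apply/(ae_eq_integral_abs leb measurableT m1).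
  by apply: (ae_mono (D0 x)) => s /= -> _.
pose I (s : mR) := (\int[leb4]_x a (x, s))%E.
have mI : measurable_fun setT I by exact: (measurable_fun_fubini_tonelli_G a).
have I0 s : (0 <= I s)%E by apply: integral_ge0 => x _.
have : (\int[leb]_s `|I s| = 0)%E.
  by rewrite -e; apply: eq_integral => s _; rewrite gee0_abs.
move=> /(ae_eq_integral_abs leb measurableT mI) h.
apply: (ae_mono h) => s /(_ Logic.I) /= Is.
have m2 : measurable_fun setT (fun x : M4 R => (D (x, s))%:E).
  by apply/measurable_EFinP; exact: (measurableT_comp mD (pair2_measurable s)).
have /(ae_eq_integral_abs leb4 measurableT m2) h' : (\int[leb4]_x `|(D (x, s))%:E| = 0)%E by exact: Is.
by apply: (ae_mono h') => x /(_ Logic.I) /= [].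
Qed.

Lemma stint_time (h : M4 R * mR -> R) (c : mR -> R) (M : R) : measurable_fun setT c ->
  (forall s, `|c s| <= M) -> stint h -> stint (fun z => c z.2 * h z).
Proof.
move=> mc cM [mh ih lh].
have mc2 : measurable_fun setT (fun z : M4 R * mR => c z.2).
  exact: (measurableT_comp mc measurable_snd).
split; first exact: measurable_funM.
- move=> r; have := integrable_bounded_mul measurableT mc2 (fun z _ => cM z.2) (ih r).
  by congr (_.-integrable _ _); apply/funext => z /=; rewrite mulrCA.
- by move=> s; exact: (locintZ (c s) (lh s)).
Qed.

Variables (T : R) (Gam : set mR).
Hypotheses (mGam : measurable Gam) (GamT : Gam `<=` `]0, T[%classic).
Hypothesis GamE : leb (`[0, T]%classic `\` Gam) = 0%E.
Variables (u : R4 R * R -> 'rV[R]_4) (Du : R4 R * R -> 'M[R]_4).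
Let ST : set (M4 R * mR) := slab T.
Hypothesis mu : forall i, measurable_fun ST (fun z => u z 0 i).
Hypothesis su : forall i, stint (hat Gam (fun z => u z 0 i)).
Hypothesis sDu : forall i j, stint (hat Gam (fun z => Du z i j)).
Hypothesis wk : forall k i j x s, Ccinfty k ->
  cv ('D_(e4 R j) k) (fun y => hat Gam (fun z => u z 0 i) (y, s)) x =
  cv k (fun y => hat Gam (fun z => Du z i j) (y, s)) x.
Hypothesis divu : weakly_divfree_slab T u.

(** Weak divergence-freeness tested with the kernel at [x] times [theta] says that the mollified
    divergence at [x] integrates to 0 against every such [theta]. So it vanishes at almost every
    time for each [x], and Tonelli exchanges the quantifiers. *)
Lemma divergence_ae (eta : R4 R -> R) (S : R -> R) : Ccinfty eta -> smooth_step S ->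
  {ae leb, forall s, {ae leb4, forall x,
    \sum_i cv eta (fun y => hat Gam (fun z => Du z i i) (y, s)) x = 0}}.
Proof.
move=> Ceta step; have Ce := Ccinfty_Cc Ceta.
have Cd j : Cc ('D_(e4 R j) eta) by exact/Ccinfty_Cc/Ccinfty_D.
have GT' : Gam `<=` `[0, T]%classic.
  by move=> s /GamT /=; rewrite !in_itv/= => /andP[/ltW -> /ltW ->].
pose D (z : M4 R * mR) : R := \sum_i cv eta (fun y => hat Gam (fun z => Du z i i) (y, z.2)) z.1.
have tD : tdom D by apply: tdom_sum => i; exact: tdom_cv.
apply: (ae_slice_eq0 (D := D)) => [|x]; first exact: tD.1.
apply: (ae_eq0_test (T := T) step (tdom_slice x tD)).
  move=> s sT; rewrite /D big1// => i _; apply: Rintegral_eq0 => y _.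
  rewrite /hat indicE memNset ?mul0r ?mulr0// => /GamT /=; rewrite in_itv/= => h.
  by move: sT; rewrite h.
move=> theta a b sth a0 ab bT th01 thab.
have th0 s : T < `|s| -> theta s = 0.
  move=> Ts; apply: thab; have [s0|s0] := ltP s 0; first by left; exact: lt_trans a0.
  by right; rewrite (lt_trans bT)// -(ger0_norm s0).
have mth : measurable_fun setT (theta : mR -> R).
  by apply: continuous_measurable_fun; exact: Ck_continuous (sth 0%N).
have thb s : `|theta s| <= 1 by have /andP[? ?] := th01 s; rewrite ger0_norm.
have [K [cK tK]] := test_fun_compact x Ceta th0.
have cK' : compact (K `&` (setT `*` `[a, b]%classic)).
  apply: (subclosed_compact _ cK) => //; apply: closedI.
    by apply: compact_closed => //; exact: norm_hausdorff.
  rewrite (_ : _ `*` _ = snd @^-1` `[a, b]%classic); last by apply/seteqP; split=> [z []|z] //=.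
  by apply: closed_comp => [z _|]; [exact: cvg_snd|exact: itv_closed].
have tab z : test_fun eta theta x z != 0 -> (K `&` (setT `*` `[a, b]%classic)) z.
  move=> hz; split; first exact: tK.
  split=> //=; rewrite in_itv/=; move: hz; rewrite /test_fun mulf_eq0 negb_or => /andP[_ hz].
  by rewrite !leNgt; apply/andP; split; apply: contra hz => hs; apply/eqP/thab; [left|right].
have [cs sK] := supp_compact cK' tab.
have /divu : Ccinfty (test_fun eta theta x) by split=> //; exact: test_fun_smooth.
have sT : supp (test_fun eta theta x) `<=` setT `*` `]0, T[%classic.
  move=> z /sK [_ [_ /=]]; rewrite !in_itv/= => /andP[az zb]; split=> //=.
  by rewrite (lt_le_trans a0 az) (le_lt_trans zb bT).
move=> /(_ sT) e0; pose f i (z : R4 R * R) := theta z.2 * u z 0 i.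
have hf i : hat Gam (f i) = (fun z => theta z.2 * hat Gam (fun z => u z 0 i) z).
  by apply/funext => z; rewrite /hat /f mulrCA.
have mf i : measurable_fun ST (f i).
  by apply: measurable_funM => //; apply: measurable_funTS; exact: (measurableT_comp mth measurable_snd).
have sf i : stint (hat Gam (f i)) by rewrite hf; exact: stint_time mth thb (su i).
have Ckj j : Cc (fun y => -1 * 'D_(e4 R j) eta y) by exact: CcZ.
have := slab_sum_cv mGam GT' GamE x Ckj (lexx T) mf sf.
rewrite (_ : \int[leb41]_(z in slab T) _ = 0); last first.
  rewrite -[RHS]e0; apply: eq_Rintegral => z _; apply: eq_bigr => i _.
  rewrite (dx_test_fun x Ceta sth) /f; ring.
set W := (X in _ = X) => e; transitivity (-1 * W); last by rewrite -e mulr0.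
rewrite /W -RintegralZl//; last first.
  apply: integrable_le_ind; apply: (tdom_slice x (G := fun z => \sum_j cv (fun y => -1 * 'D_(e4 R j) eta y)
    (fun y => hat Gam (f j) (y, z.2)) z.1)).
  by apply: tdom_sum => j; exact: tdom_cv.
apply: eq_Rintegral => s _; rewrite mulrCA [X in _ = _ * X]mulr_sumr /D/=.
have [/set_mem sG|sG] := boolP (s \in Gam); last first.
  rewrite !big1 ?mulr0// => j _; last first.
    by apply: Rintegral_eq0 => y _; rewrite /hat indicE (negbTE sG) mul0r mulr0.
  rewrite (_ : cv _ _ _ = 0) ?mulr0//.
  by apply: Rintegral_eq0 => y _; rewrite /hat indicE (negbTE sG) mul0r mulr0.
have := GamT sG; rewrite /= in_itv/= => /andP[_ /ltW ->]; rewrite mul1r mulr_sumr.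
apply: eq_bigr => j _; have [_ _ lj] := su j.
rewrite cvZk//; last by have [_ _] := sf j.
rewrite hf /= (cvZ (theta s) x (Cd j) (lj s)) -wk//; ring.
Qed.

End DivergenceTime.

(** * Modulus of continuity of convolutions *)

Section Modulus.
Context {R : realType}.
Local Notation leb := (@lebesgue_measure R).
Implicit Types (k v : R4 R -> R).

Lemma lipschitz_line k j : Ccinfty k -> exists2 M, 0 <= M & forall (y : R4 R) (h : R),
  `|k (y + h *: e4 R j) - k y| <= M * `|h|.
Proof.
move=> Ck; have [M M0 hM] := Cc_bounded (Ccinfty_Cc (Ccinfty_D (e4 R j) Ck)).
exists M => [|y h]; first exact: ltW.
have pos (x : R4 R) (t : R) : 0 < t -> `|k (x + t *: e4 R j) - k x| <= M * `|t|.
  move=> t0; pose g (s : R) := k (x + s *: e4 R j).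
  have dg (s : R) : is_derive s (1 : R) g ('D_(e4 R j) k (x + s *: e4 R j)).
    exact: (pderiv_line x s (smooth_pderiv j Ck.1)).1.
  have cg : {within `[0, t], continuous g}.
    apply: continuous_subspaceT => s; apply: differentiable_continuous.
    by apply/derivable1_diffP; case: (dg s).
  have [c _ e] := MVT t0 (fun s _ => dg s) cg.
  have -> : k x = g 0 by rewrite /g scale0r addr0.
  by rewrite -/(g t) e subr0 normrM ler_wpM2r.
have [h0|h0|->] := ltgtP h 0; last by rewrite scale0r addr0 subrr !normr0 mulr0.
  have := pos (y + h *: e4 R j) (- h); rewrite oppr_gt0 => /(_ h0).
  by rewrite -addrA -scalerDl subrr scale0r addr0 normrN distrC.
exact: pos.
Qed.

Lemma coordinates (x : R4 R) : x = x.1.1.1 *: e4 R (@Ordinal 4 0 isT) + x.1.1.2 *: e4 R (@Ordinal 4 1 isT)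
  + x.1.2 *: e4 R (@Ordinal 4 2 isT) + x.2 *: e4 R (@Ordinal 4 3 isT).
Proof.
case: x => [[[a b] c] d]; rewrite /e4/=.
congr (((_, _), _), _); rewrite /= /GRing.scale/= ?mulr1 ?mulr0 ?addr0 ?add0r//.
Qed.

(** Going from one point to the other along the coordinate axes, one at a time, reduces the bound to
    the four partial derivatives. *)
Lemma lipschitz_Ccinfty k : Ccinfty k -> exists2 M, 0 < M & forall x y : R4 R,
  `|k x - k y| <= M * `|x - y|.
Proof.
move=> Ck; have [M0 M00 h0] := lipschitz_line (@Ordinal 4 0 isT) Ck.
have [M1 M10 h1] := lipschitz_line (@Ordinal 4 1 isT) Ck.
have [M2 M20 h2] := lipschitz_line (@Ordinal 4 2 isT) Ck.
have [M3 M30 h3] := lipschitz_line (@Ordinal 4 3 isT) Ck.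
exists (M0 + M1 + M2 + M3 + 1) => [|x y]; first by rewrite ltr_pwDr// !addr_ge0.
have ex : x = y + (x - y) by rewrite addrC subrK.
rewrite [in k x]ex; move: (x - y) => w.
have [w0 w1 w2 w3] : [/\ `|w.1.1.1| <= `|w|, `|w.1.1.2| <= `|w|, `|w.1.2| <= `|w| & `|w.2| <= `|w|].
  by case: w => [[[a b] c] d]; rewrite !prod_normE/= !le_max !lexx ?orbT.
have -> : y + w = y + w.1.1.1 *: e4 R (@Ordinal 4 0 isT) + w.1.1.2 *: e4 R (@Ordinal 4 1 isT)
    + w.1.2 *: e4 R (@Ordinal 4 2 isT) + w.2 *: e4 R (@Ordinal 4 3 isT).
  by rewrite {1}[w]coordinates !addrA.
set y1 := y + _; set y2 := y1 + _; set y3 := y2 + _; set y4 := y3 + _.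
have H0 := h0 y w.1.1.1; have H1 := h1 y1 w.1.1.2; have H2 := h2 y2 w.1.2; have H3 := h3 y3 w.2.
have -> : k y4 - k y = (k y4 - k y3) + (k y3 - k y2) + (k y2 - k y1) + (k y1 - k y) by ring.
apply: (le_trans (ler_normD _ _)); apply: (@le_trans _ _ (M3 * `|w| + M2 * `|w| + M1 * `|w| + M0 * `|w|)).
  apply: lerD; last by rewrite (le_trans H0)// ler_wpM2l.
  apply: (le_trans (ler_normD _ _)); apply: lerD; last by rewrite (le_trans H1)// ler_wpM2l.
  apply: (le_trans (ler_normD _ _)); apply: lerD; last by rewrite (le_trans H2)// ler_wpM2l.
  by rewrite (le_trans H3)// ler_wpM2l.
by have := normr_ge0 w; rewrite !mulrDl mul1r; lra.
Qed.

(** The difference of the two translated kernels is at most [M d] and, as [d <= 1], lives in a fixed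
    cube around [x]; there [|v| <= 1 + v^2] replaces Cauchy-Schwarz. [L] depends on the kernel
    alone, not on [v]. *)
Lemma cv_modulus k : Ccinfty k -> exists2 L, 0 < L & forall v N d x y, locint v ->
  (\int[leb4]_z (v z ^+ 2)%:E <= N%:E)%E -> d <= 1 -> `|x - y| <= d ->
  `|cv k v x - cv k v y| <= L * (1 + N) * d.
Proof.
move=> Ck; have Cck := Ccinfty_Cc Ck; have [M M0 hM] := lipschitz_Ccinfty Ck.
have [a a0 ka] := Cc_support Cck.
set c := fine (leb4 (cube (a + 1)) : \bar R).
have c0 : 0 <= c by apply: fine_ge0.
exists (M * (c + 1)) => [|v N d x y lv vN d1 xy]; first by rewrite mulr_gt0// ltr_wpDl.
have ix := shift_integrable x Cck lv; have iy := shift_integrable y Cck lv.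
rewrite /cv -RintegralB//.
have mI : measurable_fun (setT : set (M4 R)) (fun z : M4 R => \1_(cube (a + 1)) ((x : R4 R) - z) : R).
  have m1 : measurable_fun (setT : set (M4 R)) (\1_(cube (a + 1)) : M4 R -> R).
    by apply: measurable_indic; exact: measurable_cube.
  exact: (measurableT_comp m1 (preserves_leb4_sub x).1).
have mv2 : measurable_fun (setT : set (M4 R)) (fun z : M4 R => v z ^+ 2).
  by apply: measurable_funX; exact: lv.1.
have hI : (\int[leb4]_z (\1_(cube (a + 1)) ((x : R4 R) - z) : R)%:E <= c%:E)%E.
  rewrite ((preserves_leb4_sub x).2 (fun z => (\1_(cube (a + 1)) z : R)%:E)).
  - by rewrite integral_indic ?setIT /c ?fineK ?ge0_fin_numE ?leb4_cube_lty//; exact: measurable_cube.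
  - by apply/measurable_EFinP; apply: measurable_indic; exact: measurable_cube.
  - by move=> z; rewrite lee_fin.
have d0 : 0 <= d by exact: le_trans (normr_ge0 _) xy.
have idf : leb4.-integrable setT (EFin \o (fun z : M4 R => k (x - z) * v z - k (y - z) * v z)).
  by have := integrableB measurableT ix iy.
have := @normr_Rintegral_le2 _ _ _ leb4 _ _ _ (M * d) (M * d) c N idf mI mv2 _ _ _ _ _ hI vN.
have Md : 0 <= M * d by rewrite mulr_ge0// ltW.
have N0 : 0 <= N by rewrite -lee_fin (le_trans _ vN)// integral_ge0// => z _; rewrite lee_fin sqr_ge0.
move=> h; apply: (@le_trans _ _ (M * d * c + M * d * N)).
  apply: h => // [z|z]; first exact: sqr_ge0.
  rewrite -mulrBl normrM -mulrDr indicE.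
  have h1 : `|k (x - z) - k (y - z)| <= M * d.
    apply: (le_trans (hM _ _)); rewrite opprB addrA subrK.
    by apply: ler_wpM2l; [exact: ltW|].
  have [_|xz] := boolP (_ \in _).
    apply: ler_pM => //; have := sqr_ge0 (`|v z| - 1); rewrite sqrrB real_normK ?num_real//.
    rewrite (_ : true%:R = 1 :> R)// expr1n mulr1.
    by have := normr_ge0 (v z); lra.
  move: xz; rewrite notin_setE /cube/= => /negP; rewrite -ltNge => xz.
  have yz : `|x - z| <= `|y - z| + d.
    rewrite -[x - z](subrK (y - z)) addrC (le_trans (ler_normD _ _))// lerD2l//.
    by rewrite opprB addrA subrK.
  have -> : k (x - z) = 0 by apply: ka; move: xz; lra.
  have -> : k (y - z) = 0 by apply: ka; move: xz yz d1; lra.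
  by rewrite subrr normr0 mul0r; apply: mulr_ge0 => //; apply: addr_ge0 => //; exact: sqr_ge0.
have : 0 <= M * d * c by exact: mulr_ge0.
have : 0 <= M * d * N by exact: mulr_ge0.
have : 0 <= M * d * c * N by rewrite mulr_ge0// mulr_ge0.
nra.
Qed.

End Modulus.

(** * Pointwise Young and interpolation inequalities *)

Section Young32.
Context {R : realType}.

Lemma young_32 (t x y : R) : 0 < t ->
  `|x * y| <= t ^+ 3 * `|x| ^+ 3 + t^-1 `^ (3 / 2) * `|y| `^ (3 / 2).
Proof.
move=> t0; have ti : 0 <= t^-1 by rewrite invr_ge0 ltW.
have := @conjugate_powR R (t * `|x|) (t^-1 * `|y|) 3 (3 / 2).
rewrite mulrACA mulfV ?gt_eqF// mul1r -normrM => h.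
apply: (le_trans (h _ _ _ _ _)) => //.
- by rewrite mulr_ge0// ltW.
- by rewrite mulr_ge0.
- by field.
rewrite (@powRM _ t^-1)// powR_mulrn ?mulr_ge0 ?(ltW t0)// exprMn.
have A0 : 0 <= t ^+ 3 * `|x| ^+ 3 by rewrite mulr_ge0// exprn_ge0// ltW.
have B0 : 0 <= t^-1 `^ (3 / 2) * `|y| `^ (3 / 2) by rewrite mulr_ge0// powR_ge0.
by move: A0 B0; lra.
Qed.

(** Interpolation of L3 between L2 and L4, with a free weight [N] in place of optimal exponents; it
    amounts to [(N - |x|)^2 >= 0]. *)
Lemma cube_le_sqr_four (N x : R) : 0 < N -> `|x| ^+ 3 <= 2^-1 * N * x ^+ 2 + 2^-1 * N^-1 * x ^+ 4.
Proof.
move=> N0; rewrite -[x ^+ 2]real_normK ?num_real// (_ : x ^+ 4 = (`|x| ^+ 2) ^+ 2); last first.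
  by rewrite real_normK ?num_real// -exprM.
move: `|x| (normr_ge0 x) => y y0.
have -> : 2^-1 * N * y ^+ 2 + 2^-1 * N^-1 * (y ^+ 2) ^+ 2 =
    2^-1 * N^-1 * y ^+ 2 * (N ^+ 2 + y ^+ 2) by field; rewrite gt_eqF.
have -> : y ^+ 3 = 2^-1 * N^-1 * y ^+ 2 * (2 * N * y) by field; rewrite gt_eqF.
apply: ler_wpM2l; first by rewrite !mulr_ge0// ?invr_ge0 ?exprn_ge0 ?(ltW N0).
have := sqr_ge0 (N - y); rewrite sqrrB; lra.
Qed.

End Young32.

(** * Energy rate of a solution at one good time *)

Section SliceEstimate.
Context {R : realType}.

Lemma integral_indic_mul (E : set (M4 R)) (g : M4 R -> R) :
  (\int[leb4]_x (\1_E x * g x)%:E = \int[leb4]_(x in E) (g x)%:E)%E.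
Proof.
rewrite [RHS]integral_mkcond; apply: eq_integral => x _; rewrite patchE indicE.
by case: (x \in E); rewrite ?mul1r ?mul0r.
Qed.

Variables (C0 : R) (zeta : nat -> R4 R -> R).
Hypotheses (C00 : 0 < C0) (Hz : forall n, ball_cutoff C0 n.+1%:R (zeta n)).

Section Sobolev.
Variables (k v : R4 R -> R) (Dv : 'I_4 -> R4 R -> R) (N N1 : R).
Hypotheses (Ck : Ccinfty k) (dk : density k) (lv : locint v) (lDv : forall j, locint (Dv j)).
Hypothesis wk : forall j x, cv ('D_(e4 R j) k) v x = cv k (Dv j) x.
Hypotheses (N0 : 0 < N) (N1N : N1 <= N).
Hypothesis vN : (\int[leb4]_x (v x ^+ 2)%:E <= N1%:E)%E.
Hypothesis DN : forall j, (\int[leb4]_x (Dv j x ^+ 2)%:E <= N%:E)%E.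

(** The factor that is left when [N^2] is taken out of the bound of [sobolev_cv]. *)
Definition sobolev_constant : R := 81 * (2 + 2 * C0 ^+ 2) ^+ 2.

Lemma cv_sqr_le (A : set (M4 R)) : measurable A ->
  (\int[leb4]_(x in A) (cv k v x ^+ 2)%:E <= N1%:E)%E.
Proof.
move=> mA; apply: le_trans vN.
exact: (young_cv dk lv (@convex_sqr R) mA measurableT (fun _ _ _ _ => Logic.I)).
Qed.

Let mcv : measurable_fun (setT : set (M4 R)) (cv k v).
Proof. by apply: measurable_cv; [exact: Ccinfty_Cc|exact: lv.1]. Qed.

Lemma cube_cv_le (A : set (M4 R)) (l e : R) : 0 < l -> measurable A ->
  (\int[leb4]_(x in A) (cv k v x ^+ 2)%:E <= e%:E)%E ->
  (\int[leb4]_(x in A) (`|cv k v x| ^+ 3)%:E <=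
    (2^-1 * l * e + 2^-1 * l^-1 * (sobolev_constant * N ^+ 2))%:E)%E.
Proof.
move=> l0 mA Ae.
have mX n : measurable_fun A (fun x => (cv k v x ^+ n)%:E).
  by apply: measurable_funTS; apply/measurable_EFinP; exact: measurable_funX.
have l2 : 0 <= 2^-1 * l by rewrite mulr_ge0// ltW.
have l3 : 0 <= 2^-1 * l^-1 by rewrite mulr_ge0// invr_ge0 ltW.
have m1 : measurable_fun A (fun x => ((2^-1 * l)%:E * (cv k v x ^+ 2)%:E)%E) by exact: measurable_funeM.
have m2 : measurable_fun A (fun x => ((2^-1 * l^-1)%:E * (cv k v x ^+ 4)%:E)%E) by exact: measurable_funeM.
have e4 x : 0 <= cv k v x ^+ 4 by rewrite (exprM _ 2 2) sqr_ge0.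
have h2 x : A x -> (0 <= (cv k v x ^+ 2)%:E)%E by rewrite lee_fin sqr_ge0.
have h4 x : A x -> (0 <= (cv k v x ^+ 4)%:E)%E by rewrite lee_fin.
have h1 x : A x -> (0 <= (2^-1 * l)%:E * (cv k v x ^+ 2)%:E)%E.
  by move=> Ax; apply: mule_ge0; [rewrite lee_fin|exact: h2].
have h3 x : A x -> (0 <= (2^-1 * l^-1)%:E * (cv k v x ^+ 4)%:E)%E.
  by move=> Ax; apply: mule_ge0; [rewrite lee_fin|exact: h4].
apply: (@le_trans _ _ (\int[leb4]_(x in A) ((2^-1 * l)%:E * (cv k v x ^+ 2)%:E + (2^-1 * l^-1)%:E * (cv k v x ^+ 4)%:E))%E).
  apply: ge0_le_integral => //.
  - by apply: measurable_funTS; exact: measurable_absX.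
  - exact: emeasurable_funD.
  - by move=> x _; rewrite -!EFinM -EFinD lee_fin; exact: cube_le_sqr_four.
rewrite ge0_integralD// !ge0_integralZl ?lee_fin// EFinD; apply: leeD.
  by rewrite [in leRHS]EFinM; apply: lee_wpmul2l; rewrite ?lee_fin.
rewrite [in leRHS]EFinM; apply: lee_wpmul2l; rewrite ?lee_fin//.
have vN' : (\int[leb4]_x (v x ^+ 2)%:E <= N%:E)%E by apply: le_trans vN _; rewrite lee_fin.
have := sobolev_cv C00 Hz Ck dk lv lDv wk N0 vN' DN.
rewrite exprMn mulrA -/sobolev_constant; apply: le_trans.
have m4T : measurable_fun setT (fun x : M4 R => (cv k v x ^+ 4)%:E).
  by apply/measurable_EFinP; exact: measurable_funX.
have p4 x : setT x -> (0 <= (cv k v x ^+ 4)%:E)%E by rewrite lee_fin.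
apply: ge0_subset_integral => //.
Qed.

(** The weight [l = N] makes both terms linear in [N], although the L4 bound is quadratic. With
    [N = N1 + D(s)] the cubic integral is then integrable in time. *)
Lemma cube_cv_linear : (\int[leb4]_x (`|cv k v x| ^+ 3)%:E <=
  (2^-1 * (N1 + sobolev_constant) * N)%:E)%E.
Proof.
apply: (le_trans (cube_cv_le N0 measurableT (cv_sqr_le measurableT))); rewrite lee_fin.
rewrite le_eqVlt; apply/orP; left; apply/eqP; field; exact: lt0r_neq0.
Qed.

End Sobolev.

Variables (chi eta psi : R4 R -> R) (v : 'I_4 -> R4 R -> R) (Dv : 'I_4 -> 'I_4 -> R4 R -> R).
Variables (p : R4 R -> R) (f : 'I_4 -> R4 R -> R) (d rho kappa N N1 Pi Phi L t : R).
Hypotheses (Cchi : Ccinfty chi) (dchi : density chi).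
Hypotheses (Ceta : Ccinfty eta) (deta : density eta) (d1 : d <= 1).
Hypothesis eta0 : forall x, d < `|x| -> eta x = 0.
Hypotheses (Cpsi : Ccinfty psi) (psi01 : forall x, 0 <= psi x <= 1).
Hypothesis psi0 : forall x, `|x| <= rho -> psi x = 0.
Hypothesis dpsi : forall j x, `|'D_(e4 R j) psi x| <= kappa.
Hypotheses (lv : forall i, locint (v i)) (lDv : forall i j, locint (Dv i j)).
Hypotheses (lp : locint p) (lf : forall i, locint (f i)).
Hypothesis wk : forall k i j x, Ccinfty k -> cv ('D_(e4 R j) k) (v i) x = cv k (Dv i j) x.
Hypothesis div_eta : {ae leb4, forall x, \sum_i cv eta (Dv i i) x = 0}.
Hypothesis div_chi : {ae leb4, forall x, \sum_i cv chi (Dv i i) x = 0}.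
Hypotheses (N0 : 0 < N) (N1N : N1 <= N).
Hypothesis vN : forall i, (\int[leb4]_x (v i x ^+ 2)%:E <= N1%:E)%E.
Hypothesis DN : forall i j, (\int[leb4]_x (Dv i j x ^+ 2)%:E <= N%:E)%E.
Hypothesis pPi : (\int[leb4]_x (`|p x| `^ (3 / 2))%:E <= Pi%:E)%E.
Hypothesis fPhi : forall i, (\int[leb4]_(x in ~` cube (rho - 1)) (`|f i x| `^ (3 / 2))%:E <= Phi%:E)%E.
Hypothesis L0 : 0 <= L.
Hypothesis modulus : forall (v : R4 R -> R) (N d : R) (x y : R4 R), locint v ->
  (\int[leb4]_z (v z ^+ 2)%:E <= N%:E)%E -> d <= 1 -> `|x - y| <= d ->
  `|cv chi v x - cv chi v y| <= L * (1 + N) * d.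
Hypothesis t0 : 0 < t.

Let S := 2^-1 * (N1 + sobolev_constant) * N.
Let omega := L * (1 + N1) * d.

(** The abstract inequality with [b = chi * v]. Its commutator at [x] is the integral of
    [eta (x - y) Dv(y) (b y - b x)], in which only [|x - y| <= d] matters, so the modulus of
    continuity of [b] bounds it by [omega] times the mollified [|Dv|]. *)
Lemma slice_estimate :
  \sum_i \int[leb4]_x (psi x * (cv eta (v i) x *
    mollified_rhs eta Dv p f (fun j => cv chi (v j)) i x)) +
  \sum_i \sum_j \int[leb4]_x (psi x * cv eta (Dv i j) x ^+ 2) <=
  16 * (kappa * N + kappa * S + omega * N) +
  4 * (kappa * (S + Pi) + (t ^+ 3 * S + t^-1 `^ (3 / 2) * Phi)).
Proof.
have Cc_chi := Ccinfty_Cc Cchi.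
have mE : measurable (~` cube rho : set (M4 R)) by apply: measurableC; exact: measurable_cube.
have mB : measurable (~` cube (rho - 1) : set (M4 R)) by apply: measurableC; exact: measurable_cube.
have d0 : 0 <= d.
  rewrite leNgt; apply/negP => d0; have [_ _] := deta.
  rewrite Rintegral_eq0; first by move/eqP; rewrite eq_sym oner_eq0.
  by move=> x _; apply: eta0; exact: lt_le_trans (normr_ge0 _).
have N10 : 0 <= N1 by rewrite -lee_fin (le_trans _ (vN ord0))// integral_ge0// => x _; rewrite lee_fin sqr_ge0.
have om0 : 0 <= omega by rewrite /omega !mulr_ge0// addr_ge0.
apply: (@energy_inequality _ eta psi v Dv p f (fun j => cv chi (v j))
  (fun j => cv ('D_(e4 R j) chi) (v j)) Ceta Cpsi lv lDv lp lf _ div_eta _ _ _ _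
  (~` cube rho) (fun i j => cv eta (fun y => `|Dv i j y|)) kappa omega (t ^+ 3) (t^-1 `^ (3 / 2)) N S Pi Phi mE) => //.
- by move=> i j x; exact: wk.
- by move=> j; exact: cv_pderiv.
- by move=> j; exact: locbd_cv.
- by move=> j; apply: locbd_cv => //; exact/Ccinfty_Cc/Ccinfty_D.
- apply: (ae_mono div_chi) => x h; rewrite -[RHS]h; apply: eq_bigr => j _; exact: wk.
- by move=> x /contrapT; exact: psi0.
- by rewrite exprn_ge0// ltW.
- exact: powR_ge0.
- by move=> x y; exact: young_32.
- by move=> x y; have := young_32 x y (@ltr01 R); rewrite expr1n invr1 powR1 !mul1r.
- by move=> i; apply: (le_trans (cv_sqr_le deta (lv i) (vN i) measurableT)); rewrite lee_fin.
- move=> i j; apply: le_trans (DN i j).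
  exact: (young_cv deta (lDv i j) (@convex_sqr R) measurableT measurableT (fun _ _ _ _ => Logic.I)).
- by move=> i; exact: (cube_cv_linear Ceta deta (lv i) (lDv i) (fun j x => wk i j x Ceta) N0 N1N (vN i) (DN i)).
- by move=> i; exact: (cube_cv_linear Cchi dchi (lv i) (lDv i) (fun j x => wk i j x Cchi) N0 N1N (vN i) (DN i)).
- apply: le_trans pPi.
  exact: (young_cv deta lp (@convex_pow32 R) measurableT measurableT (fun _ _ _ _ => Logic.I)).
(* [eta] reaches no farther than [d <= 1], so outside [cube rho] the mollified force only sees the
   force outside [cube (rho - 1)]. *)
- move=> i; rewrite integral_indic_mul; apply: le_trans (fPhi i).
  apply: (young_cv deta (lf i) (@convex_pow32 R) mE mB) => x y; rewrite /cube/= => xr e yr.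
  apply: xr; move: e; apply: contraR; rewrite -ltNge => xr; apply/eqP/eta0.
  have := lerB_dist x y; move: xr yr d1; lra.
- move=> i j; apply: measurable_cv; first exact: Ccinfty_Cc.
  by apply: measurableT_comp => //; exact: (lDv i j).1.
- move=> i j; apply: le_trans (DN i j).
  have la : locint (fun y => `|Dv i j y|).
    split; first by apply: measurableT_comp => //; exact: (lDv i j).1.
    by move=> r; have := integrable_norm ((lDv i j).2 r).
  have := young_cv deta la (@convex_sqr R) measurableT measurableT (fun _ _ _ _ => Logic.I).
  by under [in leRHS]eq_integral do rewrite real_normK ?num_real//.
move=> i j x.
have Ce := Ccinfty_Cc Ceta; have [_ e0 _] := deta.
have lb : locint (fun y => cv chi (v j) y * Dv i j y) by apply: locbd_locint => //; exact: locbd_cv.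
have la : locint (fun y => `|Dv i j y|).
  split; first by apply: measurableT_comp => //; exact: (lDv i j).1.
  by move=> r; have := integrable_norm ((lDv i j).2 r).
have i1 := shift_integrable x Ce lb; have i2 := shift_integrable x Ce (lDv i j).
have i3 := shift_integrable x Ce la.
have i2' : leb4.-integrable setT (EFin \o (fun y : R4 R => cv chi (v j) x * (eta (x - y) * Dv i j y))).
  by have := integrableZl measurableT (cv chi (v j) x) i2.
have i3' : leb4.-integrable setT (EFin \o (fun y : R4 R => omega * (eta (x - y) * `|Dv i j y|))).
  by have := integrableZl measurableT omega i3.
rewrite [X in omega * X]ger0_norm; last by apply: Rintegral_ge0 => y _; exact: mulr_ge0.
rewrite /cv -/(cv chi (v j) x) -RintegralZl// -RintegralB// -RintegralZl//.
have i4 := integrableB measurableT i1 i2'.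
apply: (le_trans (le_normr_Rintegral _ _)) => //.
apply: le_Rintegral => //; first by have := integrable_norm i4.
move=> y _; rewrite -/(cv chi (v j) y).
have -> : eta (x - y) * (cv chi (v j) y * Dv i j y) - cv chi (v j) x * (eta (x - y) * Dv i j y) =
  eta (x - y) * Dv i j y * (cv chi (v j) y - cv chi (v j) x) by ring.
rewrite !normrM (ger0_norm (e0 _)) [leRHS]mulrC distrC.
have [->|ey] := eqVneq (eta (x - y)) 0; first by rewrite !mul0r.
apply: ler_wpM2l; first exact: mulr_ge0.
by apply: modulus => //; rewrite leNgt; apply: contra ey => h; exact/eqP/eta0.
Qed.

End SliceEstimate.

Lemma le_sum44 (R : numDomainType) (F : 'I_4 -> 'I_4 -> R) i j :
  (forall k l, 0 <= F k l) -> F i j <= \sum_k \sum_l F k l.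
Proof.
move=> F0; rewrite (bigD1 i)//= (bigD1 j)//= -addrA ler_wpDr//.
by apply: addr_ge0; [|apply: sumr_ge0 => k _]; apply: sumr_ge0 => l _.
Qed.

(** * Energy bound in time and tails of the mollified solution *)

Section EnergyBound.
Context {R : realType}.
Local Notation mR := (measurableTypeR R).
Local Notation leb := (@lebesgue_measure R).

Lemma tdom_pairing (psi : R4 R -> R) (H : M4 R * mR -> R) : Cc psi -> tdom H ->
  leb.-integrable setT (EFin \o (fun s => \int[leb4]_x (psi x * H (x, s)))).
Proof.
move=> Cp [mH dH]; have [r r0 pr] := Cc_support Cp; have [m im Hm] := dH r.
have ip : leb4.-integrable setT (EFin \o (fun x => `|psi x|)).
  by have := integrable_norm (Cc_integrable Cp).
have mK : measurable_fun setT (fun z : M4 R * mR => psi z.1 * H z).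
  by apply: measurable_funM => //; exact: (measurableT_comp (Cc_measurable Cp) measurable_fst).
have dom (x : M4 R) (s : mR) : `|psi x * H (x, s)| <= `|psi x| * m s.
  rewrite normrM; have [xr|/pr ->] := leP `|x : R4 R| r; last by rewrite normr0 !mul0r.
  by apply: ler_wpM2l => //; exact: Hm.
exact: (integrable_Rintegral2 (integrable_prod_dom mK ip im dom) (prod_dom_slice2 mK ip dom)).
Qed.

Lemma integrable_sum4 (F : 'I_4 -> mR -> R) : (forall j, leb.-integrable setT (EFin \o F j)) ->
  leb.-integrable setT (EFin \o (fun s => \sum_j F j s)).
Proof.
move=> iF; elim: (index_enum _) => [|i s ih].
  have -> : (fun x : mR => \sum_(j <- [::]) F j x) = (fun=> 0) by apply/funext => x; rewrite big_nil.
  by have := integrable0 leb [set: mR].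
have -> : (fun x : mR => \sum_(j <- i :: s) F j x) = (fun x => F i x + \sum_(j <- s) F j x).
  by apply/funext => x; rewrite big_cons.
by have := integrableD measurableT (iF i) ih.
Qed.

Variables (T : R) (Gam : set mR).
Hypotheses (mGam : measurable Gam) (GamT : Gam `<=` `[0, T]%classic).
Hypothesis GamE : leb (`[0, T]%classic `\` Gam) = 0%E.
Local Notation hat := (hat Gam).

Variables (chi : R4 R -> R) (u0 : R4 R -> 'rV[R]_4) (f u : R4 R * R -> 'rV[R]_4).
Variables (Du : R4 R * R -> 'M[R]_4) (p : R4 R * R -> R).
Hypothesis sol : distributional_solution T chi u0 f u Du p.
Let ST : set (M4 R * mR) := slab T.
Hypothesis mDu : forall i j, measurable_fun ST (fun z => Du z i j).
Hypothesis mb : forall i j, measurable_fun ST (fun z => Defs.conv chi u z 0 j * Du z i j).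
Hypothesis mp : measurable_fun ST p.
Hypothesis mf : forall i, measurable_fun ST (fun z => f z 0 i).
Hypothesis su : forall i, stint (hat (fun z => u z 0 i)).
Hypothesis sDu : forall i j, stint (hat (fun z => Du z i j)).
Hypothesis sb : forall i j, stint (hat (fun z => Defs.conv chi u z 0 j * Du z i j)).
Hypothesis sp : stint (hat p).
Hypothesis sf : forall i, stint (hat (fun z => f z 0 i)).
Hypothesis lu0 : forall i, locint (fun y => u0 y 0 i).
Hypothesis lu : forall t i, 0 <= t <= T -> locint (fun y => u (y, t) 0 i).
Variable theta : R -> R.
Hypotheses (stheta : smooth theta) (theta1 : forall s, `|s| <= T + 1 -> theta s = 1).
Hypothesis theta0 : forall s, 2 * (T + 1) < `|s| -> theta s = 0.

Variables (C0 : R) (zeta : nat -> R4 R -> R).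
Hypotheses (C00 : 0 < C0) (Hz : forall n, ball_cutoff C0 n.+1%:R (zeta n)).
Variables (eta psi : R4 R -> R) (d rho kappa N1 L t : R) (Dfun Pfun Ffun : mR -> R).
Hypotheses (Cchi : Ccinfty chi) (dchi : density chi).
Hypotheses (Ceta : Ccinfty eta) (deta : density eta) (d1 : d <= 1).
Hypothesis eta0 : forall x, d < `|x| -> eta x = 0.
Hypotheses (Cpsi : Ccinfty psi) (psi01 : forall x, 0 <= psi x <= 1).
Hypothesis psi0 : forall x, `|x| <= rho -> psi x = 0.
Hypothesis dpsi : forall j x, `|'D_(e4 R j) psi x| <= kappa.
Hypothesis wk : forall k i j x s, Ccinfty k ->
  cv ('D_(e4 R j) k) (fun y => hat (fun z => u z 0 i) (y, s)) x =
  cv k (fun y => hat (fun z => Du z i j) (y, s)) x.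
Hypothesis div : forall k s, k = eta \/ k = chi ->
  {ae leb4, forall x, \sum_i cv k (fun y => hat (fun z => Du z i i) (y, s)) x = 0}.
Hypothesis N10 : 0 < N1.
Hypothesis uN : forall s i, (\int[leb4]_x (hat (fun z => u z 0 i) (x, s) ^+ 2)%:E <= N1%:E)%E.
Hypotheses (iD : leb.-integrable setT (EFin \o Dfun)) (iP : leb.-integrable setT (EFin \o Pfun)).
Hypotheses (iF : leb.-integrable setT (EFin \o Ffun)).
Hypotheses (D0 : forall s, 0 <= Dfun s) (P0 : forall s, 0 <= Pfun s) (F0 : forall s, 0 <= Ffun s).
Hypothesis DN : forall s i j, (\int[leb4]_x (hat (fun z => Du z i j) (x, s) ^+ 2)%:E <= (Dfun s)%:E)%E.
Hypothesis pN : forall s, (\int[leb4]_x (`|hat p (x, s)| `^ (3 / 2))%:E <= (Pfun s)%:E)%E.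
Hypothesis fN : forall s i, (\int[leb4]_(x in ~` cube (rho - 1))
  (`|hat (fun z => f z 0 i) (x, s)| `^ (3 / 2))%:E <= (Ffun s)%:E)%E.
Hypothesis L0 : 0 <= L.
Hypothesis modulus : forall (v : R4 R -> R) (N d : R) (x y : R4 R), locint v ->
  (\int[leb4]_z (v z ^+ 2)%:E <= N%:E)%E -> d <= 1 -> `|x - y| <= d ->
  `|cv chi v x - cv chi v y| <= L * (1 + N) * d.
Hypothesis t0 : 0 < t.

Let cS := 2^-1 * (N1 + sobolev_constant C0).
(** The coefficient of [N1 + Dfun s] in [slice_estimate]; the pressure and the force give the two
    other terms of [rate]. *)
Definition energy_rate : R :=
  16 * (kappa + kappa * cS + L * (1 + N1) * d) + 4 * (kappa * cS + t ^+ 3 * cS).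

Let U i s := cv eta (fun y => hat (fun z => u z 0 i) (y, s)).
Let V i j s := cv eta (fun y => hat (fun z => Du z i j) (y, s)).
Let G i := rhs_field Gam chi f u Du p eta i.
Let U0 i := cv eta (fun y => u0 y 0 i).

Let offGam (g : R4 R * R -> R) (s : mR) : ~ Gam s -> (fun y => hat g (y, s)) = (fun _ => 0).
Proof. by move=> sG; apply/funext => y; rewrite /hat indicE memNset// mul0r. Qed.

Let cv0 (k : R4 R -> R) (x : R4 R) : cv k (fun=> 0) x = 0.
Proof. by apply: Rintegral_eq0 => y _; rewrite mulr0. Qed.

Let G_off i x s : ~ Gam s -> G i (x, s) = 0.
Proof.
move=> sG; rewrite /G /rhs_field /mollified_rhs /= !offGam// !cv0.
rewrite !big1 ?subr0 ?addr0// => j _; rewrite !offGam//.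
by apply: Rintegral_eq0 => y _; rewrite cv0 mul0r mulr0.
Qed.

Let F i := evolution (U0 i) (G i).

(** By [representation] the abstract evolution is the mollified velocity, and zeroing changes
    nothing at a good time. *)
Let FU i x s : Gam s -> F i x s = U i s x.
Proof.
move=> sG; have sT := GamT sG; rewrite /= in_itv/= in sT.
rewrite /F /G /U0 -(representation mGam GamT GamE sol mDu mb mp mf sDu sb sp sf lu0 lu stheta theta1 theta0 Ceta)//.
by apply: eq_Rintegral => y _; rewrite /hat indicE mem_set// mul1r.
Qed.

Let rate s := energy_rate * (\1_Gam s * N1 + Dfun s) + 4 * kappa * Pfun s + 4 * t^-1 `^ (3 / 2) * Ffun s.

Let k0 : 0 <= kappa. Proof. exact: le_trans (normr_ge0 _) (dpsi ord0 0). Qed.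

Let energy_rate_ge0 : 0 <= energy_rate.
Proof.
have s0 : 0 <= sobolev_constant C0 by rewrite /sobolev_constant mulr_ge0// sqr_ge0.
have c0 : 0 <= cS by rewrite mulr_ge0// addr_ge0// ltW.
have d0 : 0 <= d.
  rewrite leNgt; apply/negP => d0; have [_ _] := deta.
  rewrite Rintegral_eq0; first by move/eqP; rewrite eq_sym oner_eq0.
  by move=> x _; apply: eta0; exact: lt_le_trans (normr_ge0 _).
have t30 : 0 <= t ^+ 3 * cS by rewrite mulr_ge0// exprn_ge0// ltW.
have om0 : 0 <= L * (1 + N1) * d by rewrite !mulr_ge0// addr_ge0// ltW.
by rewrite addr_ge0// mulr_ge0// !addr_ge0// mulr_ge0.
Qed.

Let rate_ge0 s : 0 <= rate s.
Proof.
have r0 := energy_rate_ge0.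
by rewrite !addr_ge0// !mulr_ge0 ?powR_ge0// ?addr_ge0// ?indicE ?mulr_ge0// ltW.
Qed.

Let rate_slice s :
  \sum_i \int[leb4]_x (psi x * (F i x s * G i (x, s))) +
  \sum_i \sum_j \int[leb4]_x (psi x * V i j s x ^+ 2) <= rate s.
Proof.
have [/set_mem sG|/negP sG] := boolP (s \in Gam); last first.
  have {}sG : ~ Gam s by move=> h; apply: sG; rewrite mem_set.
  rewrite !big1 ?addr0.
  - exact: rate_ge0.
  - move=> i _; rewrite big1// => j _; apply: Rintegral_eq0 => x _.
    by rewrite /V offGam// cv0 expr2 mul0r mulr0.
  - by move=> i _; apply: Rintegral_eq0 => x _; rewrite G_off// !mulr0.
rewrite /rate indicE mem_set// mul1r.
(* One number bounds both the velocity and the gradient, as the Sobolev bound requires, and it is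
   positive because it serves as interpolation weight. *)
have N0 : 0 < N1 + Dfun s by rewrite ltr_wpDr.
have N1N : N1 <= N1 + Dfun s by rewrite lerDl.
have DN' i j : (\int[leb4]_x (hat (fun z => Du z i j) (x, s) ^+ 2)%:E <= (N1 + Dfun s)%:E)%E.
  by apply: (le_trans (DN s i j)); rewrite lee_fin lerDr ltW.
have sl (h : M4 R * mR -> R) : stint h -> locint (fun y => h (y, s)) by case.
have := @slice_estimate R C0 zeta C00 Hz chi eta psi (fun i y => hat (fun z => u z 0 i) (y, s))
  (fun i j y => hat (fun z => Du z i j) (y, s)) (fun y => hat p (y, s))
  (fun i y => hat (fun z => f z 0 i) (y, s)) d rho kappa (N1 + Dfun s) N1 (Pfun s) (Ffun s) L t
  Cchi dchi Ceta deta d1 eta0 Cpsi psi01 psi0 dpsi (fun i => sl _ (su i)) (fun i j => sl _ (sDu i j))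
  (sl _ sp) (fun i => sl _ (sf i)) (fun k i j x Ck => wk i j x s Ck)
  (div s (or_introl erefl)) (div s (or_intror erefl)) N0 N1N (uN s) DN' (pN s) (fN s) L0 modulus t0.
set X := (X in X <= _ -> _); set Y := (X in _ <= X -> _).
move=> XY; apply: (@le_trans _ _ X); last first.
  apply: (le_trans XY); rewrite le_eqVlt; apply/orP; left; apply/eqP.
  rewrite /Y /energy_rate /cS.
  by move: (N1 + Dfun s) (sobolev_constant C0) (t^-1 `^ (3 / 2)) => A B C; ring.
rewrite le_eqVlt; apply/orP; left; apply/eqP; congr (_ + _).
by apply: eq_bigr => i _; apply: eq_Rintegral => x _; rewrite FU.
Qed.

(** Dominated by [Dfun]: Young's inequality for the mollified gradient, and [psi <= 1]. *)
Let cutoff_component_integrable i j :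
leb.-integrable setT (EFin \o (fun s => \int[leb4]_x (psi x * V i j s x ^+ 2))).
Proof.
have Ce := Ccinfty_Cc Ceta; have Cp := Ccinfty_Cc Cpsi.
pose B s := \int[leb4]_x (psi x * V i j s x ^+ 2).
have tV : tdom (fun z => cv eta (fun y => hat (fun z => Du z i j) (y, z.2)) z.1) by exact: tdom_cv.
apply: (Rintegral_le_ge0 measurableT _ iD).
  pose K (w : mR * M4 R) : R := psi w.2 * cv eta (fun y => hat (fun z => Du z i j) (y, w.1)) w.2 ^+ 2.
  apply: (measurable_Rintegral leb4 (F := K)); apply: measurable_funM.
    exact: (measurableT_comp (Cc_measurable Cp) measurable_snd).
  apply: measurable_funX; apply: (measurableT_comp tV.1 (g := fun w : mR * M4 R => (w.2, w.1))).
  by apply: measurable_fun_pair.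
move=> s _; have [_ _ /(_ s) ls] := sDu i j.
have bV : locbd (V i j s) by exact: locbd_cv.
have mV2 : measurable_fun (setT : set (M4 R)) (fun x => V i j s x ^+ 2).
  by apply: measurable_funX; exact: bV.1.
have V2 : (\int[leb4]_x (V i j s x ^+ 2)%:E <= (Dfun s)%:E)%E.
  apply: le_trans (DN s i j).
  exact: (young_cv deta ls (@convex_sqr R) measurableT measurableT (fun _ _ _ _ => Logic.I)).
have := @normr_Rintegral_le2 _ _ _ leb4 _ _ (fun=> 0) 1 0 (Dfun s) 0
  (Cc_locbd_integrable Cp (locbdM bV bV)) mV2 (measurable_cst _) (fun x => sqr_ge0 _)
  (fun=> lexx 0) ler01 (lexx 0) _ V2 _.
rewrite mul1r mul0r addr0; apply; last by rewrite integral0.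
move=> x; rewrite mul1r addr0 normrM -[leRHS]mul1r; have /andP[p0 p1] := psi01 x.
by apply: ler_pM => //; [rewrite ger0_norm|rewrite ger0_norm// -expr2 sqr_ge0].
Qed.

(** [rate_slice] is integrated in time through the balance [energy_in_time]. The part with [N1] is
    only present on [Gam], whose measure is at most [T]. *)
Lemma energy_bound t' : 0 <= t' <= T ->
  \sum_i \int[leb4]_x (psi x * F i x t' ^+ 2) +
  2 * \int[leb]_s ((s <= t')%R%:R * \sum_i \sum_j \int[leb4]_x (psi x * V i j s x ^+ 2)) <=
  \sum_i \int[leb4]_x (psi x * U0 i x ^+ 2) +
  2 * (energy_rate * (N1 * T + \int[leb]_s Dfun s) + 4 * kappa * \int[leb]_s Pfun s +
       4 * t^-1 `^ (3 / 2) * \int[leb]_s Ffun s).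
Proof.
move=> tT.
have Ce := Ccinfty_Cc Ceta; have Cp := Ccinfty_Cc Cpsi.
have tG i : tdom (G i) by exact: tdom_rhs.
have bU0 i : locbd (U0 i) by exact: locbd_cv.
have tFG i : tdom (fun z => F i z.1 z.2 * G i z).
  split; first by apply: measurable_funM; [exact: measurable_evolution|exact: (tG i).1].
  move=> r; have [M hM] := evolution_bounded (bU0 i) (tG i) r; have [m im Gm] := (tG i).2 r.
  exists (fun s => M * m s); first by have := integrableZl measurableT M im.
  by move=> x s xr; rewrite normrM; apply: ler_pM => //; [exact: hM|exact: Gm].
pose A i s := \int[leb4]_x (psi x * (F i x s * G i (x, s))).
have iA i : leb.-integrable setT (EFin \o A i) by exact: (tdom_pairing Cp (tFG i)).
pose B i j s := \int[leb4]_x (psi x * V i j s x ^+ 2).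
have iB i j : leb.-integrable setT (EFin \o B i j) by exact: cutoff_component_integrable.
have iAt i : leb.-integrable setT (EFin \o (fun s => (s <= t')%R%:R * A i s)) by exact: integrable_le_ind.
have eq i : \int[leb4]_x (psi x * F i x t' ^+ 2) = \int[leb4]_x (psi x * U0 i x ^+ 2) +
    2 * \int[leb]_s ((s <= t')%R%:R * A i s) by exact: (energy_in_time Cp (bU0 i) (tG i)).
under eq_bigr do rewrite eq.
rewrite big_split/= -mulr_sumr -addrA lerD2l -mulrDr ler_pM2l//.
rewrite -(Rintegral_sum4 measurableT iAt).
have iSA : leb.-integrable setT (EFin \o (fun s => \sum_i (s <= t')%R%:R * A i s)).
  exact: integrable_sum4.
have iSB : leb.-integrable setT (EFin \o (fun s => \sum_i \sum_j B i j s)).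
  by apply: integrable_sum4 => // i; exact: integrable_sum4.
have iSBt := integrable_le_ind t' iSB.
rewrite -RintegralD//.
have iG : leb.-integrable setT (EFin \o (fun s : mR => \1_Gam s * N1)).
  apply: (integrable_setT_zero (m := leb) mGam).
    by move=> s sG; rewrite indicE memNset// mul0r.
  apply: (bounded_integrable (m := leb) (M := N1)) => //.
  - apply: (le_lt_trans _ (leb_segment_lty 0 T)); apply: le_measure; rewrite ?inE//.
  - apply: measurable_funTS; apply: measurable_funM => //; exact: measurable_indic.
  - by move=> s sG; rewrite indicE mem_set// mul1r ger0_norm// ltW.
have iGD : leb.-integrable setT (EFin \o (fun s => \1_Gam s * N1 + Dfun s)).
  by have := integrableD measurableT iG iD.
have ir1 : leb.-integrable setT (EFin \o (fun s => energy_rate * (\1_Gam s * N1 + Dfun s))).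
  by have := integrableZl measurableT energy_rate iGD.
have ir2 : leb.-integrable setT (EFin \o (fun s => 4 * kappa * Pfun s)).
  by have := integrableZl measurableT (4 * kappa) iP.
have ir3 : leb.-integrable setT (EFin \o (fun s => 4 * t^-1 `^ (3 / 2) * Ffun s)).
  by have := integrableZl measurableT (4 * t^-1 `^ (3 / 2)) iF.
have ir12 : leb.-integrable setT (EFin \o (fun s => energy_rate * (\1_Gam s * N1 + Dfun s) + 4 * kappa * Pfun s)).
  by have := integrableD measurableT ir1 ir2.
have ir : leb.-integrable setT (EFin \o rate) by have := integrableD measurableT ir12 ir3.
have iAB := integrableD measurableT iSA iSBt.
apply: (@le_trans _ _ (\int[leb]_s rate s)).
  apply: le_Rintegral => // s _; rewrite -mulr_sumr -mulrDr.
  have [_|_] := boolP (s <= t'); last by rewrite mul0r.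
  by rewrite mul1r; exact: rate_slice.
rewrite /rate RintegralD// RintegralD// !RintegralZl// RintegralD//.
rewrite -!addrA lerD2r; apply: ler_wpM2l; first exact: energy_rate_ge0.
rewrite lerD2r.
rewrite -lee_fin EFin_Rintegral//.
rewrite (_ : (\int[leb]_s (\1_Gam s * N1)%:E = N1%:E * leb Gam)%E); last first.
  rewrite -[X in leb X]setIT -integral_indic// -ge0_integralZl//; last by rewrite lee_fin ltW.
    by apply: eq_integral => s _; rewrite -EFinM mulrC.
  by apply/measurable_EFinP; exact: measurable_indic.
rewrite EFinM; apply: lee_wpmul2l; first by rewrite lee_fin ltW.
have T0 : 0 <= T by case/andP: tT => a b; exact: le_trans b.
apply: (@le_trans _ _ (leb `[0, T])); first by apply: le_measure; rewrite ?inE.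
rewrite lebesgue_measure_itv/=; case: ifPn => // _; first by rewrite -EFinB subr0.
Qed.

Variables (A : set (M4 R)) (e0 N2 N3 Phi : R).
Hypotheses (mA : measurable A) (psiA : forall x, A x -> psi x = 1).
Hypothesis u0e : forall i, (\int[leb4]_(x in ~` cube (rho - 1)) (u0 x 0 i ^+ 2)%:E <= e0%:E)%E.
Hypotheses (T0 : 0 <= T) (DN2 : \int[leb]_s Dfun s <= N2) (PN3 : \int[leb]_s Pfun s <= N3).
Hypothesis FPhi : \int[leb]_s Ffun s <= Phi.

(** Four components of the initial energy beyond [rho - 1], plus twice the integrated rate; the 2
    comes from differentiating a square. *)
Definition tail_bound : R := 4 * e0 +
  2 * (energy_rate * (N1 * T + N2) + 4 * kappa * N3 + 4 * t^-1 `^ (3 / 2) * Phi).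

Let Ce : Cc eta. Proof. exact: Ccinfty_Cc. Qed.
Let Cp : Cc psi. Proof. exact: Ccinfty_Cc. Qed.

Let initial_le i : \int[leb4]_x (psi x * U0 i x ^+ 2) <= e0.
Proof.
have mE : measurable (~` cube rho : set (M4 R)) by apply: measurableC; exact: measurable_cube.
have mB : measurable (~` cube (rho - 1) : set (M4 R)) by apply: measurableC; exact: measurable_cube.
have bU : locbd (U0 i) by exact: locbd_cv.
rewrite -lee_fin EFin_Rintegral//; last exact: (Cc_locbd_integrable Cp (locbdM bU bU)).
have mU2 : measurable_fun (setT : set (M4 R)) (fun x => (\1_(~` cube rho) x * U0 i x ^+ 2)%:E).
  apply/measurable_EFinP; apply: measurable_funM; first exact: measurable_indic.
  by apply: measurable_funX; exact: bU.1.
have mp2 : measurable_fun (setT : set (M4 R)) (fun x => (psi x * U0 i x ^+ 2)%:E).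
  apply/measurable_EFinP; apply: measurable_funM; first exact: Cc_measurable.
  by apply: measurable_funX; exact: bU.1.
apply: (@le_trans _ _ (\int[leb4]_x (\1_(~` cube rho) x * U0 i x ^+ 2)%:E)%E).
  apply: ge0_le_integralT => // x; have /andP[p0 p1] := psi01 x.
    by rewrite lee_fin mulr_ge0// sqr_ge0.
  rewrite lee_fin indicE; have [_|] := boolP (x \in _).
    by rewrite ler_wpM2r// sqr_ge0.
  by rewrite notin_setE => /contrapT/psi0 ->; rewrite !mul0r.
rewrite integral_indic_mul; apply: le_trans (u0e i).
apply: (young_cv deta (lu0 i) (@convex_sqr R) mE mB) => x y; rewrite /cube/= => xr e yr.
apply: xr; move: e; apply: contraR; rewrite -ltNge => xr; apply/eqP/eta0.
have := lerB_dist x y; move: xr yr d1; lra.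
Qed.

Let total_le t' : 0 <= t' <= T ->
  \sum_i \int[leb4]_x (psi x * F i x t' ^+ 2) +
  2 * \int[leb]_s ((s <= t')%R%:R * \sum_i \sum_j \int[leb4]_x (psi x * V i j s x ^+ 2)) <=
  tail_bound.
Proof.
move=> tT; apply: (le_trans (energy_bound tT)); apply: lerD.
  by rewrite -sum_const4; apply: ler_sum => i _; exact: initial_le.
apply: ler_wpM2l => //; apply: lerD; last first.
  by apply: ler_wpM2l => //; rewrite mulr_ge0// powR_ge0.
apply: lerD; last by apply: ler_wpM2l => //; rewrite mulr_ge0.
by apply: ler_wpM2l; [exact: energy_rate_ge0|rewrite lerD2l].
Qed.

Let psi_int_ge0 (g : R4 R -> R) : 0 <= \int[leb4]_x (psi x * g x ^+ 2).
Proof.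
apply: Rintegral_ge0 => x _; have /andP[p0 _] := psi01 x.
by rewrite mulr_ge0// sqr_ge0.
Qed.

Let cutoff_le (g : R4 R -> R) : locbd g ->
  (\int[leb4]_(x in A) (g x ^+ 2)%:E <= (\int[leb4]_x (psi x * g x ^+ 2))%:E)%E.
Proof.
move=> bg; rewrite EFin_Rintegral//; last exact: (Cc_locbd_integrable Cp (locbdM bg bg)).
have mg2 : measurable_fun (setT : set (M4 R)) (fun x => g x ^+ 2).
  by apply: measurable_funX; exact: bg.1.
rewrite -integral_indic_mul; apply: ge0_le_integralT.
- by apply/measurable_EFinP; apply: measurable_funM => //; exact: measurable_indic.
- by apply/measurable_EFinP; apply: measurable_funM => //; exact: Cc_measurable.
- by move=> x; rewrite lee_fin mulr_ge0 ?sqr_ge0// indicE.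
move=> x; rewrite lee_fin indicE; have /andP[p0 _] := psi01 x.
have [/set_mem xA|_] := boolP (x \in A); first by rewrite psiA.
by rewrite mul0r mulr_ge0// sqr_ge0.
Qed.

(** The tail is read from [total_le] at the time [s] itself, all other terms being nonnegative. *)
Lemma velocity_tail s i : Gam s ->
  (\int[leb4]_(x in A) (U i s x ^+ 2)%:E <= tail_bound%:E)%E.
Proof.
move=> sG; have sT := GamT sG; rewrite /= in_itv/= in sT.
have [_ _ ls] := su i; have bU : locbd (U i s) by exact: locbd_cv.
apply: (le_trans (cutoff_le bU)); rewrite lee_fin; apply: le_trans (total_le sT).
rewrite (bigD1 i)//= -!addrA; apply: ler_wpDr.
  apply: addr_ge0; first by apply: sumr_ge0 => j _; exact: psi_int_ge0.
  apply: mulr_ge0 => //; apply: Rintegral_ge0 => r _; apply: mulr_ge0 => //.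
  by apply: sumr_ge0 => j _; apply: sumr_ge0 => l _; exact: psi_int_ge0.
rewrite le_eqVlt; apply/orP; left; apply/eqP; apply: eq_Rintegral => x _.
by rewrite FU.
Qed.

Lemma gradient_tail i j :
  (\int[leb]_s \int[leb4]_(x in A) (V i j s x ^+ 2)%:E <= tail_bound%:E)%E.
Proof.
have TT : 0 <= T <= T by rewrite T0 lexx.
have iB : leb.-integrable setT (EFin \o (fun s => \sum_i \sum_j \int[leb4]_x (psi x * V i j s x ^+ 2))).
  by apply: integrable_sum4 => k; apply: integrable_sum4 => l; exact: cutoff_component_integrable.
have iBt := integrable_le_ind T iB.
have B0 s : 0 <= (s <= T)%R%:R * \sum_i \sum_j \int[leb4]_x (psi x * V i j s x ^+ 2).
  by apply: mulr_ge0 => //; apply: sumr_ge0 => k _; apply: sumr_ge0 => l _; exact: psi_int_ge0.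
set Y := fun s => (s <= T)%R%:R * _ in iBt B0.
apply: (@le_trans _ _ (\int[leb]_s Y s)%:E).
  rewrite EFin_Rintegral//.
  have [mV _] : tdom (fun z => cv eta (fun y => hat (fun z => Du z i j) (y, z.2)) z.1) by exact: tdom_cv.
  pose K (z : M4 R * mR) : \bar R := (\1_A z.1 * (cv eta (fun y => hat (fun z => Du z i j) (y, z.2)) z.1) ^+ 2)%:E.
  have mK : measurable_fun setT K.
    apply/measurable_EFinP; apply: measurable_funM; last exact: measurable_funX.
    have mI : measurable_fun setT (\1_A : M4 R -> R) by exact: measurable_indic.
    exact: (measurableT_comp mI measurable_fst).
  have K0 z : (0 <= K z)%E by rewrite lee_fin mulr_ge0 ?sqr_ge0// indicE.
  have := measurable_fun_fubini_tonelli_G K mK K0 (m1 := leb4); rewrite /fubini_G => mG.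
  rewrite [leLHS](eq_integral (fun s => (\int[leb4]_x K (x, s))%E)); last first.
    by move=> s _; rewrite -integral_indic_mul.
  apply: ge0_le_integralT => //.
  - by apply/measurable_EFinP; apply/measurable_EFinP; case/integrableP : iBt.
  - by move=> s; apply: integral_ge0 => x _.
  move=> s; rewrite /K/= integral_indic_mul.
  have [/set_mem sG|sG] := boolP (s \in Gam); last first.
    rewrite integral0_eq; first by rewrite lee_fin; exact: B0.
    move=> x _; rewrite offGam ?cv0 ?expr2 ?mul0r//.
    by move=> h; move: sG; rewrite mem_set.
  have sT := GamT sG; rewrite /= in_itv/= in sT; have /andP[_ sT'] := sT.
  have [_ _ ls] := sDu i j; have bV : locbd (V i j s) by exact: locbd_cv.
  apply: (le_trans (cutoff_le bV)); rewrite lee_fin /Y sT' mul1r.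
  by apply: (le_sum44 (F := fun k l => \int[leb4]_x (psi x * V k l s x ^+ 2))) => k l; exact: psi_int_ge0.
rewrite lee_fin; apply: le_trans (total_le TT).
have Y0 : 0 <= \int[leb]_s Y s by apply: Rintegral_ge0 => s _; exact: B0.
rewrite -/Y; apply: ler_wpDl.
  by apply: sumr_ge0 => k _; exact: psi_int_ge0.
by rewrite mulr_natl mulr2n lerDl.
Qed.

End EnergyBound.

(** The weight [N / sigma] multiplies the L2 tail by [1 / sigma] and the Sobolev term by [sigma], up
    to a common factor of order [N]. The error [dl * sigma / N] allowed on the tail then contributes
    half of [dl]. *)
Lemma interpolation_limit (R : realFieldType) (Xn X N S sigma dl : R) : 0 < N -> 0 < sigma -> 0 < dl ->
  Xn <= X + dl * sigma / N ->
  2^-1 * (N / sigma) * Xn + 2^-1 * (N / sigma)^-1 * (S * N ^+ 2) <=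
  2^-1 * (X / sigma + sigma * S) * N + dl.
Proof.
move=> N0 s0 d0 h.
apply: (@le_trans _ _ (2^-1 * (N / sigma) * (X + dl * sigma / N) + 2^-1 * (N / sigma)^-1 * (S * N ^+ 2))).
  by rewrite lerD2r; apply: ler_wpM2l => //; rewrite mulr_ge0// divr_ge0// ltW.
rewrite -subr_ge0; have -> : 2^-1 * (X / sigma + sigma * S) * N + dl -
  (2^-1 * (N / sigma) * (X + dl * sigma / N) + 2^-1 * (N / sigma)^-1 * (S * N ^+ 2)) = 2^-1 * dl.
  by field; rewrite !gt_eqF.
by rewrite mulr_ge0// ltW.
Qed.

(** * Removal of the mollification and of the outer cutoff *)

Section Limits.
Context {R : realType}.
Local Notation mR := (measurableTypeR R).
Local Notation leb := (@lebesgue_measure R).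

Lemma limn_einf_le (a : \bar R) (b : nat -> \bar R) :
  (forall delta, 0 < delta -> exists N, forall n, (N <= n)%N -> (b n <= a + delta%:E)%E) ->
  (limn_einf b <= a)%E.
Proof.
move=> H; rewrite limn_einf_lim (cvg_lim _ (@cvg_einfs_sup _ b))//.
apply/lee_addgt0Pr => d d0; have [N HN] := H d d0.
apply: ge_ereal_sup => _ [n _ <-]; apply: (le_trans _ (HN (maxn N n) (leq_maxl _ _))).
by apply: ereal_inf_lbound; exists (maxn N n) => //=; exact: leq_maxr.
Qed.

Lemma exhaust_cubes (g : M4 R -> \bar R) (B : set (M4 R)) (X : \bar R) : measurable_fun setT g ->
  (forall x, 0 <= g x)%E -> measurable B ->
  (forall m : nat, \int[leb4]_(x in cube m%:R `\` B) g x <= X)%E -> (\int[leb4]_(x in ~` B) g x <= X)%E.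
Proof.
move=> mg g0 mB H; have mC : measurable (~` B) by exact: measurableC.
rewrite integral_mkcond; apply: integral_cube_bound.
- by apply/(measurable_restrictT _ mC); exact: measurable_funTS.
- by move=> x; rewrite patchE; case: ifP.
by move=> m; rewrite -integral_mkcondr; exact: H.
Qed.

Lemma spacetime_slices (g : M4 R * mR -> \bar R) (A : set (M4 R)) : measurable_fun setT g ->
  (forall z, 0 <= g z)%E -> measurable A ->
  (\int[leb]_s \int[leb4]_(x in A) g (x, s) = \int[leb4]_(x in A) \int[leb]_s g (x, s))%E.
Proof.
move=> mg g0 mA.
have mI : measurable_fun setT (fun z : M4 R * mR => (\1_A z.1)%:E : \bar R).
  apply/measurable_EFinP; have h : measurable_fun setT (\1_A : M4 R -> R) by exact: measurable_indic.
  exact: (measurableT_comp h measurable_fst).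
pose K (z : M4 R * mR) : \bar R := ((\1_A z.1)%:E * g z)%E.
have mK : measurable_fun setT K by exact: emeasurable_funM.
have K0 z : (0 <= K z)%E by apply: mule_ge0; rewrite ?lee_fin ?indicE.
transitivity (\int[leb]_s \int[leb4]_x K (x, s))%E.
  apply: eq_integral => s _; rewrite [LHS]integral_mkcond; apply: eq_integral => x _.
  by rewrite patchE /K/= indicE; case: (x \in A); rewrite ?mul1e ?mul0e.
rewrite -(fubini_tonelli K mK K0) [RHS]integral_mkcond; apply: eq_integral => x _.
rewrite patchE /K/= indicE; case: (x \in A); last first.
  by rewrite integral0_eq// => s _; rewrite mul0e.
by apply: eq_integral => s _; rewrite mul1e.
Qed.

Lemma measurable_set_slice_integral (g : M4 R * mR -> R) (A : set (M4 R)) : measurable_fun setT g ->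
  (forall z, 0 <= g z) -> measurable A ->
  measurable_fun setT (fun s => \int[leb4]_(x in A) (g (x, s))%:E)%E.
Proof.
move=> mg g0 mA.
have mI : measurable_fun setT (\1_A : M4 R -> R) by exact: measurable_indic.
pose K (z : M4 R * mR) : \bar R := (\1_A z.1 * g z)%:E.
have mK : measurable_fun setT K.
  apply/measurable_EFinP; apply: measurable_funM => //; exact: (measurableT_comp mI measurable_fst).
have K0 z : (0 <= K z)%E by rewrite lee_fin mulr_ge0// indicE.
have := measurable_fun_fubini_tonelli_G K mK K0 (m1 := leb4); rewrite /fubini_G.
rewrite (_ : (fun y => _) = (fun s => \int[leb4]_(x in A) (g (x, s))%:E)%E)//.
by apply/funext => s; rewrite -integral_indic_mul.
Qed.

Lemma exhaust_spacetime (g : M4 R * mR -> \bar R) (B : set (M4 R)) (X : \bar R) : measurable_fun setT g ->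
  (forall z, 0 <= g z)%E -> measurable B ->
  (forall m : nat, \int[leb]_s \int[leb4]_(x in cube m%:R `\` B) g (x, s) <= X)%E ->
  (\int[leb]_s \int[leb4]_(x in ~` B) g (x, s) <= X)%E.
Proof.
move=> mg g0 mB H; have mC : measurable (~` B) by exact: measurableC.
rewrite spacetime_slices//; apply: exhaust_cubes => //.
- exact: (measurable_fun_fubini_tonelli_F g).
- by move=> x; apply: integral_ge0 => s _.
move=> m; rewrite -spacetime_slices//; apply: measurableD => //; exact: measurable_cube.
Qed.

Variables (T : R) (Gam : set mR).
Hypotheses (mGam : measurable Gam) (GamT : Gam `<=` `[0, T]%classic).
Hypothesis GamE : leb (`[0, T]%classic `\` Gam) = 0%E.
Local Notation hat := (hat Gam).

Variables (chi : R4 R -> R) (u0 : R4 R -> 'rV[R]_4) (f u : R4 R * R -> 'rV[R]_4).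
Variables (Du : R4 R * R -> 'M[R]_4) (p : R4 R * R -> R).
Hypothesis sol : distributional_solution T chi u0 f u Du p.
Let ST : set (M4 R * mR) := slab T.
Hypothesis mDu : forall i j, measurable_fun ST (fun z => Du z i j).
Hypothesis mb : forall i j, measurable_fun ST (fun z => Defs.conv chi u z 0 j * Du z i j).
Hypothesis mp : measurable_fun ST p.
Hypothesis mf : forall i, measurable_fun ST (fun z => f z 0 i).
Hypothesis su : forall i, stint (hat (fun z => u z 0 i)).
Hypothesis sDu : forall i j, stint (hat (fun z => Du z i j)).
Hypothesis sb : forall i j, stint (hat (fun z => Defs.conv chi u z 0 j * Du z i j)).
Hypothesis sp : stint (hat p).
Hypothesis sf : forall i, stint (hat (fun z => f z 0 i)).
Hypothesis lu0 : forall i, locint (fun y => u0 y 0 i).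
Hypothesis lu : forall t i, 0 <= t <= T -> locint (fun y => u (y, t) 0 i).
Variable theta : R -> R.
Hypotheses (stheta : smooth theta) (theta1 : forall s, `|s| <= T + 1 -> theta s = 1).
Hypothesis theta0 : forall s, 2 * (T + 1) < `|s| -> theta s = 0.

Variables (C0 : R) (zeta : nat -> R4 R -> R).
Hypotheses (C00 : 0 < C0) (Hz : forall n, ball_cutoff C0 n.+1%:R (zeta n)).

Hypothesis annulus : forall rho r : R, 0 < rho -> rho <= r -> exists psi, annulus_cutoff (2 * C0) rho r psi.
Variables (eta : nat -> R4 R -> R) (rho N1 N2 N3 Phi e0 L t : R) (Dfun Pfun Ffun : mR -> R).
Hypothesis etaP : forall n, mollifier n.+1%:R^-1 (eta n).
Hypotheses (Cchi : Ccinfty chi) (dchi : density chi) (rho0 : 0 < rho).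
Hypothesis wk : forall k i j x s, Ccinfty k ->
  cv ('D_(e4 R j) k) (fun y => hat (fun z => u z 0 i) (y, s)) x =
  cv k (fun y => hat (fun z => Du z i j) (y, s)) x.
Hypothesis div : forall k s, (exists n, k = eta n) \/ k = chi ->
  {ae leb4, forall x, \sum_i cv k (fun y => hat (fun z => Du z i i) (y, s)) x = 0}.
Hypothesis N10 : 0 < N1.
Hypothesis uN : forall s i, (\int[leb4]_x (hat (fun z => u z 0 i) (x, s) ^+ 2)%:E <= N1%:E)%E.
Hypotheses (iD : leb.-integrable setT (EFin \o Dfun)) (iP : leb.-integrable setT (EFin \o Pfun)).
Hypotheses (iF : leb.-integrable setT (EFin \o Ffun)).
Hypotheses (D0 : forall s, 0 <= Dfun s) (P0 : forall s, 0 <= Pfun s) (F0 : forall s, 0 <= Ffun s).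
Hypothesis DN : forall s i j, (\int[leb4]_x (hat (fun z => Du z i j) (x, s) ^+ 2)%:E <= (Dfun s)%:E)%E.
Hypothesis pN : forall s, (\int[leb4]_x (`|hat p (x, s)| `^ (3 / 2))%:E <= (Pfun s)%:E)%E.
Hypothesis fN : forall s i, (\int[leb4]_(x in ~` cube (rho - 1))
  (`|hat (fun z => f z 0 i) (x, s)| `^ (3 / 2))%:E <= (Ffun s)%:E)%E.
Hypothesis L0 : 0 <= L.
Hypothesis modulus : forall (v : R4 R -> R) (N d : R) (x y : R4 R), locint v ->
  (\int[leb4]_z (v z ^+ 2)%:E <= N%:E)%E -> d <= 1 -> `|x - y| <= d ->
  `|cv chi v x - cv chi v y| <= L * (1 + N) * d.
Hypothesis t0 : 0 < t.
Hypothesis u0e : forall i, (\int[leb4]_(x in ~` cube (rho - 1)) (u0 x 0 i ^+ 2)%:E <= e0%:E)%E.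
Hypotheses (T0 : 0 <= T) (DN2 : \int[leb]_s Dfun s <= N2) (PN3 : \int[leb]_s Pfun s <= N3).
Hypothesis FPhi : \int[leb]_s Ffun s <= Phi.

Let X (d : R) := tail_bound T C0 d (2 * C0 / rho) N1 L t e0 N2 N3 Phi.
Let B : set (M4 R) := cube (2 * rho).
Let mB : measurable B. Proof. exact: measurable_cube. Qed.
Let mA m : measurable (cube m `\` B : set (M4 R)).
Proof. by apply: measurableD => //; exact: measurable_cube. Qed.

Let d1 n : n.+1%:R^-1 <= 1 :> R. Proof. by rewrite invf_le1 ?ler1n// ltr0n. Qed.

(** The outer radius is at least [m], so [psi] is one on the part of [cube m] that lies beyond
    [2 * rho]. *)
Let cutoff m : exists psi : R4 R -> R, [/\ Ccinfty psi, forall x, 0 <= psi x <= 1,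
  forall x, `|x| <= rho -> psi x = 0, forall j x, `|'D_(e4 R j) psi x| <= 2 * C0 / rho &
  forall x, (cube m `\` B) x -> psi x = 1].
Proof.
have h : rho <= Num.max m rho by rewrite le_max lexx orbT.
have [psi [c p01 p0 p1 dp]] := annulus rho0 h; exists psi; split=> // x [xm].
rewrite /B /cube/= => /negP; rewrite -ltNge => xr; apply: p1 => //.
by rewrite (le_trans xm)// le_max lexx.
Qed.

Let velocity_n n m i s : Gam s ->
  (\int[leb4]_(x in cube m `\` B) (cv (eta n) (fun y => hat (fun z => u z 0 i) (y, s)) x ^+ 2)%:E
   <= (X n.+1%:R^-1)%:E)%E.
Proof.
move=> sG; have [psi [Cpsi psi01 psi0 dpsi psi1]] := cutoff m.
have [Ceta _ _ eta0] := etaP n; have deta := mollifier_density (etaP n).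
have div' k r : k = eta n \/ k = chi ->
    {ae leb4, forall x, \sum_i cv k (fun y => hat (fun z => Du z i i) (y, r)) x = 0}.
  by move=> [->|->]; apply: div; [left; exists n|right].
have h := (velocity_tail mGam GamT GamE sol mDu mb mp mf su sDu sb sp sf lu0 lu stheta theta1 theta0 C00 Hz
  Cchi dchi Ceta deta (d1 n) eta0 Cpsi psi01 psi0 dpsi wk div' N10 uN iD iP iF D0 P0 F0 DN pN fN
  L0 modulus t0 (mA m) psi1 u0e DN2 PN3 FPhi i sG).
rewrite /X; exact: h.
Qed.

Let gradient_n n m i j :
  (\int[leb]_s \int[leb4]_(x in cube m `\` B) (cv (eta n) (fun y => hat (fun z => Du z i j) (y, s)) x ^+ 2)%:E
   <= (X n.+1%:R^-1)%:E)%E.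
Proof.
have [psi [Cpsi psi01 psi0 dpsi psi1]] := cutoff m.
have [Ceta _ _ eta0] := etaP n; have deta := mollifier_density (etaP n).
have div' k r : k = eta n \/ k = chi ->
    {ae leb4, forall x, \sum_i cv k (fun y => hat (fun z => Du z i i) (y, r)) x = 0}.
  by move=> [->|->]; apply: div; [left; exists n|right].
have h := (gradient_tail mGam GamT GamE sol mDu mb mp mf su sDu sb sp sf lu0 lu stheta theta1 theta0 C00 Hz
  Cchi dchi Ceta deta (d1 n) eta0 Cpsi psi01 psi0 dpsi wk div' N10 uN iD iP iF D0 P0 F0 DN pN fN
  L0 modulus t0 (mA m) psi1 u0e T0 DN2 PN3 FPhi i j).
rewrite /X; exact: h.
Qed.

(** [X] is affine in the mollification radius. Its slope carries [L], which depends on [chi]; this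
    is harmless as a single solution is considered here. *)
Let X_cvg delta : 0 < delta -> exists N, forall n, (N <= n)%N -> X n.+1%:R^-1 <= X 0 + delta.
Proof.
move=> d0; pose c := 32 * (L * (1 + N1)) * (N1 * T + N2).
have XE d : X d = X 0 + c * d by rewrite /X /tail_bound /energy_rate /c; ring.
have [N HN] : exists N : nat, `|c| / delta < N%:R.
  by exists (Num.truncn (`|c| / delta)).+1; exact: truncnS_gt.
exists N => n Nn; rewrite XE lerD2l (le_trans (ler_norm _))// normrM [`|_^-1|]ger0_norm//.
rewrite ler_pdivrMr ?ltr0n// mulrC -ler_pdivrMr//; apply: (le_trans (ltW HN)).
by rewrite ler_nat; exact: leqW.
Qed.

Let sqrE (g : R4 R -> R) (A : set (M4 R)) :
  (\int[leb4]_(x in A) (`|g x| ^+ 2)%:E = \int[leb4]_(x in A) (g x ^+ 2)%:E)%E.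
Proof. by apply: eq_integral => x _; rewrite real_normK ?num_real. Qed.

Let lim_velocity_cube m i s : Gam s ->
  (\int[leb4]_(x in cube m `\` B) (hat (fun z => u z 0 i) (x, s) ^+ 2)%:E <= (X 0)%:E)%E.
Proof.
move=> sG; have [_ _ /(_ s) ls] := su i; rewrite -sqrE.
apply: (le_trans (lsc_mollified etaP 1 ls (mA m) (r := m) _)); first by move=> x [].
apply: limn_einf_le => dl dl0; have [N HN] := X_cvg dl0; exists N => n Nn.
by rewrite sqrE; apply: (le_trans (velocity_n n m i sG)); rewrite -EFinD lee_fin; exact: HN.
Qed.

Lemma lim_velocity i s : Gam s ->
  (\int[leb4]_(x in ~` B) (hat (fun z => u z 0 i) (x, s) ^+ 2)%:E <= (X 0)%:E)%E.
Proof.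
move=> sG; have [_ _ /(_ s) ls] := su i; apply: exhaust_cubes => //.
- by apply/measurable_EFinP; apply: measurable_funX; exact: ls.1.
- by move=> x; rewrite lee_fin sqr_ge0.
by move=> m; exact: lim_velocity_cube.
Qed.

(** Lower semicontinuity acts on each time slice, so the limit crosses the time integral by Fatou;
    the outer cube is exhausted afterwards. *)
Lemma lim_gradient i j :
  (\int[leb]_s \int[leb4]_(x in ~` B) (hat (fun z => Du z i j) (x, s) ^+ 2)%:E <= (X 0)%:E)%E.
Proof.
have [mh _ lh] := sDu i j.
apply: (exhaust_spacetime (g := fun z => (hat (fun z => Du z i j) z ^+ 2)%:E)) => //.
- by apply/measurable_EFinP; exact: measurable_funX.
- by move=> z; rewrite lee_fin sqr_ge0.
move=> m; pose h n s : \bar R := (\int[leb4]_(x in cube m%:R `\` B)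
  (cv (eta n) (fun y => hat (fun z => Du z i j) (y, s)) x ^+ 2)%:E)%E.
have mh' n : measurable_fun setT (h n).
  have [mV _] : tdom (fun z => cv (eta n) (fun y => hat (fun z => Du z i j) (y, z.2)) z.1).
    by apply: tdom_cv => //; have [Ce _ _ _] := etaP n; exact: Ccinfty_Cc.
  apply: (measurable_set_slice_integral (g := fun z => cv (eta n) (fun y => hat (fun z => Du z i j) (y, z.2)) z.1 ^+ 2)) => //.
  - exact: measurable_funX.
  - by move=> z; exact: sqr_ge0.
have h0 n s : setT s -> (0 <= h n s)%E by move=> _; apply: integral_ge0 => x _; rewrite lee_fin sqr_ge0.
apply: (@le_trans _ _ (\int[leb]_s limn_einf (h^~ s))%E).
  apply: ge0_le_integral => //.
  - by move=> s _; apply: integral_ge0 => x _; rewrite lee_fin sqr_ge0.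
  - apply: (measurable_set_slice_integral (g := fun z => hat (fun z => Du z i j) z ^+ 2)) => //.
    + exact: measurable_funX.
    + by move=> z; exact: sqr_ge0.
  - apply: (emeasurable_fun_cvg (fun n s => einfs (h^~ s) n)).
      by move=> n; exact: measurable_fun_einfs.
    by move=> s _; rewrite limn_einf_lim; exact: is_cvg_einfs.
  move=> s _; rewrite -sqrE; apply: (le_trans (lsc_mollified etaP 1 (lh s) (mA m%:R) (r := m%:R) _)).
    by move=> x [].
  by under [X in limn_einf X]eq_fun do rewrite sqrE.
apply: (le_trans (fatou _ measurableT mh' h0)).
apply: limn_einf_le => dl dl0; have [N HN] := X_cvg dl0; exists N => n Nn.
by apply: (le_trans (gradient_n n m%:R i j)); rewrite -EFinD lee_fin; exact: HN.
Qed.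

(** At each good time the cubic tail is interpolated with the weight [(N1 + Dfun s) / sigma], hence
    is bounded linearly in [N1 + Dfun s], and this bound is integrated in time. *)
Lemma lim_cube i (sigma : R) : 0 < sigma ->
  (\int[leb]_s \int[leb4]_(x in ~` B) (`|hat (fun z => u z 0 i) (x, s)| ^+ 3)%:E <=
   (2^-1 * (X 0 / sigma + sigma * sobolev_constant C0) * (N1 * T + N2))%:E)%E.
Proof.
move=> s0; have [mh _ lh] := su i.
have X0 : 0 <= X 0.
  rewrite -lee_fin; apply: le_trans (lim_gradient i i); apply: integral_ge0 => s _.
  by apply: integral_ge0 => x _; rewrite lee_fin sqr_ge0.
pose c := 2^-1 * (X 0 / sigma + sigma * sobolev_constant C0).
have c0 : 0 <= c.
  by rewrite /c mulr_ge0// addr_ge0// ?divr_ge0 ?(ltW s0)// mulr_ge0 ?(ltW s0)// /sobolev_constant mulr_ge0// sqr_ge0.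
have step s : (\int[leb4]_(x in ~` B) (`|hat (fun z => u z 0 i) (x, s)| ^+ 3)%:E <=
    (c * (\1_Gam s * N1 + Dfun s))%:E)%E.
  have [/set_mem sG|sG] := boolP (s \in Gam); last first.
    rewrite integral0_eq; first by rewrite lee_fin mulr_ge0// addr_ge0// mulr_ge0 ?(ltW N10)// indicE.
    by move=> x _; rewrite /hat indicE (negbTE sG) mul0r normr0 expr0n.
  rewrite indicE mem_set// mul1r; apply: exhaust_cubes => //.
  - by apply: measurable_absX; exact: (lh s).1.
  move=> m; apply: (le_trans (lsc_mollified etaP 2 (lh s) (mA m%:R) (r := m%:R) _)); first by move=> x [].
  have N0 : 0 < N1 + Dfun s by rewrite ltr_wpDr.
  have N1N : N1 <= N1 + Dfun s by rewrite lerDl.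
  apply: limn_einf_le => dl dl0.
  (* The accuracy asked from the mollified tail depends on the time [s]; this is allowed because the
     limit in [n] is taken slice by slice. *)
  have [N HN] := X_cvg (divr_gt0 (mulr_gt0 dl0 s0) N0); exists N => n Nn.
  have [Ceta _ _ eta0] := etaP n; have deta := mollifier_density (etaP n).
  have DN' j : (\int[leb4]_x (hat (fun z => Du z i j) (x, s) ^+ 2)%:E <= (N1 + Dfun s)%:E)%E.
    by apply: (le_trans (DN s i j)); rewrite lee_fin lerDr ltW.
  have lD j : locint (fun y => hat (fun z => Du z i j) (y, s)) by have [_ _] := sDu i j.
  have l0 : 0 < (N1 + Dfun s) / sigma by rewrite divr_gt0.
  apply: (le_trans (cube_cv_le C00 Hz Ceta deta (lh s) lD (fun j x => wk i j x s Ceta) N0 N1N (uN s i) DN'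
    l0 (mA m%:R) (velocity_n n m%:R i sG))).
  rewrite -EFinD lee_fin; exact: interpolation_limit (HN n Nn).
have mD : measurable_fun setT Dfun by apply/measurable_EFinP; case/integrableP : iD.
have mG : measurable_fun setT (fun s : mR => \1_Gam s * N1 : R).
  by apply: measurable_funM => //; exact: measurable_indic.
have mR0 : measurable_fun setT (fun s : mR => (\1_Gam s * N1 + Dfun s)%:E).
  by apply/measurable_EFinP; exact: measurable_funD.
have mG' : measurable_fun setT (fun s : mR => (\1_Gam s * N1)%:E) by exact/measurable_EFinP.
have mD' : measurable_fun setT (fun s : mR => (Dfun s)%:E) by exact/measurable_EFinP.
have g0 s : setT s -> (0 <= (\1_Gam s * N1)%:E)%E by rewrite lee_fin mulr_ge0 ?(ltW N10)// indicE.
have D0' s : setT s -> (0 <= (Dfun s)%:E)%E by rewrite lee_fin.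
apply: (@le_trans _ _ (\int[leb]_s (c%:E * (\1_Gam s * N1 + Dfun s)%:E))%E).
  apply: ge0_le_integral => //.
  - by move=> s _; apply: integral_ge0 => x _; rewrite lee_fin exprn_ge0.
  - apply: (measurable_set_slice_integral (g := fun z => `|hat (fun z => u z 0 i) z| ^+ 3)) => //.
    + by apply: measurable_funX; exact: (measurableT_comp (@normr_measurable _ _) mh).
    + exact: measurableC.
  - exact: measurable_funeM.
rewrite ge0_integralZl//; last first.
  by move=> s _; rewrite lee_fin addr_ge0// mulr_ge0 ?(ltW N10)// indicE.
rewrite [leRHS]EFinM; apply: lee_wpmul2l; first by rewrite lee_fin.
under eq_integral do rewrite EFinD.
rewrite ge0_integralD// EFinD; apply: leeD; last by rewrite -EFin_Rintegral// lee_fin.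
rewrite (_ : (\int[leb]_s (\1_Gam s * N1)%:E = N1%:E * leb Gam)%E); last first.
  rewrite -[X in leb X]setIT -integral_indic// -ge0_integralZl//; last by rewrite lee_fin ltW.
    by apply: eq_integral => s _; rewrite -EFinM mulrC.
  by apply/measurable_EFinP; exact: measurable_indic.
rewrite EFinM; apply: lee_wpmul2l; first by rewrite lee_fin ltW.
apply: (@le_trans _ _ (leb `[0, T])); first by apply: le_measure; rewrite ?inE.
rewrite lebesgue_measure_itv/=; case: ifPn => // _; first by rewrite -EFinB subr0.
Qed.

End Limits.

(** * From norms to slice integrals, and good times *)

Section Unpacking.
Context {R : realType}.
Local Notation mR := (measurableTypeR R).
Local Notation leb := (@lebesgue_measure R).

Lemma Lnorm_le d (X : measurableType d) (m : {measure set X -> \bar R}) (f : X -> \bar R) (r C : R) :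
  0 < r -> ('N[m]_(r%:E)[f] <= C%:E)%E -> (\int[m]_x `|f x| `^ r <= (C `^ r)%:E)%E.
Proof.
move=> r0 h; rewrite -poweR_Lnorm ?gt_eqF// -poweR_EFin; apply: gt0_ler_poweR => //.
- exact: ltW.
- by rewrite in_itv/= Lnorm_ge0 leey.
- by rewrite in_itv/= leey andbT; apply: le_trans h; exact: Lnorm_ge0.
Qed.

Lemma Lnorm_lty d (X : measurableType d) (m : {measure set X -> \bar R}) (f : X -> \bar R) (r : R) :
  0 < r -> ('N[m]_(r%:E)[f] < +oo)%E -> (\int[m]_x `|f x| `^ r < +oo)%E.
Proof. by move=> r0 h; rewrite -poweR_Lnorm ?gt_eqF//; exact: poweR_lty. Qed.

Lemma euclid_ge0 m n (A : 'M[R]_(m, n)) : 0 <= euclid A.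
Proof. exact: sqrtr_ge0. Qed.

Lemma euclid_sqr m n (A : 'M[R]_(m, n)) : euclid A ^+ 2 = \sum_i \sum_j A i j ^+ 2.
Proof.
by rewrite sqr_sqrtr// sumr_ge0// => i _; rewrite sumr_ge0// => j _; exact: sqr_ge0.
Qed.

Lemma euclid_row (v : 'rV[R]_4) : euclid v ^+ 2 = \sum_i v 0 i ^+ 2.
Proof. by rewrite euclid_sqr big_ord1. Qed.

Lemma euclid_entry (v : 'rV[R]_4) i : `|v 0 i| <= euclid v.
Proof.
rewrite -(ger0_norm (euclid_ge0 v)) -ler_sqr ?nnegrE// !real_normK ?num_real// euclid_row.
by rewrite (bigD1 i)//= lerDl sumr_ge0// => j _; exact: sqr_ge0.
Qed.

(** In dimension four the Euclidean norm is at most twice the largest entry, and 8 is the cube of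
    2. *)
Lemma euclid_cube (v : 'rV[R]_4) : euclid v ^+ 3 <= 8 * \sum_i `|v 0 i| ^+ 3.
Proof.
have [i hi] : exists i, forall j, `|v 0 j| <= `|v 0 i|.
  pose i := [arg max_(i > (ord0 : 'I_4)) `|v 0 i|]%O; exists i => j.
  by rewrite /i; case: arg_maxP => // k _ /(_ j isT).
have e2 : euclid v <= 2 * `|v 0 i|.
  rewrite -ler_sqr ?nnegrE ?euclid_ge0 ?mulr_ge0// euclid_row exprMn.
  apply: (@le_trans _ _ (\sum_(j < 4) `|v 0 i| ^+ 2)).
    by apply: ler_sum => j _; rewrite -(real_normK (num_real (v 0 j))) lerXn2r ?nnegrE.
  by rewrite sum_const4 -natrX.
apply: (@le_trans _ _ ((2 * `|v 0 i|) ^+ 3)).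
  by apply: lerXn2r; rewrite ?nnegrE ?euclid_ge0 ?mulr_ge0.
rewrite exprMn -natrX; apply: ler_wpM2l => //.
by rewrite (bigD1 i)//= lerDl sumr_ge0// => j _; exact: exprn_ge0.
Qed.

Lemma ae_and d (X : measurableType d) (m : {measure set X -> \bar R}) (P Q : X -> Prop) :
  {ae m, forall x, P x} -> {ae m, forall x, Q x} -> {ae m, forall x, P x /\ Q x}.
Proof.
move=> hP hQ; have := negligibleU hP hQ; apply: negligibleS => x /= h.
by have [Px|] := pselect (P x); [right => Qx; apply: h|left].
Qed.

(** An almost-everywhere statement comes with a measurable null set that contains the exceptional
    times; removing it keeps measurability and full measure. *)
Lemma good_times (T : R) (G0 : set mR) (P : mR -> Prop) : measurable G0 ->
  leb (`[0, T]%classic `\` G0) = 0%E -> {ae leb, forall s, G0 s -> P s} ->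
  exists Gam : set mR, [/\ measurable Gam, Gam `<=` G0, leb (`[0, T]%classic `\` Gam) = 0%E &
    forall s, Gam s -> P s].
Proof.
move=> mG0 G00 [N [mN N0 sub]]; exists (G0 `\` N); split.
- exact: measurableD.
- by move=> s [].
- apply/eqP; rewrite eq_le measure_ge0 andbT.
  have m1 : measurable (`[0, T]%classic `\` G0 : set mR) by exact: measurableD.
  apply: (@le_trans _ _ (leb ((`[0, T]%classic `\` G0) `|` N))).
    apply: le_measure; rewrite ?inE.
    + by apply: measurableD => //; exact: measurableD.
    + exact: measurableU.
    move=> s [sT h]; have [sN|sN] := pselect (N s); first by right.
    by left; split=> // sG; apply: h.
  by rewrite le_eqVlt; apply/orP; left; apply/eqP; exact: etrans (measureU0 m1 mN N0) G00.
- move=> s [sG sN]; apply: contrapT => h; apply: sN; apply: sub => /= h'; apply: h; exact: h'.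
Qed.

Lemma open_interval_full (T : R) : leb (`[0, T]%classic `\` `]0, T[%classic) = 0%E.
Proof.
apply/eqP; rewrite eq_le measure_ge0 andbT.
apply: (@le_trans _ _ (leb ([set 0] `|` [set T]))).
  apply: le_measure; rewrite ?inE; [exact: measurableD|exact: measurableU|].
  move=> s [/=]; rewrite !in_itv/= => /andP[s0 sT] /negP; rewrite negb_and -!leNgt => /orP[h|h].
    by left; apply/eqP; rewrite eq_le h s0.
  by right; apply/eqP; rewrite eq_le h sT.
have e : leb ([set (0 : R)] `|` [set T]) = leb [set (0 : R)].
  by apply: measureU0 => //; exact: lebesgue_measure_set1.
by rewrite [leLHS]e lebesgue_measure_set1.
Qed.

Lemma slice_ae_finite (I : mR -> \bar R) : measurable_fun setT I -> (forall s, 0 <= I s)%E ->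
  (\int[leb]_s I s < +oo)%E -> {ae leb, forall s, (I s < +oo)%E}.
Proof.
move=> mI I0 Ioo.
have iI : leb.-integrable setT I.
  apply/integrableP; split=> //; by under eq_integral do rewrite gee0_abs//.
have := integrable_ae measurableT iI; move=> h; apply: (ae_mono h) => s /(_ Logic.I).
by rewrite ge0_fin_numE.
Qed.

Lemma fine_integrable (I : mR -> \bar R) (C : R) : measurable_fun setT I -> (forall s, 0 <= I s)%E ->
  (forall s, I s < +oo)%E -> (\int[leb]_s I s <= C%:E)%E ->
  [/\ leb.-integrable setT (EFin \o (fun s => fine (I s))), forall s, 0 <= fine (I s),
      forall s, I s = (fine (I s))%:E & \int[leb]_s fine (I s) <= C].
Proof.
move=> mI I0 Ioo IC; have fE s : I s = (fine (I s))%:E by rewrite fineK// ge0_fin_numE.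
have iI : leb.-integrable setT (EFin \o (fun s => fine (I s))).
  apply: ge0_integrable => //.
  - by apply/measurable_EFinP; move: mI; congr measurable_fun; apply/funext => s; exact: fE.
  - by move=> s _; exact: fine_ge0.
  by under eq_integral do rewrite -fE; exact: le_lt_trans IC (ltry _).
split=> //; first by move=> s; exact: fine_ge0.
by rewrite -lee_fin EFin_Rintegral//; under eq_integral do rewrite -fE.
Qed.

(** [Psi] will be the square or the power 3/2. Since [|a| <= 1 + Psi a], a finite integral of [Psi]
    gives integrability over any cube and the bounded time interval. *)
Lemma stint_growth (h : M4 R * mR -> R) (Psi : R -> R) (T : R) : measurable_fun setT h ->
  measurable_fun setT Psi -> (forall a, 0 <= Psi a) -> (forall a, `|a| <= 1 + Psi a) ->
  (forall z, ~ `[0, T]%classic z.2 -> h z = 0) ->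
  (forall s, \int[leb4]_x (Psi (h (x, s)))%:E < +oo)%E ->
  (\int[leb]_s \int[leb4]_x (Psi (h (x, s)))%:E < +oo)%E -> stint h.
Proof.
move=> mh mPsi Psi0 grow h0 slice tot.
have mPh : measurable_fun setT (fun z => Psi (h z)) by exact: (measurableT_comp mPsi mh).
split=> //.
- move=> r; have mC := @measurable_cube R r.
  have mI : measurable_fun setT (fun z : M4 R * mR => \1_(cube r `*` `[0, T]%classic) z : R).
    by apply: measurable_indic; apply: measurableX => //; exact: measurable_itv.
  have iI : (leb4 \x leb)%E.-integrable setT (EFin \o (fun z : M4 R * mR => \1_(cube r `*` `[0, T]%classic) z : R)).
    apply: ge0_integrable => //.
    rewrite integral_indic ?setIT//; last by apply: measurableX => //; exact: measurable_itv.
    have : ((leb4 \x leb)%E (cube r `*` `[0%R, T]%classic) < +oo)%E.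
      rewrite product_measure1E//.
      apply: lte_mul_pinfty => //; last exact: leb_segment_lty.
      by rewrite ge0_fin_numE//; exact: leb4_cube_lty.
    by [].
  have iP : (leb4 \x leb)%E.-integrable setT (EFin \o (fun z => Psi (h z))).
    apply: ge0_integrable => //.
    have mPE : measurable_fun setT (fun z => (Psi (h z))%:E) by exact/measurable_EFinP.
    have P0 z : (0 <= (Psi (h z))%:E)%E by rewrite lee_fin.
    by rewrite (fubini_tonelli2 (fun z => (Psi (h z))%:E) mPE P0).
  have iS : (leb4 \x leb)%E.-integrable setT (EFin \o (fun z : M4 R * mR => \1_(cube r `*` `[0, T]%classic) z + Psi (h z))).
    by have := integrableD measurableT iI iP.
  apply: (Rintegral_le_ge0 measurableT _ iS).
    apply: measurable_funM => //.
    have m1 : measurable_fun setT (\1_(cube r) : M4 R -> R) by exact: measurable_indic.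
    exact: (measurableT_comp m1 measurable_fst).
  move=> z _; rewrite normrM.
  have [zT|/h0 ->] := pselect (`[0, T]%classic z.2); last first.
    by rewrite normr0 mulr0 addr_ge0// indicE.
  rewrite !indicE; have [/set_mem zr|zr] := boolP (z.1 \in cube r); last by rewrite normr0 mul0r addr_ge0.
  by rewrite mem_set// normr1 mul1r.
move=> s; have mhs : measurable_fun (setT : set (M4 R)) (fun y => h (y, s)).
  exact: (measurableT_comp mh (pair2_measurable s)).
split=> // r; have mC := @measurable_cube R r.
have i1 : leb4.-integrable (cube r : set (M4 R)) (EFin \o (fun=> 1 : R)).
  by apply: (bounded_integrable (m := leb4) (M := 1)) => //; [exact: leb4_cube_lty|move=> x _; rewrite normr1].
have iP : leb4.-integrable setT (EFin \o (fun y => Psi (h (y, s)))).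
  apply: ge0_integrable => //; exact: (measurableT_comp mPsi mhs).
have iP' : leb4.-integrable (cube r : set (M4 R)) (EFin \o (fun y => Psi (h (y, s)))).
  exact: integrableS iP.
have iS : leb4.-integrable (cube r : set (M4 R)) (EFin \o (fun y => 1 + Psi (h (y, s)))).
  by have := integrableD mC i1 iP'.
apply: (Rintegral_le_ge0 mC _ iS) => [|y _]; [exact: measurable_funTS|exact: grow].
Qed.

Lemma grow_sqr (a : R) : `|a| <= 1 + a ^+ 2.
Proof.
by have := sqr_ge0 (`|a| - 1); rewrite sqrrB real_normK ?num_real// expr1n mulr1; have := normr_ge0 a; lra.
Qed.

Lemma grow_pow32 (a : R) : `|a| <= 1 + `|a| `^ (3 / 2).
Proof.
have [a1|a1] := leP `|a| 1; first by rewrite (le_trans a1)// lerDl powR_ge0.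
apply: (@le_trans _ _ (`|a| `^ (3 / 2))); last by rewrite lerDr.
rewrite -{1}[`|a|]powRr1//; apply: ler_powR; first exact: ltW.
lra.
Qed.

(** If every tail exceeded [delta], the integral over each cube would be at most the total minus
    [delta], and exhaustion by cubes would bound the total by the same number. *)
Lemma tail_small (g : M4 R -> \bar R) (delta : R) : measurable_fun setT g -> (forall x, 0 <= g x)%E ->
  (\int[leb4]_x g x < +oo)%E -> 0 < delta ->
  exists m : nat, (\int[leb4]_(x in ~` cube m%:R) g x <= delta%:E)%E.
Proof.
move=> mg g0 goo d0; apply: contrapT => /forallNP H.
have mC (m : nat) : measurable (cube m%:R : set (M4 R)) by exact: measurable_cube.
set Itot := (\int[leb4]_x g x)%E in goo.
have I0 : (0 <= Itot)%E by exact: integral_ge0.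
have fI : Itot \is a fin_num by rewrite ge0_fin_numE.
have : (Itot <= Itot - delta%:E)%E.
  apply: integral_cube_bound => // m; rewrite leeBrDr//.
  have -> : Itot = (\int[leb4]_(x in cube m%:R) g x + \int[leb4]_(x in ~` cube m%:R) g x)%E.
    rewrite -ge0_integral_setU//; first by rewrite setUv.
    - exact: measurableC.
    - by rewrite setUv.
    - by apply/disj_setPCl.
  apply: leeD => //; apply: ltW; rewrite ltNge; apply/negP; exact: H.
by rewrite -(fineK fI) -EFinB lee_fin; lra.
Qed.

End Unpacking.

(** * Integrability of the fields of one solution *)

Section OneSolution.
Context {R : realType}.
Local Notation mR := (measurableTypeR R).
Local Notation leb := (@lebesgue_measure R).

Lemma D_reflect (k : R4 R -> R) (x v y : R4 R) : smooth k ->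
  'D_v (fun y => k (x - y)) y = - 'D_v k (x - y).
Proof.
move=> sk; pose L0 (z : R4 R) : R4 R := - z.
have L0l (h : R) (z w : R4 R) : L0 (h *: z + w) = h *: L0 z + L0 w by rewrite /L0 opprD scalerN.
rewrite (D_affine _ _ _ _ L0l) /L0.
pose L1 (h : R) : R4 R := h *: v; have Ll := line_linear v.
have sg : smooth (fun h : R => k (x - y + L1 h)).
  apply: smooth_affine => // h; apply: cvgZr_tmp; exact: cvg_id.
have dg : derivable (fun h : R => k (x - y + L1 h)) 0 1 by exact: smooth_derivable.
have := D_realZ (-1) dg.
by rewrite !(D_affine _ _ _ _ Ll) /L1 scale1r scaleN1r scale0r addr0 mulN1r.
Qed.

Lemma locally_integrable_locint (g : R4 R -> R) : locally_integrable4 g -> locint g.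
Proof.
move=> h; split; last by move=> r; apply: h; exact: compact_cube.
have -> : (setT : set (M4 R)) = \bigcup_(n : nat) (cube n%:R : set (M4 R)).
  apply/seteqP; split=> // x _; exists (Num.truncn `|x : R4 R|).+1 => //.
  by rewrite /cube/=; apply: ltW; exact: truncnS_gt.
apply/measurable_fun_bigcup => n; first exact: measurable_cube.
by apply/measurable_EFinP; have /integrableP[] := h _ (@compact_cube R n%:R).
Qed.

(** The test function is [k (x - .)]: its derivative carries a minus sign that cancels the one of
    the weak formulation. *)
Lemma weak_jacobian_cv (v : R4 R -> 'rV[R]_4) (Dv : R4 R -> 'M[R]_4) (k : R4 R -> R) i j x :
  weak_jacobian v Dv -> Ccinfty k ->
  cv ('D_(e4 R j) k) (fun y => v y 0 i) x = cv k (fun y => Dv y i j) x.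
Proof.
move=> /(_ i j)[/locally_integrable_locint lv _ H] Ck; have [a a0 k0] := Cc_support (Ccinfty_Cc Ck).
have Cp : Ccinfty (fun y => k (x - y)).
  apply: (@CcinftyI _ _ (a + `|x|)).
    apply: (smooth_affine (L := fun y : R4 R => - y)); last exact: Ck.1.
      by move=> h y w; rewrite opprD scalerN.
    by move=> y; apply: cvgN; exact: cvg_id.
  move=> y h; apply: k0; rewrite -ltrBrDr in h; apply: (lt_le_trans h).
  by rewrite -(normrN (x - y)) opprB lerB_dist.
have := H _ Cp; rewrite /cv.
rewrite (_ : \int[leb4]_y (v y 0 i * _) = - \int[leb4]_y ('D_(e4 R j) k (x - y) * v y 0 i)).
  move=> /oppr_inj ->; by apply: eq_Rintegral => y _; rewrite mulrC.
rewrite -mulN1r -RintegralZl//; last first.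
  exact: (shift_integrable x (Ccinfty_Cc (Ccinfty_D (e4 R j) Ck)) lv).
by apply: eq_Rintegral => y _; rewrite D_reflect; [ring|exact: Ck.1].
Qed.

Variables (T : R) (Gam : set mR).
Let J : set mR := `]0, T[%classic.
Hypotheses (mGam : measurable Gam) (GamJ : Gam `<=` J).
Let ST : set (M4 R * mR) := slab T.

Let GamT : Gam `<=` `[0, T]%classic.
Proof. by move=> s /GamJ /=; rewrite !in_itv/= => /andP[/ltW -> /ltW ->]. Qed.
Let mJ : measurable J. Proof. exact: measurable_itv. Qed.
Let JT : J `<=` `[0, T]%classic.
Proof. by move=> s /=; rewrite !in_itv/= => /andP[/ltW -> /ltW ->]. Qed.

Lemma hat_on (g : R4 R * R -> R) s : Gam s -> (fun y => hat Gam g (y, s)) = (fun y => g (y, s)).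
Proof. by move=> sG; apply/funext => y; rewrite /hat indicE mem_set// mul1r. Qed.

Lemma hat_off (g : R4 R * R -> R) s : ~ Gam s -> (fun y => hat Gam g (y, s)) = (fun=> 0).
Proof. by move=> sG; apply/funext => y; rewrite /hat indicE memNset// mul0r. Qed.

Lemma hat_slice_le (g : R4 R * R -> R) (Psi : R -> R) (A : set (M4 R)) s : Psi 0 = 0 -> (forall a, 0 <= Psi a) ->
  (\int[leb4]_(x in A) (Psi (hat Gam g (x, s)))%:E <= \int[leb4]_(x in A) (Psi (hat J g (x, s)))%:E)%E.
Proof.
move=> P0 Pge; have [sG|sG] := pselect (Gam s).
  rewrite le_eqVlt; apply/orP; left; apply/eqP; apply: eq_integral => x _.
  by rewrite /hat !indicE !mem_set//; exact: GamJ.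
rewrite integral0_eq; first by apply: integral_ge0 => x _; rewrite lee_fin.
by move=> x _; rewrite /hat indicE memNset// mul0r P0.
Qed.

Section Growth.
Variables (g : R4 R * R -> R) (Psi : R -> R).
Hypotheses (mg : measurable_fun ST g) (mPsi : measurable_fun setT Psi) (P0 : Psi 0 = 0).
Hypotheses (Pge : forall a, 0 <= Psi a) (grow : forall a, `|a| <= 1 + Psi a).

Lemma measurable_hat_slice (G0 : set mR) (A : set (M4 R)) : measurable G0 -> G0 `<=` `[0, T]%classic -> measurable A ->
  measurable_fun setT (fun s => \int[leb4]_(x in A) (Psi (hat G0 g (x, s)))%:E)%E.
Proof.
move=> mG0 G0T mA; apply: (measurable_set_slice_integral (g := fun z => Psi (hat G0 g z))) => //.
exact: (measurableT_comp mPsi (measurable_hat mG0 G0T mg)).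
Qed.

Lemma hat_total_le (A : set (M4 R)) : measurable A ->
  (\int[leb]_s \int[leb4]_(x in A) (Psi (hat Gam g (x, s)))%:E <=
   \int[leb]_s \int[leb4]_(x in A) (Psi (hat J g (x, s)))%:E)%E.
Proof.
move=> mA; apply: ge0_le_integralT.
- exact: measurable_hat_slice.
- exact: measurable_hat_slice.
- by move=> s; apply: integral_ge0 => x _; rewrite lee_fin.
- by move=> s; exact: hat_slice_le.
Qed.

Lemma hat_stint : (forall s, Gam s -> \int[leb4]_x (Psi (hat J g (x, s)))%:E < +oo)%E ->
  (\int[leb]_s \int[leb4]_x (Psi (hat J g (x, s)))%:E < +oo)%E -> stint (hat Gam g).
Proof.
move=> fin tot.
have z0 (z : M4 R * mR) : ~ `[0, T]%classic z.2 -> hat Gam g z = 0.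
  by move=> zT; rewrite /hat indicE memNset ?mul0r// => /GamT; exact: zT.
have sl s : (\int[leb4]_x (Psi (hat Gam g (x, s)))%:E < +oo)%E.
  have [sG|sG] := pselect (Gam s).
    by apply: le_lt_trans (fin s sG); exact: hat_slice_le.
  by rewrite integral0_eq// => x _; rewrite /hat indicE memNset// mul0r P0.
apply: (stint_growth (measurable_hat mGam GamT mg) mPsi Pge grow z0 sl).
by apply: le_lt_trans tot; exact: hat_total_le.
Qed.

End Growth.

Variables (chi : R4 R -> R) (u : R4 R * R -> 'rV[R]_4) (Du : R4 R * R -> 'M[R]_4) (N1 : R).
Hypotheses (Cchi : Ccinfty chi).
Hypothesis mu : forall i, measurable_fun ST (fun z => u z 0 i).
Hypothesis mDu : forall i j, measurable_fun ST (fun z => Du z i j).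
Hypothesis su : forall i, stint (hat Gam (fun z => u z 0 i)).
Hypothesis sDu : forall i j, stint (hat Gam (fun z => Du z i j)).
Hypothesis uN : forall s i, (\int[leb4]_x (hat Gam (fun z => u z 0 i) (x, s) ^+ 2)%:E <= N1%:E)%E.

Lemma measurable_transport i j : measurable_fun ST (fun z => Defs.conv chi u z 0 j * Du z i j).
Proof.
apply: measurable_funM => //; have ms : measurable ST by exact: measurableX.
have mr : measurable_fun setT ((fun z => u z 0 j) \_ ST) by exact/(measurable_restrictT _ ms).
have := measurable_cv_joint (Ccinfty_Cc Cchi) mr => /(measurable_funTS (D := ST)).
apply: eq_measurable_fun => z /set_mem [_ zT]; rewrite /Defs.conv mxE; apply: eq_Rintegral => y _.
by rewrite patchE mem_set.
Qed.

(** The convolved velocity is bounded on each cube uniformly in time: by [cv_le] and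
    [|a| <= 1 + a^2] it is controlled by the measure of a cube plus [N1]. *)
Lemma stint_transport i j : stint (hat Gam (fun z => Defs.conv chi u z 0 j * Du z i j)).
Proof.
have Cc := Ccinfty_Cc Cchi; have [C [a [C0 a0 kC]]] := cv_le Cc.
pose b (z : M4 R * mR) := cv chi (fun y => hat Gam (fun z => u z 0 j) (y, z.2)) z.1.
have [mhu _ lu] := su j; have [mh ih lh] := sDu i j.
have mb : measurable_fun setT b by exact: measurable_cv_joint.
have bb r : exists M, forall (x : R4 R) s, `|x| <= r -> `|b (x, s)| <= M.
  exists (C * (fine (leb4 (cube (a + r)) : \bar R) + N1)) => x s xr.
  apply: (le_trans (kC _ _ _ (lu s) xr)); apply: ler_wpM2l => //.
  have mC := @measurable_cube R (a + r).
  have iv : leb4.-integrable setT (EFin \o (fun y => \1_(cube (a + r)) y * `|hat Gam (fun z => u z 0 j) (y, s)|)).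
    apply: (integrable_setT_zero (m := leb4) mC).
      by move=> y yr; rewrite indicE memNset// mul0r.
    have := integrable_norm ((lu s).2 (a + r)); apply: eq_integrable => // y yr /=.
    by rewrite indicE yr mul1r.
  pose g1 (y : M4 R) : R := \1_(cube (a + r)) y.
  pose g2 (y : M4 R) : R := hat Gam (fun z => u z 0 j) (y, s) ^+ 2.
  have m1 : measurable_fun setT g1 by exact: measurable_indic.
  have m2 : measurable_fun setT g2 by apply: measurable_funX; exact: (lu s).1.
  have p1 y : setT y -> 0 <= g1 y by rewrite /g1 indicE.
  have p2 y : setT y -> 0 <= g2 y by move=> _; exact: sqr_ge0.
  have le y : setT y -> \1_(cube (a + r)) y * `|hat Gam (fun z => u z 0 j) (y, s)| <= 1 * g1 y + 1 * g2 y.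
    move=> _; rewrite !mul1r /g1 /g2 indicE; case: (y \in _); last by rewrite mul0r add0r sqr_ge0.
    by rewrite mul1r; exact: grow_sqr.
  have b1 : (\int[leb4]_y (g1 y)%:E <= (fine (leb4 (cube (a + r)) : \bar R))%:E)%E.
    by rewrite integral_indic ?setIT ?fineK ?ge0_fin_numE ?leb4_cube_lty.
  have := Rintegral_le2 measurableT iv m1 m2 p1 p2 ler01 ler01 le b1 (uN s j).
  by rewrite !mul1r.
have -> : hat Gam (fun z => Defs.conv chi u z 0 j * Du z i j) = (fun z => b z * hat Gam (fun z => Du z i j) z).
  by apply/funext => z; rewrite hat_transport.
split; first exact: measurable_funM.
- move=> r; have [M hM] := bb r.
  have mI : measurable_fun setT (fun z : M4 R * mR => \1_(cube r) z.1 : R).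
    have m1 : measurable_fun setT (\1_(cube r) : M4 R -> R) by apply: measurable_indic; exact: measurable_cube.
    exact: (measurableT_comp m1 measurable_fst).
  pose h (z : M4 R * mR) : R := \1_(cube r) z.1 * b z.
  have mh' : measurable_fun setT h by exact: measurable_funM.
  have hb (z : M4 R * mR) : setT z -> `|h z| <= `|M|.
    move=> _; rewrite /h indicE; have [/set_mem zr|_] := boolP (z.1 \in cube r); last by rewrite mul0r normr0.
    by rewrite mul1r (le_trans _ (ler_norm _))//; case: z zr => x s /= xr; exact: hM.
  have := integrable_bounded_mul measurableT mh' hb (ih r).
  congr (_.-integrable _ _); apply/funext => z /=; congr (_%:E).
  by rewrite /h !indicE; case: (z.1 \in _); rewrite ?mul1r ?mul0r.
- by move=> s; exact: (locbd_locint (locbd_cv Cc (lu s)) (lh s)).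
Qed.

End OneSolution.

(** * Tails of one solution *)

Section SolutionTails.
Context {R : realType}.
Local Notation mR := (measurableTypeR R).
Local Notation leb := (@lebesgue_measure R).

(** The plateau of radius [T + 1] makes [theta] constant in a neighbourhood of [0, T], so its
    derivative vanishes up to both ends. *)
Lemma time_cutoff_exists (S : R -> R) (T : R) : smooth_step S -> 0 <= T -> exists theta : R -> R,
  [/\ smooth theta, forall s, `|s| <= T + 1 -> theta s = 1 &
      forall s, 2 * (T + 1) < `|s| -> theta s = 0].
Proof.
move=> step T0; have T1 : 0 < T + 1 by rewrite ltr_wpDl.
have [kappa [sk _ k1 k0]] := bump_exists step.
exists (fun s => kappa (0 + (T + 1)^-1 * s)); split.
- apply: (smooth_affine (L := fun s : R => (T + 1)^-1 * s)) => //.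
    by move=> h y w; rewrite mulrDr; congr (_ + _); exact: mulrCA.
  by move=> s; apply: cvgM; [exact: cvg_cst|exact: cvg_id].
- move=> s hs; rewrite add0r k1// normrM gtr0_norm ?invr_gt0// mulrC ler_pdivrMr// mul1r.
  exact: hs.
- move=> s hs; rewrite add0r k0// normrM gtr0_norm ?invr_gt0// mulrC ltr_pdivlMr//.
Qed.

(** The finite quantifier is reduced to the countable case by indexing with naturals through
    [inord]. *)
Lemma ae_forall4 d (X : measurableType d) (m : {measure set X -> \bar R}) (P : 'I_4 -> X -> Prop) :
  (forall i, {ae m, forall x, P i x}) -> {ae m, forall x, forall i, P i x}.
Proof.
move=> h; have h' n : {ae m, forall x, P (inord n) x} by exact: h.
have := ae_foralln h'; move=> H; apply: (ae_mono H) => x Hx i.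
by have := Hx i; rewrite inord_val.
Qed.

Variables (T : R) (S : R -> R) (C0 : R) (zeta : nat -> R4 R -> R).
Hypotheses (T0 : 0 < T) (step : smooth_step S) (C00 : 0 < C0).
Hypothesis Hz : forall n, ball_cutoff C0 n.+1%:R (zeta n).
Hypothesis annulus : forall rho r : R, 0 < rho -> rho <= r -> exists psi, annulus_cutoff (2 * C0) rho r psi.
Variable eta : nat -> R4 R -> R.
Hypothesis etaP : forall n, mollifier n.+1%:R^-1 (eta n).
Let J : set mR := `]0, T[%classic.
Let ST : set (M4 R * mR) := slab T.
Variables (chi : R4 R -> R) (u0 : R4 R -> 'rV[R]_4) (f u : R4 R * R -> 'rV[R]_4).
Variables (Du : R4 R * R -> 'M[R]_4) (p : R4 R * R -> R).
Hypotheses (Cchi : Ccinfty chi) (dchi : density chi).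
Hypothesis sol : distributional_solution T chi u0 f u Du p.
Hypothesis mu : forall i, measurable_fun ST (fun z => u z 0 i).
Hypothesis mDu : forall i j, measurable_fun ST (fun z => Du z i j).
Hypothesis mp : measurable_fun ST p.
Hypothesis mf : forall i, measurable_fun ST (fun z => f z 0 i).
Hypothesis lu0 : forall i, locint (fun y => u0 y 0 i).
Variables (N1 N2 N3 : R).
Hypothesis N10 : 0 < N1.
Hypothesis HuN : {ae leb, forall s, J s -> forall i, (\int[leb4]_x (u (x, s) 0 i ^+ 2)%:E <= N1%:E)%E}.
Hypothesis HH1 : {ae leb, forall s, J s -> weak_jacobian (fun x => u (x, s)) (fun x => Du (x, s))}.
Hypothesis HD : forall i j,
  (\int[leb]_s \int[leb4]_x (hat J (fun z => Du z i j) (x, s) ^+ 2)%:E <= N2%:E)%E.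
Hypothesis HP : (\int[leb]_s \int[leb4]_x (`|hat J p (x, s)| `^ (3 / 2))%:E <= N3%:E)%E.
Hypothesis HF : forall i,
  (\int[leb]_s \int[leb4]_x (`|hat J (fun z => f z 0 i) (x, s)| `^ (3 / 2))%:E < +oo)%E.

Let mJ : measurable J. Proof. exact: measurable_itv. Qed.
Let JT : J `<=` `[0, T]%classic.
Proof. by move=> s /=; rewrite !in_itv/= => /andP[/ltW -> /ltW ->]. Qed.

Let msq : measurable_fun setT (fun a : R => a ^+ 2). Proof. by have [] := @convex_sqr R. Qed.
Let m32 : measurable_fun setT (fun a : R => `|a| `^ (3 / 2)). Proof. by have [] := @convex_pow32 R. Qed.
Let sq0 : (0 : R) ^+ 2 = 0. Proof. by rewrite expr2 mul0r. Qed.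
Let p320 : `|0 : R| `^ (3 / 2) = 0. Proof. by rewrite normr0 powR0. Qed.

(** [HuN], [HH1] and the finiteness of the space-time integrals provide each clause at almost every
    time of [J]. *)
Let regular s := [/\ forall i, (\int[leb4]_x (u (x, s) 0 i ^+ 2)%:E <= N1%:E)%E,
  weak_jacobian (fun x => u (x, s)) (fun x => Du (x, s)),
  forall i j, (\int[leb4]_x (hat J (fun z => Du z i j) (x, s) ^+ 2)%:E < +oo)%E,
  (\int[leb4]_x (`|hat J p (x, s)| `^ (3 / 2))%:E < +oo)%E &
  forall i, (\int[leb4]_x (`|hat J (fun z => f z 0 i) (x, s)| `^ (3 / 2))%:E < +oo)%E].

Let regular_ae : {ae leb, forall s, J s -> regular s}.
Proof.
have h1 : {ae leb, forall s, forall i j, (\int[leb4]_x (hat J (fun z => Du z i j) (x, s) ^+ 2)%:E < +oo)%E}.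
  apply: ae_forall4 => i; apply: ae_forall4 => j; apply: slice_ae_finite.
  - exact: (measurable_hat_slice (mDu i j) msq (fun a => sqr_ge0 a) mJ JT measurableT).
  - by move=> s; apply: integral_ge0 => x _; rewrite lee_fin sqr_ge0.
  - exact: le_lt_trans (HD i j) (ltry _).
have h2 : {ae leb, forall s, (\int[leb4]_x (`|hat J p (x, s)| `^ (3 / 2))%:E < +oo)%E}.
  apply: slice_ae_finite.
  - exact: (measurable_hat_slice mp m32 (fun a => powR_ge0 _ _) mJ JT measurableT).
  - by move=> s; apply: integral_ge0 => x _; rewrite lee_fin powR_ge0.
  - exact: le_lt_trans HP (ltry _).
have h3 : {ae leb, forall s, forall i, (\int[leb4]_x (`|hat J (fun z => f z 0 i) (x, s)| `^ (3 / 2))%:E < +oo)%E}.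
  apply: ae_forall4 => i; apply: slice_ae_finite.
  - exact: (measurable_hat_slice (mf i) m32 (fun a => powR_ge0 _ _) mJ JT measurableT).
  - by move=> s; apply: integral_ge0 => x _; rewrite lee_fin powR_ge0.
  - exact: HF.
apply: (ae_mono (ae_and (ae_and HuN HH1) (ae_and h1 (ae_and h2 h3)))).
by move=> s [[a b] [c [d e]]] Js; split=> //; [exact: a|exact: b].
Qed.

Section Times.
Variable Gam : set mR.
Hypotheses (mGam : measurable Gam) (GamJ : Gam `<=` J) (GamR : forall s, Gam s -> regular s).

Lemma regular_uN s i : (\int[leb4]_x (hat Gam (fun z => u z 0 i) (x, s) ^+ 2)%:E <= N1%:E)%E.
Proof.
have [sG|sG] := pselect (Gam s).
  have [h _ _ _ _] := GamR sG; apply: le_trans (h i); rewrite le_eqVlt; apply/orP; left; apply/eqP.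
  by apply: eq_integral => x _; rewrite /hat indicE mem_set// mul1r.
rewrite integral0_eq; first by rewrite lee_fin ltW.
by move=> x _; rewrite /hat indicE memNset// mul0r expr2 mul0r.
Qed.

Lemma regular_stint_u i : stint (hat Gam (fun z => u z 0 i)).
Proof.
have GT : Gam `<=` `[0, T]%classic by move=> s /GamJ/JT.
have mh := measurable_hat mGam GT (mu i).
apply: (stint_growth (T := T) mh msq (fun a => sqr_ge0 a) (@grow_sqr R)).
- by move=> z zT; rewrite /hat indicE memNset ?mul0r// => /GT; exact: zT.
- by move=> s; exact: le_lt_trans (regular_uN s i) (ltry _).
apply: (@le_lt_trans _ _ (\int[leb]_s (\1_Gam s * N1)%:E)%E).
  apply: ge0_le_integralT.
  - apply: (measurable_set_slice_integral (g := fun z => hat Gam (fun z => u z 0 i) z ^+ 2)) => //.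
      exact: measurable_funX.
    by move=> z; exact: sqr_ge0.
  - by apply/measurable_EFinP; apply: measurable_funM => //; exact: measurable_indic.
  - by move=> s; apply: integral_ge0 => x _; rewrite lee_fin sqr_ge0.
  - move=> s; have [sG|sG] := pselect (Gam s).
      by rewrite indicE mem_set// mul1r; exact: regular_uN.
    rewrite integral0_eq; first by rewrite indicE memNset// mul0r.
    by move=> x _; rewrite /hat indicE memNset// mul0r expr2 mul0r.
rewrite (_ : (\int[leb]_s (\1_Gam s * N1)%:E = N1%:E * leb Gam)%E); last first.
  rewrite -[X in leb X]setIT -integral_indic// -ge0_integralZl//; last by rewrite lee_fin ltW.
    by apply: eq_integral => s _; rewrite -EFinM mulrC.
  by apply/measurable_EFinP; exact: measurable_indic.
apply: lte_mul_pinfty => //; first by rewrite lee_fin ltW.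
by apply: (le_lt_trans _ (leb_segment_lty 0 T)); apply: le_measure; rewrite ?inE.
Qed.

Lemma regular_stint_Du i j : stint (hat Gam (fun z => Du z i j)).
Proof.
apply: (hat_stint mGam GamJ (mDu i j) msq sq0 (fun a => sqr_ge0 a) (@grow_sqr R)).
- by move=> s /GamR[].
- exact: le_lt_trans (HD i j) (ltry _).
Qed.

Lemma regular_stint_p : stint (hat Gam p).
Proof.
apply: (hat_stint mGam GamJ mp m32 p320 (fun a => powR_ge0 _ _) (@grow_pow32 R)).
- by move=> s /GamR[].
- exact: le_lt_trans HP (ltry _).
Qed.

Lemma regular_stint_f i : stint (hat Gam (fun z => f z 0 i)).
Proof.
apply: (hat_stint mGam GamJ (mf i) m32 p320 (fun a => powR_ge0 _ _) (@grow_pow32 R)).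
- by move=> s /GamR[].
- exact: HF.
Qed.

Lemma regular_wk (k : R4 R -> R) i j x s : Ccinfty k ->
  cv ('D_(e4 R j) k) (fun y => hat Gam (fun z => u z 0 i) (y, s)) x =
  cv k (fun y => hat Gam (fun z => Du z i j) (y, s)) x.
Proof.
move=> Ck; have [sG|sG] := pselect (Gam s).
  rewrite !hat_on//; have [_ w _ _ _] := GamR sG; exact: (weak_jacobian_cv i j x w Ck).
rewrite !hat_off// /cv !Rintegral_eq0// => y _; exact: mulr0.
Qed.

End Times.

Variables (rho t e0 Phi : R).
Hypotheses (rho0 : 0 < rho) (t0 : 0 < t).
Hypothesis u0e : forall i, (\int[leb4]_(x in ~` cube (rho - 1)) (u0 x 0 i ^+ 2)%:E <= e0%:E)%E.
Hypothesis FPhi : forall i, (\int[leb]_s \int[leb4]_(x in ~` cube (rho - 1))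
  (`|hat J (fun z => f z 0 i) (x, s)| `^ (3 / 2))%:E <= Phi%:E)%E.

(** In [X] the mollification radius and the commutator constant are 0, so that no quantity attached
    to [chi] remains and the bound is the same for all members of the sequence. *)
Lemma solution_tails : let X := tail_bound T C0 0 (2 * C0 / rho) N1 0 t e0 (16 * N2) N3 (4 * Phi) in
  exists Gam : set mR, [/\ measurable Gam, Gam `<=` J, leb (`[0, T]%classic `\` Gam) = 0%E &
  [/\ forall i s, Gam s ->
      (\int[leb4]_(x in ~` cube (2 * rho)) (hat Gam (fun z => u z 0 i) (x, s) ^+ 2)%:E <= X%:E)%E,
    forall i j, (\int[leb]_s \int[leb4]_(x in ~` cube (2 * rho))
      (hat Gam (fun z => Du z i j) (x, s) ^+ 2)%:E <= X%:E)%E &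
    forall i (sigma : R), 0 < sigma -> (\int[leb]_s \int[leb4]_(x in ~` cube (2 * rho))
      (`|hat Gam (fun z => u z 0 i) (x, s)| ^+ 3)%:E <=
      (2^-1 * (X / sigma + sigma * sobolev_constant C0) * (N1 * T + 16 * N2))%:E)%E]].
Proof.
(* Times are taken in the open interval because the divergence is tested on functions supported in
   the open slab; the two end points are negligible. *)
move=> X; have [G1 [mG1 G1J G1E G1R]] := good_times mJ (open_interval_full T) regular_ae.
have [divu lu _] := sol.
have hdiv k : Ccinfty k -> {ae leb, forall s, {ae leb4, forall x,
    \sum_i cv k (fun y => hat G1 (fun z => Du z i i) (y, s)) x = 0}}.
  move=> Ck; exact: (divergence_ae mG1 G1J G1E mu (regular_stint_u mG1 G1J G1R)
    (regular_stint_Du mG1 G1J G1R) (regular_wk G1R) divu Ck step).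
have hdivn n := hdiv (eta n) (let: And4 c _ _ _ := etaP n in c).
have hall := ae_and (ae_foralln hdivn) (hdiv chi Cchi).
(* The kernels [eta n] are countably many, so one null set of times serves them all. The divergences
   are those of the fields zeroed outside [G1], hence this second selection of times. *)
have hall' : {ae leb, forall s, G1 s -> (forall n, {ae leb4, forall x,
      \sum_i cv (eta n) (fun y => hat G1 (fun z => Du z i i) (y, s)) x = 0}) /\
    {ae leb4, forall x, \sum_i cv chi (fun y => hat G1 (fun z => Du z i i) (y, s)) x = 0}}.
  by apply: (ae_mono hall) => s h _.
have [Gam [mGam GG1 GamE Gdiv]] := good_times mG1 G1E hall'.
have GamJ : Gam `<=` J by move=> s /GG1/G1J.
have GamR s : Gam s -> regular s by move=> /GG1/G1R.
have GamT : Gam `<=` `[0, T]%classic by move=> s /GamJ/JT.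
have su := regular_stint_u mGam GamJ GamR; have sDu := regular_stint_Du mGam GamJ GamR.
have sp := regular_stint_p mGam GamJ GamR; have sf := regular_stint_f mGam GamJ GamR.
have wk := regular_wk GamR; have uN := regular_uN GamR.
have mb := measurable_transport Cchi mu mDu.
have sb i j := stint_transport Cchi su sDu uN i j.
have divG (k : R4 R -> R) s : (exists n, k = eta n) \/ k = chi ->
    {ae leb4, forall x, \sum_i cv k (fun y => hat Gam (fun z => Du z i i) (y, s)) x = 0}.
  move=> hk; have [sG|sG] := pselect (Gam s); last first.
    by apply: aeW => x; rewrite big1// => i _; rewrite hat_off//; apply: Rintegral_eq0 => y _; exact: mulr0.
  have [d1 d2] := Gdiv s sG.
  case: hk => [[n ->]|->]; [apply: (ae_mono (d1 n))|apply: (ae_mono d2)] => x h; rewrite -[RHS]h;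
    by apply: eq_bigr => i _; rewrite (hat_on _ sG) (hat_on _ (GG1 _ sG)).
have [theta [sth th1 th0]] := time_cutoff_exists step (ltW T0).
have [L L0 mod] := cv_modulus Cchi.
pose I i j s := (\int[leb4]_x (hat Gam (fun z => Du z i j) (x, s) ^+ 2)%:E)%E.
have Ifin i j := @fine_integrable R (I i j) N2
  (measurable_hat_slice (mDu i j) msq (fun a => sqr_ge0 a) mGam GamT measurableT).
have {}Ifin i j : [/\ leb.-integrable setT (EFin \o (fun s => fine (I i j s))), forall s, 0 <= fine (I i j s),
      forall s, I i j s = (fine (I i j s))%:E & \int[leb]_s fine (I i j s) <= N2].
  apply: Ifin.
  - by move=> s; apply: integral_ge0 => x _; rewrite lee_fin sqr_ge0.
  - move=> s; have [sG|sG] := pselect (Gam s).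
      have [_ _ h _ _] := GamR s sG; apply: le_lt_trans (h i j).
      exact: (@hat_slice_le R T Gam GamJ (fun z => Du z i j) (fun a => a ^+ 2) setT s sq0 (fun a => sqr_ge0 a)).
    by rewrite /I integral0_eq// => x _; rewrite /hat indicE memNset// mul0r expr2 mul0r.
  - exact: le_trans (hat_total_le mGam GamJ (mDu i j) msq sq0 (fun a => sqr_ge0 a) measurableT) (HD i j).
pose Ip s := (\int[leb4]_x (`|hat Gam p (x, s)| `^ (3 / 2))%:E)%E.
have Ipfin : [/\ leb.-integrable setT (EFin \o (fun s => fine (Ip s))), forall s, 0 <= fine (Ip s),
      forall s, Ip s = (fine (Ip s))%:E & \int[leb]_s fine (Ip s) <= N3].
  apply: fine_integrable.
  - exact: (measurable_hat_slice mp m32 (fun a => powR_ge0 _ _) mGam GamT measurableT).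
  - by move=> s; apply: integral_ge0 => x _; rewrite lee_fin powR_ge0.
  - move=> s; have [sG|sG] := pselect (Gam s).
      have [_ _ _ h _] := GamR s sG; apply: le_lt_trans h.
      exact: (@hat_slice_le R T Gam GamJ p (fun a => `|a| `^ (3 / 2)) setT s p320 (fun a => powR_ge0 _ _)).
    by rewrite /Ip integral0_eq// => x _; rewrite /hat indicE memNset// mul0r p320.
  - exact: le_trans (hat_total_le mGam GamJ mp m32 p320 (fun a => powR_ge0 _ _) measurableT) HP.
have mE : measurable (~` cube (rho - 1) : set (M4 R)) by apply: measurableC; exact: measurable_cube.
pose If i s := (\int[leb4]_(x in ~` cube (rho - 1)) (`|hat Gam (fun z => f z 0 i) (x, s)| `^ (3 / 2))%:E)%E.
have Iffin i : [/\ leb.-integrable setT (EFin \o (fun s => fine (If i s))), forall s, 0 <= fine (If i s),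
      forall s, If i s = (fine (If i s))%:E & \int[leb]_s fine (If i s) <= Phi].
  apply: fine_integrable.
  - exact: (measurable_hat_slice (mf i) m32 (fun a => powR_ge0 _ _) mGam GamT mE).
  - by move=> s; apply: integral_ge0 => x _; rewrite lee_fin powR_ge0.
  - move=> s; have [sG|sG] := pselect (Gam s).
      have [_ _ _ _ h] := GamR s sG; apply: le_lt_trans (h i).
      apply: (le_trans (@hat_slice_le R T Gam GamJ (fun z => f z 0 i) (fun a => `|a| `^ (3 / 2)) (~` cube (rho - 1)) s p320 (fun a => powR_ge0 _ _))).
      have mh := measurable_hat mJ JT (mf i).
      have mg : measurable_fun setT (fun x : M4 R => (`|hat J (fun z => f z 0 i) (x, s)| `^ (3 / 2))%:E).
        apply/measurable_EFinP; apply: (measurableT_comp m32).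
        exact: (measurableT_comp mh (pair2_measurable s)).
      have g0 (x : M4 R) : setT x -> (0 <= (`|hat J (fun z => f z 0 i) (x, s)| `^ (3 / 2))%:E)%E.
        by move=> _; rewrite lee_fin powR_ge0.
      by apply: ge0_subset_integral.
    by rewrite /If integral0_eq// => x _; rewrite /hat indicE memNset// mul0r p320.
  - exact: le_trans (hat_total_le mGam GamJ (mf i) m32 p320 (fun a => powR_ge0 _ _) mE) (FPhi i).
(* Summing over the entries gives one majorant for all components, at the price of the factors 16
   and 4 in the bound. *)
pose Dfun s := \sum_i \sum_j fine (I i j s); pose Pfun s := fine (Ip s); pose Ffun s := \sum_i fine (If i s).
have iD2 i : leb.-integrable setT (EFin \o (fun s => \sum_j fine (I i j s))).
  by apply: integrable_sum4 => j; have [] := Ifin i j.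
have iD : leb.-integrable setT (EFin \o Dfun) by exact: integrable_sum4.
have iF : leb.-integrable setT (EFin \o Ffun) by apply: integrable_sum4 => i; have [] := Iffin i.
have [iP P0 PE PN3] := Ipfin.
have D0 s : 0 <= Dfun s by apply: sumr_ge0 => i _; apply: sumr_ge0 => j _; have [_ h _ _] := Ifin i j.
have F0 s : 0 <= Ffun s by apply: sumr_ge0 => i _; have [_ h _ _] := Iffin i.
have DN s i j : (\int[leb4]_x (hat Gam (fun z => Du z i j) (x, s) ^+ 2)%:E <= (Dfun s)%:E)%E.
  have [_ _ h _] := Ifin i j; rewrite -/(I i j s) h lee_fin.
  by apply: (le_sum44 (F := fun i j => fine (I i j s))) => k l; have [_ h' _ _] := Ifin k l.
have pN s : (\int[leb4]_x (`|hat Gam p (x, s)| `^ (3 / 2))%:E <= (Pfun s)%:E)%E by rewrite -/(Ip s) PE.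
have fN s i : (\int[leb4]_(x in ~` cube (rho - 1)) (`|hat Gam (fun z => f z 0 i) (x, s)| `^ (3 / 2))%:E <= (Ffun s)%:E)%E.
  have [_ _ h _] := Iffin i; rewrite -/(If i s) h lee_fin /Ffun (bigD1 i)//= lerDl.
  by apply: sumr_ge0 => j _; have [_ h' _ _] := Iffin j.
have DN2 : \int[leb]_s Dfun s <= 16 * N2.
  rewrite (Rintegral_sum4 measurableT iD2) -sum_const44; apply: ler_sum => i _.
  have iDj j : leb.-integrable setT (EFin \o (fun s => fine (I i j s))) by have [] := Ifin i j.
  rewrite (Rintegral_sum4 measurableT iDj); apply: ler_sum => j _.
  by have [_ _ _ h] := Ifin i j; exact: h.
have FP : \int[leb]_s Ffun s <= 4 * Phi.
  have iFi i : leb.-integrable setT (EFin \o (fun s => fine (If i s))) by have [] := Iffin i.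
  rewrite (Rintegral_sum4 measurableT iFi) -sum_const4; apply: ler_sum => i _.
  by have [_ _ _ h] := Iffin i; exact: h.
have lu' t' i : 0 <= t' <= T -> locint (fun y => u (y, t') 0 i).
  by move=> h; apply: locally_integrable_locint; exact: lu.
(* [L] only enters multiplied by the mollification radius, which is 0 in the limit. *)
have XE : tail_bound T C0 0 (2 * C0 / rho) N1 L t e0 (16 * N2) N3 (4 * Phi) = X.
  by rewrite /X /tail_bound /energy_rate !mulr0.
have mod' (v : R4 R -> R) (N d : R) (x y : R4 R) : locint v ->
  (\int[leb4]_z (v z ^+ 2)%:E <= N%:E)%E -> d <= 1 -> `|x - y| <= d ->
  `|cv chi v x - cv chi v y| <= L * (1 + N) * d by exact: mod.
exists Gam; split=> //; split.
- move=> i s sG; rewrite -XE.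
  exact: (lim_velocity mGam GamT GamE sol mDu mb mp mf su sDu sb sp sf lu0 lu' sth th1 th0 C00 Hz annulus
    etaP Cchi dchi rho0 wk divG N10 uN iD iP iF D0 P0 F0 DN pN fN (ltW L0) mod' t0 u0e DN2 PN3 FP i sG).
- move=> i j; rewrite -XE.
  exact: (lim_gradient mGam GamT GamE sol mDu mb mp mf su sDu sb sp sf lu0 lu' sth th1 th0 C00 Hz annulus
    etaP Cchi dchi rho0 wk divG N10 uN iD iP iF D0 P0 F0 DN pN fN (ltW L0) mod' t0 u0e (ltW T0) DN2 PN3 FP i j).
- move=> i sigma sg; rewrite -XE.
  exact: (lim_cube mGam GamT GamE sol mDu mb mp mf su sDu sb sp sf lu0 lu' sth th1 th0 C00 Hz annulus
    etaP Cchi dchi rho0 wk divG N10 uN iD iP iF D0 P0 F0 DN pN fN (ltW L0) mod' t0 u0e (ltW T0) DN2 PN3 FP i sg).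
Qed.

End SolutionTails.

(** * Reading the norms of the hypotheses, and choice of the constants *)

Section Tightness.
Context {R : realType}.
Local Notation mR := (measurableTypeR R).
Local Notation leb := (@lebesgue_measure R).

Lemma open_sub_segment (T : R) : (`]0, T[%classic : set mR) `<=` `[0, T]%classic.
Proof. by move=> s /=; rewrite !in_itv/= => /andP[/ltW -> /ltW ->]. Qed.

Lemma norm2_poweR m n (w : M4 R -> 'M[R]_(m, n)) :
  (`|Lp_norm leb4 setT 2%:E (fun x => euclid (w x))| `^ 2 =
   \int[leb4]_x (\sum_i \sum_j w x i j ^+ 2)%:E)%E.
Proof.
rewrite gee0_abs ?Lnorm_ge0// /Lp_norm poweR_Lnorm//; apply: eq_integral => x _.
rewrite patchE mem_set//.
have -> : `|(EFin \o (fun x => euclid (w x))) x|%E = (euclid (w x))%:E.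
  by rewrite /= ger0_norm ?euclid_ge0.
by rewrite poweR_EFin powR_mulrn ?euclid_ge0// euclid_sqr.
Qed.

Lemma mixed_sup_slices (T C : R) m n (v : M4 R * mR -> 'M[R]_(m, n)) :
  (mixed_norm T +oo 2%:E v <= C%:E)%E ->
  {ae leb, forall s, `[0, T]%classic s -> (\int[leb4]_x (\sum_i \sum_j v (x, s) i j ^+ 2)%:E <= (C `^ 2)%:E)%E}.
Proof.
(* The norm with exponent +oo is an essential supremum when the total mass is positive, hence the
   comparison with the unit segment. *)
rewrite /mixed_norm unlock ifT; last first.
  apply: (@lt_le_trans _ _ (leb `[0%R, 1%R]%classic)).
    by rewrite lebesgue_measure_itv/= lte_fin ltr01 -EFinD lte_fin subr0 ltr01.
  by apply: le_measure; rewrite ?inE//.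
move=> /ess_supP h; apply: (ae_mono h) => s; rewrite /= patchE => hs sT.
rewrite mem_set// in hs; rewrite -norm2_poweR -poweR_EFin; apply: gt0_ler_poweR => //.
- by rewrite in_itv/= abse_ge0 leey.
- by rewrite in_itv/= leey andbT; apply: le_trans hs; exact: abse_ge0.
Qed.

Lemma measurable_slice (T s : R) m n (v : M4 R * mR -> 'M[R]_(m, n)) i j :
  measurable_mx (slab T) v -> `[0, T]%classic s -> measurable_fun setT (fun x : M4 R => v (x, s) i j).
Proof.
move=> mv sT; have mT : measurable (`[0, T]%classic : set mR) by exact: measurable_itv.
have mh := measurable_hat mT (@subset_refl _ _) (mv i j).
have := measurableT_comp mh (@pair2_measurable _ _ (M4 R) mR s).
by congr measurable_fun; apply/funext => x /=; rewrite /hat indicE mem_set// mul1r.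
Qed.

Lemma mixed_sup_component (T C : R) (v : M4 R * mR -> 'rV[R]_4) : measurable_mx (slab T) v ->
  (mixed_norm T +oo 2%:E v <= C%:E)%E ->
  {ae leb, forall s, `]0, T[%classic s -> forall i, (\int[leb4]_x (v (x, s) 0 i ^+ 2)%:E <= (C `^ 2)%:E)%E}.
Proof.
move=> mv /mixed_sup_slices h; apply: (ae_mono h) => s hs /open_sub_segment sT i.
apply: le_trans (hs sT); have ms k := measurable_slice 0 k mv sT.
apply: ge0_le_integralT.
- by apply/measurable_EFinP; exact: measurable_funX.
- apply/measurable_EFinP; apply: measurable_sum => k; apply: measurable_sum => l.
  by rewrite (ord1 k); exact: measurable_funX.
- by move=> x; rewrite lee_fin sqr_ge0.
- by move=> x; rewrite lee_fin big_ord1 (bigD1 i)//= lerDl sumr_ge0// => k _; exact: sqr_ge0.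
Qed.

Lemma mixed_L2_component (T C : R) (w : M4 R * mR -> 'M[R]_4) : measurable_mx (slab T) w ->
  (mixed_norm T 2%:E 2%:E w <= C%:E)%E -> forall i j,
  (\int[leb]_s \int[leb4]_x (hat `]0, T[%classic (fun z => w z i j) (x, s) ^+ 2)%:E <= (C `^ 2)%:E)%E.
Proof.
rewrite /mixed_norm => mw hw i j; have two0 : (0 : R) < 2 by [].
have h := Lnorm_le two0 hw; apply: le_trans h.
set I : set mR := `[0, T]%classic; have mI : measurable I by exact: measurable_itv.
have II : I `<=` `[0, T]%classic by [].
have mh k l := measurable_hat mI II (mw k l).
have mJ : measurable (`]0, T[%classic : set mR) by exact: measurable_itv.
have mhJ := measurable_hat mJ (@open_sub_segment T) (mw i j).
pose Q (z : M4 R * mR) := \sum_k \sum_l hat I (fun z => w z k l) z ^+ 2.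
have mQ : measurable_fun setT Q.
  by apply: measurable_sum => k; apply: measurable_sum => l; exact: measurable_funX.
have Q0 z : 0 <= Q z by apply: sumr_ge0 => k _; apply: sumr_ge0 => l _; exact: sqr_ge0.
rewrite [leRHS](_ : _ = \int[leb]_s \int[leb4]_x (Q (x, s))%:E)%E; last first.
  apply: eq_integral => s _; rewrite patchE; case: ifPn => [/set_mem sI|sI].
    rewrite norm2_poweR; apply: eq_integral => x _; congr EFin.
    by apply: eq_bigr => k _; apply: eq_bigr => l _; rewrite /hat indicE mem_set// mul1r.
  (* Outside the segment the restriction takes the default value [point] of the extended reals,
     which is 0. *)
  have -> : (`|(point : \bar R)| `^ 2 = 0)%E by rewrite (_ : point = 0%:E)// abse0 poweR_EFin powR0// pnatr_eq0.
  rewrite integral0_eq// => x _; rewrite /Q big1// => k _; rewrite big1// => l _.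
  by rewrite /hat indicE (negbTE sI) mul0r expr0n.
apply: ge0_le_integralT.
- exact: (measurable_set_slice_integral (measurable_funX _ mhJ) (fun z => sqr_ge0 _) measurableT).
- exact: (measurable_set_slice_integral mQ Q0 measurableT).
- by move=> s; apply: integral_ge0 => x _; rewrite lee_fin sqr_ge0.
move=> s; apply: ge0_le_integralT.
- apply/measurable_EFinP; apply: measurable_funX; exact: (measurableT_comp mhJ (pair2_measurable s)).
- apply/measurable_EFinP; exact: (measurableT_comp mQ (pair2_measurable s)).
- by move=> x; rewrite lee_fin sqr_ge0.
move=> x; rewrite lee_fin; have [sJ|sJ] := pselect (`]0, T[%classic s).
  have -> : hat `]0, T[%classic (fun z => w z i j) (x, s) = hat I (fun z => w z i j) (x, s).
    by rewrite /hat !indicE !mem_set//; exact: open_sub_segment.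
  by apply: (le_sum44 (F := fun k l => hat I (fun z => w z k l) (x, s) ^+ 2)) => k l; exact: sqr_ge0.
by rewrite {1}/hat indicE memNset// mul0r expr0n; exact: Q0.
Qed.

Lemma tonelli_slices (K : M4 R * mR -> \bar R) : measurable_fun setT K -> (forall z, 0 <= K z)%E ->
  (\int[leb41]_z K z = \int[leb]_s \int[leb4]_x K (x, s))%E.
Proof. by move=> mK K0; exact: (fubini_tonelli2 K mK K0). Qed.

Lemma slab_L32_component (T : R) (q g : M4 R * mR -> R) :
  measurable_fun (slab T : set (M4 R * mR)) q -> measurable_fun (slab T : set (M4 R * mR)) g ->
  (forall z, `|q z| <= `|g z|) ->
  (\int[leb]_s \int[leb4]_x (`|hat `]0, T[%classic q (x, s)| `^ (3 / 2))%:E <=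
   \int[leb41]_z (`|((EFin \o g) \_ (slab T)) z| `^ (3 / 2)))%E.
Proof.
move=> mq mg qg; have mJ : measurable (`]0, T[%classic : set mR) by exact: measurable_itv.
have mhJ := measurable_hat mJ (@open_sub_segment T) mq.
have m32 : measurable_fun setT (fun a : R => `|a| `^ (3 / 2)) by have [] := @convex_pow32 R.
have mS : measurable (slab T : set (M4 R * mR)) by exact: measurableX.
have mr : measurable_fun setT (g \_ (slab T : set (M4 R * mR))) by exact/(measurable_restrictT _ mS).
rewrite -(@tonelli_slices (fun z => (`|hat `]0, T[%classic q z| `^ (3 / 2))%:E)).
- rewrite [leRHS](_ : _ = \int[leb41]_z (`|(g \_ (slab T)) z| `^ (3 / 2))%:E)%E; last first.
    by apply: eq_integral => z _; rewrite !patchE; case: ifP => //= _; rewrite ?normr0 ?abse0.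
  apply: ge0_le_integralT.
  + apply/measurable_EFinP; exact: (measurableT_comp m32 mhJ).
  + apply/measurable_EFinP; exact: (measurableT_comp m32 mr).
  + by move=> z; rewrite lee_fin powR_ge0.
  + move=> z; rewrite lee_fin; apply: ge0_ler_powR; rewrite ?nnegrE ?normr_ge0//.
    have [sJ|sJ] := pselect (`]0, T[%classic z.2).
      by rewrite /hat indicE mem_set// mul1r patchE mem_set//; split=> //; exact: open_sub_segment.
    by rewrite /hat indicE memNset// mul0r normr0.
- apply/measurable_EFinP; exact: (measurableT_comp m32 mhJ).
- by move=> z; rewrite lee_fin powR_ge0.
Qed.

(** Passing from [0, T] to [Gam] changes the integrand on a null set only; Tonelli then puts the
    time integral outside. *)
Lemma slab_tail_slices (T : R) (Gam : set mR) (q : M4 R * mR -> R) (Psi : R -> R) (E : set (M4 R)) :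
  measurable Gam -> Gam `<=` `[0, T]%classic -> leb (`[0, T]%classic `\` Gam) = 0%E ->
  measurable E -> measurable_fun (slab T : set (M4 R * mR)) q -> measurable_fun setT Psi ->
  Psi 0 = 0 -> (forall a, 0 <= Psi a) ->
  (\int[leb41]_(z in E `*` `[0%R, T]%classic) (Psi (q z))%:E =
   \int[leb]_s \int[leb4]_(x in E) (Psi (hat Gam q (x, s)))%:E)%E.
Proof.
move=> mGam GamT GamE mE mq mPsi P0 Pge.
pose G (z : M4 R * mR) : \bar R := (\1_E z.1 * Psi (hat Gam q z))%:E.
have mh := measurableT_comp mPsi (measurable_hat mGam GamT mq).
have mI : measurable_fun setT (\1_E : M4 R -> R) by exact: measurable_indic.
have mG : measurable_fun setT G.
  apply/measurable_EFinP; apply: measurable_funM; last exact: mh.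
  exact: (measurableT_comp mI measurable_fst).
have mS : measurable (E `*` `[0, T]%classic : set (M4 R * mR)) by exact: measurableX.
have mST : measurable (slab T : set (M4 R * mR)) by exact: measurableX.
transitivity (\int[leb41]_z G z)%E.
  rewrite [LHS]integral_mkcond; apply: ae_eq_integral => //.
    apply/(measurable_restrictT _ mS); apply/measurable_EFinP; apply: (measurableT_comp mPsi).
    by apply: (measurable_funS mST _ mq) => z [].
  apply: (ae_mono (slab_ae mGam GamT GamE (fun z => Psi (q z)) (lexx T))) => z hz _.
  rewrite patchE /G; have [zG|zG] := pselect (Gam z.2).
    rewrite /hat !indicE (mem_set zG) mul1r.
    have [zE|zE] := pselect (E z.1); first by rewrite !mem_set ?mul1r//; split=> //; exact: GamT.
    by rewrite !memNset ?mul0r// => -[].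
  rewrite /hat !indicE (memNset zG) mul0r P0 mulr0; case: ifPn => // /set_mem[_ zT].
  by move: hz; rewrite patchE mem_set// /hat indicE (memNset zG) mul0r mulr0/= => ->.
rewrite (tonelli_slices mG); last by move=> z; rewrite lee_fin mulr_ge0// indicE.
by apply: eq_integral => s _; rewrite -integral_indic_mul.
Qed.

Lemma integral_sum4_le d (X : measurableType d) (m : {measure set X -> \bar R}) (D : set X)
  (F : 'I_4 -> X -> R) (c : R) : measurable D -> (forall i, measurable_fun D (F i)) ->
  (forall i x, 0 <= F i x) -> (forall i, \int[m]_(x in D) (F i x)%:E <= c%:E)%E ->
  (\int[m]_(x in D) (\sum_i F i x)%:E <= (4 * c)%:E)%E.
Proof.
move=> mD mF F0 hF; under eq_integral do rewrite -sumEFin.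
rewrite ge0_integral_sum//.
- by rewrite -sum_const4 -sumEFin; apply: lee_sum.
- by move=> i; apply/measurable_EFinP.
- by move=> i x _; rewrite lee_fin.
Qed.

Lemma tails_small4 (g : 'I_4 -> M4 R -> \bar R) (delta : R) :
  (forall i, measurable_fun setT (g i)) -> (forall i x, 0 <= g i x)%E ->
  (forall i, \int[leb4]_x g i x < +oo)%E -> 0 < delta ->
  exists m : nat, forall i (r : R), m%:R <= r -> (\int[leb4]_(x in ~` cube r) g i x <= delta%:E)%E.
Proof.
move=> mg g0 goo d0.
have /choice[m hm] : forall i, exists m : nat, (\int[leb4]_(x in ~` cube m%:R) g i x <= delta%:E)%E.
  by move=> i; exact: tail_small.
exists (\sum_i m i)%N => i r mr; apply: le_trans (hm i).
have mC (s : R) : measurable (~` cube s : set (M4 R)) by apply: measurableC; exact: measurable_cube.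
have sub : (~` cube r : set (M4 R)) `<=` ~` cube (m i)%:R.
  move=> x h hx; apply: h; apply: (le_trans hx); apply: le_trans mr.
  by rewrite ler_nat (bigD1 i)//= leq_addr.
have g0' x : (~` cube (m i)%:R) x -> (0 <= g i x)%E by [].
have m1 := mC r; have m2 := mC (m i)%:R.
have m3 := measurable_funTS (D := ~` cube (m i)%:R) (mg i).
by apply: ge0_subset_integral.
Qed.

(** Young's weight [t] is fixed before the rest, as it governs a term that no choice of [rho]
    reduces; [Phi] must then beat [t^(-3/2)], and [rho] acts through [kappa = 2 C0 / rho]. Each of
    the four terms receives [delta / 4]. *)
Lemma tail_bound_small (T C0 N1 N2 N3 delta : R) : 0 < T -> 0 < N1 -> 0 <= N2 -> 0 < C0 -> 0 <= N3 -> 0 < delta ->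
  exists t e0 Phi rho0 : R, [/\ 0 < t, 0 < e0, 0 < Phi & forall rho, 0 < rho -> rho0 <= rho ->
    tail_bound T C0 0 (2 * C0 / rho) N1 0 t e0 N2 N3 Phi <= delta].
Proof.
move=> T0 N10 N20 C00 N30 d0; pose cS := 2^-1 * (N1 + sobolev_constant C0); pose K := N1 * T + N2.
have S0 : 0 <= sobolev_constant C0 by rewrite /sobolev_constant mulr_ge0// sqr_ge0.
have cS0 : 0 < cS by rewrite mulr_gt0// ltr_wpDr.
have K0 : 0 < K by rewrite ltr_wpDr// mulr_gt0.
pose B := 2 * ((16 * (1 + cS) + 4 * cS) * K + 4 * N3).
have cS0' := ltW cS0; have K0' := ltW K0.
have cS1 : 0 <= 16 * (1 + cS) + 4 * cS by lra.
have B0 : 0 <= B by rewrite /B mulr_ge0// addr_ge0// mulr_ge0.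
pose a := 8 * cS * K; have a0 : 0 < a by rewrite /a mulr_gt0// mulr_gt0.
have ad : 0 < 4 * a + delta by rewrite addr_gt0// mulr_gt0.
(* This value is at most 1, so [t^3 <= t], and it satisfies [a * t <= delta / 4]. *)
pose t := delta / (4 * a + delta).
have t0 : 0 < t by rewrite divr_gt0.
have t1 : t <= 1 by rewrite ler_pdivrMr// mul1r lerDr mulr_ge0// ltW.
have t3 : t ^+ 3 <= t by rewrite exprS; apply: ler_piMr; [exact: ltW|apply: exprn_ile1 => //; exact: ltW].
have at4 : a * t ^+ 3 <= delta / 4.
  apply: (@le_trans _ _ (a * t)); first by apply: ler_wpM2l => //; exact: ltW.
  rewrite /t mulrA ler_pdivrMr//.
  have -> : delta / 4 * (4 * a + delta) = a * delta + delta * delta / 4 by field.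
  by rewrite lerDl divr_ge0// mulr_ge0// ltW.
pose w := t^-1 `^ (3 / 2); have w0 : 0 <= w by exact: powR_ge0.
have w1 : 0 < w + 1 by rewrite ltr_wpDl.
pose Phi := delta / (32 * (w + 1)).
have Phi4 : 8 * w * Phi <= delta / 4.
  rewrite /Phi mulrA ler_pdivrMr ?mulr_gt0//.
  have -> : delta / 4 * (32 * (w + 1)) = 8 * w * delta + 8 * delta by field.
  by rewrite lerDl mulr_ge0// ltW.
exists t, (delta / 16), Phi, (8 * C0 * B / delta); split=> //.
- by rewrite divr_gt0.
- by rewrite divr_gt0// mulr_gt0.
move=> rho rho0 hrho; set kappa := 2 * C0 / rho.
have kB : kappa * B <= delta / 4.
  rewrite ler_pdivrMr// in hrho; have kE : kappa * rho = 2 * C0 by rewrite /kappa divfK// gt_eqF.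
  rewrite -(ler_pM2r rho0); have -> : kappa * B * rho = 2 * C0 * B by rewrite mulrAC kE.
  by lra.
(* The four terms are the initial energy, everything that carries the gradient of the cutoff, the
   part of the force absorbed by Young's inequality, and the tail of the force. *)
have -> : tail_bound T C0 0 kappa N1 0 t (delta / 16) N2 N3 Phi =
    delta / 4 + kappa * B + a * t ^+ 3 + 8 * w * Phi.
  by rewrite /tail_bound /energy_rate -/cS -/K -/w /B /a; field.
by lra.
Qed.

Lemma sqr_integrable_locint (v : M4 R -> R) : measurable_fun setT v ->
  (\int[leb4]_x (v x ^+ 2)%:E < +oo)%E -> locint v.
Proof.
move=> mv v2; split=> // r; have mC := @measurable_cube R r.
have i2 : leb4.-integrable setT (EFin \o (fun x => v x ^+ 2)).
  apply: ge0_integrable => //; [exact: measurable_funX|by move=> x _; exact: sqr_ge0].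
have i1 : leb4.-integrable (cube r : set (M4 R)) (EFin \o (fun=> 1 : R)).
  by apply: (bounded_integrable (M := 1)) => //; [exact: leb4_cube_lty|move=> x _; rewrite normr1].
have iS := integrableD mC i1 (integrableS measurableT mC (@subsetT _ _) i2).
apply: (le_integrable mC _ _ iS); first by apply/measurable_EFinP; exact: measurable_funTS.
move=> x _ /=; rewrite lee_fin (le_trans (grow_sqr (v x)))//; exact: ler_norm.
Qed.

Lemma measurable_euclid d (X : measurableType d) (A : set X) m n (v : X -> 'M[R]_(m, n)) :
  measurable_mx A v -> measurable_fun A (fun x => euclid (v x)).
Proof.
move=> mv; have ms := continuous_measurable_fun (@sqrt_continuous R).
apply: (measurableT_comp ms); apply: measurable_sum => i; apply: measurable_sum => j.
exact: measurable_funX.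
Qed.

Lemma integral_segment_le (T delta : R) (I : mR -> \bar R) : 0 < T -> 0 <= delta -> measurable_fun setT I ->
  (forall s, 0 <= I s)%E -> (forall s, I s <= (\1_(`[0, T]%classic) s * delta)%:E)%E ->
  (\int[leb]_s I s <= (T * delta)%:E)%E.
Proof.
move=> T0 d0 mI I0 hI; have mT : measurable (`[0, T]%classic : set mR) by exact: measurable_itv.
have m1 : measurable_fun setT (\1_(`[0, T]%classic : set mR) : mR -> R) by exact: measurable_indic.
apply: (@le_trans _ _ (\int[leb]_s (\1_(`[0, T]%classic) s * delta)%:E)%E).
  by apply: ge0_le_integralT => //; apply/measurable_EFinP; exact: measurable_funM.
under eq_integral do rewrite mulrC EFinM.
rewrite ge0_integralZl//; last by apply/measurable_EFinP.
have e : leb `[0, T]%classic = T%:E by rewrite lebesgue_measure_itv/= lte_fin T0 -EFinB subr0.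
have h : (\int[leb]_s (\1_(`[0%R, T]%classic : set mR) s)%:E = leb `[0%R, T]%classic)%E.
  by rewrite integral_indic// setIT.
by rewrite h e -EFinM lee_fin mulrC.
Qed.

Lemma slab_minus (T r : R) : slab T `\` (cube r `*` `[0, T]%classic) =
  (~` cube r) `*` `[0, T]%classic :> set (M4 R * mR).
Proof.
apply/seteqP; split=> z.
  by move=> [[_ zT] h]; split=> // zr; apply: h.
by move=> [h zT]; split; [split|move=> [zr _]; exact: h].
Qed.

(** [sigma] absorbs the Sobolev term and [delta], proportional to [sigma], the tail term. The
    factors 4 and 8 are the number of components and the constant of [euclid_cube]. *)
Lemma cube_parameters (S0 K0 eps : R) : 0 <= S0 -> 0 <= K0 -> 0 < eps ->
  exists sigma delta, [/\ 0 < sigma, 0 < delta &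
    4 * (8 * (2^-1 * (delta / sigma + sigma * S0) * K0)) < eps].
Proof.
move=> S00 K00 e0; have SK : 0 <= S0 * K0 by exact: mulr_ge0.
have h1 : 0 < 64 * (S0 * K0 + 1) by rewrite mulr_gt0// ltr_wpDl.
have h2 : 0 < 64 * (K0 + 1) by rewrite mulr_gt0// ltr_wpDl.
pose sigma := eps / (64 * (S0 * K0 + 1)); have s0 : 0 < sigma by rewrite divr_gt0.
pose c := eps / (64 * (K0 + 1)); have c0 : 0 < c by rewrite divr_gt0.
exists sigma, (sigma * c); split=> //; first exact: mulr_gt0.
rewrite [sigma * c]mulrC mulfK ?gt_eqF//.
have cE : c * (64 * (K0 + 1)) = eps by rewrite /c divfK// gt_eqF.
have sE : sigma * (64 * (S0 * K0 + 1)) = eps by rewrite /sigma divfK// gt_eqF.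
have -> : 4 * (8 * (2^-1 * (c + sigma * S0) * K0)) = 16 * (c * K0) + 16 * (sigma * (S0 * K0)) by field.
have e1 : 64 * (c * K0) + 64 * c = eps by rewrite -cE; ring.
have e2 : 64 * (sigma * (S0 * K0)) + 64 * sigma = eps by rewrite -sE; ring.
lra.
Qed.

End Tightness.

(** * Tails that are uniform along the sequence *)

Section UniformTails.
Context {R : realType}.
Local Notation mR := (measurableTypeR R).
Local Notation leb := (@lebesgue_measure R).

(** The good times depend on [k], the radius does not: it is chosen from the data [u0], [f] and the
    uniform bounds alone, through [solution_tails], whose bound ignores [chi]. *)
Lemma uniform_tails (T : R) (u0 : R4 R -> 'rV[R]_4) (f : R4 R * R -> 'rV[R]_4)
  (chi : nat -> R4 R -> R) (u : nat -> R4 R * R -> 'rV[R]_4) (Du : nat -> R4 R * R -> 'M[R]_4)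
  (p : nat -> R4 R * R -> R) : 0 < T -> measurable_mx setT u0 ->
  (Lp_norm leb4 setT 2%:E (fun x => euclid (u0 x)) < +oo)%E ->
  measurable_mx (slab T) f ->
  (Lp_norm leb41 (slab T) (3 / 2)%:E (fun z => euclid (f z)) < +oo)%E ->
  standard_mollifiers chi -> approximating_sequence T chi u0 f u Du p ->
  exists S0 K0 : R, [/\ 0 <= S0, 0 <= K0 & forall delta, 0 < delta -> exists r : R, forall k,
    exists Gam : set mR, [/\ measurable Gam, Gam `<=` `[0, T]%classic, leb (`[0, T]%classic `\` Gam) = 0%E &
    [/\ forall i s, Gam s ->
        (\int[leb4]_(x in ~` cube r) (hat Gam (fun z => u k z 0 i) (x, s) ^+ 2)%:E <= delta%:E)%E,
      forall i j, (\int[leb]_s \int[leb4]_(x in ~` cube r)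
        (hat Gam (fun z => Du k z i j) (x, s) ^+ 2)%:E <= delta%:E)%E &
      forall i (sigma : R), 0 < sigma -> (\int[leb]_s \int[leb4]_(x in ~` cube r)
        (`|hat Gam (fun z => u k z 0 i) (x, s)| ^+ 3)%:E <=
        (2^-1 * (delta / sigma + sigma * S0) * K0)%:E)%E]]].
Proof.
move=> T0 u0_meas u0_L2 f_meas f_L32 chi_moll uDup.
have [Cchi chi0 chi1 _] := chi_moll.
have third0 : (0 : R) < 3^-1 by rewrite invr_gt0.
(* One third is the radius that [smooth_step_exists] asks for; every cutoff below descends from this
   kernel. *)
have [eta0 m0] := mollifier_exists chi_moll third0; have [S step] := smooth_step_exists m0.
have [C0 C00 hball] := ball_cutoff_exists step.
have ex_eta (n : nat) : exists e : R4 R -> R, mollifier n.+1%:R^-1 e.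
  by apply: (mollifier_exists chi_moll); rewrite invr_gt0.
have [eta etaP] := choice ex_eta.
have ex_zeta (n : nat) : exists z : R4 R -> R, ball_cutoff C0 n.+1%:R z by exact: hball.
have [zeta Hz] := choice ex_zeta.
have annulus rho r : 0 < rho -> rho <= r -> exists psi, annulus_cutoff (2 * C0) rho r psi.
  move=> r0 rr; have [z1 h1] := hball _ r0; have [z2 h2] := hball r (lt_le_trans r0 rr).
  by eexists; exact: (annulus_cutoff_exists C00 r0 rr h1 h2).
have [hk [C hC] [C' hC'] _] := uDup.
(* The added 1 makes [N1] positive even when [C] is 0. *)
pose N1 := C `^ 2 + 1; pose N2 := C `^ 2; pose N3 := C' `^ (3 / 2).
have N20 : 0 <= N2 by exact: powR_ge0.
have N30 : 0 <= N3 by exact: powR_ge0.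
have N10 : 0 < N1 by rewrite ltr_wpDl// powR_ge0.
have r32 : (0 : R) < 3 / 2 by rewrite divr_gt0.
have m32 : measurable_fun setT (fun a : R => `|a| `^ (3 / 2)) by have [] := @convex_pow32 R.
have iu0 i : (\int[leb4]_x (u0 x 0 i ^+ 2)%:E < +oo)%E.
  have h : (\int[leb4]_x (\sum_k \sum_l u0 x k l ^+ 2)%:E < +oo)%E.
    by rewrite -norm2_poweR gee0_abs ?Lnorm_ge0//; exact: poweR_lty.
  apply: le_lt_trans h; apply: ge0_le_integralT.
  - by apply/measurable_EFinP; apply: measurable_funX; exact: u0_meas.
  - by apply/measurable_EFinP; apply: measurable_sum => k; apply: measurable_sum => l; apply: measurable_funX; exact: u0_meas.
  - by move=> x; rewrite lee_fin sqr_ge0.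
  - by move=> x; rewrite lee_fin big_ord1 (bigD1 i)//= lerDl sumr_ge0// => k _; exact: sqr_ge0.
have lu0 i := sqr_integrable_locint (u0_meas 0 i) (iu0 i).
pose J : set mR := `]0, T[%classic; have mJ : measurable J by exact: measurable_itv.
have HF i : (\int[leb]_s \int[leb4]_x (`|hat J (fun z => f z 0 i) (x, s)| `^ (3 / 2))%:E < +oo)%E.
  apply: le_lt_trans (Lnorm_lty r32 f_L32).
  apply: (slab_L32_component (f_meas 0 i) (measurable_euclid f_meas)) => z.
  by rewrite [leRHS]ger0_norm ?euclid_ge0//; exact: euclid_entry.
have mhf i := measurable_hat mJ (@open_sub_segment R T) (f_meas 0 i).
pose Kf i (z : M4 R * mR) : \bar R := (`|hat J (fun z => f z 0 i) z| `^ (3 / 2))%:E.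
have mKf i : measurable_fun setT (Kf i) by apply/measurable_EFinP; exact: (measurableT_comp m32 (mhf i)).
have Kf0 i z : (0 <= Kf i z)%E by rewrite lee_fin powR_ge0.
pose G i (x : M4 R) : \bar R := (\int[leb]_s Kf i (x, s))%E.
have mG i : measurable_fun setT (G i) by exact: (measurable_fun_fubini_tonelli_F (Kf i) (mKf i) (Kf0 i)).
have G0 i x : (0 <= G i x)%E by exact: integral_ge0.
have Goo i : (\int[leb4]_x G i x < +oo)%E.
  by rewrite /G -(spacetime_slices (mKf i) (Kf0 i) measurableT); exact: HF.
have N200 : 0 <= 16 * N2 by rewrite mulr_ge0.
have S00 : 0 <= sobolev_constant C0 by rewrite /sobolev_constant mulr_ge0// sqr_ge0.
have K00 : 0 <= N1 * T + 16 * N2 by rewrite addr_ge0// ltW// mulr_gt0.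
exists (sobolev_constant C0), (N1 * T + 16 * N2); split=> // delta delta0.
have [t [e0 [Phi [rho0 [t0 e00 Phi0 small]]]]] := tail_bound_small T0 N10 N200 C00 N30 delta0.
have [m1 h1] := @tails_small4 R (fun i x => (u0 x 0 i ^+ 2)%:E) e0
  (fun i => (measurable_EFinP _ _).2 (measurable_funX _ (u0_meas 0 i))) (fun i x => sqr_ge0 _) iu0 e00.
(* [solution_tails] adds up the four components of the force, so each of them gets a quarter of
   [Phi]. *)
have Phi40 : 0 < Phi / 4 by rewrite divr_gt0.
have [m2 h2] := tails_small4 mG G0 Goo Phi40.
(* [rho - 1] must reach [m1] and [m2], since kernels of radius at most 1 cost one unit. *)
pose rho := Num.max rho0 (1 + m1%:R + m2%:R).
have rr : 1 + m1%:R + m2%:R <= rho by rewrite le_max lexx orbT.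
have m10 : (0 : R) <= m1%:R by exact: ler0n.
have m20 : (0 : R) <= m2%:R by exact: ler0n.
have rho0' : 0 < rho by apply: lt_le_trans rr; lra.
have rm1 : m1%:R <= rho - 1 by lra.
have rm2 : m2%:R <= rho - 1 by lra.
have mE : measurable (~` cube (rho - 1) : set (M4 R)) by apply: measurableC; exact: measurable_cube.
have Xd := small rho rho0' (_ : rho0 <= rho); rewrite le_max lexx in Xd; have {}Xd := Xd isT.
have FPhi i : (\int[leb]_s \int[leb4]_(x in ~` cube (rho - 1)) (Kf i (x, s)) <= (Phi / 4)%:E)%E.
  by rewrite (spacetime_slices (mKf i) (Kf0 i) mE); exact: h2.
(* The annulus cutoff equals one only beyond [2 * rho]. *)
exists (2 * rho) => k; have [[mu mDu _ H1k _] mp _ sol] := hk k; have [cu cDu] := hC k.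
have HuN : {ae leb, forall s, J s -> forall i, (\int[leb4]_x (u k (x, s) 0 i ^+ 2)%:E <= N1%:E)%E}.
  apply: (ae_mono (mixed_sup_component mu cu)) => s hs sJ i; apply: (le_trans (hs sJ i)).
  by rewrite lee_fin /N1 lerDl.
have HH1 : {ae leb, forall s, J s -> weak_jacobian (fun x => u k (x, s)) (fun x => Du k (x, s))}.
  by apply: (ae_mono H1k) => s hs /open_sub_segment; rewrite /= in_itv/= => /hs[].
have HD := mixed_L2_component mDu cDu.
have HP : (\int[leb]_s \int[leb4]_x (`|hat J (p k) (x, s)| `^ (3 / 2))%:E <= N3%:E)%E.
  apply: le_trans (Lnorm_le r32 (hC' k)).
  by apply: (slab_L32_component mp mp) => z.
have dchi : density (chi k) by split=> //; exact: Ccinfty_Cc.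
have [Gam [mGam GamJ GamE [a b c]]] := solution_tails T0 step C00 Hz annulus etaP (Cchi k) dchi sol (mu 0) mDu mp
  (f_meas 0) lu0 N10 HuN HH1 HD HP HF rho0' t0 (fun i => h1 i _ rm1) FPhi.
have XE : 4 * (Phi / 4) = Phi by field.
rewrite XE in a b c.
exists Gam; split=> //; first by move=> s /GamJ; exact: open_sub_segment.
split.
- by move=> i s sG; apply: (le_trans (a i s sG)); rewrite lee_fin.
- by move=> i j; apply: (le_trans (b i j)); rewrite lee_fin.
- move=> i sigma sg; apply: (le_trans (c i sigma sg)); rewrite lee_fin; apply: ler_wpM2r => //.
  apply: ler_wpM2l => //; rewrite lerD2r; apply: ler_wpM2r => //.
  by rewrite invr_ge0 ltW.
Qed.

End UniformTails.

Theorem lemma2p5 (R : realType) (T : R)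
  (u0 : R4 R -> 'rV[R]_4) (f : R4 R * R -> 'rV[R]_4)
  (chi : nat -> R4 R -> R)
  (u : nat -> R4 R * R -> 'rV[R]_4) (Du : nat -> R4 R * R -> 'M[R]_4)
  (p : nat -> R4 R * R -> R)
  (T_gt0 : 0 < T)
  (u0_meas : measurable_mx setT u0)
  (u0_L2 : (Lp_norm leb4 setT 2%:E (fun x => euclid (u0 x)) < +oo)%E)
  (u0_div : weakly_divfree u0)
  (f_meas : measurable_mx (slab T) f)
  (f_L32 : (Lp_norm leb41 (slab T) (3 / 2)%:E (fun z => euclid (f z)) < +oo)%E)
  (f_div : weakly_divfree_slab T f)
  (chi_moll : standard_mollifiers chi)
  (uDup_approx : approximating_sequence T chi u0 f u Du p) :
  [/\ tight (slab T) (fun k A =>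
        \int[leb41]_(z in A) (euclid (Du k z) ^+ 2)%:E)%E,
      tight (slab T) (fun k A =>
        \int[leb41]_(z in A) (euclid (u k z) ^+ 2)%:E)%E &
      tight (slab T) (fun k A =>
        \int[leb41]_(z in A) (euclid (u k z) ^+ 3)%:E)%E].
Proof.
have [S0 [K0 [S00 K00 tails]]] := uniform_tails T_gt0 u0_meas u0_L2 f_meas f_L32 chi_moll uDup_approx.
have [hk _ _ _] := uDup_approx.
have mu k : measurable_mx (slab T) (u k) by have [[]] := hk k.
have mDu k : measurable_mx (slab T) (Du k) by have [[]] := hk k.
have mC (r : R) : measurable (~` cube r : set (M4 R)) by apply: measurableC; exact: measurable_cube.
have mT : measurable (`[0, T]%classic : set (measurableTypeR R)) by exact: measurable_itv.
have mS : measurable (slab T : set (M4 R * measurableTypeR R)) by exact: measurableX.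
have mE (r : R) : measurable ((~` cube r) `*` `[0, T]%classic : set (M4 R * measurableTypeR R)).
  by exact: measurableX.
have subE (r : R) : (~` cube r) `*` `[0, T]%classic `<=` slab T by move=> z [_ ?].
have cK (r : R) : compact (cube r `*` `[0, T]%classic).
  by apply: compact_setX; [exact: compact_cube|exact: segment_compact].
have subK (r : R) : cube r `*` `[0, T]%classic `<=` slab T by move=> z [_ ?].
have restr (r : R) (h : M4 R * measurableTypeR R -> R) : measurable_fun (slab T : set (M4 R * measurableTypeR R)) h ->
    measurable_fun ((~` cube r) `*` `[0, T]%classic : set (M4 R * measurableTypeR R)) h.
  by apply: measurable_funS => //; exact: subE.
have msq : measurable_fun setT (fun a : R => a ^+ 2) by have [] := @convex_sqr R.
have m3 : measurable_fun setT (fun a : R => `|a| ^+ 3).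
  by apply: (measurable_funX 3 (f := fun a : R => `|a|)); apply: continuous_measurable_fun; exact: (@norm_continuous _ R^o).
have n0 n : (0 : R) ^+ n.+1 = 0 by rewrite expr0n.
split=> eps eps0.
(* The sixteen entries of the Jacobian add up to [eps / 2]. *)
- have d0 : 0 < eps / 32 by rewrite divr_gt0.
  have [r hr] := tails _ d0; exists (cube r `*` `[0, T]%classic); split=> // k.
  have [Gam [mGam GamT GamE [_ hD _]]] := hr k; rewrite slab_minus.
  apply: (@le_lt_trans _ _ (4 * (4 * (eps / 32)))%:E); last by rewrite lte_fin; lra.
  under eq_integral do rewrite euclid_sqr.
  apply: (integral_sum4_le (m := leb41) (F := fun i (z : M4 R * measurableTypeR R) => \sum_j Du k z i j ^+ 2)) => //.
  + by move=> i; apply: measurable_sum => j; apply: measurable_funX; apply: restr; exact: mDu.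
  + by move=> i z; apply: sumr_ge0 => j _; exact: sqr_ge0.
  move=> i; apply: (integral_sum4_le (m := leb41) (F := fun j (z : M4 R * measurableTypeR R) => Du k z i j ^+ 2)) => //.
  + by move=> j; apply: measurable_funX; apply: restr; exact: mDu.
  + by move=> j z; exact: sqr_ge0.
  move=> j; rewrite (slab_tail_slices mGam GamT GamE (mC r) (mDu k i j) msq (n0 1%N) (fun a => sqr_ge0 a)).
  exact: hD.
(* The bound holds at each good time: integration over [0, T] multiplies it by [T], and four
   components then add up to [eps / 2]. *)
- have d0 : 0 < eps / (8 * T) by rewrite divr_gt0// mulr_gt0.
  have [r hr] := tails _ d0; exists (cube r `*` `[0, T]%classic); split=> // k.
  have [Gam [mGam GamT GamE [hu _ _]]] := hr k; rewrite slab_minus.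
  apply: (@le_lt_trans _ _ (4 * (T * (eps / (8 * T))))%:E); last first.
    have -> : 4 * (T * (eps / (8 * T))) = eps / 2 by field; rewrite gt_eqF.
    by rewrite lte_fin; lra.
  under eq_integral do rewrite euclid_row.
  apply: (integral_sum4_le (m := leb41) (F := fun i (z : M4 R * measurableTypeR R) => u k z 0 i ^+ 2)) => //.
  + by move=> i; apply: measurable_funX; apply: restr; exact: mu.
  + by move=> i z; exact: sqr_ge0.
  move=> i; rewrite (slab_tail_slices mGam GamT GamE (mC r) (mu k 0 i) msq (n0 1%N) (fun a => sqr_ge0 a)).
  apply: integral_segment_le => //; first exact: ltW.
  + apply: (measurable_set_slice_integral _ (fun z => sqr_ge0 _) (mC r)).
    exact: (measurable_funX _ (measurable_hat mGam GamT (mu k 0 i))).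
  + by move=> s; apply: integral_ge0 => x _; rewrite lee_fin sqr_ge0.
  (* At the other times [hat] is 0, so the bound holds at every time. *)
  move=> s; have [sG|sG] := pselect (Gam s).
    by rewrite [in leRHS]indicE mem_set ?mul1r; [exact: hu|exact: GamT].
  rewrite integral0_eq; first by rewrite lee_fin mulr_ge0// ltW.
  by move=> x _; rewrite /hat indicE memNset// mul0r n0.
- have [sigma [delta [sigma0 delta0 hlt]]] := cube_parameters S00 K00 eps0.
  have [r hr] := tails _ delta0; exists (cube r `*` `[0, T]%classic); split=> // k.
  have [Gam [mGam GamT GamE [_ _ h3]]] := hr k; rewrite slab_minus.
  apply: (@le_lt_trans _ _ (4 * (8 * (2^-1 * (delta / sigma + sigma * S0) * K0)))%:E); last by rewrite lte_fin.
  have mu3 i : measurable_fun ((~` cube r) `*` `[0, T]%classic : set (M4 R * measurableTypeR R))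
      (fun z => `|u k z 0 i| ^+ 3).
    by apply: (measurableT_comp m3); apply: restr; exact: mu.
  have mu8 i : measurable_fun ((~` cube r) `*` `[0, T]%classic : set (M4 R * measurableTypeR R))
      (fun z => 8 * `|u k z 0 i| ^+ 3).
    by apply: measurable_funM => //; exact: mu3.
  apply: (@le_trans _ _ (\int[leb41]_(z in (~` cube r) `*` `[0%R, T]%classic) (\sum_i 8 * `|u k z 0 i| ^+ 3)%:E)%E).
    apply: ge0_le_integral => //.
    + by move=> z _; rewrite lee_fin exprn_ge0// euclid_ge0.
    + by apply/measurable_EFinP; apply: measurable_funX; apply: restr; exact: (measurable_euclid (mu k)).
    + by apply/measurable_EFinP; apply: measurable_sum => i; exact: mu8.
    + by move=> z _; rewrite lee_fin -mulr_sumr; exact: euclid_cube.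
  apply: (integral_sum4_le (m := leb41) (F := fun i (z : M4 R * measurableTypeR R) => 8 * `|u k z 0 i| ^+ 3)) => //.
  move=> i; under eq_integral do rewrite EFinM.
  rewrite ge0_integralZl//; do ?[by apply/measurable_EFinP; exact: mu3|by move=> z _; rewrite lee_fin exprn_ge0].
  rewrite EFinM; apply: lee_wpmul2l; first by rewrite lee_fin.
  rewrite (@slab_tail_slices R T Gam (fun z => u k z 0 i) (fun a => `|a| ^+ 3) (~` cube r) mGam GamT GamE (mC r) (mu k 0 i) m3).
  + exact: h3.
  + by rewrite normr0 n0.
  + by move=> a; rewrite exprn_ge0.
Qed.
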